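(* Let $\mathcal X$ be a $GC_6$ set with no maximal line (i.e. no line contains $7$ nodes of $\mathcal X$). Then there is no node $A\in\mathcal X$ whose m-d sequence is $(6,6,6,4,3,2)$.
   Context: $\Pi_n$ is the space of bivariate (real) polynomials of total degree $\le n$; nodes are distinct points of the plane. A line is denoted by the same letter as a linear polynomial defining it. A finite set $\mathcal X$ of nodes is $n$-correct if for any data $(c_P)_{P\in\mathcal X}$ there is a unique $p\in\Pi_n$ with $p(P)=c_P$ for all $P\in\mathcal X$ (so $\#\mathcal X=(n+1)(n+2)/2$; $28$ for $n=6$). The $n$-fundamental polynomial $p_A^\star\in\Pi_n$ of $A\in\mathcal X$ satisfies $p_A^\star(A)=1$ and vanishes on $\mathcal X\setminus\{A\}$. An $n$-correct set is a $GC_n$ set if every $p_A^\star$, $A\in\mathcal X$, is a product of $n$ linear factors. A maximal line of a $GC_n$ set is a line through $n+1$ of its nodes. A node $A$ uses a line $\ell$ if $p_A^\star=\ell q$ with $q\in\Pi_{n-1}$. Distribution sequences. For a node $A$ of a $GC_n$ set $\mathcal X$, let $\mathcal L_A$ be the set of the $n$ lines used by $A$ (the linear factors of $p_A^\star$). Order $\mathcal L_A$ as $(\ell_1,\dots,\ell_n)$ and put $k_s=\#\big((\mathcal X\setminus\bigcup_{i<s}\ell_i)\cap\ell_s\big)$. The m-d sequence (maximal distribution sequence) of $A$ is the lexicographically maximal sequence $(k_1,\dots,k_n)$ over all orderings of $\mathcal L_A$; so each $\ell_s$ passes through the maximal possible number of nodes not on the previous lines, and $k_1\ge\dots\ge k_n$,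 $k_1+\dots+k_n=\#\mathcal X-1$. *)

(* Defs.v *)
From mathcomp Require Import all_boot all_order all_algebra.
From mathcomp Require Import finmap mpoly reals.

Set Implicit Arguments.
Unset Strict Implicit.
Unset Printing Implicit Defensive.

Import Order.TTheory GRing.Theory Num.Theory.
Local Open Scope ring_scope.
Local Open Scope fset_scope.

Section GCSets.
Variable R : realType.

Implicit Types (n : nat) (p q l m : {mpoly R[2]}) (P A B : R * R)
  (X : {fset R * R}).

Definition peval p P : R := p.@[fun i : 'I_2 => if i == 0 then P.1 else P.2].

(* [msize p] is the total degree of [p] plus one, and [msize 0 = 0]. *)
Definition Pi n : pred {mpoly R[2]} := [pred p | (msize p <= n.+1)%N].

Definition is_line : pred {mpoly R[2]} := [pred l | msize l == 2%N].

Definition on_line l P : bool := peval l P == 0.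

(* A line is represented by any polynomial defining it, so equality of lines
   is equality of the point sets and not of the polynomials. *)
Definition same_line l m : Prop := forall P, on_line l P = on_line m P.

Definition n_correct n X : Prop :=
  forall c : R * R -> R,
    exists! p, p \in Pi n /\ (forall P, P \in X -> peval p P = c P).

Definition fundamental n X A p : Prop :=
  [/\ p \in Pi n, peval p A = 1
    & forall B, B \in X -> B != A -> peval p B = 0].

Definition GC_set n X : Prop :=
  n_correct n X /\
  forall A, A \in X -> forall p, fundamental n X A p ->
    exists2 ls : n.-tuple {mpoly R[2]},
      all is_line ls & p = \prod_(l <- ls) l.

Definition maximal_line n X l : Prop :=
  is_line l /\ #|` [fset P in X | on_line l P]| = n.+1.

Definition uses n X A l : Prop :=
  is_line l /\
  exists p q, [/\ fundamental n X A p, q \in Pi n.-1 & p = l * q].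

(* [ls] lists, each exactly once as a line, the lines used by [A]. *)
Definition used_lines_ordering n X A (ls : n.-tuple {mpoly R[2]}) : Prop :=
  [/\ forall i, uses n X A (tnth ls i),
      forall i j, same_line (tnth ls i) (tnth ls j) -> i = j
    & forall l, uses n X A l -> exists i, same_line l (tnth ls i)].

Definition distribution n X (ls : n.-tuple {mpoly R[2]}) : n.-tuple nat :=
  [tuple #|` [fset P in X |
               [forall i : 'I_n, (i < s)%N ==> ~~ on_line (tnth ls i) P]
               && on_line (tnth ls s) P]| | s < n].

Definition md_sequence n X A (k : n.-tuple nat) : Prop :=
  (exists2 ls : n.-tuple {mpoly R[2]},
     used_lines_ordering X A ls & distribution X ls = k) /\
  (forall ls : n.-tuple {mpoly R[2]}, used_lines_ordering X A ls ->
     (distribution X ls <= k :> n.-tuplelexi nat)%O).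

End GCSets.

(* Main.v *)
Require Import Defs.
From mathcomp Require Import all_boot all_order all_algebra.
From mathcomp Require Import finmap mpoly reals.
From mathcomp Require Import ring zify.

(** Let [el 0], [el 1], [el 2] be the first three lines of the m-d sequence: they are disjoint on
    the nodes and carry 18 nodes ("primary" nodes), while the ten remaining nodes [Y] carry a
    unisolvent cubic problem and the fourth line has four nodes in [Y].  If a node uses a line
    [m], dividing its fundamental polynomial by [m] leaves a quintic vanishing at all other nodes
    off [m].  A combination of the quintics of several users of [m], made to vanish at a few more
    points, is divisible by two of the [el i], and its cubic quotient vanishes on [Y] off [m];
    this bounds the number of primary nodes using [m] in terms of [m] and [Y].

    The set [Y] has at least three lines with four nodes.  If it has exactly three, counting the
    lines through the node of [Y] outside them (each primary node uses one of those) gives a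
    contradiction.  Otherwise there are four such lines in general position, and counting at
    the intersection of two of them shows that the line joining it to the opposite intersection
    is used by 2, 2 and at least 1 nodes of the three [el i].  Their quintics then have a common
    cubic factor, which is a product of three lines, and together with [m] we get four lines
    partitioning [Y] that are used by two nodes of each [el i].  The other twelve primary nodes
    use neither these four lines nor the lines with four nodes in [Y], so each of their 72 lines
    meets [Y] in few points; as each of them has to cover [Y], this yields 48 <= 46. *)

(** Everything rests on counting zeros on a line: degree below [n] and [n] zeros imply divisibility.
    The [el i] have six nodes, just enough for a quintic, and each division needs one zero less than
    the one before. Hence the node where [m] meets the first line divided out costs a condition, the
    one on the second line nothing, and this is the origin of the [+ 1] in the bounds. Lines with
    seven nodes being absent, a line with four nodes in [Y] meets at most two of the [el i] in nodes
    and has at most one primary user. The final constants: twelve nodes, each with six lines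
    covering ten nodes, give an excess of 120 - 72 = 48. One pair of opposite intersections accounts
    for at most 4 of it, and four triples of nodes for 9 each, or 12 if collinear. Six such triples
    exist in all; two are collinear by the choice of the partition and five cannot be, so 46 = 4 +
    12 + 12 + 9 + 9. *)

Set Implicit Arguments.
Unset Strict Implicit.
Unset Printing Implicit Defensive.

Import Order.TTheory GRing.Theory Num.Theory.
Local Open Scope ring_scope.

(** * Polynomial functions and lines in the plane *)

Section PlanePolynomials.
Variable R : realFieldType.
Notation pt := (R * R)%type.

(* [(a, b, c)] stands for the linear polynomial [a x + b y + c]. *)
Definition line := {t : R * R * R | (t.1.1 != 0) || (t.1.2 != 0)}.
Definition la (l : line) : R := (val l).1.1.
Definition lb (l : line) : R := (val l).1.2.
Definition lc (l : line) : R := (val l).2.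
Definition lev (l : line) (P : pt) : R := la l * P.1 + lb l * P.2 + lc l.
Coercion lev : line >-> Funclass.
Implicit Types (l m : line) (P Q S : pt) (f g : pt -> R) (n : nat) (s : seq pt).

(* [pol n f]: [f] is a polynomial function of degree < [n], in particular [pol 0 f] says that [f] is zero. *)
Fixpoint pol n f : Prop :=
  match n with
  | 0%N => forall P, f P = 0
  | n'.+1 => exists f1 f2 c,
      [/\ pol n' f1, pol n' f2 & forall P, f P = P.1 * f1 P + P.2 * f2 P + c]
  end.

Lemma pol_ext n f g : f =1 g -> pol n f -> pol n g.
Proof.
case: n => [|n] fg /=; first by move=> h P; rewrite -fg.
by move=> [f1 [f2 [c [h1 h2 h]]]]; exists f1, f2, c; split=> // P; rewrite -fg.
Qed.

Lemma pol0 n : pol n (fun=> 0).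
Proof.
elim: n => [|n IH] //=; exists (fun=> 0), (fun=> 0), 0; split=> // P; ring.
Qed.

Lemma polC n c : pol n.+1 (fun=> c).
Proof. by exists (fun=> 0), (fun=> 0), c; split=> *; rewrite ?mulr0 ?add0r //; apply: pol0. Qed.

Lemma pol_lin n f g a b : pol n f -> pol n g -> pol n (fun P => a * f P + b * g P).
Proof.
elim: n f g => [|n IH] f g /=; first by move=> h1 h2 P; rewrite h1 h2; ring.
move=> [f1 [f2 [c [h1 h2 h]]]] [g1 [g2 [d [k1 k2 k]]]].
exists (fun P => a * f1 P + b * g1 P), (fun P => a * f2 P + b * g2 P), (a * c + b * d).
split; try exact: IH.
by move=> P; rewrite h k; ring.
Qed.

Lemma pol_wid n k f : (n <= k)%N -> pol n f -> pol k f.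
Proof.
elim: n k f => [|n IH] [|k] f //=.
  by move=> _ h; apply: (@pol_ext k.+1 (fun=> 0)) (pol0 _) => P; rewrite h.
rewrite ltnS => le [f1 [f2 [c [h1 h2 h]]]].
by exists f1, f2, c; split => //; apply: IH.
Qed.

Lemma pol_scale n f a : pol n f -> pol n (fun P => a * f P).
Proof. by move=> h; apply: pol_ext (pol_lin a 0 h h) => P /=; ring. Qed.

Lemma pol_x n f : pol n f -> pol n.+1 (fun P => P.1 * f P).
Proof. by move=> h; exists f, (fun=> 0), 0; split=> [||P] //; [exact: pol0|ring]. Qed.

Lemma pol_y n f : pol n f -> pol n.+1 (fun P => P.2 * f P).
Proof. by move=> h; exists (fun=> 0), f, 0; split=> [||P] //; [exact: pol0|ring]. Qed.

Lemma pol_line n l f : pol n f -> pol n.+1 (fun P => l P * f P).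
Proof.
move=> h.
have h1 := pol_lin (la l) (lb l) (pol_x h) (pol_y h).
have h2 := pol_lin 1 (lc l) h1 (pol_wid (leqnSn n) h).
by apply: pol_ext h2 => P; rewrite /lev /=; ring.
Qed.

Lemma pol_lev n l : pol n.+2 l.
Proof. by apply: pol_ext (pol_line l (polC n 1)) => P; rewrite mulr1. Qed.

Definition lprod (L : seq line) (P : pt) : R := \prod_(l <- L) l P.

Lemma lprod_cons l L P : lprod (l :: L) P = l P * lprod L P.
Proof. by rewrite /lprod big_cons. Qed.

Lemma lprod_nil P : lprod [::] P = 1.
Proof. by rewrite /lprod big_nil. Qed.

Lemma lprod_eq0 L P : (lprod L P == 0) = has (fun l => l P == 0) L.
Proof. by rewrite /lprod prodf_seq_eq0; apply: eq_has => l. Qed.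

Lemma pol_lprod n L : (size L < n)%N -> pol n (lprod L).
Proof.
elim: L n => [|l L IH] [|n] //= h.
  by apply: pol_ext (polC n 1) => P; rewrite lprod_nil.
have hL : pol n (lprod L) by apply: IH.
by apply: pol_ext (pol_line l hL) => P; rewrite lprod_cons.
Qed.

(* The linear form orthogonal to [l], which parametrizes [l]. *)
Definition tcoord l P : R := - lb l * P.1 + la l * P.2.

Lemma lnorm l : 0 < la l ^+ 2 + lb l ^+ 2.
Proof.
case/orP: (valP l) => h.
  by rewrite ltr_wpDr ?sqr_ge0 // exprn_even_gt0.
by rewrite ltr_wpDl ?sqr_ge0 // exprn_even_gt0.
Qed.

Lemma coordx l P : P.1 = (la l * (l P - lc l) - lb l * tcoord l P) / (la l ^+ 2 + lb l ^+ 2).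
Proof.
have h := lnorm l; have h0 : la l ^+ 2 + lb l ^+ 2 != 0 by rewrite gt_eqF.
by rewrite /lev /tcoord; field.
Qed.

Lemma coordy l P : P.2 = (lb l * (l P - lc l) + la l * tcoord l P) / (la l ^+ 2 + lb l ^+ 2).
Proof.
have h := lnorm l; have h0 : la l ^+ 2 + lb l ^+ 2 != 0 by rewrite gt_eqF.
by rewrite /lev /tcoord; field.
Qed.

Lemma tcoord_inj l P Q : l P = 0 -> l Q = 0 -> tcoord l P = tcoord l Q -> P = Q.
Proof.
move=> h1 h2 h3; rewrite (surjective_pairing P) (surjective_pairing Q).
by rewrite (coordx l P) (coordy l P) (coordx l Q) (coordy l Q) h1 h2 h3.
Qed.

Definition lpt l (t : R) : pt :=
  ((- la l * lc l - lb l * t) / (la l ^+ 2 + lb l ^+ 2),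
   (- lb l * lc l + la l * t) / (la l ^+ 2 + lb l ^+ 2)).

Lemma lptP l t : l (lpt l t) = 0.
Proof.
have h := lnorm l; have h0 : la l ^+ 2 + lb l ^+ 2 != 0 by rewrite gt_eqF.
by rewrite /lev /lpt /=; field.
Qed.

Lemma tcoord_lpt l t : tcoord l (lpt l t) = t.
Proof.
have h := lnorm l; have h0 : la l ^+ 2 + lb l ^+ 2 != 0 by rewrite gt_eqF.
by rewrite /tcoord /lpt /=; field.
Qed.

(** Both coordinates are affine in [l P] and [tcoord l P], so by induction a polynomial is a
    multiple of [l] plus a univariate polynomial in the parameter of [l]. The bound on the remainder
    makes counting zeros on [l] possible. *)
Lemma euclid n l f : pol n f ->
  exists g (h : {poly R}), [/\ pol n.-1 g, (size h <= n)%N &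
    forall P, f P = l P * g P + h.[tcoord l P]].
Proof.
elim: n f => [|n IH] f /=.
  by move=> h; exists (fun=> 0), 0; split=> //; rewrite ?size_poly0 // => P; rewrite h horner0; ring.
move=> [f1 [f2 [c [h1 h2 hf]]]].
have [g1 [k1 [pg1 sk1 e1]]] := IH _ h1; have [g2 [k2 [pg2 sk2 e2]]] := IH _ h2.
set N := la l ^+ 2 + lb l ^+ 2.
have N0 : N != 0 by rewrite gt_eqF // lnorm.
pose al : R := la l / N; pose be : R := lb l / N; pose ga : R := - (la l * lc l) / N; pose de : R := - (lb l * lc l) / N.
have ex P : P.1 = al * l P - be * tcoord l P + ga.
  by rewrite {1}(coordx l P) /al /be /ga -/N; field.
have ey P : P.2 = be * l P + al * tcoord l P + de.
  by rewrite {1}(coordy l P) /al /be /de -/N; field.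
pose k : {poly R} := (ga%:P - be *: 'X) * k1 + (de%:P + al *: 'X) * k2 + c%:P.
have pk (q : {poly R}) j : (size q <= j)%N -> pol j (fun P => q.[tcoord l P]).
  elim/poly_ind: q j => [|q a IHq] j.
    by move=> _; apply: pol_ext (pol0 j) => P; rewrite horner0.
  case: j => [|j].
    by rewrite leqn0 size_poly_eq0 => /eqP -> P; rewrite horner0.
  rewrite size_MXaddC; case: ifP => [/andP[/eqP-> /eqP->] _|_ lt].
    by apply: pol_ext (pol0 j.+1) => P; rewrite !hornerE; ring.
  have hq := IHq j lt.
  have hh := pol_lin (- lb l) (la l) (pol_x hq) (pol_y hq).
  apply: pol_ext (pol_lin 1 a hh (polC j 1)) => P.
  by rewrite hornerMXaddC /tcoord /=; ring.
exists (fun P => 1 * (P.1 * g1 P + P.2 * g2 P) + 1 * (al * k1.[tcoord l P] + be * k2.[tcoord l P])), k; split.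
- apply: pol_lin; last by apply: pol_lin; apply: pk.
  case: n {IH h1 h2 sk1 sk2} pg1 pg2 => [|n] /= pg1 pg2.
    by move=> P; rewrite pg1 pg2; ring.
  by exists g1, g2, 0; split=> // P; ring.
- rewrite /k; apply: leq_trans (size_polyD _ _) _; rewrite geq_max; apply/andP; split; last by rewrite (leq_trans (size_polyC_leq1 _)).
  have aux (a b : R) (q : {poly R}) : (size q <= n)%N -> (size ((a%:P + b *: 'X) * q)%R <= n.+1)%N.
    have [-> _|q0 sq] := eqVneq q 0; first by rewrite mulr0 size_poly0.
    apply: leq_trans (size_polyMleq _ _) _.
    have : (size (a%:P + b *: 'X)%R <= 2)%N.
      apply: leq_trans (size_polyD _ _) _; rewrite geq_max (leq_trans (size_polyC_leq1 _)) //=.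
      by apply: leq_trans (size_scale_leq _ _) _; rewrite size_polyX.
    by move: (size (a%:P + b *: 'X)%R) => z; lia.
  apply: leq_trans (size_polyD _ _) _; rewrite geq_max !aux // -scaleNr.
  by rewrite aux.
- move=> P; rewrite hf e1 e2 /k !(hornerD, hornerM, hornerN, hornerC, hornerZ, hornerX).
  have E1 : P.1 * k1.[tcoord l P] = (al * l P - be * tcoord l P + ga) * k1.[tcoord l P] by rewrite {1}(ex P).
  have E2 : P.2 * k2.[tcoord l P] = (be * l P + al * tcoord l P + de) * k2.[tcoord l P] by rewrite {1}(ey P).
  by rewrite (mulrDr P.1) (mulrDr P.2) E1 E2; ring.
Qed.

(** The remainder of [euclid] has degree below [n] and a root at the parameter of each point of [s],
    hence is zero. Nearly every later degree argument is an application of this. *)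
Lemma div_line n l f s : pol n f -> uniq s -> (n <= size s)%N ->
  (forall P, P \in s -> l P = 0 /\ f P = 0) ->
  exists g, pol n.-1 g /\ forall P, f P = l P * g P.
Proof.
move=> pf us sz hs; have [g [h [pg sh e]]] := euclid l pf.
exists g; split=> // P.
suff h0 : h = 0 by rewrite e h0 horner0 addr0.
apply: (@roots_geq_poly_eq0 _ _ (map (tcoord l) s)).
- apply/allP => t /mapP[Q /hs[lQ fQ] ->]; apply/rootP.
  by have := e Q; rewrite fQ lQ mul0r add0r => <-.
- rewrite map_inj_in_uniq // => Q S /hs[lQ _] /hs[lS _]; exact: tcoord_inj.
- by rewrite size_map (leq_trans sh).
Qed.

(* Equality of lines as point sets: proportional equations give distinct elements of [line]. *)
Definition eql l m := forall P, (l P == 0) = (m P == 0).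

Lemma eql_refl l : eql l l. Proof. by []. Qed.
Lemma eql_sym l m : eql l m -> eql m l. Proof. by move=> h P. Qed.
Lemma eql_trans l m k : eql l m -> eql m k -> eql l k.
Proof. by move=> h h' P; rewrite h h'. Qed.

Lemma line2_prop l m P Q : P <> Q -> l P = 0 -> l Q = 0 -> m P = 0 -> m Q = 0 ->
  exists2 k, k != 0 & forall S, l S = k * m S.
Proof.
move=> PQ lP lQ mP mQ.
pose t := tcoord m Q - tcoord m P.
have t0 : t != 0 by rewrite subr_eq0; apply/eqP => h; case: PQ; apply: (tcoord_inj mP mQ).
(* [l] is constant, hence zero, along [m] *)
have N0 : la m ^+ 2 + lb m ^+ 2 != 0 by rewrite gt_eqF // lnorm.
have cross : la l * lb m - lb l * la m = 0.
  have h : (la l * lb m - lb l * la m) * t = 0.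
    have e : forall S, m S = 0 -> l S * (la m ^+ 2 + lb m ^+ 2) =
       - (la l * lb m - lb l * la m) * tcoord m S - (la l * la m + lb l * lb m) * lc m + lc l * (la m ^+ 2 + lb m ^+ 2).
      move=> S mS; rewrite /lev (coordx m S) (coordy m S) mS; by field.
    have eP := e P mP; have eQ := e Q mQ; rewrite /t.
    have -> : (la l * lb m - lb l * la m) * (tcoord m Q - tcoord m P) =
      l P * (la m ^+ 2 + lb m ^+ 2) - l Q * (la m ^+ 2 + lb m ^+ 2) by rewrite eP eQ; ring.
    by rewrite lP lQ; ring.
  by move/eqP: h; rewrite mulf_eq0 (negbTE t0) orbF => /eqP.
(* The projection of the normal of [l] on that of [m]; the two are parallel by [cross]. *)
pose k := (la l * la m + lb l * lb m) / (la m ^+ 2 + lb m ^+ 2).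
have ka : la l = k * la m.
  apply: (mulIf N0); rewrite /k.
  have -> : (la l * la m + lb l * lb m) / (la m ^+ 2 + lb m ^+ 2) * la m * (la m ^+ 2 + lb m ^+ 2) = (la l * la m + lb l * lb m) * la m by field.
  have -> : la l * (la m ^+ 2 + lb m ^+ 2) = (la l * la m + lb l * lb m) * la m + lb m * (la l * lb m - lb l * la m) by ring.
  by rewrite cross; ring.
have kb : lb l = k * lb m.
  apply: (mulIf N0); rewrite /k.
  have -> : (la l * la m + lb l * lb m) / (la m ^+ 2 + lb m ^+ 2) * lb m * (la m ^+ 2 + lb m ^+ 2) = (la l * la m + lb l * lb m) * lb m by field.
  have -> : lb l * (la m ^+ 2 + lb m ^+ 2) = (la l * la m + lb l * lb m) * lb m - la m * (la l * lb m - lb l * la m) by ring.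
  by rewrite cross; ring.
have kc : lc l = k * lc m.
  have : l P = k * m P by rewrite lP mP mulr0.
  by rewrite /lev ka kb => h; apply: (addrI (k * la m * P.1 + k * lb m * P.2)); rewrite h; ring.
exists k => [|S]; last by rewrite /lev ka kb kc; ring.
by apply/eqP => k0; have := valP l; rewrite -/(la l) -/(lb l) ka kb k0 !mul0r eqxx.
Qed.

Lemma line2 l m P Q : P <> Q -> l P = 0 -> l Q = 0 -> m P = 0 -> m Q = 0 -> eql l m.
Proof.
move=> PQ lP lQ mP mQ S; have [k k0 ->] := line2_prop PQ lP lQ mP mQ.
by rewrite mulf_eq0 (negbTE k0).
Qed.

Lemma line_pt l s : exists P, l P = 0 /\ P \notin s.
Proof.
pose t := [seq lpt l i%:R | i <- iota 0 (size s).+1].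
have ut : uniq t.
  rewrite map_inj_in_uniq ?iota_uniq // => i j _ _ /(congr1 (tcoord l)).
  by rewrite !tcoord_lpt => /eqP; rewrite eqr_nat => /eqP.
have [/allP h|/allPn[P Pt Ps]] := boolP (all (mem s) t).
  by have := uniq_leq_size ut h; rewrite size_map size_iota ltnn.
by exists P; split=> //; case/mapP: Pt => i _ ->; exact: lptP.
Qed.

Lemma line_pts l s n : exists t, [/\ uniq t, size t = n & forall P, P \in t -> l P = 0 /\ P \notin s].
Proof.
elim: n => [|n [t [ut st h]]]; first by exists [::].
have [P [lP]] := line_pt l (s ++ t); rewrite mem_cat => /norP[Ps Pt].
exists (P :: t); split; rewrite /= ?ut ?Pt ?st // => Q; rewrite inE => /orP[/eqP->//|]; exact: h.
Qed.

Lemma eqlP l m : eql l m -> exists2 k, k != 0 & forall S, l S = k * m S.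
Proof.
move=> h; have [P [lP _]] := line_pt l [::]; have [Q [lQ]] := line_pt l [:: P].
rewrite inE => /eqP QP; apply: (@line2_prop l m P Q) => //; try by apply/eqP; rewrite -h ?lP ?lQ.
by move=> e; case: QP.
Qed.

Lemma line_of (a b c : R) : (a != 0) || (b != 0) ->
  exists l, forall P, l P = a * P.1 + b * P.2 + c.
Proof.
by move=> h; exists (exist (fun t : R * R * R => (t.1.1 != 0) || (t.1.2 != 0)) (a, b, c) h).
Qed.

Lemma line_thru P Q : exists l, l P = 0 /\ l Q = 0.
Proof.
have [->|PQ] := eqVneq P Q.
  have [|l h] := @line_of 1 0 (- Q.1); first by rewrite oner_neq0.
  by exists l; rewrite h; split; ring.
have [|l h] := @line_of (Q.2 - P.2) (P.1 - Q.1) (Q.1 * P.2 - P.1 * Q.2).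
  rewrite !subr_eq0 -negb_and; apply: contra PQ => /andP[/eqP h1 /eqP h2].
  by rewrite (surjective_pairing P) (surjective_pairing Q) h1 h2.
by exists l; rewrite !h; split; ring.
Qed.

Lemma pt_off l : exists P, l P != 0.
Proof.
exists (lpt l 0 + (la l, lb l)); apply/negP => /eqP h.
have := lnorm l; have N0 : la l ^+ 2 + lb l ^+ 2 != 0 by rewrite gt_eqF // lnorm.
have : l (lpt l 0 + (la l, lb l)) = l (lpt l 0) + (la l ^+ 2 + lb l ^+ 2).
  by rewrite /lev /=; ring.
by rewrite h lptP add0r => <-; rewrite ltxx.
Qed.

Lemma pol_line0 n l f s : pol n f -> uniq s -> (n <= size s)%N ->
  (forall P, P \in s -> l P = 0 /\ f P = 0) -> forall P, l P = 0 -> f P = 0.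
Proof.
by move=> h1 h2 h3 h4 P lP; have [g [_ ->]] := div_line h1 h2 h3 h4; rewrite lP mul0r.
Qed.

(** Only points [P] of [l] matter. A line [k] through [P] and a point off [l] meets [l] only in [P],
    so [f] has as many zeros on [k] as divisibility needs and vanishes at [P] too. *)
Lemma pol_cancel n l f : pol n f -> (forall P, l P * f P = 0) -> forall P, f P = 0.
Proof.
move=> pf h P; have [lP|] := eqVneq (l P) 0; last first.
  by have := h P => /eqP; rewrite mulf_eq0 => /orP[/eqP->|/eqP//]; rewrite eqxx.
have [Q lQ] := pt_off l; have [k [kP kQ]] := line_thru P Q.
have [t [ut st ht]] := line_pts k [:: P] n.
apply: (pol_line0 (l := k) pf ut) => //; first by rewrite st.
move=> S /ht[kS]; rewrite inE => /eqP SP; split=> //.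
apply/eqP; have /eqP := h S; rewrite mulf_eq0 => /orP[/eqP lS|//].
by have := line2 SP kS kP lS lP Q; rewrite kQ eqxx (negbTE lQ).
Qed.

Lemma lprod_seq m L s : uniq s -> (size L < size s)%N ->
  (forall P, P \in s -> m P = 0 /\ lprod L P = 0) -> exists2 l, l \in L & eql l m.
Proof.
elim: L s => [|l L IH] s us sz hs.
  case: s us sz hs => //= P s _ _ /(_ P); rewrite mem_head => /(_ isT)[_].
  by rewrite lprod_nil => /eqP; rewrite oner_eq0.
have [h|h] := boolP (1 < count (fun P => l P == 0%R) s)%N.
  exists l; first exact: mem_head.
  have us' := filter_uniq (fun P => l P == 0) us.
  have hm := mem_filter (fun P => l P == 0).
  move: h us' (hm ^~ s); rewrite -size_filter.
  case: [seq P <- s | l P == 0] => [|P [|Q t]] //= _ /andP[PQ _] hP.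
  have := hP P; rewrite inE eqxx => /esym/andP[/eqP lP /hs[mP _]].
  have := hP Q; rewrite !inE eqxx orbT => /esym/andP[/eqP lQ /hs[mQ _]].
  by apply: (line2 _ lP lQ mP mQ) => e; rewrite e inE eqxx in PQ.
have [] := IH [seq P <- s | l P != 0] (filter_uniq _ us).
- have := count_predC (fun P => l P == 0) s; rewrite size_filter /predC /=.
  move: h sz => /=; set a := count _ s; set b := count _ s; lia.
- move=> P; rewrite mem_filter => /andP[lP /hs[mP]]; rewrite lprod_cons => /eqP.
  by rewrite mulf_eq0 (negbTE lP) /= => /eqP.
- by move=> k kL km; exists k => //; rewrite inE kL orbT.
Qed.

Lemma lprod_dvd m L : (forall P, m P = 0 -> lprod L P = 0) -> exists2 l, l \in L & eql l m.
Proof.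
move=> h; have [t [ut st ht]] := line_pts m [::] (size L).+1.
by apply: (@lprod_seq m L t) => //; rewrite ?st // => P /ht[mP _]; split=> //; exact: h.
Qed.

Lemma lprod_rem l L P : l \in L -> lprod L P = l P * lprod (rem l L) P.
Proof. by move=> h; rewrite /lprod (big_rem l). Qed.

Lemma pol_sum n (U : seq pt) (c : pt -> R) (q : pt -> pt -> R) :
  (forall D, D \in U -> pol n (q D)) -> pol n (fun P => \sum_(D <- U) c D * q D P).
Proof.
elim: U => [|D U IH] h; first by apply: pol_ext (pol0 n) => P; rewrite big_nil.
have h1 : pol n (q D) by apply: h; rewrite mem_head.
have h2 := IH (fun S hS => h S (mem_behead (s := D :: U) hS)).
by apply: pol_ext (pol_lin (c D) 1 h1 h2) => P; rewrite big_cons mul1r.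
Qed.

(** Gaussian elimination, with unknowns indexed by [U] and equations by [s]: a pivot [D0] with
    [q D0 S] nonzero removes one of each. *)
Lemma kern (U s : seq pt) (q : pt -> pt -> R) : uniq U -> (size s < size U)%N ->
  exists c : pt -> R, (exists2 D, D \in U & c D != 0) /\
    (forall S, S \in s -> \sum_(D <- U) c D * q D S = 0).
Proof.
elim: s U q => [|S s IH] U q uU sz.
  case: U uU sz => //= D U _ _; exists (fun=> 1); split=> //.
  by exists D; rewrite ?mem_head ?oner_neq0.
have [/allP h|/allPn[D0 D0U qD0]] := boolP (all (fun D => q D S == 0) U).
  have [c [h1 h2]] := IH U q uU (ltnW sz).
  exists c; split=> // T; rewrite inE => /orP[/eqP->|/h2//].
  by rewrite big_seq big1 // => D /h/eqP->; rewrite mulr0.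
pose q' D P := q D P - q D S / q D0 S * q D0 P.
have [||c [[D1 D1U cD1] h2]] := IH (rem D0 U) q'; first exact: rem_uniq.
  by rewrite size_rem //; move: sz => /=; case: (size U).
have D1D0 : D1 != D0 by apply/eqP => e; rewrite e mem_rem_uniqF in D1U.
pose a := - \sum_(D <- rem D0 U) c D * (q D S / q D0 S).
exists (fun D => if D == D0 then a else c D); split.
  by exists D1; rewrite ?(negbTE D1D0) // (mem_rem D1U).
have eqs T : \sum_(D <- U) (if D == D0 then a else c D) * q D T = \sum_(D <- rem D0 U) c D * q' D T.
  rewrite (big_rem D0) //= eqxx /a mulNr mulr_suml -sumrN -big_split /= big_seq [RHS]big_seq.
  apply: eq_bigr => D DU; rewrite ifN; last by apply/eqP => e; rewrite e mem_rem_uniqF in DU.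
  by rewrite /q'; ring.
move=> T; rewrite inE eqs => /orP[/eqP->|/h2//].
by rewrite big1 // => D _; rewrite /q' divfK ?subrr ?mulr0.
Qed.

End PlanePolynomials.

Lemma seq_choice (T : eqType) (A : Type) (a0 : A) (U : seq T) (H : T -> A -> Prop) :
  (forall D, D \in U -> exists q, H D q) -> exists Q : T -> A, forall D, D \in U -> H D (Q D).
Proof.
elim: U => [|D U IH] h; first by exists (fun=> a0).
have [Q hQ] := IH (fun S hS => h S (mem_behead (s := D :: U) hS)).
have [q hq] := h D (mem_head _ _).
exists (fun S => if S == D then q else Q S) => S; rewrite inE.
by have [->|_] := eqVneq S D => //= /hQ.
Qed.

Lemma neqs (T : eqType) (x y : T) : x != y -> y != x.
Proof. by rewrite eq_sym. Qed.

Lemma third (i j : 'I_3) : i != j -> exists k : 'I_3, [/\ k != i, k != j & forall h, [|| h == i, h == j | h == k]].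
Proof.
case: i j => [[|[|[|//]]] hi] [[|[|[|//]]] hj] // _.
- by exists ord_max; split=> // -[[|[|[|//]]] hh].
- by exists (Ordinal (isT : (1 < 3)%N)); split=> // -[[|[|[|//]]] hh].
- by exists ord_max; split=> // -[[|[|[|//]]] hh].
- by exists ord0; split=> // -[[|[|[|//]]] hh].
- by exists (Ordinal (isT : (1 < 3)%N)); split=> // -[[|[|[|//]]] hh].
- by exists ord0; split=> // -[[|[|[|//]]] hh].
Qed.

Lemma other (i : 'I_3) : exists j : 'I_3, j != i.
Proof. by case: i => [[|[|[|//]]] hi]; [exists ord_max|exists ord0|exists ord0]. Qed.

(** * Users of a line and combinations of their quintics *)

Section Config.
Variable R : realFieldType.
Notation pt := (R * R)%type.
Notation line := (line R).
Implicit Types (l m : line) (P Q S D : pt) (f g q : pt -> R) (n : nat) (s U : seq pt) (i j k : 'I_3).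

Variable X : seq pt.
Hypothesis uX : uniq X.
Hypothesis Xc : forall f, pol 7 f -> (forall P, P \in X -> f P = 0) -> forall P, f P = 0.
Hypothesis GC : forall D, D \in X -> exists L : seq line,
  [/\ size L = 6%N, lprod L D != 0 & forall P, P \in X -> P <> D -> lprod L P = 0].

Definition cn l := count (fun P => l P == 0) X.

(** The zeros on [l] are its nodes outside [E], at least [cn l - size E] of them, and the points of
    [t], which are distinct from these because they lie outside [X]. *)
Lemma divXs n l f (E t : seq pt) : pol n f -> (n + size E <= cn l + size t)%N -> uniq t ->
  (forall P, P \in X -> l P = 0 -> P \notin E -> f P = 0) ->
  (forall P, P \in t -> [/\ l P = 0, f P = 0 & P \notin X]) ->
  exists g, pol n.-1 g /\ forall P, f P = l P * g P.
Proof.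
move=> pf sz ut h ht.
pose s := [seq P <- X | (l P == 0) && (P \notin E)].
apply: (@div_line _ n l f (s ++ t)) => //.
- rewrite cat_uniq filter_uniq // ut andbT; apply/hasPn => P /ht[_ _ PX].
  by rewrite /= mem_filter negb_and PX orbT.
- rewrite size_cat size_filter.
  have : (cn l <= count (fun P => (l P == 0%R) && (P \notin E)) X + size E)%N.
    apply: (@leq_trans (count (fun P => (l P == 0%R) && (P \notin E)) X + count (mem E) X)%N).
      rewrite -count_predUI; apply: leq_trans (leq_addr _ _).
      by apply: sub_count => P /= ->; case: (P \in E).
    rewrite leq_add2l -size_filter uniq_leq_size ?filter_uniq // => P.
    by rewrite mem_filter => /andP[].
  by move: sz; lia.
move=> P; rewrite mem_cat => /orP[|/ht[]//].
by rewrite mem_filter => /andP[/andP[/eqP lP PE] PX]; split=> //; exact: h.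
Qed.

Lemma divX n l f (E : seq pt) : pol n f -> (n + size E <= cn l)%N ->
  (forall P, P \in X -> l P = 0 -> P \notin E -> f P = 0) ->
  exists g, pol n.-1 g /\ forall P, f P = l P * g P.
Proof. by move=> h1 h2 h3; apply: (@divXs n l f E [::]) => //; rewrite addn0. Qed.

Definition fund D f := [/\ pol 7 f, f D != 0 & forall P, P \in X -> P <> D -> f P = 0].

Lemma fund_eq D f g : fund D f -> fund D g -> forall P, g D * f P = f D * g P.
Proof.
move=> [pf fD f0] [pg gD g0] P; apply/eqP; rewrite -subr_eq0; apply/eqP.
suff /(_ P) e : forall S, g D * f S + - f D * g S = 0 by rewrite -e; ring.
apply: Xc (pol_lin _ _ pf pg) _ => S SX.
by have [->|/eqP SD] := eqVneq S D; [ring|rewrite (f0 S) // (g0 S) //; ring].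
Qed.

(* [m * q] is a scalar multiple of the fundamental polynomial of [D], so [D] uses [m]. *)
Definition usesq m D q :=
  [/\ D \in X, m D != 0, pol 6 q, q D != 0 & forall P, P \in X -> P <> D -> m P != 0 -> q P = 0].
Definition usr m D := exists q, usesq m D q.

Lemma usesq_fund m D q : usesq m D q -> fund D (fun P => m P * q P).
Proof.
move=> [DX mD pq qD q0]; split; first exact: pol_line.
  by rewrite mulf_neq0.
move=> P PX PD; have [->|mP] := eqVneq (m P) 0; first by rewrite mul0r.
by rewrite q0 ?mulr0.
Qed.

Lemma usr_X m D : usr m D -> D \in X. Proof. by case=> q []. Qed.
Lemma usr_off m D : usr m D -> m D != 0. Proof. by case=> q []. Qed.

Lemma fund_usesq m D f g : D \in X -> fund D f -> pol 6 g -> (forall P, f P = m P * g P) -> usesq m D g.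
Proof.
move=> DX [pf fD f0] pg e; move: (fD); rewrite e mulf_eq0 negb_or => /andP[mD gD].
split=> // P PX PD mP; have := f0 P PX PD; rewrite e => /eqP.
by rewrite mulf_eq0 (negbTE mP) => /eqP.
Qed.

Lemma eql_usr m l D : eql m l -> usr m D -> usr l D.
Proof.
move=> /eqlP[k k0 e] [q [DX mD pq qD q0]]; exists q.
have e0 P : (m P != 0) = (l P != 0) by rewrite e mulf_eq0 (negbTE k0).
by split=> // [|P PX PD lP]; rewrite -?e0 //; apply: q0 => //; rewrite e0.
Qed.

Lemma lns_fund D L : D \in X -> size L = 6%N -> lprod L D != 0 ->
  (forall P, P \in X -> P <> D -> lprod L P = 0) -> fund D (lprod L).
Proof. by move=> DX sL h1 h2; split=> //; apply: pol_lprod; rewrite sL. Qed.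

Lemma usr_lns m D L : D \in X -> size L = 6%N -> lprod L D != 0 ->
  (forall P, P \in X -> P <> D -> lprod L P = 0) -> usr m D -> exists2 l, l \in L & eql l m.
Proof.
move=> DX sL h1 h2 [q hq]; apply: lprod_dvd => P mP.
have := fund_eq (usesq_fund hq) (lns_fund DX sL h1 h2) P.
case: hq => _ mD _ qD _; rewrite mP mul0r mulr0 => /esym/eqP.
by rewrite mulf_eq0 mulf_eq0 (negbTE mD) (negbTE qD) => /eqP.
Qed.

Lemma lns_usr l D L : D \in X -> size L = 6%N -> lprod L D != 0 ->
  (forall P, P \in X -> P <> D -> lprod L P = 0) -> l \in L -> usr l D.
Proof.
move=> DX sL h1 h2 lL; exists (lprod (rem l L)).
apply: (fund_usesq DX (lns_fund DX sL h1 h2)) => [|P]; last exact: lprod_rem.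
by apply: pol_lprod; rewrite size_rem // sL.
Qed.

Lemma usr_at D P : D \in X -> P \in X -> P <> D -> exists m, usr m D /\ m P = 0.
Proof.
move=> DX PX PD; have [L [sL h1 h2]] := GC DX.
have /eqP := h2 P PX PD; rewrite lprod_eq0 => /hasP[l lL /eqP lP].
by exists l; split=> //; apply: (lns_usr DX sL h1 h2).
Qed.

(** Both lines divide the same fundamental polynomial, and [l] has at most one point on [m], so [l]
    divides what is left after [m]. *)
Lemma usr2 m l D q : usesq m D q -> usr l D -> ~ eql m l ->
  exists q', [/\ pol 5 q', (forall P, q P = l P * q' P) & usesq l D (fun P => m P * q' P)].
Proof.
move=> hq [g hg] ne; have [DX mD pq qD q0] := hq.
have e := fund_eq (usesq_fund hq) (usesq_fund hg).
(* Seven points: at most one lies on [m], and a quintic needs six zeros. *)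
have [t [ut st ht]] := line_pts l [::] 7.
have [q' [pq' eq']] : exists q', pol 5 q' /\ forall P, q P = l P * q' P.
  apply: (@div_line _ 6 l q [seq P <- t | m P != 0]) => //; first exact: filter_uniq.
  - have h : (count (fun P => m P == 0%R) t <= 1)%N.
      rewrite leqNgt -size_filter; apply/negP.
      have us' := filter_uniq (fun P => m P == 0) ut.
      have hm := mem_filter (fun P => m P == 0).
      move: us' (hm ^~ t); case: [seq P <- t | m P == 0] => [|A [|B r]] //= /andP[AB _] hP _.
      have := hP A; rewrite inE eqxx => /esym/andP[/eqP mA /ht[lA _]].
      have := hP B; rewrite !inE eqxx orbT => /esym/andP[/eqP mB /ht[lB _]].
      by case: ne; apply: (line2 _ mA mB lA lB) => e'; rewrite e' inE eqxx in AB.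
    have := count_predC (fun P => m P == 0) t; rewrite st size_filter.
    by move: h; set a := count _ _; rewrite /predC /=; set b := count _ _; lia.
  - move=> P; rewrite mem_filter => /andP[mP /ht[lP _]]; split=> //.
    case: hg => _ lD _ gD _; have /= := e P; rewrite lP mul0r mulr0 => /eqP.
    by rewrite !mulf_eq0 (negbTE lD) (negbTE gD) (negbTE mP) => /eqP.
exists q'; split=> //; apply: (fund_usesq DX (usesq_fund hq)) => [|P]; first exact: pol_line.
by rewrite eq'; ring.
Qed.

(** Without a common node of [m] and [l], the quintic of [D] for [m] would vanish at the six nodes
    of [l], and [D] would use [l]. *)
Lemma hit6 l m D : (6 <= cn l)%N -> ~ usr l D -> usr m D -> l D != 0 ->
  exists P, [/\ P \in X, l P = 0 & m P = 0].
Proof.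
move=> c6 nl [q hq] lD; have [DX mD pq qD q0] := hq.
have [/hasP[P PX /andP[/eqP lP /eqP mP]]|/hasPn h] := boolP (has (fun P => (l P == 0) && (m P == 0)) X).
  by exists P.
case: nl; have [|P PX lP _|q' [pq' e]] := @divX 6 l q [::] pq.
- by rewrite addn0.
- apply: q0 => // [e|]; first by rewrite -e lP eqxx in lD.
  by have := h P PX; rewrite lP eqxx.
exists (fun P => m P * q' P); apply: (fund_usesq DX (usesq_fund hq)) => [|P]; first exact: pol_line.
by rewrite e; ring.
Qed.

(* [s] imposes fewer conditions than there are users, hence some nonzero combination of their
   quintics vanishes on [s]. *)
Lemma Wm m U s : uniq U -> (forall D, D \in U -> usr m D) -> (size s < size U)%N ->
  exists f, [/\ pol 6 f, forall P, P \in X -> m P != 0 -> P \notin U -> f P = 0,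
    forall S, S \in s -> f S = 0, forall S, (forall D q, D \in U -> usesq m D q -> q S = 0) -> f S = 0 &
    exists2 D, D \in U & f D != 0].
Proof.
move=> uU hU sz; have [Q hQ] := seq_choice (fun=> 0 : R) hU.
have [c [[D DU cD] h]] := @kern _ U s Q uU sz.
exists (fun P => \sum_(D <- U) c D * Q D P); split=> //.
- by apply: pol_sum => S /hQ[].
- move=> P PX mP PU; rewrite big_seq big1 // => S SU.
  by have [_ _ _ _ ->] := hQ S SU => //; rewrite ?mulr0 // => e; rewrite e SU in PU.
- by move=> S hS; rewrite big_seq big1 // => D' DU'; rewrite (hS D' (Q D') DU' (hQ D' DU')) mulr0.
- exists D => //; have [DX mD _ QD _] := hQ D DU.
  rewrite (big_rem D) //= big_seq big1 ?addr0 ?mulf_neq0 // => S SU.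
  have SU' := mem_rem SU; have [_ _ _ _ ->] := hQ S SU' => //; first by rewrite mulr0.
  by move=> e; rewrite -e mem_rem_uniqF in SU.
Qed.

(** * Three disjoint lines with six nodes and the cubics on the other ten nodes *)

Variable el : 'I_3 -> line.
Hypothesis el6 : forall i, cn (el i) = 6%N.
Hypothesis eld : forall i j P, P \in X -> el i P = 0 -> el j P = 0 -> i = j.

Definition Y := [seq P <- X | [forall i, el i P != 0]].
Hypothesis sY : size Y = 10%N.

Lemma inY P : reflect (P \in X /\ forall i, el i P != 0) (P \in Y).
Proof. by rewrite mem_filter andbC; apply: (iffP andP) => -[h1 /forallP h2]. Qed.

Lemma eld' i j P : P \in X -> el i P = 0 -> j != i -> el j P != 0.
Proof. by move=> PX iP; apply: contraNneq => jP; apply/eqP; apply: (eld PX). Qed.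

Lemma el_neq i j : i != j -> ~ eql (el i) (el j).
Proof.
move=> ij h; have : (0 < cn (el i))%N by rewrite el6.
rewrite -has_count => /hasP[P PX /eqP iP].
by have := eld' PX iP (neqs ij); rewrite -h iP eqxx.
Qed.

(** After division by [el j] the quintic vanishes at the six nodes of the third line, and its
    quotient at the five nodes of [el i] other than [D]; being divisible by [el i], it would vanish
    at [D]. *)
Lemma prim_not_el m D i j : usr m D -> el i D = 0 -> ~ eql m (el j).
Proof.
move=> [q [DX mD pq qD q0]] iD e.
have [ji|ji] := eqVneq j i; first by rewrite e ji iD eqxx in mD.
have [k [kj ki _]] := third ji.
have z P : P \in X -> P <> D -> el j P != 0 -> q P = 0 by move=> PX PD h; apply: q0 => //; rewrite e.
have [|P PX kP _|g [pg eg]] := @divX 6 (el k) q [::] pq; first by rewrite addn0 el6.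
  apply: z => //; last by rewrite (eld' PX kP) // eq_sym.
  by move=> e1; have := eld' DX iD ki; rewrite -e1 kP eqxx.
have [|P PX iP|h [_ eh]] := @divX 5 (el i) g [:: D] pg; first by rewrite el6.
  rewrite inE => /eqP PD; have := z P PX PD (eld' PX iP ji); rewrite eg => /eqP.
  by rewrite mulf_eq0 (negbTE (eld' PX iP ki)) => /eqP.
by move: qD; rewrite eg eh iD mul0r mulr0 eqxx.
Qed.

Lemma prim_not_usr D i j : el i D = 0 -> ~ usr (el j) D.
Proof. by move=> iD h; apply: (prim_not_el h iD (eql_refl (el j))). Qed.

Lemma meets m D i j : usr m D -> el i D = 0 -> j != i ->
  exists P, [/\ P \in X, el j P = 0 & m P = 0].
Proof.
move=> h iD ji; apply: (hit6 _ _ h _); rewrite ?el6 //; first exact: (prim_not_usr iD).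
by apply: (eld' (usr_X h) iD ji).
Qed.

Lemma meet_uniq m D i j P Q : usr m D -> el i D = 0 -> el j P = 0 -> m P = 0 -> el j Q = 0 -> m Q = 0 -> P = Q.
Proof.
move=> h iD jP mP jQ mQ; apply/eqP; apply/negP => /negP/eqP PQ.
by apply: (prim_not_el h iD); exact: (line2 PQ mP mQ jP jQ).
Qed.

(** Where the two lines divided out in [cubic] do not vanish, so that zeros of the quintic pass to
    the cubic. *)
Definition offi i P := forall h, h != i -> el h P != 0.

Lemma Y_offi i P : P \in Y -> offi i P.
Proof. by move=> /inY[_ h] k _. Qed.

Lemma el_offi i P : P \in X -> el i P = 0 -> offi i P.
Proof. by move=> PX iP k ki; apply: eld' iP ki. Qed.

(** One condition, at [Pj], makes a combination of the quintics vanish at all six nodes of [el j].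
    The quotient is a quartic, for which the five nodes of [el k] other than [Pk] suffice, so [Pk]
    costs nothing; hence [s] may have two points fewer than [U]. The clause on points where all the
    quintics vanish serves for a second line used by all of [U]. *)
Lemma cubic m i U s : uniq U -> (forall D, D \in U -> usr m D /\ el i D = 0) ->
  ((size s).+1 < size U)%N -> (forall S, S \in s -> offi i S) ->
  exists r, [/\ pol 4 r, forall P, P \in X -> offi i P -> m P != 0 -> P \notin U -> r P = 0,
    forall S, S \in s -> r S = 0,
    forall S, offi i S -> (forall D q, D \in U -> usesq m D q -> q S = 0) -> r S = 0 &
    exists2 D, D \in U & r D != 0].
Proof.
move=> uU hU sz so.
have [D0 D0U] : exists D0, D0 \in U by case: (U) sz => // D0 U' _; exists D0; rewrite mem_head.
have [u0 iD0] := hU _ D0U.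
have [j ji] := other i; have [k [kj ki _]] := third ji.
have [Pj [PjX jPj mPj]] := meets u0 iD0 ji.
have [Pk [PkX kPk mPk]] := meets u0 iD0 ki.
have [f [pf f0 fs fv [D DU fD]]] := @Wm m U (Pj :: s) uU (fun D h => (hU D h).1) sz.
have offU P h : P \in X -> el h P = 0 -> h != i -> P \notin U.
  by move=> PX hP hi; apply/negP => /hU[_ iP]; have := eld' PX iP hi; rewrite hP eqxx.
have [|P PX jP _|g [pg eg]] := @divX 6 (el j) f [::] pf; first by rewrite addn0 el6.
  have [->|/eqP PPj] := eqVneq P Pj; first by apply: fs; rewrite mem_head.
  apply: f0 => //; last exact: (offU _ j).
  by apply/negP => /eqP mP; apply: PPj; exact: (meet_uniq u0 iD0 jP mP jPj mPj).
have [|P PX kP|r [pr er]] := @divX 5 (el k) g [:: Pk] pg; first by rewrite el6.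
  rewrite inE => /eqP PPk; have : f P = 0.
    apply: f0 => //; last exact: (offU _ k).
    by apply/negP => /eqP mP; apply: PPk; exact: (meet_uniq u0 iD0 kP mP kPk mPk).
  rewrite eg => /eqP; rewrite mulf_eq0 => /orP[/eqP jP|/eqP//].
  by have := eld' PX kP (neqs kj); rewrite jP eqxx.
have e P : f P = el j P * (el k P * r P) by rewrite eg er.
have z P : offi i P -> f P = 0 -> r P = 0.
  move=> oP /eqP; rewrite e !mulf_eq0 (negbTE (oP _ ji)) (negbTE (oP _ ki)) => /eqP//.
exists r; split=> //.
- by move=> P PX oP mP PU; apply: z => //; apply: f0.
- by move=> S Ss; apply: z; [exact: so|apply: fs; rewrite inE Ss orbT].
- by move=> S oS hS; apply: z => //; exact: fv.
- by exists D => //; apply: contra fD => /eqP rD; rewrite e rD !mulr0.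
Qed.

(* [Y] is unisolvent for cubics: multiply by the three lines [el i]. *)
Lemma Y3 f : pol 4 f -> (forall P, P \in Y -> f P = 0) -> forall P, f P = 0.
Proof.
move=> pf z; pose i0 : 'I_3 := ord0; have [j ji] := other i0; have [k [kj ki hk]] := third ji.
apply: (pol_cancel (l := el i0) pf); apply: (pol_cancel (l := el j) (pol_line (el i0) pf)).
apply: (pol_cancel (l := el k) (pol_line _ (pol_line _ pf))).
apply: Xc; first by do 3 apply: pol_line.
move=> P PX; have [/eqP->|h1] := boolP (el i0 P == 0); first by rewrite !(mul0r, mulr0).
have [/eqP->|h2] := boolP (el j P == 0); first by rewrite !(mul0r, mulr0).
have [/eqP->|h3] := boolP (el k P == 0); first by rewrite !(mul0r, mulr0).
rewrite z ?mulr0 //; apply/inY; split=> // h.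
by case/or3P: (hk h) => /eqP->.
Qed.

(** The cubic of two distinct users vanishes at the four other nodes of [el i], none being on [m];
    so [el i] divides it and it vanishes at the users. *)
Lemma pair_one m D D' i : usr m D -> usr m D' -> el i D = 0 -> el i D' = 0 ->
  (forall P, P \in X -> el i P = 0 -> m P != 0) -> D = D'.
Proof.
move=> h h' iD iD' nm; apply/eqP; apply/negP => /negP DD'.
have [|S|//|//|r [pr r0 _ _ [E EU rE]]] := @cubic m i [:: D; D'] [::].
- by rewrite /= inE DD'.
- by rewrite !inE => /orP[/eqP->|/eqP->].
have [|P PX iP PU|g [_ eg]] := @divX 4 (el i) r [:: D; D'] pr; first by rewrite el6.
  by apply: r0 => //; [exact: el_offi|exact: nm].
by move: rE; rewrite eg; move: EU; rewrite !inE => /orP[/eqP->|/eqP->]; rewrite ?iD ?iD' mul0r eqxx.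
Qed.

Definition ym m := [seq P <- Y | m P == 0].

(** With two more users than nodes of [Y] on [m], the cubic could be killed at these nodes as well
    and would vanish on all of [Y]. *)
Lemma ybound m i U : uniq U -> (forall D, D \in U -> usr m D /\ el i D = 0) ->
  (size U <= (size (ym m)).+1)%N.
Proof.
move=> uU hU; rewrite leqNgt; apply/negP => sz.
have [S|r [pr r0 rs _ [D DU rD]]] := @cubic m i U (ym m) uU hU sz.
  by rewrite mem_filter => /andP[_]; exact: Y_offi.
move: rD; rewrite (Y3 pr) ?eqxx // => P PY.
have [mP|mP] := eqVneq (m P) 0; first by apply: rs; rewrite mem_filter mP eqxx.
apply: r0 => //; [by case/inY: PY|exact: Y_offi|].
by apply/negP => /hU[_ iP]; case/inY: PY => _ /(_ i); rewrite iP eqxx.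
Qed.

Definition yfund y g := [/\ pol 4 g, g y != 0 & forall P, P \in Y -> P <> y -> g P = 0].

(** Killing all nodes of [Y] on [m] except [y] turns the cubic of the users into a multiple of the
    fundamental cubic [g] of [y], which inherits its zeros on [el i]. *)
Lemma base m i U y g : uniq U -> (forall D, D \in U -> usr m D /\ el i D = 0) ->
  (size (ym m) < size U)%N -> y \in Y -> m y = 0 -> yfund y g ->
  forall P, P \in X -> el i P = 0 -> m P != 0 -> P \notin U -> g P = 0.
Proof.
move=> uU hU sz yY my [pg gy g0] P PX iP mP PU.
have yym : y \in ym m by rewrite mem_filter my eqxx.
have [||r [pr r0 rs _ [D DU rD]]] := @cubic m i U (rem y (ym m)) uU hU.
- by rewrite size_rem //; case: (ym m) yym sz.
- by move=> S /mem_rem; rewrite mem_filter => /andP[_]; exact: Y_offi.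
have z Q : Q \in Y -> Q <> y -> r Q = 0.
  move=> QY Qy; have [mQ|mQ] := eqVneq (m Q) 0.
    have uym : uniq (ym m) by rewrite /ym /Y !filter_uniq.
    by apply: rs; rewrite (mem_rem_uniq _ uym); apply/andP; split; [apply/eqP|rewrite mem_filter mQ eqxx].
  apply: r0 => //; [by case/inY: QY|exact: Y_offi|].
  by apply/negP => /hU[_ iQ]; case/inY: QY => _ /(_ i); rewrite iQ eqxx.
have e Q : r y * g Q + - g y * r Q = 0.
  apply: (Y3 (pol_lin (r y) (- g y) pg pr)) => S SY.
  by have [->|/eqP Sy] := eqVneq S y; [ring|rewrite (g0 S) // (z S) //; ring].
have ry : r y != 0.
  apply: contraNneq rD => ry; have /eqP := e D.
  by rewrite ry mul0r add0r mulf_eq0 oppr_eq0 (negbTE gy).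
have /eqP := e P; rewrite (r0 P PX (el_offi PX iP) mP PU) mulr0 addr0 mulf_eq0 (negbTE ry).
by move/eqP.
Qed.

Hypothesis M6 : forall l, (cn l <= 6)%N.

Lemma Yel P i : P \in Y -> el i P != 0.
Proof. by case/inY. Qed.

Lemma YX P : P \in Y -> P \in X.
Proof. by case/inY. Qed.

Lemma uY : uniq Y.
Proof. exact: filter_uniq. Qed.

Lemma uym m : uniq (ym m).
Proof. exact: filter_uniq uY. Qed.

Lemma in_ym m P : (P \in ym m) = (m P == 0) && (P \in Y).
Proof. exact: mem_filter. Qed.

Lemma notY P : P \in X -> P \notin Y -> exists i, el i P = 0.
Proof.
move=> PX; rewrite mem_filter PX andbT => /forallPn[i]; rewrite negbK => /eqP h.
by exists i.
Qed.

Lemma elY P i : el i P = 0 -> P \notin Y.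
Proof. by move=> iP; apply/negP => /(@Yel P i); rewrite iP eqxx. Qed.

Lemma on6 l t : uniq t -> (forall P, P \in t -> P \in X /\ l P = 0) -> (size t <= 6)%N.
Proof.
move=> ut ht; apply: leq_trans (M6 l); rewrite /cn -size_filter uniq_leq_size // => P /ht[PX lP].
by rewrite mem_filter lP eqxx PX.
Qed.

Lemma take_count (T : eqType) (p : pred T) (s : seq T) n : uniq s -> (n <= count p s)%N ->
  exists t, [/\ uniq t, size t = n & forall x, x \in t -> x \in s /\ p x].
Proof.
move=> us h; exists (take n (filter p s)); split.
- by rewrite take_uniq // filter_uniq.
- by rewrite size_takel // size_filter.
- by move=> x /mem_take; rewrite mem_filter => /andP[].
Qed.

Lemma el_pt m i D : el i D = 0 -> m D != 0 ->
  exists Q, forall P, P \in X -> el i P = 0 -> m P = 0 -> P = Q.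
Proof.
move=> iD mD; have [/hasP[Q QX /andP[/eqP iQ /eqP mQ]]|/hasPn h] :=
  boolP (has (fun Q => (el i Q == 0) && (m Q == 0)) X).
  exists Q => P PX iP mP; apply/eqP; apply/negP => /negP/eqP PQ.
  by move: mD; rewrite (line2 PQ mP mQ iP iQ) iD eqxx.
by exists D => P PX iP mP; have := h P PX; rewrite iP mP eqxx.
Qed.

Lemma max_neq_el la i : (0 < size (ym la))%N -> ~ eql la (el i).
Proof.
case E : (ym la) => [//|y s] _ e; have : y \in ym la by rewrite E mem_head.
by rewrite in_ym e => /andP[iy /(Yel i)]; rewrite iy.
Qed.

(** A user on [el i] forces [la] to meet the two other lines in nodes. With four nodes in [Y] this
    makes six, and a node on [el i] would be a seventh. *)
Lemma max_avoid la i D Q : (4 <= size (ym la))%N -> usr la D -> el i D = 0 ->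
  Q \in X -> el i Q = 0 -> la Q = 0 -> False.
Proof.
move=> h4 u0 iD QX iQ lQ; have [j ji] := other i; have [k [kj ki _]] := third ji.
have [Pj [PjX jPj lPj]] := meets u0 iD ji; have [Pk [PkX kPk lPk]] := meets u0 iD ki.
have u : uniq (Q :: Pj :: Pk :: ym la).
  rewrite /= uym !inE !in_ym (negbTE (elY iQ)) (negbTE (elY jPj)) (negbTE (elY kPk)) !andbF !orbF !andbT.
  rewrite negb_or -!andbA; apply/and3P; split; apply/eqP => e.
  - by have := eld' QX iQ ji; rewrite e jPj eqxx.
  - by have := eld' QX iQ ki; rewrite e kPk eqxx.
  - by have := eld' PjX jPj kj; rewrite e kPk eqxx.
have : (size (Q :: Pj :: Pk :: ym la) <= 6)%N.
  apply: (@on6 la) => // P; rewrite !inE => /or4P[/eqP->|/eqP->|/eqP->|] //.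
  by rewrite in_ym => /andP[/eqP-> /YX].
by move: h4 => /=; lia.
Qed.

(* If [m] misses the four nodes of [Y] on [la], then either every [el i] has at most one user of
   [m], or all primary users of [m] lie on one [el i]. *)
Section LemmaV.
Variables (m la : line) (D D' : pt) (i : 'I_3).
Hypotheses (la4 : (4 <= size (ym la))%N) (mis : forall P, P \in Y -> la P = 0 -> m P != 0).
Hypotheses (uD : usr m D) (uD' : usr m D') (iD : el i D = 0) (iD' : el i D' = 0) (DD' : D <> D').

(** The cubic of [D] and [D'] vanishes at four nodes of [la], so [la] divides it. Without [Q] the
    conic left would vanish at all nodes of [el i] but [D], [D'] and one on [m]; three zeros suffice
    for [el i] to divide it, and the cubic would vanish at the users. *)
Lemma lemV_Q : exists Q, [/\ Q \in X, el i Q = 0, la Q = 0 & [/\ m Q != 0, Q <> D & Q <> D']].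
Proof.
have [/hasP[Q QX /and5P[/eqP iQ /eqP lQ mQ /eqP QD /eqP QD']]|/hasPn h] :=
  boolP (has (fun Q => [&& el i Q == 0, la Q == 0, m Q != 0, Q != D & Q != D']) X).
  by exists Q.
have [|S|//|//|r [pr r0 _ _ [E EU rE]]] := @cubic m i [:: D; D'] [::].
- by rewrite /= inE andbT; apply/eqP.
- by rewrite !inE => /orP[/eqP->|/eqP->].
have [P|g [pg eg]] := div_line (l := la) pr (uym la) la4.
  rewrite in_ym => /andP[/eqP lP PY]; split=> //; apply: r0 => //; [exact: YX|exact: Y_offi|exact: mis|].
  rewrite !inE; apply/negP => PU; have := Yel i PY.
  by case/orP: PU => /eqP->; rewrite ?iD ?iD' eqxx.
have [Pm hPm] := el_pt iD (usr_off uD).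
have [|P PX iP|c [_ ec]] := @divX 3 (el i) g [:: D; D'; Pm] pg; first by rewrite el6.
  rewrite !inE !negb_or => /and3P[PD PD' PPm].
  have mP : m P != 0 by apply: contraNneq PPm => mP; rewrite (hPm P PX iP mP).
  have /eqP : r P = 0 by apply: r0 => //; [exact: el_offi|rewrite !inE negb_or PD PD'].
  rewrite eg mulf_eq0 => /orP[lP|/eqP//]; have := h P PX.
  by rewrite iP eqxx lP mP PD PD'.
by move: rE; rewrite eg ec; move: EU; rewrite !inE => /orP[/eqP->|/eqP->]; rewrite ?iD ?iD' mul0r mulr0 eqxx.
Qed.

Variable Q : pt.
Hypotheses (QX : Q \in X) (iQ : el i Q = 0) (lQ : la Q = 0) (mQ : m Q != 0) (QD : Q <> D) (QD' : Q <> D').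

Let QY : Q \notin Y. Proof. exact: elY iQ. Qed.

(** A further node of [la] off [m] would be, with [Q] and the four nodes of [Y], a sixth zero on
    [la] of the quintic of [D]; then [D] would use [la], against [max_avoid]. *)
Lemma lemV_only P : P \in X -> la P = 0 -> m P != 0 -> P \in Y \/ P = Q.
Proof.
move=> PX lP mP; have [PY|PY] := boolP (P \in Y); [by left|right].
apply/eqP; apply/negP => /negP/eqP PQ; have [h hP] := notY PX PY.
have hi : h != i.
  apply/eqP => hi; apply: (@max_neq_el la i); first by rewrite (leq_trans _ la4).
  by apply: (line2 PQ lP lQ _ iQ); rewrite -hi.
have [q hq] := uD; have [DX mD pq qD q0] := hq.
have [||S|g [pg eg]] := @div_line _ 6 la q (Q :: P :: ym la) pq.
- by rewrite /= uym !inE !in_ym (negbTE QY) (negbTE PY) !andbF orbF !andbT; apply/eqP => e; apply: PQ.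
- by rewrite /= !ltnS.
- rewrite !inE in_ym => /or3P[/eqP->|/eqP->|/andP[/eqP lS SY]].
  + by split=> //; apply: q0.
  + split=> //; apply: q0 => // e; rewrite e in hP.
    by move: hi; rewrite (eld DX hP iD) eqxx.
  + split=> //; apply: q0; [exact: YX| |exact: mis].
    by move=> e; move: (Yel i SY); rewrite e iD eqxx.
apply: (max_avoid la4 _ iD QX iQ lQ).
exists (fun P => m P * g P); apply: (fund_usesq DX (usesq_fund hq)) => [|S]; first exact: pol_line.
by rewrite eg; ring.
Qed.

(** The quintics of the three users are combined so as to vanish at [D'] and at six points of [la].
    Divisions by [la], [el k] and [el j] show that the result vanishes at [D''] too, so it belongs
    to [D] alone and makes [D] a user of [la]. *)
Lemma lemV_S D'' j : usr m D'' -> el j D'' = 0 -> j = i.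
Proof.
move=> u'' jD''; apply/eqP; apply/negP => /negP ji.
have [k [kj ki _]] := third ji.
(* An auxiliary point outside [X], the sixth zero on [la] besides [Q] and the four nodes of [Y]. *)
have [T [lT TX]] := line_pt la X.
have DX := usr_X uD; have DX' := usr_X uD'; have DX'' := usr_X u''.
have ne S : el i S = 0 -> S <> D''.
  by move=> iS e; have := eld' DX'' jD'' (neqs ji); rewrite -e iS eqxx.
have [|S|//|f [pf f0 fs _ [E EU fE]]] := @Wm m [:: D; D'; D''] [:: T; D'].
- rewrite /= !inE negb_or andbT -andbA; apply/and3P.
  by split; apply/eqP => //; exact: ne.
- by rewrite !inE => /or3P[/eqP->|/eqP->|/eqP->].
have fD' : f D' = 0 by apply: fs; rewrite !inE eqxx orbT.
have fT : f T = 0 by apply: fs; rewrite !inE eqxx.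
have offU S h : lev (el h) S = 0 -> S \in X -> h != i -> h != j -> S \notin [:: D; D'; D''].
  move=> hS SX hi hj; rewrite !inE; apply/negP => /or3P[/eqP e|/eqP e|/eqP e].
  - by have := eld' SX hS (neqs hi); rewrite e iD eqxx.
  - by have := eld' SX hS (neqs hi); rewrite e iD' eqxx.
  - by have := eld' SX hS (neqs hj); rewrite e jD'' eqxx.
have [||S|g [pg eg]] := @div_line _ 6 la f (Q :: T :: ym la) pf.
- rewrite /= uym !inE !in_ym (negbTE QY) andbF orbF andbT; apply/andP; split.
    by apply: contraNneq TX => <-.
  by apply: contra TX => /andP[_ /YX].
- by rewrite /= !ltnS.
- rewrite !inE in_ym => /or3P[/eqP->|/eqP->|/andP[/eqP lS SY]] //; split=> //.
    apply: f0 => //; rewrite !inE; apply/negP => /or3P[/eqP|/eqP|/eqP] //; exact: ne.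
  apply: f0; [exact: YX|exact: mis|].
  rewrite !inE; apply/negP => SU; have := Yel i SY; have := Yel j SY.
  by case/or3P: SU => /eqP->; rewrite ?iD ?iD' ?jD'' eqxx.
have laoff h S : h != i -> S \in X -> lev (el h) S = 0 -> m S != 0 -> la S != 0.
  move=> hi SX hS mS; apply/negP => /eqP lS; case: (lemV_only SX lS mS) => [|e].
    by rewrite (negbTE (elY hS)).
  by have := eld' SX hS (neqs hi); rewrite e iQ eqxx.
have [Pk hPk] : exists Pk, forall P, P \in X -> el k P = 0 -> m P = 0 -> P = Pk.
  have [Pk [_ kPk mPk]] := meets uD iD ki.
  by exists Pk => P PX kP mP; exact: (meet_uniq uD iD kP mP kPk mPk).
have [Pj hPj] : exists Pj, forall P, P \in X -> el j P = 0 -> m P = 0 -> P = Pj.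
  have [Pj [_ jPj mPj]] := meets uD iD ji.
  by exists Pj => P PX jP mP; exact: (meet_uniq uD iD jP mP jPj mPj).
have [|S SX kS|h [ph eh]] := @divX 5 (el k) g [:: Pk] pg; first by rewrite el6.
  rewrite inE => SPk; have mS : m S != 0 by apply: contraNneq SPk => mS; rewrite (hPk S SX kS mS).
  have /eqP := f0 S SX mS (offU _ _ kS SX ki kj); rewrite eg mulf_eq0.
  by rewrite (negbTE (laoff _ _ ki SX kS mS)) => /eqP.
have [|S SX jS|c [pc ec]] := @divX 4 (el j) h [:: Pj; D''] ph; first by rewrite el6.
  rewrite !inE negb_or => /andP[SPj SD''].
  have mS : m S != 0 by apply: contraNneq SPj => mS; rewrite (hPj S SX jS mS).
  have /eqP : f S = 0.
    apply: f0 => //; rewrite !inE (negbTE SD'') orbF; apply/negP => SU.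
    by have := eld' SX jS (neqs ji); case/orP: SU => /eqP->; rewrite ?iD ?iD' eqxx.
  rewrite eg eh !mulf_eq0 (negbTE (laoff _ _ ji SX jS mS)) (negbTE (eld' SX jS kj)) => /eqP//.
have fD'' : f D'' = 0 by rewrite eg eh ec jD'' mul0r !mulr0.
have fD : f D != 0.
  by move: fE; move: EU; rewrite !inE => /or3P[/eqP->|/eqP->|/eqP->]; rewrite ?fD' ?fD'' ?eqxx.
have hq : usesq m D f.
  split=> //; first exact: usr_off uD.
  move=> S SX SD mS; have [->//|SD'] := eqVneq S D'; have [->//|SD''] := eqVneq S D''.
  by apply: f0 => //; rewrite !inE (negbTE SD') (negbTE SD'') !orbF; apply/eqP.
apply: (max_avoid la4 _ iD QX iQ lQ).
exists (fun P => m P * g P); apply: (fund_usesq DX (usesq_fund hq)) => [|S]; first exact: pol_line.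
by rewrite eg; ring.
Qed.

End LemmaV.

(** Two users on one [el i] are excluded by [pair_one], since [la] has no node there; users on
    different lines, because each forces a node of [la] on the line of the other. *)
Lemma max_user1 la D D' i j : (4 <= size (ym la))%N -> usr la D -> usr la D' ->
  el i D = 0 -> el j D' = 0 -> D = D'.
Proof.
move=> l4 u u' iD jD'; have [ij|ij] := eqVneq i j.
  apply: (@pair_one la D D' i) => //; first by rewrite ij.
  by move=> P PX iP; apply/negP => /eqP lP; exact: (max_avoid l4 u iD PX iP lP).
have [P [PX jP lP]] := meets u iD (neqs ij).
by case: (max_avoid l4 u' jD' PX jP lP).
Qed.

(** * Products of lines over [Y] and lines through a node of [Y] *)

Definition E i := [seq P <- X | el i P == 0].

Lemma in_E i P : (P \in E i) = (el i P == 0) && (P \in X).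
Proof. exact: mem_filter. Qed.

Lemma uE i : uniq (E i). Proof. exact: filter_uniq. Qed.

Lemma sE i : size (E i) = 6%N.
Proof. by rewrite size_filter; exact: el6. Qed.

(** In degree 6 the six nodes of [el i] are one zero short, so a point [T] is added. A combination
    of the 19 fundamental polynomials of [y] and the primary nodes is killed at 7 + 6 + 5 points,
    hence divisible by the three lines in turn. Its cubic quotient cannot vanish at [y], else it
    would vanish on [Y]; so the combination is a multiple of the fundamental polynomial of [y]. *)
Lemma fundY y : y \in Y -> exists f, fund y f /\ forall i P, el i P = 0 -> f P = 0.
Proof.
move=> yY; pose i : 'I_3 := ord0; have [j ji] := other i; have [k [kj ki hk]] := third ji.
have [T [iT TX]] := line_pt (el i) X.
pose U := y :: E i ++ E j ++ E k.
have dis h h' P : P \in E h -> h' != h -> P \notin E h'.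
  by rewrite !in_E => /andP[/eqP hP PX] hh; rewrite (negbTE (eld' PX hP hh)).
have uU : uniq U.
  rewrite /= !mem_cat !in_E !(negbTE (Yel _ yY)) /= !cat_uniq !uE /= andbT.
  apply/andP; split; apply/hasPn => P; rewrite ?mem_cat.
    by case/orP=> PE; [exact: (dis j i) (neqs ji)|exact: (dis k i) (neqs ki)].
  by move=> PE; exact: (dis k j) (neqs kj).
have UX P : P \in U -> P \in X.
  by rewrite inE !mem_cat !in_E => /or4P[/eqP->|/andP[]|/andP[]|/andP[]] //; exact: YX.
have [q hq] := @seq_choice _ _ (fun=> 0 : R) U (fun D q => fund D q) (fun D hD => match GC (UX D hD) with
   ex_intro L (And3 a b c) => ex_intro _ (lprod L) (lns_fund (UX D hD) a b c) end).
have [|c [[D DU cD] hc]] := @kern _ U ((T :: E i) ++ E j ++ behead (E k)) q uU.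
  by rewrite /U /= !size_cat size_behead !sE.
pose f P := \sum_(D <- U) c D * q D P.
have pf : pol 7 f by apply: pol_sum => S /hq[].
have fU S : S \in U -> f S = c S * q S S.
  move=> SU; rewrite /f (big_rem S) // big_seq big1; [exact: addr0|] => S' S'U.
  have [_ _ ->] := hq S' (mem_rem S'U); rewrite ?mulr0 //; first exact: UX.
  by move=> e; rewrite e mem_rem_uniqF in S'U.
have f0 S : S \in Y -> S <> y -> f S = 0.
  move=> SY Sy; rewrite /f big_seq big1 // => S' S'U.
  have [_ _ ->] := hq S' S'U; rewrite ?mulr0 //; first exact: YX.
  move=> e; move: S'U; rewrite -e inE !mem_cat !in_E !(negbTE (Yel _ SY)) /= orbF => /eqP; exact: Sy.
have fE S : S \in E i ++ E j ++ behead (E k) -> f S = 0.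
  by rewrite !mem_cat => SE; apply: hc; rewrite !mem_cat inE -orbA SE orbT.
have fT : f T = 0 by apply: hc; rewrite !mem_cat inE eqxx.
have [||P|g1 [pg1 e1]] := @div_line _ 7 (el i) f (T :: E i) pf.
- by rewrite /= uE andbT in_E negb_and TX orbT.
- by rewrite /= sE.
- rewrite inE => /orP[/eqP->//|PE]; split; last by apply: fE; rewrite mem_cat PE.
  by move: PE; rewrite in_E => /andP[/eqP].
have [|P PE|g2 [pg2 e2]] := @div_line _ 6 (el j) g1 (E j) pg1 (uE j); first by rewrite sE.
  have := PE; rewrite in_E => /andP[/eqP jP PX]; split=> //.
  have /eqP : f P = 0 by apply: fE; rewrite !mem_cat PE orbT.
  by rewrite e1 mulf_eq0 (negbTE (eld' PX jP (neqs ji))) => /eqP.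
have ub : uniq (behead (E k)) by move: (uE k); case: (E k) => //= a s /andP[].
have [|P PE'|h [ph e3]] := @div_line _ 5 (el k) g2 (behead (E k)) pg2 ub; first by rewrite size_behead sE.
  have PE := mem_behead PE'; move: (PE); rewrite in_E => /andP[/eqP kP PX]; split=> //.
  have /eqP : f P = 0 by apply: fE; rewrite !mem_cat PE' !orbT.
  by rewrite e1 e2 !mulf_eq0 (negbTE (eld' PX kP (neqs ki))) (negbTE (eld' PX kP (neqs kj))) => /eqP.
have ef P : f P = el i P * (el j P * (el k P * h P)) by rewrite e1 e2 e3.
have fy : f y != 0.
  have fD : f D != 0 by rewrite fU // mulf_neq0 //; case: (hq D DU).
  apply: contraNneq fD => fy; rewrite ef (_ : h D = 0) ?mulr0 //.
  apply: (Y3 ph) => S SY; have /eqP : f S = 0 by have [->//|/eqP Sy] := eqVneq S y; exact: f0.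
  by rewrite ef !mulf_eq0 !(negbTE (Yel _ SY)) => /eqP.
exists f; split; last first.
  by move=> h' P h'P; rewrite ef; case/or3P: (hk h') h'P => /eqP-> ->; rewrite !(mul0r, mulr0).
split=> // P PX Py; have [PY|PY] := boolP (P \in Y); first by rewrite f0.
have [h' h'P] := notY PX PY; rewrite ef.
by case/or3P: (hk h') h'P => /eqP-> ->; rewrite !(mul0r, mulr0).
Qed.

Lemma fundY_el y f i P : y \in Y -> fund y f -> el i P = 0 -> f P = 0.
Proof.
move=> yY hf iP; have [g [hg g0]] := fundY yY.
have /eqP := fund_eq hg hf P; rewrite (g0 _ _ iP) mulr0 eq_sym mulf_eq0.
by case: hg => _ /negbTE-> _ /eqP.
Qed.

(** By [fundY_el] three of the six factors are the [el i]; the other three form the fundamental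
    cubic of [y] on [Y]. Thus [Y] is a GC_3 set. *)
Lemma yprod y : y \in Y -> exists L : seq line,
  [/\ size L = 3%N, lprod L y != 0 & forall P, P \in Y -> P <> y -> lprod L P = 0].
Proof.
move=> yY; have [L [sL Ly L0]] := GC (YX yY).
have hL := lns_fund (YX yY) sL Ly L0.
have rm i (A : seq line) : (forall P, el i P = 0 -> lprod A P = 0) ->
   exists2 l : line, l \in A & eql l (el i) by exact: lprod_dvd.
pose i : 'I_3 := ord0; have [j ji] := other i; have [k [kj ki hk]] := third ji.
have [li liL ei] := rm i L (fun P iP => fundY_el yY hL iP).
have [lj ljL ej] := rm j L (fun P iP => fundY_el yY hL iP).
have [lk lkL ek] := rm k L (fun P iP => fundY_el yY hL iP).
have ne (l l' : line) a b : a != b -> eql l (el a) -> eql l' (el b) -> l != l'.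
  by move=> ab h h'; apply/eqP => e; apply: (el_neq ab); apply: eql_trans (eql_sym h) _; rewrite e.
have mr (l l' : line) A : l \in A -> l != l' -> l \in rem l' A.
  elim: A => //= a A IH; rewrite inE => /orP[/eqP->|lA] ll.
    by rewrite (negbTE ll) inE eqxx.
  by case: ifP => // _; rewrite inE IH ?orbT.
have ljL' : lj \in rem li L by apply: (mr) => //; exact: ne ji ej ei.
have lkL' : lk \in rem lj (rem li L) by apply: (mr); [apply: (mr) => //; exact: ne ki ek ei|exact: ne kj ek ej].
have e P : lprod L P = li P * (lj P * (lk P * lprod (rem lk (rem lj (rem li L))) P)).
  by rewrite (lprod_rem _ liL) (lprod_rem _ ljL') (lprod_rem _ lkL').
exists (rem lk (rem lj (rem li L))); split.
- by rewrite !size_rem // sL.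
- by move: Ly; rewrite e !mulf_eq0 !negb_or => /and4P[].
move=> P PY Py; have /eqP := L0 P (YX PY) Py.
by rewrite e !mulf_eq0 ei ej ek !(negbTE (Yel _ PY)) => /eqP.
Qed.

(* Subtracting from the product of the lines its interpolant at the nodes of [Y], whose
   summands all vanish on the lines [el i], would leave a sextic vanishing on [X]. *)
Lemma cover_at y (L : seq line) : y \in Y -> size L = 6%N -> (forall l, l \in L -> l y = 0) ->
  (forall P, P \in X -> P \notin Y -> lprod L P = 0) -> False.
Proof.
move=> yY sL Ly h.
have [q hq] := @seq_choice _ _ (fun=> 0 : R) Y (fun D q => fund D q) (fun D hD => match GC (YX hD) with
   ex_intro L (And3 a b c) => ex_intro _ (lprod L) (lns_fund (YX hD) a b c) end).
pose c D := lprod L D / q D D.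
have pS : pol 7 (fun P => \sum_(D <- Y) c D * q D P) by apply: pol_sum => S /hq[].
have pL : pol 7 (lprod L) by apply: pol_lprod; rewrite sL.
have z P : 1 * lprod L P + -1 * (\sum_(D <- Y) c D * q D P) = 0.
  apply: (Xc (pol_lin 1 (-1) pL pS)) => S SX.
  have [SY|SY] := boolP (S \in Y).
    rewrite (big_rem S) // big_seq big1.
      have [_ qS _] := hq S SY; rewrite /c divfK //= addr0 mul1r mulN1r subrr //.
    move=> D DY; have [_ _ ->] := hq D (mem_rem DY); rewrite ?mulr0 //.
    by move=> e; rewrite e mem_rem_uniqF ?uY in DY.
  rewrite h // big_seq big1 ?mulr0 ?addr0 // => D DY.
  have [_ _ ->] := hq D DY; rewrite ?mulr0 //.
  by move=> e; rewrite e DY in SY.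
have [|l lL e] := @lprod_dvd _ (el ord0) L.
  move=> P iP; have := z P; rewrite big_seq big1 ?mulr0 ?addr0 ?mul1r // => D DY.
  by rewrite (fundY_el DY (hq D DY) iP) mulr0.
by have := Yel ord0 yY; rewrite -e Ly ?eqxx.
Qed.

Lemma count_add3 (T : Type) (a b c h : pred T) (s : seq T) :
  (forall x, (a x + b x + c x <= h x)%N) -> (count a s + count b s + count c s <= count h s)%N.
Proof. by move=> H; elim: s => //= x s IH; have := H x; lia. Qed.

Lemma sum_count_mem (T S : eqType) (c : T -> S) (M : seq S) (s : seq T) : uniq M ->
  (\sum_(m <- M) count (fun x => c x == m) s)%N = count (fun x => c x \in M) s.
Proof.
move=> uM; elim: s => [|x s IH] /=; first by rewrite big1.
rewrite big_split /= IH; congr (_ + _)%N.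
rewrite -(count_uniq_mem _ uM) -sum1_count [RHS]big_mkcond /=; apply: eq_bigr => m _.
by rewrite eq_sym; case: eqVneq.
Qed.

Definition hit m i := has (fun P => m P == 0) (E i).

Lemma hitP m i : reflect (exists P, [/\ P \in X, el i P = 0 & m P = 0]) (hit m i).
Proof.
apply: (iffP hasP) => [[P]|[P [PX iP mP]]].
  by rewrite in_E => /andP[/eqP iP PX] /eqP mP; exists P.
by exists P; rewrite ?in_E ?iP ?mP ?eqxx.
Qed.

(** [T] collects the lines through [y] meeting all three [el i] in nodes, [c D] is a line through
    [y] used by [D], and [d i] counts the lines through [y] that miss only [el i]. Lines counted by
    [T], [d j] and [d k] meet the third [el i] in distinct nodes, of which there are six. Six lines
    in [T] would cover all primary nodes, against [cover_at]. A node of [el i] whose line is not in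
    [T] uses a line missing only [el i], and by [pair_one] no other node of [el i] does. *)
Lemma count_at y : y \in Y -> exists (T : seq line) (c : pt -> line) (d : 'I_3 -> nat),
  [/\ uniq T,
      forall D i, D \in X -> el i D = 0 -> usr (c D) D /\ c D y = 0,
      forall m, m \in T -> m y = 0 /\ forall i, hit m i,
      forall m m' P, m \in T -> m' \in T -> P \in X -> P <> y -> m P = 0 -> m' P = 0 -> m = m' &
  [/\ (size T <= 5)%N, forall j k, j != k -> (size T + d j + d k <= 6)%N &
      forall i, (6 <= d i + \sum_(m <- T) count (fun D => c D == m) (E i))%N]].
Proof.
move=> yY; pose X' := rem y X.
have [th hth] := @seq_choice _ _ (el ord0) X (fun P l => l y = 0 /\ l P = 0) (fun P _ => line_thru y P).
have inX' P : (P \in X') = (P != y) && (P \in X) by rewrite /X' (mem_rem_uniq _ uX).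
(* A canonical equation for each line through [y], taken from the first node on it, so that equal
   lines become equal terms and can be counted. *)
pose fl P := [seq Q <- X' | th P Q == 0]; pose can P := th (head P (fl P)).
have flP P : P \in X' -> P \in fl P.
  by move=> PX; rewrite mem_filter PX andbT; move: PX; rewrite inX' => /andP[_ /hth[_ ->]].
have hd P : P \in X' -> head P (fl P) \in fl P by move=> /flP; case: (fl P) => //= a s _; rewrite mem_head.
have hd' P : P \in X' -> th P (head P (fl P)) = 0 /\ head P (fl P) \in X'.
  by move=> /hd; rewrite mem_filter => /andP[/eqP].
have thru m m' P : P \in X' -> m y = 0 -> m' y = 0 -> m P = 0 -> m' P = 0 -> eql m m'.
  by rewrite inX' => /andP[/eqP Py _] my m'y mP m'P; exact: (line2 Py mP my m'P m'y).
have can0 P : P \in X' -> can P y = 0 /\ can P P = 0.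
  move=> PX; have [h1 h2] := hd' P PX.
  have PX' : P \in X by move: PX; rewrite inX' => /andP[].
  have hX : head P (fl P) \in X by move: h2; rewrite inX' => /andP[].
  have [a1 a2] := hth _ hX; have [b1 b2] := hth _ PX'; split=> //.
  by apply/eqP; rewrite (thru _ (th P) _ h2 a1 b1 a2 h1) b2 eqxx.
have can_eq P P' S : P \in X' -> P' \in X' -> S \in X' -> can P S = 0 -> can P' S = 0 -> can P = can P'.
  move=> PX PX' SX e e'; have [a b] := can0 P PX; have [a' b'] := can0 P' PX'.
  have q1 := thru _ _ _ SX a a' e e'.
  have aux Q : Q \in X' -> eql (th Q) (can Q).
    move=> QX; have [u v] := can0 Q QX; apply: (thru _ _ Q) => //; move: QX; rewrite inX' => /andP[_ /hth[]] //.
  have efl : fl P = fl P' by apply: eq_filter => Q; rewrite (aux P PX) q1 -(aux P' PX').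
  by rewrite /can efl; have := flP P' PX'; case: (fl P').
have XX' i P : P \in X -> el i P = 0 -> P \in X'.
  by move=> PX iP; rewrite inX' PX andbT; apply/eqP => e; have := Yel i yY; rewrite -e iP eqxx.
have ex0 D : D \in X -> exists P, (exists i, el i D = 0) -> P \in X' /\ usr (can P) D.
  move=> DX; have [/existsP[i /eqP iD]|/existsP h] := boolP [exists i, el i D == 0]; last first.
    by exists y => -[i iD]; case: h; exists i; apply/eqP.
  have [|m [u my]] := @usr_at D y DX (YX yY).
    by move=> e; have := elY iD; rewrite -e yY.
  have [j ji] := other i; have [P [PX jP mP]] := meets u iD ji.
  have PX' := XX' _ _ PX jP; have [a b] := can0 P PX'.
  by exists P => _; split=> //; exact: eql_usr (thru _ _ _ PX' my a mP b) u.
have [c0 hc0] := seq_choice y ex0.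
pose c D := can (c0 D).
have hc D i : D \in X -> el i D = 0 -> usr (c D) D /\ c D y = 0.
  by move=> DX iD; have [|PX u] := hc0 D DX; [exists i|split=> //; case: (can0 _ PX)].
have cX' D i : D \in X -> el i D = 0 -> c0 D \in X'.
  by move=> DX iD; have [|//] := hc0 D DX; exists i.
pose M := undup [seq can P | P <- X'].
have inM m : m \in M -> exists2 P, P \in X' & m = can P by rewrite mem_undup => /mapP.
pose tri m := [forall i, hit m i]; pose T := [seq m <- M | tri m].
pose miss i m := ~~ hit m i && [forall j, (j != i) ==> hit m j]; pose d i := count (miss i) M.
have hM i : (count (fun m => hit m i) M <= 6)%N.
  rewrite -size_filter -(sE i) -(size_map can); apply: uniq_leq_size; first by rewrite filter_uniq ?undup_uniq.
  move=> m; rewrite mem_filter => /andP[/hitP[P [PX iP mP]] /inM[P0 P0X e]].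
  apply/mapP; exists P; first by rewrite in_E iP eqxx.
  rewrite e; apply: (can_eq _ _ P) => //; rewrite ?(XX' _ _ PX iP) -?e //.
  by case: (can0 P (XX' _ _ PX iP)).
have sT j k : j != k -> (size T + d j + d k <= 6)%N.
  move=> jk; have [i [ij ik hi]] := third jk; apply: leq_trans (hM i).
  rewrite /T size_filter; apply: count_add3 => m.
  have [/forallP t|] := boolP (tri m).
    by rewrite /miss !t.
  move=> _; have [/andP[nj /forallP aj]|_] := boolP (miss j m); have [/andP[nk /forallP ak]|_] := boolP (miss k m) => //=.
  - by have := aj k; rewrite (neqs jk) (negbTE nk).
  - by have := aj i; rewrite ij /= => ->.
  - by have := ak i; rewrite ik /= => ->.
have uT : uniq T by rewrite filter_uniq ?undup_uniq.
exists T, c, d; split=> //.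
- by move=> m; rewrite mem_filter => /andP[/forallP h /inM[P PX e]]; split=> //; rewrite e; case: (can0 P PX).
- move=> m m' P; rewrite !mem_filter => /andP[_ /inM[Q QX e]] /andP[_ /inM[Q' QX' e']] PX /eqP Py mP m'P.
  by rewrite e e'; apply: (can_eq _ _ P); rewrite -?e -?e' // inX' Py.
split=> //.
- rewrite leqNgt; apply/negP => s5.
  have [j ji] := other ord0; have s6 : size T = 6%N by have := sT _ _ ji; lia.
  apply: (cover_at yY s6).
    by move=> m; rewrite mem_filter => /andP[_ /inM[P PX ->]]; case: (can0 P PX).
  move=> P PX PY; have [i iP] := notY PX PY; have PX' := XX' _ _ PX iP.
  have sub : {subset T <= map can (E i)}.
    move=> m; rewrite mem_filter => /andP[/forallP/(_ i)/hitP[S [SX iS mS]] /inM[Q QX e]].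
    apply/mapP; exists S; first by rewrite in_E iS eqxx.
    rewrite e; apply: (can_eq _ _ S) => //; rewrite ?(XX' _ _ SX iS) -?e //.
    by case: (can0 S (XX' _ _ SX iS)).
  have [|_ eqT] := uniq_min_size uT sub; first by rewrite size_map sE s6.
  apply/eqP; rewrite lprod_eq0; apply/hasP; exists (can P).
    by rewrite eqT map_f // in_E iP eqxx.
  by case: (can0 P PX') => _ ->.
move=> i; rewrite (sum_count_mem c (E i) uT).
pose bad D := c D \notin T.
have -> : 6%N = (count bad (E i) + count (fun D => c D \in T) (E i))%N.
  by rewrite -(sE i) -(count_predC bad) /bad; congr (_ + _)%N; apply: eq_count => D /=; rewrite negbK.
rewrite leq_add2r -size_filter -(size_map c) /d -size_filter.
have bm D : D \in E i -> bad D -> miss i (c D) /\ c D \in M.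
  rewrite in_E => /andP[/eqP iD DX] bD; have [u cy] := hc D i DX iD.
  have cM : c D \in M by rewrite mem_undup; apply/mapP; exists (c0 D); first exact: (cX' D i).
  have oth j : j != i -> hit (c D) j by move=> ji; apply/hitP; exact: meets u iD ji.
  split=> //; apply/andP; split; last by apply/forallP => j; apply/implyP; exact: oth.
  apply: contra bD => hi; rewrite mem_filter cM andbT; apply/forallP => j.
  by have [->//|] := eqVneq j i; exact: oth.
apply: uniq_leq_size.
  rewrite map_inj_in_uniq ?filter_uniq ?uE // => D D'; rewrite (mem_filter bad D) (mem_filter bad D') => /andP[bD DE] /andP[_ DE'] e.
  have [/andP[nh _] _] := bm D DE bD.
  move: DE DE'; rewrite !in_E => /andP[/eqP iD DX] /andP[/eqP iD' DX'].
  have [u _] := hc D i DX iD; have [u' _] := hc D' i DX' iD'.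
  apply: (@pair_one (c D) D D' i) => //; first by rewrite e.
  move=> P PX iP; apply: contra nh => /eqP mP; apply/hitP; by exists P.
move=> m /mapP[D]; rewrite (mem_filter bad) => /andP[bD DE] ->.
by have [h1 h2] := bm D DE bD; rewrite mem_filter h1.
Qed.

Lemma max_el_uniq la i P Q : (0 < size (ym la))%N -> la P = 0 -> la Q = 0 -> el i P = 0 -> el i Q = 0 -> P = Q.
Proof.
move=> h lP lQ iP iQ; apply/eqP; apply/negP => /negP/eqP PQ.
by apply: (@max_neq_el la i h); exact: (line2 PQ lP lQ iP iQ).
Qed.

Lemma lemV_all m la i D D' : (4 <= size (ym la))%N -> (forall P, P \in Y -> la P = 0 -> m P != 0) ->
  usr m D -> usr m D' -> el i D = 0 -> el i D' = 0 -> D <> D' ->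
  exists Q, [/\ Q \in X, el i Q = 0, la Q = 0, m Q != 0 & forall D'', usr m D'' -> el i D'' = 0 -> D'' <> Q].
Proof.
move=> l4 mis u u' iD iD' DD'; have l0 : (0 < size (ym la))%N by apply: leq_trans l4.
have [Q [QX iQ lQ [mQ QD _]]] := lemV_Q l4 mis u u' iD iD' DD'.
exists Q; split=> // D'' u'' iD'' e; have [e'|/eqP DD''] := eqVneq D D''; first by apply: QD; rewrite e'.
have [Q' [_ iQ' lQ' [_ _ Q'D]]] := lemV_Q l4 mis u u'' iD iD'' DD''.
by apply: Q'D; rewrite e; exact: (max_el_uniq l0 lQ' lQ iQ' iQ).
Qed.

Lemma lemV_single m la i D D' : (4 <= size (ym la))%N -> (forall P, P \in Y -> la P = 0 -> m P != 0) ->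
  usr m D -> usr m D' -> el i D = 0 -> el i D' = 0 -> D <> D' ->
  forall D'' j, usr m D'' -> el j D'' = 0 -> j = i.
Proof.
move=> l4 mis u u' iD iD' DD'.
have [Q [QX iQ lQ [mQ QD QD']]] := lemV_Q l4 mis u u' iD iD' DD'.
exact: (lemV_S l4 mis u u' iD iD' DD' QX iQ lQ mQ QD QD').
Qed.

Lemma two_of (T : eqType) (s : seq T) : uniq s -> (2 <= size s)%N -> exists x y, [/\ x \in s, y \in s & x <> y].
Proof.
case: s => [|x [|y s]] //= /andP[xy _] _; exists x, y; rewrite !inE !eqxx !orbT; split=> // e.
by rewrite e inE eqxx in xy.
Qed.

(** Besides the users, [el i] carries a node [P] on [m] and the node [Q] on [la], which leaves at
    most four of its six nodes. *)
Lemma typed_S m la i U : (4 <= size (ym la))%N -> (forall P, P \in Y -> la P = 0 -> m P != 0) ->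
  uniq U -> (forall D, D \in U -> usr m D /\ el i D = 0) -> (2 <= size U)%N -> hit m i ->
  [/\ forall D j, usr m D -> el j D = 0 -> j = i,
      exists P Q, [/\ [/\ P \in X, el i P = 0 & m P = 0], [/\ Q \in X, el i Q = 0 & la Q = 0],
        m Q != 0, uniq (P :: Q :: U) & {subset P :: Q :: U <= E i}] &
      (size U <= 4)%N].
Proof.
move=> l4 mis uU hU s2 /hitP[P [PX iP mP]].
have [D [D' [DU DU' DD']]] := two_of uU s2.
have [u iD] := hU D DU; have [u' iD'] := hU D' DU'.
have [Q [QX iQ lQ mQ nQ]] := lemV_all l4 mis u u' iD iD' DD'.
have uu : uniq (P :: Q :: U).
  rewrite /= uU andbT inE negb_or -andbA; apply/and3P; split.
  - by apply: contra mQ => /eqP <-; rewrite mP.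
  - by apply/negP => /hU[/usr_off]; rewrite mP eqxx.
  - by apply/negP => /hU[uQ _]; case: (nQ Q uQ iQ).
have sub : {subset P :: Q :: U <= E i}.
  move=> S; rewrite !inE => /or3P[/eqP->|/eqP->|/hU[uS iS]]; rewrite in_E ?iP ?iQ ?iS eqxx //.
  exact: usr_X uS.
split.
- exact: (lemV_single l4 mis u u' iD iD' DD').
- by exists P, Q.
- by have := uniq_leq_size uu sub; rewrite sE.
Qed.

(** * Arithmetic of the lines through a node of [Y] *)

Definition o0 : 'I_3 := ord0.
Definition o1 : 'I_3 := Ordinal (isT : (1 < 3)%N).
Definition o2 : 'I_3 := ord_max.

Lemma ord3P (P : 'I_3 -> Prop) : P o0 -> P o1 -> P o2 -> forall i, P i.
Proof.
by move=> h0 h1 h2 [[|[|[|//]]] hi]; [have -> : Ordinal hi = o0 by apply: val_inj|have -> : Ordinal hi = o1 by apply: val_inj|have -> : Ordinal hi = o2 by apply: val_inj].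
Qed.

(** In the applications [u m i] is the number of nodes of [el i] whose chosen line is [m]. The
    predicate [sp] marks lines exempt from the dichotomy of [lemV_single]; the others have either at
    least two such nodes on a single [el i], or at most one on each. *)
Definition numS (u : line -> 'I_3 -> nat) (sp : pred line) i m := ~~ sp m && (2 <= u m i)%N.
Definition numB (u : line -> 'I_3 -> nat) (sp : pred line) m :=
  ~~ sp m && [&& (u m o0 <= 1)%N, (u m o1 <= 1)%N & (u m o2 <= 1)%N].

Section Numeric.
Variables (T : seq line) (u : line -> 'I_3 -> nat) (sp : pred line) (K : nat).
Hypothesis hT : forall m, m \in T -> ~~ sp m -> forall i, (2 <= u m i)%N ->
  (u m i <= K)%N /\ forall j, j != i -> u m j = 0%N.
Local Notation S := (numS u sp).
Local Notation B := (numB u sp).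

Lemma num_size : size T = (count sp T + count B T + count (S o0) T + count (S o1) T + count (S o2) T)%N.
Proof.
move: hT; elim: T => //= m s IH h; have {IH} := IH (fun m' h' => h m' (mem_behead (s := m :: s) h')).
have := h m (mem_head _ _); rewrite /numS /numB; case: (sp m) => //=; first by lia.
move=> /(_ isT) H; have := H o0; have := H o1; have := H o2.
case: (ltnP 1 (u m o2)) => h2.
  move=> /(_ isT)[_ /[dup] /(_ o0 isT) e0 /(_ o1 isT) e1]; rewrite e0 e1 /=; lia.
case: (ltnP 1 (u m o1)) => h1.
  move=> _ /(_ isT)[_ /[dup] /(_ o0 isT) e0 /(_ o2 isT) e2]; rewrite e0 /=; lia.
case: (ltnP 1 (u m o0)) => h0 /=; lia.
Qed.

Lemma num_sum i : (\sum_(m <- T) u m i <=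
  \sum_(m <- T | sp m) u m i + \sum_(m <- T | S i m) u m i + \sum_(m <- T | B m) u m i)%N.
Proof.
move: hT; elim: T => [|m s IH] h; first by rewrite !big_nil.
have {IH} := IH (fun m' h' => h m' (mem_behead (s := m :: s) h')).
have := h m (mem_head _ _); rewrite !big_cons /numS /numB /=; case: (sp m) => //=; first by lia.
move=> /(_ isT) H; case: (ltnP 1 (u m i)) => hi; first by case: ifP; lia.
case: ifP => //; first by lia.
case: (posnP (u m i)) => [->//|p].
have a j : (u m j <= 1)%N.
  rewrite leqNgt; apply/negP => lt; have [_ hj] := H j lt; have [e|ij] := eqVneq i j.
    by rewrite e in hi; lia.
  by rewrite (hj i ij) in p.
by rewrite !a.
Qed.

Lemma num_B i : (\sum_(m <- T | B m) u m i <= count B T)%N.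
Proof.
rewrite -sum1_count; apply: leq_sum => m /andP[_ /and3P[h0 h1 h2]].
by move: i; apply: ord3P.
Qed.

Lemma num_S i : (\sum_(m <- T | S i m) u m i <= K * count (S i) T)%N.
Proof.
move: hT; elim: T => [|m s IH] h; first by rewrite big_nil.
have {IH} := IH (fun m' h' => h m' (mem_behead (s := m :: s) h')).
have := h m (mem_head _ _); rewrite big_cons /numS /=; case: (sp m) => //= /(_ isT)/(_ i).
case: (ltnP 1 (u m i)) => //= h1 /(_ isT)[h2 _]; rewrite mulnDr muln1; lia.
Qed.
End Numeric.

Lemma filter1 (A : eqType) (p : pred A) (s : seq A) (F : A -> nat) : count p s = 1%N ->
  exists x, [/\ x \in s, p x & (\sum_(y <- s | p y) F y)%N = F x].
Proof.
rewrite -size_filter -big_filter; case e : (filter p s) => [|x [|]] // _; exists x.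
have : x \in filter p s by rewrite e mem_head.
by rewrite mem_filter big_seq1 => /andP[].
Qed.

Lemma filter2 (A : eqType) (p : pred A) (s : seq A) : uniq s -> count p s = 2%N ->
  exists x y, [/\ x \in s, y \in s, p x, p y &
    x <> y /\ forall F : A -> nat, (\sum_(z <- s | p z) F z = F x + F y)%N].
Proof.
move=> us; rewrite -size_filter; case e : (filter p s) (filter_uniq p us) => [|x [|y [|]]] // /andP[xy _] _.
have : x \in filter p s by rewrite e mem_head.
have : y \in filter p s by rewrite e !inE eqxx orbT.
rewrite !mem_filter => /andP[py ys] /andP[px xs]; exists x, y; split=> //; split.
  by move=> e'; rewrite e' mem_head in xy.
by move=> F; rewrite -big_filter e !big_cons big_nil addn0.
Qed.

(** If some class [S i] were empty, the inequalities would make all of [T] of type [B] and force six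
    lines. So each class has a line; a second one would leave too little room for the [d i]. The
    same balance allows at most one line with fewer than four users, and only two lines with a user
    on every [el i] can make up for it. *)
Lemma num_case3 (T : seq line) (u : line -> 'I_3 -> nat) (d : 'I_3 -> nat) : uniq T ->
  (size T <= 5)%N -> (forall j k, j != k -> (size T + d j + d k <= 6)%N) ->
  (forall i, (6 <= d i + \sum_(m <- T) u m i)%N) ->
  (forall m i, m \in T -> (2 <= u m i)%N -> (u m i <= 4)%N /\ forall j, j != i -> u m j = 0%N) ->
  exists S : 'I_3 -> line, (forall i, S i \in T /\ (3 <= u (S i) i)%N) /\
    exists k, (forall i, i != k -> u (S i) i = 4%N) /\
     (u (S k) k = 4%N \/ exists m m', [/\ m \in T, m' \in T, m <> m' & forall i, u m i = 1%N /\ u m' i = 1%N]).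
Proof.
move=> uT s5 sd h6 hu.
have hT m : m \in T -> ~~ pred0 m -> forall i, (2 <= u m i)%N -> (u m i <= 4)%N /\ forall j, j != i -> u m j = 0%N.
  by move=> mT _ i; exact: hu.
have := num_size hT; have := num_sum hT; have := num_S hT; have := num_B T u pred0.
set S := numS u pred0; set B := numB u pred0.
rewrite count_pred0 => hB hS hsum hsz.
have z i : (\sum_(m <- T | pred0 m) u m i)%N = 0%N by rewrite big_pred0.
have c i : count (S i) T = 1%N.
  have := hB o0; have := hB o1; have := hB o2; have := hS o0; have := hS o1; have := hS o2.
  have := hsum o0; have := hsum o1; have := hsum o2; have := h6 o0; have := h6 o1; have := h6 o2.
  have := sd o0 o1 isT; have := sd o1 o2 isT; have := sd o0 o2 isT; rewrite !z.
  by move: i; apply: ord3P; lia.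
have [F hF] := @seq_choice _ _ (el o0) [:: o0; o1; o2] (fun i m => [/\ m \in T, S i m & (\sum_(y <- T | S i y) u y i)%N = u m i])
   (fun i _ => filter1 (fun m => u m i) (c i)).
have {}hF i : [/\ F i \in T, S i (F i) & (\sum_(y <- T | S i y) u y i)%N = u (F i) i].
  by apply: hF; move: i; apply: ord3P.
have F4 i : (u (F i) i <= 4)%N by have [FT /andP[_ h] _] := hF i; case: (hu _ _ FT h).
have key : (forall i, 3 <= u (F i) i)%N /\ exists k, (forall i, i != k -> u (F i) i = 4%N) /\
   (u (F k) k = 4%N \/ count B T = 2%N /\ forall i, (2 <= \sum_(m <- T | B m) u m i)%N).
  have [_ _ e0] := hF o0; have [_ _ e1] := hF o1; have [_ _ e2] := hF o2.
  move: (F4 o0) (F4 o1) (F4 o2) (hsum o0) (hsum o1) (hsum o2) (h6 o0) (h6 o1) (h6 o2) (hB o0) (hB o1) (hB o2)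
    (sd o0 o1 isT) (sd o1 o2 isT) (sd o0 o2 isT) hsz s5; rewrite !z !c e0 e1 e2.
  set a0 := u (F o0) o0; set a1 := u (F o1) o1; set a2 := u (F o2) o2 => *.
  split; first by apply: ord3P; lia.
  have [l0|l0] := ltnP a0 4.
    exists o0; split; first by apply: ord3P => // _; lia.
    by right; split; [lia|apply: ord3P; lia].
  have [l1|l1] := ltnP a1 4.
    exists o1; split; first by apply: ord3P => // _; lia.
    by right; split; [lia|apply: ord3P; lia].
  exists o2; split; first by apply: ord3P => // _; lia.
  have [l2|l2] := ltnP a2 4; last by left; lia.
  by right; split; [lia|apply: ord3P; lia].
case: key => k3 [k [k4 kB]]; exists F; split; first by move=> i; case: (hF i).
exists k; split=> //; case: kB => [->|[/(filter2 uT)[m [m' [mT m'T Bm Bm' [mm e]]]] h]]; [by left|right].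
exists m, m'; split=> // i; have := h i; rewrite e.
have le l : B l -> (u l i <= 1)%N by case/andP=> _ /and3P[? ? ?]; move: i; apply: ord3P.
by have := le m Bm; have := le m' Bm'; lia.
Qed.

Lemma num_case4_no (T : seq line) (u : line -> 'I_3 -> nat) (d : 'I_3 -> nat) :
  (size T <= 5)%N -> (forall j k, j != k -> (size T + d j + d k <= 6)%N) ->
  (forall i, (6 <= d i + \sum_(m <- T) u m i)%N) ->
  ~ (forall m i, m \in T -> (2 <= u m i)%N -> (u m i <= 3)%N /\ forall j, j != i -> u m j = 0%N).
Proof.
move=> s5 sd h6 hu.
have hT m : m \in T -> ~~ pred0 m -> forall i, (2 <= u m i)%N -> (u m i <= 3)%N /\ forall j, j != i -> u m j = 0%N.
  by move=> mT _ i; exact: hu.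
have := num_size hT; have := num_sum hT; have := num_S hT; have := num_B T u pred0.
set S := numS u pred0; set B := numB u pred0.
rewrite count_pred0 => hB hS hsum hsz.
have z i : (\sum_(m <- T | pred0 m) u m i)%N = 0%N by rewrite big_pred0.
have := hB o0; have := hB o1; have := hB o2; have := hS o0; have := hS o1; have := hS o2.
have := hsum o0; have := hsum o1; have := hsum o2; have := h6 o0; have := h6 o1; have := h6 o2.
have := sd o0 o1 isT; have := sd o1 o2 isT; have := sd o0 o2 isT; rewrite !z; lia.
Qed.

(** With two users per line confined to one [el i] the counts fall short, and only the exempt line
    can make up the difference. *)
Lemma num_case4 (T : seq line) (u : line -> 'I_3 -> nat) (d : 'I_3 -> nat) (sp : pred line) :
  (size T <= 5)%N -> (forall j k, j != k -> (size T + d j + d k <= 6)%N) ->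
  (forall i, (6 <= d i + \sum_(m <- T) u m i)%N) -> (count sp T <= 1)%N ->
  (forall m i, m \in T -> sp m -> (u m i <= 2)%N) ->
  (forall m, m \in T -> ~~ sp m -> forall i, (2 <= u m i)%N -> (u m i <= 2)%N /\ forall j, j != i -> u m j = 0%N) ->
  exists m i j k, [/\ m \in T, sp m, i != j, (k != i) && (k != j) & [/\ u m i = 2%N, u m j = 2%N & (1 <= u m k)%N]].
Proof.
move=> s5 sd h6 c1 hsp hT.
have := num_size hT; have := num_sum hT; have := num_S hT; have := num_B T u sp.
set S := numS u sp; set B := numB u sp.
move=> hB hS hsum hsz.
have arith : count sp T = 0%N \/ count sp T = 1%N by lia.
case: arith => [c0|c0].
  have z i : (\sum_(m <- T | sp m) u m i)%N = 0%N.
    by apply: big1_seq => m /andP[sm mT]; have := count_memPn; move/eqP: c0; rewrite -leqn0 leqNgt -has_count => /hasPn/(_ m mT); rewrite sm.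
  exfalso; move: (hB o0) (hB o1) (hB o2) (hS o0) (hS o1) (hS o2)
    (hsum o0) (hsum o1) (hsum o2) (h6 o0) (h6 o1) (h6 o2) (sd o0 o1 isT) (sd o1 o2 isT) (sd o0 o2 isT).
  by rewrite !z; lia.
have [m [mT sm _]] := filter1 (fun=> 0%N) c0.
have e i : (\sum_(y <- T | sp y) u y i)%N = u m i.
  have [m' [m'T sm' ->]] := filter1 (fun y => u y i) c0; have [->//|mm] := eqVneq m' m.
  have : (2 <= count sp T)%N.
    rewrite -size_filter -[2%N]/(size [:: m'; m]); apply: uniq_leq_size; first by rewrite /= inE mm.
    by move=> z; rewrite !inE mem_filter => /orP[/eqP->|/eqP->]; rewrite ?sm ?sm'.
  by rewrite c0.
have b i := hsp m i mT sm.
have key : [\/ [/\ u m o0 = 2, u m o1 = 2 & (1 <= u m o2)], [/\ u m o0 = 2, u m o2 = 2 & (1 <= u m o1)]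
   | [/\ u m o1 = 2, u m o2 = 2 & (1 <= u m o0)]]%N.
  have : ((u m o0 == 2) && (u m o1 == 2) && (1 <= u m o2) || (u m o0 == 2) && (u m o2 == 2) && (1 <= u m o1)
     || (u m o1 == 2) && (u m o2 == 2) && (1 <= u m o0))%N.
    move: (hB o0) (hB o1) (hB o2) (hS o0) (hS o1) (hS o2) (b o0) (b o1) (b o2)
      (hsum o0) (hsum o1) (hsum o2) (h6 o0) (h6 o1) (h6 o2) (sd o0 o1 isT) (sd o1 o2 isT) (sd o0 o2 isT).
    by rewrite !e; lia.
  by case/orP => [/orP[]|] /andP[/andP[/eqP ? /eqP ?] ?]; [constructor 1|constructor 2|constructor 3].
by case: key => -[h1 h2 h3]; [exists m, o0, o1, o2|exists m, o0, o2, o1|exists m, o1, o2, o0].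
Qed.

(** * Lines with four nodes in [Y] *)

Lemma lprod_neq0 (L : seq line) : ~ (forall P, lprod L P = 0).
Proof.
elim: L => [|l L IH] h; first by have /eqP := h (0, 0); rewrite lprod_nil oner_eq0.
apply: IH => P; apply: (pol_cancel (l := l) (pol_lprod (leqnn (size L).+1))) => S.
by rewrite -lprod_cons.
Qed.

Lemma no_cover (L : seq line) : (size L <= 3)%N -> ~ (forall P, P \in Y -> lprod L P = 0).
Proof. by move=> sL h; apply: (@lprod_neq0 L); apply: Y3 h; exact: pol_lprod. Qed.

(** The product belonging to one of five collinear nodes would vanish at the four others, hence on
    the whole line. *)
Lemma ym_le4 l : (size (ym l) <= 4)%N.
Proof.
rewrite leqNgt; apply/negP => s5; case e : (ym l) s5 => [//|y s] /=; rewrite ltnS => s4.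
have : y \in ym l by rewrite e mem_head.
rewrite in_ym => /andP[/eqP ly yY]; have [L [sL Ly L0]] := yprod yY.
have pL : pol 4 (lprod L) by apply: pol_lprod; rewrite sL.
move: Ly; rewrite (pol_line0 (l := l) (s := s) pL) ?eqxx //.
  by have := uym l; rewrite e => /andP[].
move=> P Ps; have : P \in ym l by rewrite e inE Ps orbT.
rewrite in_ym => /andP[/eqP lP PY]; split=> //; apply: L0 => // eP.
by have := uym l; rewrite e -eP /= Ps.
Qed.

Lemma count_cover (p q : pred pt) (s : seq pt) : (forall P, P \in s -> p P || q P) -> (size s <= count p s + count q s)%N.
Proof.
elim: s => //= P s IH h; have := h P (mem_head _ _); have := IH (fun S h' => h S (mem_behead (s := P :: s) h')).
by case: (p P); case: (q P) => //=; lia.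
Qed.

Section Classification.
Variable la : line.
(** The six nodes of [Y] off a line with four carry a conic problem; lines are classified by how
    many of these nodes they contain. *)
Definition Z := [seq P <- Y | la P != 0].
Definition zc l := count (fun P => l P == 0) Z.

Lemma in_Z P : (P \in Z) = (la P != 0) && (P \in Y).
Proof. exact: mem_filter. Qed.

Lemma uZ : uniq Z. Proof. exact: filter_uniq uY. Qed.

Hypothesis la4 : size (ym la) = 4%N.

Lemma sZ : size Z = 6%N.
Proof.
have := count_predC (fun P => la P == 0) Y; rewrite -!size_filter -/(ym la) la4 sY.
by rewrite -[filter _ _]/Z; lia.
Qed.

Lemma Zno (L : seq line) : (size L <= 2)%N -> ~ (forall P, P \in Z -> lprod L P = 0).
Proof.
move=> sL h; apply: (@no_cover (la :: L)) => // P PY; rewrite lprod_cons.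
by have [->|lP] := eqVneq (la P) 0; [rewrite mul0r|rewrite h ?mulr0 // in_Z lP].
Qed.

Lemma zc_le3 l : (zc l <= 3)%N.
Proof.
rewrite leqNgt; apply/negP => h.
have := count_predC (fun P => l P == 0) Z; rewrite -/(zc l) sZ -size_filter.
case e : (filter _ Z) => [|P [|Q [|? ?]]] /=; try lia; move=> _.
- apply: (@Zno [:: l]) => // S SZ; rewrite /lprod big_seq1; apply/eqP; apply/negP => /negP lS.
  by have := mem_filter (predC (fun P => l P == 0)) S Z; rewrite e /= lS SZ.
- have [l' [lP _]] := line_thru P P; apply: (@Zno [:: l; l']) => // S SZ.
  rewrite /lprod !big_cons big_nil mulr1; have [->|lS] := eqVneq (l S) 0; first by rewrite mul0r.
  have := mem_filter (predC (fun P => l P == 0)) S Z; rewrite e /= lS SZ inE => /eqP->.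
  by rewrite lP mulr0.
- have [l' [lP lQ]] := line_thru P Q; apply: (@Zno [:: l; l']) => // S SZ.
  rewrite /lprod !big_cons big_nil mulr1; have [->|lS] := eqVneq (l S) 0; first by rewrite mul0r.
  have := mem_filter (predC (fun P => l P == 0)) S Z; rewrite e /= lS SZ !inE => /orP[]/eqP->.
    by rewrite lP mulr0.
  by rewrite lQ mulr0.
Qed.

(** In the product for [z] one factor is [la]; the two others cover the five other nodes of [Z], so
    one of them contains three. *)
Lemma Zmiss z : z \in Z -> exists l, zc l = 3%N /\ l z != 0.
Proof.
rewrite in_Z => /andP[lz zY]; have [L [sL Lz L0]] := yprod zY.
have ne l : l \in L -> l z != 0.
  by move=> lL; move: Lz; rewrite lprod_eq0 => /hasPn/(_ l lL).
have [l0 l0L e0] : exists2 l : line, l \in L & eql l la.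
  apply: (@lprod_seq _ la L (ym la)); rewrite ?uym ?sL ?la4 // => P; rewrite in_ym => /andP[/eqP lP PY].
  by split=> //; apply: L0 => // e; rewrite -e lP eqxx in lz.
case e : (rem l0 L : seq line) => [|l [|l' [|? ?]]]; have := size_rem l0L; rewrite e sL //= => _.
have lL (k : line) : k \in [:: l; l'] -> k \in L by rewrite -e; exact: mem_rem.
have cov P : P \in rem z Z -> (l P == 0) || (l' P == 0).
  rewrite (mem_rem_uniq _ uZ) inE in_Z => /and3P[/eqP Pz lP PY]; have /eqP := L0 P PY Pz.
  by rewrite (lprod_rem _ l0L) e /lprod !big_cons big_nil mulr1 !mulf_eq0 e0 (negbTE lP).
have zZ : z \in Z by rewrite in_Z lz.
have := count_cover cov; rewrite size_rem // sZ => h.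
have sub (k : line) : (count (fun P => k P == 0%R) (rem z Z) <= zc k)%N.
  by apply: leq_count_subseq; exact: rem_subseq.
have := sub l; have := sub l'; have := zc_le3 l; have := zc_le3 l'.
have [h3|h3] := leqP 3 (zc l).
  by exists l; split; [lia|apply: ne; apply: lL; rewrite mem_head].
by exists l'; split; [lia|apply: ne; apply: lL; rewrite !inE eqxx orbT].
Qed.

Lemma Zmeet l l' : zc l = 3%N -> zc l' = 3%N -> exists P, [/\ P \in Z, l P = 0 & l' P = 0].
Proof.
move=> h h'; have [/hasP[P PZ /andP[/eqP lP /eqP lP']]|/hasPn n] := boolP (has (fun P => (l P == 0) && (l' P == 0)) Z).
  by exists P.
case: (@Zno [:: l; l']) => // P PZ; rewrite /lprod !big_cons big_nil mulr1; apply/eqP; rewrite mulf_eq0.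
have : count (fun P => (l P == 0) || (l' P == 0)) Z == size Z.
  have := count_predUI (fun P => l P == 0) (fun P => l' P == 0) Z; rewrite -/(zc l) -/(zc l') h h' sZ.
  rewrite (_ : count (predI _ _) Z = 0%N) ?addn0; first by move=> e; rewrite -[6%N]/(3 + 3)%N -e.
  by apply/eqP; rewrite -leqn0 leqNgt -has_count; apply/hasPn => S /n.
by rewrite -all_count => /allP/(_ P PZ).
Qed.

Lemma Zthird l A B : zc l = 3%N -> exists P, [/\ P \in Z, l P = 0, P <> A & P <> B].
Proof.
move=> h; have [/hasP[P PZ /and3P[/eqP lP /eqP PA /eqP PB]]|/hasPn n] := boolP (has (fun P => [&& l P == 0, P != A & P != B]) Z).
  by exists P.
have : (size (filter (fun P => l P == 0%R) Z) <= size [:: A; B])%N.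
  apply: uniq_leq_size; first by rewrite filter_uniq // uZ.
  move=> P; rewrite mem_filter => /andP[lP PZ]; have := n P PZ; rewrite lP /= !inE negb_and !negbK //.
by rewrite size_filter -/(zc l) h.
Qed.

(** [Zmiss] at a node of [l1], and then at the intersection found, gives two more lines. They meet
    pairwise by [Zmeet] and are not concurrent, so [Z] consists of the vertices of a triangle and
    one further node on each side. *)
Lemma Ztri l1 : zc l1 = 3%N -> exists l2 l3 w12 w13 w23 e1 e2 e3,
  [/\ uniq [:: w12; w13; w23; e1; e2; e3], Z =i [:: w12; w13; w23; e1; e2; e3], zc l2 = 3%N /\ zc l3 = 3%N &
   [/\ [/\ l1 w12 = 0, l1 w13 = 0 & l1 e1 = 0], [/\ l2 w12 = 0, l2 w23 = 0 & l2 e2 = 0] &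
       [/\ l3 w13 = 0, l3 w23 = 0 & l3 e3 = 0]]].
Proof.
move=> z1; have [w [wZ lw _ _]] := Zthird (0,0) (0,0) z1.
have [l2 [z2 l2w]] := Zmiss wZ; have [w12 [Z12 h12 k12]] := Zmeet z1 z2.
have [l3 [z3 l3w]] := Zmiss Z12; have [w13 [Z13 h13 k13]] := Zmeet z1 z3.
have [w23 [Z23 h23 k23]] := Zmeet z2 z3.
have [e1 [Ze1 he1 n1 n1']] := Zthird w12 w13 z1; have [e2 [Ze2 he2 n2 n2']] := Zthird w12 w23 z2.
have [e3 [Ze3 he3 n3 n3']] := Zthird w13 w23 z3.
have m12 P : l1 P = 0 -> l2 P = 0 -> P = w12.
  move=> a b; apply/eqP; apply/negP => /negP/eqP e.
  by have := line2 e a h12 b k12; move/(_ w); rewrite lw eqxx (negbTE l2w).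
have m13 P : l1 P = 0 -> l3 P = 0 -> P = w13.
  move=> a b; apply/eqP; apply/negP => /negP/eqP e.
  by have := line2 e a h13 b k13; move/(_ w12); rewrite h12 eqxx (negbTE l3w).
have m23 P : l2 P = 0 -> l3 P = 0 -> P = w23.
  move=> a b; apply/eqP; apply/negP => /negP/eqP e.
  by have := line2 e a h23 b k23; move/(_ w12); rewrite k12 eqxx (negbTE l3w).
have d1 : w12 <> w13 by move=> e; rewrite e k13 eqxx in l3w.
have d2 : w12 <> w23 by move=> e; rewrite e k23 eqxx in l3w.
have d3 : w13 <> w23 by move=> e; apply: d1; rewrite (m12 w13) // e.
have d4 : w12 <> e3 by move=> e; rewrite e he3 eqxx in l3w.
have d5 : w13 <> e2 by move=> e; apply: d1; rewrite (m12 w13) // e.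
have d6 : w23 <> e1 by move=> e; apply: d2; rewrite (m12 w23) // e.
have d7 : e1 <> e2 by move=> e; apply: n1; apply: m12 => //; rewrite e.
have d8 : e1 <> e3 by move=> e; apply: n1'; apply: m13 => //; rewrite e.
have d9 : e2 <> e3 by move=> e; apply: n2'; apply: m23 => //; rewrite e.
have u : uniq [:: w12; w13; w23; e1; e2; e3].
  rewrite /= !inE !negb_or !andbT; do !(apply/andP; split); apply/eqP => // e; by apply: n1 + apply: n1' + apply: n2 + apply: n2' + apply: n3 + apply: n3'.
have sub : {subset [:: w12; w13; w23; e1; e2; e3] <= Z}.
  by move=> P; rewrite !inE => /or4P[/eqP->|/eqP->|/eqP->|/or3P[/eqP->|/eqP->|/eqP->]].
have [|_ e] := uniq_min_size u sub; first by rewrite sZ.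
by exists l2, l3, w12, w13, w23, e1, e2, e3; split=> // P; rewrite e.
Qed.

Definition vprod v (L : seq line) :=
  [/\ size L = 3%N, lprod L v != 0 & forall P, P \in Y -> P <> v -> lprod L P = 0].

Lemma vprod_off v L l : vprod v L -> l \in L -> l v != 0.
Proof. by move=> [_ Lv _] lL; move: Lv; rewrite lprod_eq0 => /hasPn/(_ l lL). Qed.

Lemma vprod_on v L P : vprod v L -> P \in Y -> P <> v -> exists2 l : line, l \in L & l P = 0.
Proof.
move=> [_ _ L0] PY Pv; have /eqP := L0 P PY Pv; rewrite lprod_eq0 => /hasP[l lL /eqP lP].
by exists l.
Qed.

(** The three factors share the three other nodes of [la]. If one of them met none, the two others
    would contain all three; one of these would be [la] and vanish at [v]. *)
Lemma vprod_hit v L l : v \in ym la -> vprod v L -> l \in L -> exists t, [/\ t \in ym la, l t = 0 & t <> v].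
Proof.
move=> vY hL lL; have [/hasP[t tY /andP[/eqP lt /eqP tv]]|/hasPn n] := boolP (has (fun t => (l t == 0) && (t != v)) (ym la)).
  by exists t.
have [sL Lv L0] := hL.
have [||P|k kL e] := @lprod_seq _ la (rem l L) (rem v (ym la)).
- by rewrite rem_uniq // uym.
- by rewrite !size_rem // sL la4.
- rewrite (mem_rem_uniq _ (uym la)) => /andP[Pv PY]; move: (PY); rewrite in_ym => /andP[/eqP lP PY']; split=> //.
  have /eqP := L0 P PY' (elimN eqP Pv); rewrite (lprod_rem _ lL) mulf_eq0 => /orP[h|/eqP//].
  by have := n P PY; rewrite h Pv.
have := vprod_off hL (mem_rem kL); rewrite e; move: vY; rewrite in_ym => /andP[->].
by [].
Qed.

Lemma vprod_not v L l : v \in ym la -> vprod v L -> l \in L -> ~ eql l la.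
Proof.
by move=> vY hL lL e; have := vprod_off hL lL; rewrite e; move: vY; rewrite in_ym => /andP[->].
Qed.

Lemma max_of_zc l t : zc l = 3%N -> t \in ym la -> l t = 0 -> size (ym l) = 4%N.
Proof.
move=> z; rewrite in_ym => /andP[/eqP lat tY] lt; apply/eqP; rewrite eqn_leq ym_le4 /=.
have -> : 4%N = size (t :: filter (fun P => l P == 0) Z) by rewrite /= size_filter -/(zc l) z.
apply: uniq_leq_size; first by rewrite /= filter_uniq ?uZ // andbT mem_filter in_Z lat eqxx andbF.
by move=> P; rewrite inE in_ym mem_filter in_Z => /orP[/eqP->|/and3P[->]//]; rewrite lt eqxx.
Qed.

(** A factor meets [la] in a node, so three nodes in [Z] make four in [Y]. Otherwise three factors
    with at most two nodes each cover six, so each has exactly two. *)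
Lemma vprod_alt v L : v \in ym la -> vprod v L ->
  (exists l, [/\ l \in L, zc l = 3%N & size (ym l) = 4%N]) \/ (forall l, l \in L -> zc l = 2%N).
Proof.
move=> vY hL; have [/hasP[l lL /eqP z]|/hasPn n] := boolP (has (fun l => zc l == 3%N) L).
  by left; exists l; split=> //; have [t [tY lt _]] := vprod_hit vY hL lL; exact: max_of_zc z tY lt.
right; have [sL Lv L0] := hL; have cov P : P \in Z -> has (fun l : line => l P == 0) L.
  rewrite in_Z => /andP[lP PY]; rewrite -lprod_eq0 L0 // => e; move: vY; rewrite in_ym -e => /andP[h _].
  by rewrite h in lP.
have le l : l \in L -> (zc l <= 2)%N by move=> lL; have := n l lL; have := zc_le3 l; case: (zc l) => [|[|[|[|]]]].
case: L sL {hL Lv L0 n} cov le => [|a [|b [|c [|? ?]]]] //= _ cov le.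
have := @count_cover (fun P => (a P == 0) || (b P == 0)) (fun P => c P == 0) Z _.
rewrite sZ => /(_ _)/wrap[|h6]; first by move=> P /cov; rewrite orbF orbA.
have := count_predUI (fun P => a P == 0) (fun P => b P == 0) Z; rewrite /predU /= -/(zc a) -/(zc b).
move: h6; rewrite -/(zc c); set x := count _ Z; set y := count _ Z => h6 h7.
have ha : (zc a <= 2)%N by apply: le; rewrite !inE eqxx.
have hb : (zc b <= 2)%N by apply: le; rewrite !inE eqxx orbT.
have hc : (zc c <= 2)%N by apply: le; rewrite !inE eqxx !orbT.
by move=> l; rewrite !inE => /or3P[/eqP->|/eqP->|/eqP->]; lia.
Qed.

(** A line with exactly two nodes in [Z], one a vertex of the triangle, has as the other the extra
    node of the opposite side; so the vertex determines it. The factor of [L] through [v'] contains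
    a vertex [w], and the factor of [L'] through [w] is then the same line, although it must avoid
    [v']. *)
Lemma bad_uniq v v' L L' : v \in ym la -> v' \in ym la -> v <> v' -> vprod v L -> vprod v' L' ->
  (forall l, l \in L -> zc l = 2%N) -> (forall l, l \in L' -> zc l = 2%N) -> False.
Proof.
move=> vY vY' vv hL hL' b b'.
have [z0 z0Z] : exists z, z \in Z by have := sZ; case: Z => // z s _; exists z; rewrite mem_head.
have [m1 [z1 _]] := Zmiss z0Z.
have [m2 [m3 [w12 [w13 [w23 [e1 [e2 [e3 [u eZ [z2 z3] [[a1 a2 a3] [b1 b2 b3] [c1 c2 c3]]]]]]]]]]] := Ztri z1.
have Zin P : P \in [:: w12; w13; w23; e1; e2; e3] -> P \in Z by rewrite eZ.
have two l A B m : zc l = 2%N -> zc m = 3%N -> A <> B -> l A = 0 -> l B = 0 -> m A = 0 -> m B = 0 -> False.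
  move=> zl zm AB lA lB mA mB; have e := line2 AB lA lB mA mB.
  by move: zm; rewrite /zc -(eq_count (a1 := fun P => l P == 0)) // -/(zc l) zl.
have dis : [/\ w12 <> w13, w12 <> w23, w13 <> w23, w12 <> e1 & [/\ w12 <> e2, w13 <> e1, w13 <> e3, w23 <> e2 & w23 <> e3]].
  by split; [..|split] => e; move: u; rewrite e /= !inE !eqxx ?orbT ?andbF.
case: dis => d1 d2 d3 d4 [d5 d6 d7 d8 d9].
have other l A : zc l = 2%N -> exists B, [/\ B \in Z, l B = 0 & B <> A].
  move=> zl; have [/hasP[P PZ /andP[/eqP lP /eqP PA]]|/hasPn n] := boolP (has (fun P => (l P == 0) && (P != A)) Z).
    by exists P.
  have : (size (filter (fun P => l P == 0%R) Z) <= size [:: A])%N.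
    apply: uniq_leq_size; first by rewrite filter_uniq // uZ.
    by move=> P; rewrite mem_filter => /andP[lP PZ]; have := n P PZ; rewrite lP /= inE negbK.
  by rewrite size_filter -/(zc l) zl.
have p12 l : zc l = 2%N -> l w12 = 0 -> l e3 = 0.
  move=> zl lw; have [B [BZ lB Bw]] := other l w12 zl; move: BZ Bw lB; rewrite eZ !inE.
  by case/or4P=> [/eqP->|/eqP->|/eqP->|/or3P[/eqP->|/eqP->|/eqP->]] // _ lB; [case: (@two l w12 w13 m1)|case: (@two l w12 w23 m2)|case: (@two l w12 e1 m1)|case: (@two l w12 e2 m2)].
have p13 l : zc l = 2%N -> l w13 = 0 -> l e2 = 0.
  move=> zl lw; have [B [BZ lB Bw]] := other l w13 zl; move: BZ Bw lB; rewrite eZ !inE.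
  by case/or4P=> [/eqP->|/eqP->|/eqP->|/or3P[/eqP->|/eqP->|/eqP->]] // _ lB; [case: (@two l w12 w13 m1)|case: (@two l w13 w23 m3)|case: (@two l w13 e1 m1)|case: (@two l w13 e3 m3)].
have p23 l : zc l = 2%N -> l w23 = 0 -> l e1 = 0.
  move=> zl lw; have [B [BZ lB Bw]] := other l w23 zl; move: BZ Bw lB; rewrite eZ !inE.
  by case/or4P=> [/eqP->|/eqP->|/eqP->|/or3P[/eqP->|/eqP->|/eqP->]] // _ lB; [case: (@two l w12 w23 m2)|case: (@two l w13 w23 m3)|case: (@two l w23 e2 m2)|case: (@two l w23 e3 m3)].
have WY P : P \in [:: w12; w13; w23; e1; e2; e3] -> P \in Y /\ forall t, t \in ym la -> P <> t.
  move/Zin; rewrite in_Z => /andP[lP PY]; split=> // t; rewrite in_ym => /andP[/eqP lt _] e.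
  by rewrite e lt eqxx in lP.
have I12 : w12 \in [:: w12; w13; w23; e1; e2; e3] by rewrite !inE eqxx.
have I13 : w13 \in [:: w12; w13; w23; e1; e2; e3] by rewrite !inE eqxx orbT.
have I23 : w23 \in [:: w12; w13; w23; e1; e2; e3] by rewrite !inE eqxx !orbT.
have vY2 : v' \in Y by move: vY'; rewrite in_ym => /andP[].
have [l lL lv'] := vprod_on hL vY2 (nesym vv).
(* every line of [L] contains a vertex of the triangle *)
have hw : exists w e, [/\ w \in [:: w12; w13; w23], l w = 0, l e = 0, w <> e & forall k : line, zc k = 2%N -> k w = 0 -> k e = 0].
  have [l12|n12] := eqVneq (l w12) 0.
    exists w12, e3; split=> //; [by rewrite mem_head|exact: p12 (b l lL) l12|by move=> e; move: u; rewrite e /= !inE !eqxx ?orbT /= ?andbF].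
  have [l13|n13] := eqVneq (l w13) 0.
    exists w13, e2; split=> //; [by rewrite !inE eqxx orbT|exact: p13 (b l lL) l13|by move=> e; move: u; rewrite e /= !inE !eqxx ?orbT /= ?andbF].
  have [l23|n23] := eqVneq (l w23) 0.
    exists w23, e1; split=> //; [by rewrite !inE eqxx !orbT|exact: p23 (b l lL) l23|by move=> e; move: u; rewrite e /= !inE !eqxx ?orbT /= ?andbF].
  have on w : w \in [:: w12; w13; w23; e1; e2; e3] -> l w != 0 -> exists2 k : line, k \in rem l L & k w = 0.
    move=> wI lw; have [wY wn] := WY w wI; have [k kL kw] := vprod_on hL wY (wn v vY).
    have kl : k != l by apply: contraNneq lw => <-; rewrite kw.
    exists k => //; have := perm_to_rem lL => /perm_mem/(_ k); rewrite kL inE (negbTE kl) /= => <- //.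
  have [k1 k1L k1w] := on w12 I12 n12; have [k2 k2L k2w] := on w13 I13 n13; have [k3 k3L k3w] := on w23 I23 n23.
  have [sL _ _] := hL; have := size_rem lL; rewrite sL /=.
  have zk (k : line) : k \in rem l L -> zc k = 2%N by move=> /mem_rem/b.
  case: (rem l L : seq line) k1L k2L k3L zk => [|x [|y [|? ?]]] //; rewrite !inE => /orP[]/eqP E1 /orP[]/eqP E2 /orP[]/eqP E3 zk _; subst;
   (have zx : zc x = 2%N := zk x (mem_head _ _); have zy : zc y = 2%N := zk y (mem_last x [:: y]); exfalso;
   first [exact: (@two x w12 w13 m1)|exact: (@two y w12 w13 m1)|exact: (@two x w12 w23 m2)|exact: (@two y w12 w23 m2)|exact: (@two x w13 w23 m3)|exact: (@two y w13 w23 m3)]).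
case: hw => w [e [wI lw le we hk]].
have wI' : w \in [:: w12; w13; w23; e1; e2; e3] by move: wI; rewrite !inE => /or3P[]->; rewrite ?orbT.
have [wY wn] := WY w wI'; have [k kL kw] := vprod_on hL' wY (wn v' vY').
have := vprod_off hL' kL; rewrite -(line2 we lw le kw (hk k (b' k kL) kw)) lv' eqxx.
by [].
Qed.

End Classification.

(** A node [v] of [la] is good if a factor of its product has three nodes in [Z]; this factor is a
    second line with four nodes, avoiding [v]. By [bad_uniq] at most one node is bad. If [lb] meets
    [la] in a good node, that node yields a third line. Otherwise the other two sides of the
    triangle are tried; if both miss [la], each further node either yields a new line or has the
    line through [e2] and [e3] as a factor. That line meets [la] in a node [t], and the same
    alternative at [t] is contradictory. *)
Lemma three_max la : size (ym la) = 4%N -> exists lb lc : line,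
  [/\ size (ym lb) = 4%N, size (ym lc) = 4%N, ~ eql la lb, ~ eql la lc & ~ eql lb lc].
Proof.
move=> la4; have inY' v : v \in ym la -> v \in Y by rewrite in_ym => /andP[].
have [L hL] := seq_choice ([::] : seq line) yprod.
have hv v : v \in ym la -> vprod v (L v) by move=> /inY'/hL.
have lav v : v \in ym la -> la v = 0 by rewrite in_ym => /andP[/eqP].
have off v l : v \in ym la -> l v != 0 -> ~ eql la l by move=> vY lv e; rewrite -e (lav v vY) eqxx in lv.
pose good v := has (fun l => zc la l == 3%N) (L v).
have goodP v : v \in ym la -> good v -> exists l : line, [/\ l \in L v, zc la l = 3%N, size (ym l) = 4%N & l v != 0].
  move=> vY /hasP[l lL /eqP z]; have [t [tY lt _]] := vprod_hit la4 vY (hv v vY) lL.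
  by exists l; split=> //; [exact: (max_of_zc z tY lt)|exact: vprod_off (hv v vY) lL].
have badP v : v \in ym la -> ~~ good v -> forall l, l \in L v -> zc la l = 2%N.
  move=> vY /hasPn n; have [[l [lL z _]]|//] := vprod_alt la4 vY (hv v vY).
  by have := n l lL; rewrite z.
have bad1 v v' : v \in ym la -> v' \in ym la -> v <> v' -> ~~ good v -> good v'.
  move=> vY vY' vv bv; apply/negP => /negP bv'.
  exact: (bad_uniq la4 vY vY' vv (hv v vY) (hv v' vY') (badP v vY bv) (badP v' vY' bv')).
have [v0 [v0Y g0]] : exists v, v \in ym la /\ good v.
  have [v [v' [vY vY' vv]]] : exists v v', [/\ v \in ym la, v' \in ym la & v <> v'] by apply: two_of; rewrite ?uym ?la4.
  by have [g|b] := boolP (good v); [exists v|exists v'; split=> //; exact: bad1 vv b].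
have [lb [lbL zb yb lbv]] := goodP v0 v0Y g0; have nab := off v0 lb v0Y lbv.
have [u [uY lbu _]] := vprod_hit la4 v0Y (hv v0 v0Y) lbL.
have [gu|bu] := boolP (good u).
  have [lc [_ _ yc lcu]] := goodP u uY gu; exists lb, lc; split=> //; first exact: off u lc uY lcu.
  by move=> e; rewrite -e lbu eqxx in lcu.
have gv v : v \in ym la -> v <> u -> good v by move=> vY vu; apply: (bad1 u v) => // e; apply: vu.
have [l2 [l3 [w12 [w13 [w23 [e1 [e2 [e3 [uw eZ [z2 z3] [[a1 a2 a3] [b1 b2 b3] [c1 c2 c3]]]]]]]]]]] := Ztri la4 zb.
have dis : [/\ w12 <> w13, w12 <> w23, w13 <> w23, w12 <> e2 & [/\ w13 <> e3, w23 <> e2, w23 <> e3 & e2 <> e3]].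
  by split; [..|split] => e; move: uw; rewrite e /= !inE !eqxx ?orbT ?andbF.
case: dis => d1 d2 d3 d4 [d5 d6 d7 d8].
have on3 l m A B : zc la l = 3%N -> zc la m = 3%N -> l A = 0 -> m A = 0 -> l B = 0 -> m B = 0 -> A <> B -> eql l m.
  by move=> _ _ lA mA lB mB AB; exact: (line2 AB lA lB mA mB).
have ZP P : P \in [:: w12; w13; w23; e1; e2; e3] -> la P != 0 /\ P \in Y by rewrite -eZ in_Z => /andP[].
have W12 := ZP w12 (mem_head _ _).
have I13 : w13 \in [:: w12; w13; w23; e1; e2; e3] by rewrite !inE eqxx orbT.
have I23 : w23 \in [:: w12; w13; w23; e1; e2; e3] by rewrite !inE eqxx !orbT.
have I2 : e2 \in [:: w12; w13; w23; e1; e2; e3] by rewrite !inE eqxx !orbT.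
have I3 : e3 \in [:: w12; w13; w23; e1; e2; e3] by rewrite !inE eqxx !orbT.
have max23 (m : line) A : zc la m = 3%N -> A \in [:: w12; w13; w23; e1; e2; e3] -> m A = 0 -> ~ eql lb m ->
    (exists2 t, t \in ym la & m t = 0) ->
  exists lb lc : line, [/\ size (ym lb) = 4%N, size (ym lc) = 4%N, ~ eql la lb, ~ eql la lc & ~ eql lb lc].
  move=> zm AI mA nb [t tY mt]; exists lb, m; split=> //; first exact: (max_of_zc zm tY mt).
  by move=> e; have [] := ZP A AI; rewrite e mA eqxx.
have cnt3 l A B C D' : zc la l = 3%N -> l A = 0 -> l B = 0 -> l C = 0 -> l D' = 0 ->
   uniq [:: A; B; C; D'] -> {subset [:: A; B; C; D'] <= [:: w12; w13; w23; e1; e2; e3]} -> False.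
  move=> zl lA lB lC lD uu sub; have : (size [:: A; B; C; D'] <= size (filter (fun P => l P == 0%R) (Z la)))%N.
    apply: uniq_leq_size => // P PI; rewrite mem_filter eZ sub // andbT; move: PI; rewrite !inE.
    by case/or4P=> /eqP->; rewrite ?lA ?lB ?lC ?lD.
  by rewrite size_filter -/(zc la l) zl.
have lb23 : lb w23 != 0.
  apply/negP => /eqP h; apply: (@cnt3 lb w12 w13 w23 e1) => //; first by move: uw; rewrite /= !inE !negb_or -!andbA; case/and5P=> -> -> -> _ /and5P[_ -> -> _ /and5P[_ -> _ _ _]].
  by move=> P; rewrite !inE => /or4P[]->; rewrite ?orbT.
have nb2 : ~ eql lb l2 by move=> e; move: lb23; rewrite e b2 eqxx.
have nb3 : ~ eql lb l3 by move=> e; move: lb23; rewrite e c2 eqxx.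
have [/hasP[t tY /eqP l2t]|/hasPn n2] := boolP (has (fun t => l2 t == 0) (ym la)).
  by apply: (max23 l2 w12) => //; [rewrite mem_head|exists t].
have [/hasP[t tY /eqP l3t]|/hasPn n3] := boolP (has (fun t => l3 t == 0) (ym la)).
  by apply: (max23 l3 w13) => //; exists t.
have step v : v \in ym la -> v <> u ->
    (exists lc : line, [/\ size (ym lc) = 4%N, ~ eql la lc & ~ eql lb lc]) \/
    exists l' t, [/\ l' \in L v, l' e2 = 0, l' e3 = 0, t \in ym la & [/\ l' t = 0, t <> v & t <> u]].
  move=> vY vu; have hL' := hv v vY; have [g [gL zg yg gv0]] := goodP v vY (gv v vY vu).
  have [h|h] := boolP ((g w12 == 0) && (g w13 == 0)); last first.
    left; exists g; split=> //; first exact: off v g vY gv0.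
    by move=> e; move: h; rewrite -!e a1 a2 eqxx.
  case/andP: h => /eqP g12 /eqP g13; have egb : eql g lb := line2 d1 g12 g13 a1 a2.
  have lbP P : P \in [:: w23; e2; e3] -> g P != 0.
    rewrite egb !inE => /or3P[]/eqP->; first by [].
      by apply/negP => /eqP h; apply: nb2; exact: (line2 d4 a1 h b1 b3).
    by apply/negP => /eqP h; apply: nb3; exact: (line2 d5 a2 h c1 c3).
  right; have [sL _ L0] := hL'; have := size_rem gL; rewrite sL /=.
  case e : (rem g (L v) : seq line) => [|x [|y [|? ?]]] // _.
  have xL : x \in L v.
    have : x \in rem g (L v) by rewrite e mem_head.
    exact: mem_rem.
  have yL : y \in L v.
    have : y \in rem g (L v) by rewrite e !inE eqxx orbT.
    exact: mem_rem.
  have cov P : P \in Y -> P <> v -> g P != 0 -> x P = 0 \/ y P = 0.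
    move=> PY Pv gP; have /eqP := L0 P PY Pv; rewrite (lprod_rem _ gL) e /lprod !big_cons big_nil mulr1 !mulf_eq0 (negbTE gP) /=.
    by case/orP=> /eqP; [left|right].
  have cov' P : P \in [:: w23; e2; e3] -> x P = 0 \/ y P = 0.
    move=> PI; have [lP PY] : la P != 0 /\ P \in Y by apply: ZP; move: PI; rewrite !inE => /or3P[]->; rewrite ?orbT.
    by apply: cov => //; [move=> eP; move: lP; rewrite eP lav ?eqxx|exact: lbP].
  have no (k : line) : k \in L v -> k w23 = 0 -> k e2 != 0 /\ k e3 != 0.
    move=> kL kw; have [t [tY kt _]] := vprod_hit la4 vY hL' kL; split; apply/negP => /eqP ke.
      by have := n2 t tY; rewrite -(line2 d6 kw ke b2 b3) kt eqxx.
    by have := n3 t tY; rewrite -(line2 d7 kw ke c2 c3) kt eqxx.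
  (* The factor through [w23] meets [la], unlike [l2] and [l3], so it avoids [e2] and [e3], which
     the other factor must take. The latter cannot meet [la] at [u], for then the former would
     contain the two remaining nodes of [la]. *)
  have fin (k k' : line) : k \in L v -> k' \in L v -> k w23 = 0 -> (forall P, P \in Y -> P <> v -> g P != 0 -> k P = 0 \/ k' P = 0) ->
     exists l' t, [/\ l' \in L v, l' e2 = 0, l' e3 = 0, t \in ym la & [/\ l' t = 0, t <> v & t <> u]].
    move=> kL kL' kw ck; have [k2 k3] := no k kL kw.
    have ze P : P \in [:: w23; e2; e3] -> k P != 0 -> k' P = 0.
      move=> PI kP; have [lP PY] : la P != 0 /\ P \in Y by apply: ZP; move: PI; rewrite !inE => /or3P[]->; rewrite ?orbT.
      have [] := ck P PY _ (lbP P PI) => //; first by move=> eP; move: lP; rewrite eP lav ?eqxx.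
      by move=> h; rewrite h eqxx in kP.
    have [t [tY k't tv]] := vprod_hit la4 vY hL' kL'.
    exists k', t; split=> //; [by apply: ze => //; rewrite !inE eqxx orbT|by apply: ze => //; rewrite !inE eqxx !orbT|split=> // tu].
    have one (l : line) A B : l \in L v -> A \in ym la -> B \in ym la -> A <> B -> l A = 0 -> l B = 0 -> False.
      by move=> lL AY BY AB lA lB; apply: (vprod_not vY hL' lL); exact: (line2 AB lA lB (lav A AY) (lav B BY)).
    have [A [B [AI BI AB]]] : exists A B, [/\ A \in rem v (rem u (ym la)), B \in rem v (rem u (ym la)) & A <> B].
      apply: two_of; first by rewrite !rem_uniq // uym.
      by rewrite size_rem ?size_rem ?la4 // (mem_rem_uniq _ (uym la)) inE; apply/andP; split=> //; apply/eqP.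
    have inR P : P \in rem v (rem u (ym la)) -> [/\ P \in ym la, P <> u & P <> v].
      by rewrite (mem_rem_uniq _ (rem_uniq _ (uym la))) => /andP[/eqP Pv]; rewrite (mem_rem_uniq _ (uym la)) => /andP[/eqP Pu PY].
    have kz P : P \in rem v (rem u (ym la)) -> k P = 0.
      move=> /inR[PY Pu Pv]; have gP : g P != 0.
        by apply/negP => /eqP gP; apply: (one g P u) => //; apply/eqP; rewrite egb lbu.
      have [//|k'P] := ck P (inY' P PY) Pv gP; case: (one k' P u) => //; by rewrite -tu.
    have [AY _ _] := inR A AI; have [BY _ _] := inR B BI.
    by apply: (one k A B) => //; exact: kz.
  have [xw|yw] := cov' w23 (mem_head _ _).
    exact: fin x y xL yL xw cov.
  by apply: (fin y x) => // P PY Pv gP; have [] := cov P PY Pv gP; [right|left].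
have [v [vI vu]] : exists v, v \in ym la /\ v <> u.
  have [v [v' [vY vY' vv]]] : exists v v', [/\ v \in ym la, v' \in ym la & v <> v'] by apply: two_of; rewrite ?uym ?la4.
  by have [e|/eqP] := eqVneq v u; [exists v'; split=> // e'; apply: vv; rewrite e|exists v].
have [[lc [yc n1 n2']]|[l' [t [lL le2 le3 tY [lt tv tu]]]]] := step v vI vu; first by exists lb, lc.
have [[lc [yc n1 n2']]|[l'' [s [l2L l2e2 l2e3 _ _]]]] := step t tY tu; first by exists lb, lc.
have := vprod_off (hv t tY) l2L.
by rewrite -(line2 d8 le2 le3 l2e2 l2e3) lt eqxx.
Qed.

(** Disjoint, they would leave two nodes of [Y], and the line through these would complete a cover
    by three lines. *)
Lemma max_meet l l' : size (ym l) = 4%N -> size (ym l') = 4%N -> ~ eql l l' ->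
  exists P, [/\ P \in Y, l P = 0 & l' P = 0].
Proof.
move=> s s' ne; have [/hasP[P PY /andP[/eqP lP /eqP lP']]|/hasPn n] := boolP (has (fun P => (l P == 0) && (l' P == 0)) Y).
  by exists P.
have h := count_predUI (fun P => l P == 0) (fun P => l' P == 0) Y.
have c0 : count (predI (fun P => l P == 0) (fun P => l' P == 0)) Y = 0%N.
  by apply/eqP; rewrite -leqn0 leqNgt -has_count; apply/hasPn => S /n.
rewrite c0 -!size_filter -/(ym l) -/(ym l') s s' size_filter addn0 in h.
have := count_predC (predU (fun P => l P == 0) (fun P => l' P == 0)) Y; rewrite h sY.
rewrite -size_filter; case e : (filter _ Y) => [|A [|B [|? ?]]] // _.
have [k [kA kB]] := line_thru A B.
case: (@no_cover [:: l; l'; k]) => // P PY; rewrite /lprod !big_cons big_nil mulr1.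
apply/eqP; rewrite !mulf_eq0; have [//|lP] := boolP (l P == 0); have [//|lP'] := boolP (l' P == 0).
have : P \in [:: A; B] by rewrite -e mem_filter /= negb_or lP lP'.
by rewrite !inE => /orP[]/eqP->; rewrite ?kA ?kB eqxx.
Qed.

(** Concurrent in a node, they would contain 1 + 3 * 3 nodes, all of [Y]. *)
Lemma max_nconc (l1 l2 l3 : line) P : size (ym l1) = 4%N -> size (ym l2) = 4%N -> size (ym l3) = 4%N ->
  ~ eql l1 l2 -> ~ eql l1 l3 -> ~ eql l2 l3 -> P \in Y -> l1 P = 0 -> l2 P = 0 -> l3 P = 0 -> False.
Proof.
move=> s1 s2 s3 n12 n13 n23 PY h1 h2 h3.
have I l : l P = 0 -> P \in ym l by move=> h; rewrite in_ym h eqxx.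
have dis (l l' : line) Q : ~ eql l l' -> l P = 0 -> l' P = 0 -> Q \in rem P (ym l) -> Q \notin rem P (ym l').
  rewrite !(mem_rem_uniq _ (uym _)) !inE !in_ym => ne lP lP' /and3P[QP /eqP lQ QY].
  rewrite QP QY andbT /=; apply/negP => /eqP lQ'; apply: ne; exact: (line2 (elimN eqP QP) lQ lP lQ' lP').
pose s := P :: rem P (ym l1) ++ rem P (ym l2) ++ rem P (ym l3).
have us : uniq s.
  rewrite /s /= !mem_cat !(mem_rem_uniq _ (uym _)) !inE !eqxx /= !cat_uniq !(rem_uniq _ (uym _)) /= andbT.
  apply/andP; split; apply/hasPn => Q; rewrite ?mem_cat.
    by case/orP=> h; [apply: (dis l2 l1)|apply: (dis l3 l1)] => //; move/eql_sym.
  by move=> h; apply: (dis l3 l2) => //; move/eql_sym.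
have sub : {subset s <= Y}.
  by move=> Q; rewrite inE !mem_cat => /or4P[/eqP->//|||] /mem_rem; rewrite in_ym => /andP[].
have [|_ e] := uniq_min_size us sub.
  by rewrite sY /s /= !size_cat !size_rem ?I // s1 s2 s3.
case: (@no_cover [:: l1; l2; l3]) => // Q; rewrite -e inE !mem_cat /lprod !big_cons big_nil mulr1.
case/or4P=> [/eqP->|||]; first by rewrite h1 mul0r.
- by move/mem_rem; rewrite in_ym => /andP[/eqP-> _]; rewrite mul0r.
- by move/mem_rem; rewrite in_ym => /andP[/eqP-> _]; rewrite mul0r mulr0.
- by move/mem_rem; rewrite in_ym => /andP[/eqP-> _]; rewrite !mulr0.
Qed.

(* [P a b] with [a != b] is the intersection of [lam a] and [lam b], and [P a a] is the fourth
   node of [Y] on [lam a]. *)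
Definition quad (lam : 'I_4 -> line) (P : 'I_4 -> 'I_4 -> pt) :=
  [/\ forall a, size (ym (lam a)) = 4%N, forall a b, P a b \in Y, forall a b, P a b = P b a &
      forall h a b : 'I_4, (lam h (P a b) == 0) = (h == a) || (h == b)].

Lemma quadP (lam : 'I_4 -> line) : (forall a, size (ym (lam a)) = 4%N) ->
  (forall a b, a != b -> ~ eql (lam a) (lam b)) -> exists W : 'I_4 -> 'I_4 -> pt, quad lam W.
Proof.
move=> s4 ne.
have exQ (x : 'I_4 * 'I_4) : exists q : pt, x.1 != x.2 -> [/\ q \in Y, lam x.1 q = 0 & lam x.2 q = 0].
  have [_|h] := eqVneq x.1 x.2; first by exists (0, 0).
  by have [q hq] := max_meet (s4 x.1) (s4 x.2) (ne _ _ h); exists q.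
have [Q hQ] := @seq_choice _ _ ((0, 0) : pt) (enum {: 'I_4 * 'I_4}) _ (fun x _ => exQ x).
have {}hQ a b : a != b -> [/\ Q (a, b) \in Y, lam a (Q (a, b)) = 0 & lam b (Q (a, b)) = 0].
  by move=> ij; have := hQ (a, b); rewrite mem_enum => /(_ isT ij).
have un a b A B : a != b -> lam a A = 0 -> lam b A = 0 -> lam a B = 0 -> lam b B = 0 -> A = B.
  move=> ij iA jA iB jB; apply/eqP; apply/negP => /negP/eqP AB; apply: (ne a b ij); exact: (line2 AB iA iB jA jB).
have sym a b : a != b -> Q (a, b) = Q (b, a).
  by move=> ij; have [_ x y] := hQ _ _ ij; have [_ z t] := hQ _ _ (neqs ij); exact: (un a b).
have on2 h a b : a != b -> (lam h (Q (a, b)) == 0) = (h == a) || (h == b).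
  move=> ij; have [QY x y] := hQ _ _ ij; have [->|hi] := eqVneq h a; first by rewrite x eqxx.
  have [->|hj] := eqVneq h b; first by rewrite y eqxx.
  apply/negP => /eqP c; apply: (max_nconc (s4 h) (s4 a) (s4 b) _ _ _ QY c x y); exact: ne.
have exA a : exists A, [/\ A \in Y, lam a A = 0 & forall b, b != a -> A <> Q (a, b)].
  pose s := [seq Q (a, b) | b <- rem a (enum 'I_4)].
  have [/hasP[A AY h]|/hasPn n] := boolP (has (fun A => A \notin s) (ym (lam a))).
    move: AY; rewrite in_ym => /andP[/eqP iA AY]; exists A; split=> // b ji e.
    by move/negP: h; apply; rewrite e; apply: (map_f (fun b => Q (a, b))); rewrite (mem_rem_uniq _ (enum_uniq _)) inE ji mem_enum.
  have : (size (ym (lam a)) <= size s)%N.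
    by apply: uniq_leq_size (uym _) _ => A /n; rewrite negbK.
  by rewrite s4 size_map size_rem ?mem_enum // size_enum_ord.
have [A hA] := @seq_choice _ pt (0, 0) (enum 'I_4) (fun a A => [/\ A \in Y, lam a A = 0 & forall b, b != a -> A <> Q (a, b)]) (fun a _ => exA a).
have {}hA a := hA a (mem_enum _ a).
exists (fun a b => if a == b then A a else Q (a, b)); split=> //.
- by move=> a b; case: eqVneq => [e|/hQ[]//]; case: (hA a).
- by move=> a b; rewrite (eq_sym b); case: eqVneq => [->//|]; exact: sym.
- move=> h a b; case: (eqVneq a b) => [<-|]; last exact: on2.
  rewrite orbb; have [AY iA nA] := hA a; have [->|hi] := eqVneq h a; first by rewrite iA eqxx.
  apply/negP => /eqP c; apply: (nA h hi); have [_ x y] := hQ _ _ (neqs hi).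
  exact: (un a h _ _ (neqs hi)).
Qed.

(* [V k] is the vertex of the triangle of the [lam i] opposite to [lam k], [O] the node outside
   the triangle, and [o k] a line through [O] and through the nodes [e i k] with [i != k]. *)
Definition tridata (lam : 'I_3 -> line) (V : 'I_3 -> pt) (O : pt) (o : 'I_3 -> line) (e : 'I_3 -> 'I_3 -> pt) :=
  [/\ forall i, size (ym (lam i)) = 4%N,
      forall k, V k \in Y /\ forall i, (lam i (V k) == 0) = (i != k),
      O \in Y /\ forall i, lam i O != 0,
      forall i j, i != j -> e i j \in Y /\ forall h, (lam h (e i j) == 0) = (h == i) &
      (forall k, o k O = 0 /\ forall h, o k (V h) != 0) /\
      forall i j, i != j -> forall h, (o h (e i j) == 0) = (h == j)].

(** The product for the vertex [V k] contains [lam k]; its two other factors cover [O] and the two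
    inner nodes on each other side, each taking one inner node per side. The factor through [O] is
    [o k]. If two of the [o k] share an inner node, they coincide and have four nodes, which is the
    fourth line; otherwise they separate the six inner nodes. *)
Lemma tri_or_quad (lam : 'I_3 -> line) : (forall i, size (ym (lam i)) = 4%N) ->
  (forall i j, i != j -> ~ eql (lam i) (lam j)) ->
  (exists V O o e, tridata lam V O o e) \/
  (exists lam4 : 'I_4 -> line, (forall a, size (ym (lam4 a)) = 4%N) /\ forall a b, a != b -> ~ eql (lam4 a) (lam4 b)).
Proof.
move=> s4 ne.
have exV k : exists P, P \in Y /\ forall i, (lam i P == 0) = (i != k).
  have [i ik] := other k; have [j [ji jk hj]] := third ik.
  have [P [PY iP jP]] := max_meet (s4 i) (s4 j) (ne _ _ (neqs ji)); exists P; split=> // h.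
  case/or3P: (hj h) => /eqP->; rewrite ?iP ?jP ?eqxx ?ik ?jk //=.
  apply/negP => /eqP kP; apply: (max_nconc (s4 i) (s4 j) (s4 k) _ _ _ PY iP jP kP); apply: ne => //; exact: neqs.
have [V hV] := @seq_choice _ pt (0, 0) (enum 'I_3) (fun k P => P \in Y /\ forall i, (lam i P == 0) = (i != k)) (fun k _ => exV k).
have {}hV k := hV k (mem_enum _ k).
have [O [OY hO]] : exists O, O \in Y /\ forall i, lam i O != 0.
  have [/hasP[O OY /forallP h]|/hasPn n] := boolP (has (fun O => [forall i, lam i O != 0]) Y); first by exists O.
  case: (@no_cover [:: lam o0; lam o1; lam o2]) => // P PY; apply/eqP; rewrite lprod_eq0 /= orbF.
  have /forallPn[i] := n P PY; rewrite negbK => h; have : (lam o0 P == 0) || ((lam o1 P == 0) || (lam o2 P == 0)).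
    by move: i h; apply: ord3P => ->; rewrite ?orbT.
  by [].
have un i j A B : i != j -> lam i A = 0 -> lam j A = 0 -> lam i B = 0 -> lam j B = 0 -> A = B.
  move=> ij iA jA iB jB; apply/eqP; apply/negP => /negP/eqP AB; apply: (ne i j ij); exact: (line2 AB iA iB jA jB).
have lV k i : i != k -> lam i (V k) = 0 by move=> ik; apply/eqP; case: (hV k) => _ ->.
have exo k : exists l : line, [/\ l O = 0, l (V k) != 0 & forall i, i != k -> exists P, [/\ P \in Y, l P = 0 & forall h, (lam h P == 0) = (h == i)]].
  have [L [sL Lk L0]] := yprod (hV k).1; have hL : vprod (V k) L by [].
  have kV : lam k (V k) != 0 by rewrite (hV k).2 eqxx.
  have [l0 l0L e0] : exists2 l : line, l \in L & eql l (lam k).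
    apply: (@lprod_seq _ (lam k) L (ym (lam k))); rewrite ?uym ?sL ?s4 // => P; rewrite in_ym => /andP[/eqP lP PY].
    by split=> //; apply: L0 => // eP; move: kV; rewrite -eP lP eqxx.
  have := size_rem l0L; rewrite sL /=; case e : (rem l0 L : seq line) => [|x [|y [|? ?]]] // _.
  have inL (l : line) : l \in [:: x; y] -> l (V k) != 0.
    by rewrite -e => /mem_rem; exact: vprod_off.
  have cov P : P \in Y -> lam k P != 0 -> P <> V k -> x P = 0 \/ y P = 0.
    move=> PY kP PV; have /eqP := L0 P PY PV; rewrite (lprod_rem _ l0L) e /lprod !big_cons big_nil mulr1 !mulf_eq0 e0 (negbTE kP) /=.
    by case/orP=> /eqP; [left|right].
  have OV : O <> V k.
    by move=> e'; have [i ik] := other k; have := hO i; rewrite e' lV ?eqxx.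
  have fin (l l' : line) : l O = 0 -> l (V k) != 0 -> l' (V k) != 0 -> (forall P, P \in Y -> lam k P != 0 -> P <> V k -> l P = 0 \/ l' P = 0) ->
    exists l : line, [/\ l O = 0, l (V k) != 0 & forall i, i != k -> exists P, [/\ P \in Y, l P = 0 & forall h, (lam h P == 0) = (h == i)]].
    move=> lO lk lk' c; exists l; split=> // i ik; have [j [ji jk hj]] := third ik.
    have Vki : V k \in ym (lam i) by rewrite in_ym lV ?eqxx ?(hV k).1.
    have Vjk : V j <> V k by move=> e'; have := (hV k).2 j; rewrite -e' (hV j).2 eqxx jk.
    have Vji : V j \in rem (V k) (ym (lam i)).
      by rewrite (mem_rem_uniq _ (uym _)) inE in_ym (lV j i (neqs ji)) (hV j).1 eqxx !andbT; apply/eqP.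
    have [A [B [AI BI AB]]] : exists A B, [/\ A \in rem (V j) (rem (V k) (ym (lam i))), B \in rem (V j) (rem (V k) (ym (lam i))) & A <> B].
      by apply: two_of; [rewrite !rem_uniq // uym|rewrite !size_rem // s4].
    have inR P : P \in rem (V j) (rem (V k) (ym (lam i))) -> [/\ P \in Y, P <> V k & forall h, (lam h P == 0) = (h == i)].
      rewrite (mem_rem_uniq _ (rem_uniq _ (uym _))) => /andP[/eqP PVj]; rewrite (mem_rem_uniq _ (uym _)) => /andP[/eqP PVk].
      rewrite in_ym => /andP[/eqP iP PY]; split=> // h; case/or3P: (hj h) => /eqP->; first by rewrite iP !eqxx.
        rewrite (negbTE (neqs ik)); apply/negP => /eqP kP; apply: PVj.
        by apply: (un i k) => //; apply: lV; rewrite neqs // neqs.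
      rewrite (negbTE ji); apply/negP => /eqP jP; apply: PVk.
      by apply: (un i j); rewrite ?(neqs ji) //; apply: lV.
    have [AY AV hA] := inR A AI; have [BY BV hB] := inR B BI.
    have kA : lam k A != 0 by rewrite hA neqs. have kB : lam k B != 0 by rewrite hB neqs.
    have iA : lam i A = 0 by apply/eqP; rewrite hA eqxx. have iB : lam i B = 0 by apply/eqP; rewrite hB eqxx.
    have [lA|lA'] := c A AY kA AV; first by exists A.
    have [lB|lB'] := c B BY kB BV; first by exists B.
    by have := line2 AB lA' lB' iA iB; move/(_ (V k)); rewrite (lV k i ik) eqxx (negbTE lk').
  have [xO|yO] := cov O OY (hO k) OV.
    by apply: (fin x y) => //; apply: inL; rewrite !inE eqxx ?orbT.
  apply: (fin y x) => //; try by apply: inL; rewrite !inE eqxx ?orbT.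
  by move=> P PY kP PV; have [] := cov P PY kP PV; [right|left].
have [o ho] := @seq_choice _ _ (lam o0) (enum 'I_3) _ (fun k _ => exo k).
have {}ho k := ho k (mem_enum _ k).
have exe (x : 'I_3 * 'I_3) : exists q : pt, x.1 != x.2 -> [/\ q \in Y, o x.2 q = 0 & forall h, (lam h q == 0) = (h == x.1)].
  have [_|h] := eqVneq x.1 x.2; first by exists (0, 0).
  by have [_ _ H] := ho x.2; have [q hq] := H _ h; exists q.
have [e he] := @seq_choice _ _ ((0, 0) : pt) (enum {: 'I_3 * 'I_3}) _ (fun x _ => exe x).
have {}he i j : i != j -> [/\ e (i, j) \in Y, o j (e (i, j)) = 0 & forall h, (lam h (e (i, j)) == 0) = (h == i)].
  by move=> ij; have := he (i, j); rewrite mem_enum => /(_ isT ij).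
have oO k : o k O = 0 by case: (ho k).
have le i j : i != j -> lam i (e (i, j)) = 0 by move=> ij; apply/eqP; case: (he _ _ ij) => _ _ ->.
have oe i j : i != j -> o j (e (i, j)) = 0 by move=> /he[].
have eO i j : i != j -> e (i, j) <> O by move=> ij e'; have := hO i; rewrite -e' le ?eqxx.
have [/existsP[i /existsP[j /existsP[k /and4P[ij ik jk /eqP E1]]]]|/existsPn n] :=
  boolP [exists i, [exists j, [exists k, [&& i != j, i != k, j != k & e (i, j) == e (i, k)]]]].
  right; have hk : forall h, [|| h == i, h == j | h == k].
    by have [k' [k'i k'j h]] := third ij; case/or3P: (h k) => /eqP kk; [rewrite kk eqxx in ik|rewrite kk eqxx in jk|rewrite kk].
  have eo : eql (o j) (o k).
    by apply: (line2 (eO i j ij)); rewrite ?oO ?oe // E1 oe.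
  pose lam4 (h : 'I_4) := if unlift ord_max h is Some h' then lam h' else o j.
  have so : size (ym (o j)) = 4%N.
    apply/eqP; rewrite eqn_leq ym_le4 /=.
    have hm a : a != j -> exists2 P, P \in ym (o j) & forall h, (lam h P == 0) = (h == a).
      by move=> aj; have [eY oj h] := he _ _ aj; exists (e (a, j)) => //; rewrite in_ym oj eqxx.
    have [A AI hA] := hm i ij; have [B BI hB] := hm k (neqs jk).
    have [CY ok hC] := he _ _ jk; set C := e (j, k) in CY ok hC.
    have CI : C \in ym (o j) by rewrite in_ym eo ok eqxx.
    have OI : O \in ym (o j) by rewrite in_ym oO eqxx.
    rewrite -[4%N]/(size [:: A; B; C; O]); apply: uniq_leq_size; last first.
      by move=> S; rewrite !inE => /or4P[]/eqP->.
    rewrite /= !inE !negb_or !andbT; do !(apply/andP; split); apply/eqP => E2.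
    - by have := hA k; rewrite E2 hB eqxx eq_sym (negbTE ik).
    - by have := hA j; rewrite E2 hC eqxx eq_sym (negbTE ij).
    - by have := hO i; rewrite -E2 hA eqxx.
    - by have := hB j; rewrite E2 hC eqxx (negbTE jk).
    - by have := hO k; rewrite -E2 hB eqxx.
    - by have := hO j; rewrite -E2 hC eqxx.
  have no a : ~ eql (lam a) (o j) by move=> E2; have := hO a; rewrite E2 oO eqxx.
  exists lam4; split=> [t|t t' hh]; first by rewrite /lam4; case: unliftP.
  rewrite /lam4; case: unliftP hh => [a ->|->]; case: unliftP => [b ->|->] //.
  - by move=> /eqP ab; apply: ne; apply/eqP => E2; apply: ab; rewrite E2.
  - by move=> _ /eql_sym; exact: no.
left; exists V, O, o, (fun i j => e (i, j)).
have nn i j k : i != j -> i != k -> j != k -> e (i, j) <> e (i, k).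
  move=> ij ik jk /eqP E1; have := n i; rewrite negb_exists => /forallP/(_ j); rewrite negb_exists => /forallP/(_ k).
  by rewrite ij ik jk E1.
have eo a b i : a != b -> i != a -> i != b -> ~ eql (o a) (o b).
  move=> ab ia ib E1; apply: (nn i a b ia ib ab); have [_ oa _] := he _ _ ia; have [_ ob _] := he _ _ ib.
  apply/eqP; apply/negP => /negP/eqP E2; have oa' : o b (e (i, a)) = 0 by apply/eqP; rewrite -E1 oa.
  by have := line2 E2 oa' ob (le i a ia) (le i b ib); move/(_ O); rewrite oO eqxx (negbTE (hO i)).
split=> //.
- by move=> i j ij; have [? _ ?] := he _ _ ij.
split.
- move=> k; split=> // h; have [->|hk] := eqVneq h k; first by case: (ho k).
  have [j [jh jk _]] := third hk; apply/negP => /eqP oV.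
  have Vj : lam j (V h) = 0 by apply: lV.
  have ne' : V h <> e (j, k) by move=> E1; have := (hV h).2 k; rewrite E1; have [_ _ ->] := he _ _ jk; rewrite (neqs hk) eq_sym (negbTE jk).
  by have := line2 ne' oV (oe _ _ jk) Vj (le _ _ jk); move/(_ O); rewrite oO eqxx (negbTE (hO j)).
- move=> i j ij h; have [->|hj] := eqVneq h j; first by rewrite oe ?eqxx.
  apply/negP => /eqP E1; have E2 : eql (o h) (o j) by apply: (line2 (eO i j ij)); rewrite ?oO ?oe.
  have [k [kh kj _]] := third hj; exact: (eo h j k).
Qed.

(** * Exactly three lines with four nodes in [Y] *)

Definition cu (c : pt -> line) m i := count (fun D => c D == m) (E i).

Lemma max_hit3 la : size (ym la) = 4%N -> hit la o0 -> hit la o1 -> hit la o2 -> False.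
Proof.
move=> s4 /hitP[A [AX A0 lA]] /hitP[B [BX B1 lB]] /hitP[C [CX C2 lC]].
have u : uniq (A :: B :: C :: ym la).
  rewrite /= uym !inE !in_ym (negbTE (elY A0)) (negbTE (elY B1)) (negbTE (elY C2)) !andbF !orbF !andbT.
  rewrite negb_or -!andbA; apply/and3P; split; apply/eqP => e.
  - by have := @eld' o0 o1 A AX A0 isT; rewrite e B1 eqxx.
  - by have := @eld' o0 o2 A AX A0 isT; rewrite e C2 eqxx.
  - by have := @eld' o1 o2 B BX B1 isT; rewrite e C2 eqxx.
have : (size (A :: B :: C :: ym la) <= 6)%N.
  apply: (@on6 la) => // P; rewrite !inE => /or4P[/eqP->|/eqP->|/eqP->|] //.
  by rewrite in_ym => /andP[/eqP-> /YX].
by rewrite /= s4.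
Qed.

Lemma cover3 i j k : i != j -> i != k -> j != k -> forall h, [|| h == i, h == j | h == k].
Proof.
move=> ij ik jk h; have [k' [_ _ hc]] := third ij.
have kk : k = k' by case/or3P: (hc k) => /eqP E1 //; rewrite E1 eqxx in ik jk.
by rewrite kk.
Qed.

Lemma pol1_const (f : pt -> R) P Q : pol 1 f -> f P = f Q.
Proof. by move=> [f1 [f2 [c [h1 h2 h]]]]; rewrite !h h1 h2 h1 h2; ring. Qed.

Lemma line_pts_off l (M : seq line) n : (forall m, m \in M -> ~ eql m l) ->
  exists t, [/\ uniq t, size t = n & forall P, P \in t -> l P = 0 /\ forall m, m \in M -> m P != 0].
Proof.
elim: M n => [|m M IH] n h.
  by have [t [ut st ht]] := line_pts l [::] n; exists t; split=> // P /ht[lP _].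
have [t [ut st ht]] := IH n.+1 (fun m' h' => h m' (mem_behead (s := m :: M) h')).
have c1 : (count (fun P => m P == 0%R) t <= 1)%N.
  rewrite leqNgt; apply/negP => h2; have [t' [ut' st' ht']] := take_count ut h2.
  have [A [B [AI BI AB]]] := two_of ut' (ltac:(by rewrite st') : (2 <= size t')%N).
  have [/ht[lA _] /eqP mA] := ht' A AI; have [/ht[lB _] /eqP mB] := ht' B BI.
  by apply: (h m (mem_head _ _)); exact: (line2 AB mA mB lA lB).
have c2 : (n <= count (predC (fun P => m P == 0%R)) t)%N.
  by have := count_predC (fun P => m P == 0) t; rewrite st; lia.
have [t' [ut' st' ht']] := take_count ut c2; exists t'; split=> // P /ht'[/ht[lP hP] /= mP]; split=> // m'.
by rewrite inE => /orP[/eqP->|]; [|exact: hP].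
Qed.

Section Case3.
Variables (lam : 'I_3 -> line) (V : 'I_3 -> pt) (O : pt) (o : 'I_3 -> line) (e : 'I_3 -> 'I_3 -> pt).
Hypothesis T3 : tridata lam V O o e.

Lemma t4 i : size (ym (lam i)) = 4%N. Proof. by case: T3. Qed.
Lemma t4' i : (4 <= size (ym (lam i)))%N. Proof. by rewrite t4. Qed.
Lemma VY k : V k \in Y. Proof. by case: T3 => _ /(_ k)[]. Qed.
Lemma lV i k : (lam i (V k) == 0) = (i != k). Proof. by case: T3 => _ /(_ k)[]. Qed.
Lemma OY : O \in Y. Proof. by case: T3 => _ _ []. Qed.
Lemma lO i : (lam i O == 0) = false. Proof. by case: T3 => _ _ [_ /(_ i)/negbTE]. Qed.
Lemma eY i j : i != j -> e i j \in Y. Proof. by case: T3 => _ _ _ H _ /H[]. Qed.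
Lemma le i j h : i != j -> (lam h (e i j) == 0) = (h == i). Proof. by case: T3 => _ _ _ H _ /H[]. Qed.
Lemma oO k : (o k O == 0) = true. Proof. by case: T3 => _ _ _ _ [/(_ k)[-> _] _]; rewrite eqxx. Qed.
Lemma oV k h : (o k (V h) == 0) = false. Proof. by case: T3 => _ _ _ _ [/(_ k)[_ /(_ h)/negbTE]]. Qed.
Lemma oe i j h : i != j -> (o h (e i j) == 0) = (h == j). Proof. by case: T3 => _ _ _ _ [_ H] /H. Qed.

Lemma tri_Y P : P \in Y -> [\/ P = O, exists k, P = V k | exists i j, i != j /\ P = e i j].
Proof.
pose s := [:: O; V o0; V o1; V o2; e o0 o1; e o0 o2; e o1 o0; e o1 o2; e o2 o0; e o2 o1].
(* The vanishing pattern on the six lines separates the ten points. *)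
pose sig S := [:: lam o0 S == 0; lam o1 S == 0; lam o2 S == 0; o o0 S == 0; o o1 S == 0; o o2 S == 0].
have us : uniq s.
  have sO : sig O = [:: false; false; false; true; true; true] by rewrite /sig !lO !oO.
  have sV k : sig (V k) = [:: o0 != k; o1 != k; o2 != k; false; false; false] by rewrite /sig !lV !oV.
  have se i j : i != j -> sig (e i j) = [:: o0 == i; o1 == i; o2 == i; o0 == j; o1 == j; o2 == j].
    by move=> ij; rewrite /sig !(le _ ij) !(oe _ ij).
  by apply: (map_uniq (f := sig)); rewrite [map _ _]/= sO !sV !se.
have sub : {subset s <= Y}.
  by move=> S; rewrite !inE => /or4P[/eqP->|/eqP->|/eqP->|/or4P[/eqP->|/eqP->|/eqP->|/or4P[]/eqP->]]; rewrite ?OY ?VY ?eY.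
have [|_ eqs] := uniq_min_size us sub; first by rewrite sY.
rewrite -eqs !inE => /or4P[/eqP->|/eqP->|/eqP->|/or4P[/eqP->|/eqP->|/eqP->|/or4P[]/eqP->]];
  [by constructor 1|by constructor 2; exists o0|by constructor 2; exists o1|by constructor 2; exists o2|..]; constructor 3.
- by exists o0, o1.
- by exists o0, o2.
- by exists o1, o0.
- by exists o1, o2.
- by exists o2, o0.
- by exists o2, o1.
Qed.

Lemma lam_neq i j : i != j -> ~ eql (lam i) (lam j).
Proof. by move=> ij h; have := lV i j; rewrite h lV eqxx ij. Qed.

Lemma thru_o m i j : m O = 0 -> i != j -> m (e i j) = 0 -> eql m (o j).
Proof.
move=> mO ij me; apply: (@line2 _ m (o j) O (e i j)) => //; try by apply/eqP; rewrite ?oO ?oe.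
by move=> E1; have := lO i; rewrite E1 le // eqxx.
Qed.

Lemma o_neq j k : j != k -> ~ eql (o j) (o k).
Proof.
move=> jk E1; have [i [ij ik _]] := third jk; have := oe j ij.
by rewrite E1 oe // eqxx (negbTE (neqs jk)).
Qed.

Lemma o_miss j P : P \in Y -> lam j P = 0 -> o j P != 0.
Proof.
case/tri_Y => [->|[k ->]|[a [b [ab ->]]]] /eqP; rewrite ?lO ?oV ?le // oe // => /eqP ja.
by rewrite ja (negbTE ab).
Qed.

(** This makes the dichotomy of [lemV_single] available for every line through [O]. Through an inner
    node the line is some [o j], which misses [lam j]. Through a vertex [V k] and no inner node it
    misses [lam k], since a second vertex would put [O] on a side. *)
Lemma thru_miss m : m O = 0 -> exists h, forall P, P \in Y -> lam h P = 0 -> m P != 0.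
Proof.
move=> mO.
have [/existsP[i /existsP[j /andP[ij /eqP me]]]|/existsPn n] := boolP [exists i, [exists j, (i != j) && (m (e i j) == 0)]].
  by exists j => P PY jP; rewrite (thru_o mO ij me); exact: o_miss.
have ne i j : i != j -> m (e i j) != 0.
  by move=> ij; have := n i; rewrite negb_exists => /forallP/(_ j); rewrite ij.
have [/existsP[k /eqP mV]|/existsPn nV] := boolP [exists k, m (V k) == 0].
  exists k => P /tri_Y[->|[h ->]|[a [b [ab ->]]]] /eqP; rewrite ?lO ?le // ?lV; last by move=> _; exact: ne.
  move=> kh; have [i [ik ih _]] := third kh; apply/negP => /eqP mh.
  have : eql m (lam i).
    apply: (@line2 _ m (lam i) (V k) (V h)) => //; try by apply/eqP; rewrite lV.
    by move=> E1; have := lV k k; rewrite E1 lV kh eqxx.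
  by move/(_ O); rewrite mO eqxx lO.
exists o0 => P /tri_Y[->|[h ->]|[a [b [ab ->]]]] /eqP; rewrite ?lO ?le // => _; exact: ne.
Qed.

(** Without an inner node, [m] has at most one node of [Y] besides [O], and [ybound] excludes [O]
    alone; so it contains a vertex [V k]. By [base] the fundamental cubics of [O] and [V k] both
    vanish at a node [N] of [el i]. They are explicit products of lines, and the factors that could
    meet at [N] already meet in [Y]. *)
Lemma S_line m i U : m O = 0 -> hit m i -> uniq U -> (forall D, D \in U -> usr m D /\ el i D = 0) -> (3 <= size U)%N ->
  exists j, eql m (o j).
Proof.
move=> mO hm uU hU s3.
have [/existsP[a /existsP[j /andP[ij /eqP me]]]|/existsPn n] := boolP [exists i, [exists j, (i != j) && (m (e i j) == 0)]].
  by exists j; exact: thru_o mO ij me.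
have ne a j : a != j -> m (e a j) != 0.
  by move=> ij; have := n a; rewrite negb_exists => /forallP/(_ j); rewrite ij.
exfalso.
have [/existsP[k /eqP mV]|/existsPn nV] := boolP [exists k, m (V k) == 0]; last first.
  have : (size (ym m) <= size [:: O])%N.
    apply: uniq_leq_size (uym _) _ => P; rewrite in_ym => /andP[mP].
    by case/tri_Y => [->|[h Ph]|[a [b [ab Pab]]]]; [rewrite mem_head|have := nV h; rewrite -Ph mP|have := ne a b ab; rewrite -Pab mP].
  by have := ybound uU hU; move: s3 => /=; lia.
have Vu h : h != k -> m (V h) != 0.
  move=> hk; have [a [ah ak _]] := third hk; apply/negP => /eqP mh.
  have : eql m (lam a).
    apply: (@line2 _ m (lam a) (V k) (V h)) => //; try by apply/eqP; rewrite lV.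
    by move=> E1; have := lV k k; rewrite E1 lV eq_sym hk eqxx.
  by move/(_ O); rewrite mO eqxx lO.
have y2 : (size (ym m) <= 2)%N.
  have : (size (ym m) <= size [:: O; V k])%N.
    apply: uniq_leq_size (uym _) _ => P; rewrite in_ym => /andP[mP].
    case/tri_Y => [->|[h Ph]|[a [b [ab Pab]]]]; [by rewrite mem_head| |by have := ne a b ab; rewrite -Pab mP].
    have [hk|hk] := eqVneq h k; first by rewrite !inE Ph hk eqxx orbT.
    by have := Vu h hk; rewrite -Ph mP.
  by [].
have mis P : P \in Y -> lam k P = 0 -> m P != 0.
  move=> /tri_Y[->|[h ->]|[a [b [ab ->]]]] /eqP; rewrite ?lO ?lV //; last by move=> _; exact: ne.
  by rewrite eq_sym; exact: Vu.
(* Exactly three users are kept, so that with [P] and [Q] they leave a sixth node of [el i]. *)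
pose U' := take 3 U.
have uU' : uniq U' by rewrite take_uniq.
have sU' : size U' = 3%N by rewrite size_takel.
have hU' D : D \in U' -> usr m D /\ el i D = 0 by move/mem_take/hU.
have [_ [P [Q [[PX iP mP] [QX iQ lQ] mQ uPQ sub]]] _] := typed_S (t4' k) mis uU' hU' (ltac:(by rewrite sU') : (2 <= size U')%N) hm.
have [/hasP[N NE NPQ]|/hasPn h] := boolP (has (fun N => N \notin P :: Q :: U') (E i)); last first.
  have : (size (E i) <= size (P :: Q :: U'))%N by apply: uniq_leq_size (uE i) _ => S /h; rewrite negbK.
  by rewrite sE /= sU'.
move: NPQ; rewrite !inE !negb_or => /and3P[NP NQ NU].
move: NE; rewrite in_E => /andP[/eqP iN NX].
have [D [DU _]] : exists D, D \in U' /\ True by case: (U') sU' => // D s _; exists D; rewrite mem_head.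
have [uD iD] := hU' D DU.
have mN : m N != 0.
  by apply: contraNneq NP => mN; apply/eqP; exact: (meet_uniq uD iD iN mN iP mP).
have NY : N \notin Y := elY iN.
have kN : lam k N != 0.
  apply: contraNneq NQ => kN; apply/eqP; apply: (@max_el_uniq (lam k) i) => //; by rewrite t4.
have gO : yfund O (lprod [:: lam o0; lam o1; lam o2]).
  split; [exact: pol_lprod|by rewrite lprod_eq0 /= !lO|].
  move=> S SY SO; apply/eqP; rewrite lprod_eq0 /= orbF.
  case/tri_Y: SY SO => [->|[h ->]|[a [b [ab ->]]]] // _; last by rewrite !le //; move: a ab; apply: ord3P.
  by rewrite !lV; move: h; apply: ord3P.
have [a ak] := other k; have [b [ba bk hb]] := third ak.
have [l [l1 l2]] := line_thru (e a b) (e b a).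
have lV0 : l (V k) != 0.
  apply/negP => /eqP lVk; have : eql l (lam a).
    apply: (@line2 _ l (lam a) (V k) (e a b)) => //; try by apply/eqP; rewrite ?lV ?le // neqs.
    by move=> E1; have := lV b k; rewrite E1 le ?(neqs ba) // (negbTE ba) bk.
  by move/(_ (e b a)); rewrite l2 eqxx le // (negbTE (neqs ba)).
have gV : yfund (V k) (lprod [:: lam k; o k; l]).
  split; [exact: pol_lprod|by rewrite lprod_eq0 /= lV eqxx oV (negbTE lV0)|].
  move=> S SY SO; apply/eqP; rewrite lprod_eq0 /= orbF.
  case/tri_Y: SY SO => [->|[h ->]|[c [d [cd ->]]]]; first by rewrite oO orbT.
    by rewrite lV; case: (eqVneq k h) => [<-|].
  move=> _; rewrite le // oe //; case/or3P: (hb c) (hb d) cd => /eqP->; case/or3P=> /eqP->; rewrite ?eqxx ?orbT //= ?l1 ?l2 ?eqxx ?orbT //.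
have z y g : y \in Y -> m y = 0 -> yfund y g -> g N = 0.
  move=> yY my hg; apply: (base uU' hU' _ yY my hg NX iN mN NU); by rewrite sU'.
have z1 := z O _ OY mO gO; have z2 := z (V k) _ (VY k) mV gV.
have [c [ck cN]] : exists c, c != k /\ lam c N = 0.
  move/eqP: z1; rewrite lprod_eq0 /= orbF => /or3P[]/eqP h; [exists o0|exists o1|exists o2]; split=> //; apply/eqP => E1; move: kN; by rewrite -E1 h eqxx.
have both (x : line) A : x N = 0 -> x A = 0 -> lam c A = 0 -> A \in Y -> eql x (lam c).
  move=> xN xA cA AY; apply: (@line2 _ x (lam c) N A) => // E1; by rewrite E1 AY in NY.
move/eqP: z2; rewrite lprod_eq0 /= orbF (negbTE kN) /= => /orP[]/eqP h.
  have [] : ~ eql (o k) (lam c) by move/(_ O); rewrite oO lO.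
  by apply: (both _ (e c k) h); rewrite ?eY //; apply/eqP; rewrite ?oe ?le.
have [E1|E1] := eqVneq c a.
  have E2 : eql l (lam c).
    by apply: (both l (e a b) h l1); [rewrite E1; apply/eqP; rewrite le ?(neqs ba)|apply: eY; exact: neqs].
  by have := E2 (V k); rewrite (negbTE lV0) E1 lV ak.
have cb : c = b by case/or3P: (hb c) => /eqP // E2; rewrite E2 ?eqxx in E1 ck.
have E2 : eql l (lam c).
  by apply: (both l (e b a) h l2); [rewrite cb; apply/eqP; rewrite le|exact: eY].
by have := E2 (V k); rewrite (negbTE lV0) cb lV bk.
Qed.

(** Otherwise the quartic obtained by dividing the quintic by [x] vanishes at [Q] and the four nodes
    of [lam i], and [D] uses [lam i], against [max_avoid]. *)
Lemma five_hit i D x Q : el i D = 0 -> usr (o i) D -> usr x D -> ~ eql (o i) x ->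
  Q \in X -> el i Q = 0 -> lam i Q = 0 -> o i Q != 0 -> D <> Q ->
  x Q = 0 \/ exists S, [/\ S \in Y, lam i S = 0 & x S = 0].
Proof.
move=> iD [q hq] ux ne QX iQ lQ oQ DQ; have [DX mD pq qD q0] := hq.
have [q' [pq' eq' hx]] := usr2 hq ux ne.
have [xQ|xQ] := eqVneq (x Q) 0; [by left|right].
have [/hasP[S]|/hasPn n] := boolP (has (fun S => x S == 0) (ym (lam i))).
  by rewrite in_ym => /andP[/eqP lS SY] /eqP xS; exists S.
exfalso; have [||P|g [pg eg]] := @div_line _ 5 (lam i) q' (Q :: ym (lam i)) pq'.
- by rewrite /= uym andbT in_ym (negbTE (elY iQ)) andbF.
- by rewrite /= t4.
- rewrite inE => /orP[/eqP->|Pl].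
    split=> //; have /eqP := q0 Q QX (nesym DQ) oQ; rewrite eq' mulf_eq0 (negbTE xQ) => /eqP//.
  have xP := n P Pl; move: Pl; rewrite in_ym => /andP[/eqP lP PY]; split=> //.
  have PD : P <> D by move=> E1; have := Yel i PY; rewrite E1 iD eqxx.
  by have /eqP := q0 P (YX PY) PD (o_miss PY lP); rewrite eq' mulf_eq0 (negbTE xP) => /eqP.
apply: (max_avoid (t4' i) _ iD QX iQ lQ); exists (fun P => o i P * (x P * g P)).
apply: (fund_usesq DX (usesq_fund hq)) => [|P]; last by rewrite eq' eg; ring.
by do 2 apply: pol_line.
Qed.

Section FourUsers.
Variables (i j k : 'I_3) (U : seq pt) (P Q : pt).
Hypotheses (ij : i != j) (ik : i != k) (jk : j != k).
Hypotheses (uPQ : uniq (P :: Q :: U)) (sub : {subset P :: Q :: U <= E i}) (sU : size U = 4%N).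
Hypotheses (hU : forall D, D \in U -> usr (o i) D /\ el i D = 0).
Hypotheses (lQ : lam i Q = 0) (oQ : o i Q != 0).

Let QX : Q \in X. Proof. by have := sub (mem_behead (s := P :: Q :: U) (mem_head _ _)); rewrite in_E => /andP[]. Qed.
Let iQ : el i Q = 0. Proof. by have := sub (mem_behead (s := P :: Q :: U) (mem_head _ _)); rewrite in_E => /andP[/eqP]. Qed.
Let uU : uniq U. Proof. by case/and3P: uPQ. Qed.
Let nQ D : D \in U -> D <> Q.
Proof. by move=> DU E1; have := uPQ; rewrite /= -E1 DU /= andbF. Qed.

(** The cubic of [D] and [D'] for [o i] is divisible by [lam i] and, as both nodes use [x], by [x].
    The linear form [w] left vanishes at [V i] and [e k j], so it is [lam k]; it also vanishes at
    another user of [o i] off [x], which is the node sought. If [x] contains [e k j] as well, each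
    case of the last hypothesis is contradictory. *)
Lemma share D D' x : D \in U -> D' \in U -> D <> D' -> usr x D -> usr x D' ->
  x (e j k) = 0 -> x (V i) != 0 -> [\/ x (V j) = 0, x (e i j) = 0 | x Q = 0] -> hit (lam k) i.
Proof.
move=> DU DU' DD' ux ux' xe xV xz; have [u iD] := hU DU; have [u' iD'] := hU DU'.
have ki := neqs ik; have kj := neqs jk; have ji := neqs ij.
have nox : ~ eql (o i) x by move/(_ (e j k)); rewrite xe eqxx oe // (negbTE ik).
have [|S|//|//|r [pr r0 _ rv [F FU rF]]] := @cubic (o i) i [:: D; D'] [::].
- by rewrite /= inE andbT; apply/eqP.
- by rewrite !inE => /orP[]/eqP->.
have notU S : S \in Y -> S \notin [:: D; D'].
  by move=> SY; rewrite !inE; apply/negP => SU; have := Yel i SY; case/orP: SU => /eqP->; rewrite ?iD ?iD' eqxx.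
have rY S : S \in Y -> o i S != 0 -> r S = 0.
  by move=> SY oS; apply: r0 => //; [exact: YX|exact: Y_offi|exact: notU].
have [S|g [pg eg]] := div_line (l := lam i) pr (uym _) (t4' i).
  by rewrite in_ym => /andP[/eqP lS SY]; split=> //; apply: rY => //; exact: o_miss.
have [t [ut st ht]] : exists t, [/\ uniq t, size t = 3%N & forall S, S \in t -> x S = 0 /\ forall m, m \in [:: lam i; el o0; el o1; el o2] -> m S != 0].
  apply: line_pts_off => m; rewrite !inE => /or4P[]/eqP-> E1.
  - by have := E1 (e j k); rewrite xe eqxx le // (negbTE ij).
  - exact: (prim_not_el ux iD (eql_sym E1)).
  - exact: (prim_not_el ux iD (eql_sym E1)).
  - exact: (prim_not_el ux iD (eql_sym E1)).
have [||w [pw ew]] := @div_line _ 3 x g t pg ut; first by rewrite st.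
  move=> S /ht[xS oS]; split=> //; have : r S = 0.
    apply: rv; last first.
      by move=> D1 q /[!inE] /orP[]/eqP-> hq; [have [q' [_ -> _]] := usr2 hq ux nox|have [q' [_ -> _]] := usr2 hq ux' nox]; rewrite xS mul0r.
    by move=> h _; move: h; apply: ord3P; apply: oS; rewrite !inE eqxx ?orbT.
  rewrite eg => /eqP; rewrite mulf_eq0 => /orP[h|/eqP//].
  by have := oS (lam i); rewrite h mem_head => /(_ isT).
have er S : r S = lam i S * (x S * w S) by rewrite eg ew.
have rz S : r S = 0 -> lam i S != 0 -> x S != 0 -> w S = 0.
  by move=> rS lS xS; move/eqP: rS; rewrite er !mulf_eq0 (negbTE lS) (negbTE xS) => /eqP.
have wV : w (V i) = 0 by apply: rz => //; [apply: rY; rewrite ?VY ?oV|rewrite lV eqxx].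
have [D2 [D3 [D2I D3I D23]]] : exists A B, [/\ A \in rem D' (rem D U), B \in rem D' (rem D U) & A <> B].
  apply: two_of; first by rewrite !rem_uniq.
  by rewrite size_rem ?size_rem ?sU // (mem_rem_uniq _ uU) inE DU' andbT; apply/eqP => E1; apply: DD'.
have inR S : S \in rem D' (rem D U) -> [/\ S \in U, el i S = 0, r S = 0 & lam i S != 0].
  rewrite (mem_rem_uniq _ (rem_uniq _ uU)) => /andP[/eqP SD']; rewrite (mem_rem_uniq _ uU) => /andP[/eqP SD SU].
  have [uS iS] := hU SU; split=> //.
    apply: r0; [exact: usr_X uS|exact: (el_offi (usr_X uS) iS)|exact: usr_off uS|].
    by rewrite !inE; apply/norP; split; apply/eqP.
  by apply/negP => /eqP lS; apply: (nQ SU); apply: (@max_el_uniq (lam i) i) => //; rewrite t4.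
have [D2U iD2 rD2 lD2] := inR D2 D2I; have [D3U iD3 rD3 lD3] := inR D3 D3I.
have xel : ~ eql x (el i) by move/(_ (e j k)); rewrite xe eqxx (negbTE (Yel i (eY jk))).
have wnz : ~ (forall S, w S = 0) by move=> w0; move: rF; rewrite er w0 !mulr0 eqxx.
have [xe2|xe2] := eqVneq (x (e k j)) 0.
  case: xz => xz.
  - have E1 : eql x (lam k).
      apply: (@line2 _ x (lam k) (V j) (e k j)) => //; try by apply/eqP; rewrite ?lV ?le.
      by move=> E1; have := lV k j; rewrite E1 le // kj eqxx => _; have := lV i j; rewrite E1 le // ij (negbTE ik).
    by have := E1 (e j k); rewrite xe eqxx le // (negbTE kj).
  - have E1 : eql x (o j).
      apply: (@line2 _ x (o j) (e i j) (e k j)) => //; try by apply/eqP; rewrite oe.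
      by move=> E1; have := le k ij; rewrite E1 le // eqxx (negbTE ki).
    by have := E1 (e j k); rewrite xe eqxx oe // (negbTE jk).
  - have xD S : S \in U -> el i S = 0 -> x S != 0.
      by move=> SU iS; apply/negP => /eqP xS; apply: xel; exact: (line2 (nQ SU) xS xz iS iQ).
    have w2 : w D2 = 0 by apply: rz => //; exact: xD.
    have w3 : w D3 = 0 by apply: rz => //; exact: xD.
    have [|//|S|c [pc ec]] := @div_line _ 2 (el i) w [:: D2; D3] pw; first by rewrite /= inE andbT; apply/eqP.
      by rewrite !inE => /orP[]/eqP->.
    case: wnz => S; have /eqP := wV; rewrite !ec mulf_eq0 (negbTE (Yel i (VY i))) => /eqP cV.
    by rewrite (pol1_const S (V i) pc) cV mulr0.
have we : w (e k j) = 0 by apply: rz => //; [apply: rY; rewrite ?eY ?oe|rewrite le].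
have [|//|S|c [pc ec]] := @div_line _ 2 (lam k) w [:: V i; e k j] pw.
- rewrite /= inE andbT; apply/eqP => E1; have := lV j i; rewrite E1 le // (negbTE jk) ji.
  by [].
- by rewrite !inE => /orP[]/eqP->; split=> //; apply/eqP; rewrite ?lV ?le.
have cnz S : c S != 0.
  by apply/negP => /eqP cS; apply: wnz => S'; rewrite ec (pol1_const S' S pc) cS mulr0.
have fin S : S \in U -> el i S = 0 -> r S = 0 -> lam i S != 0 -> x S != 0 -> hit (lam k) i.
  move=> SU iS rS lS xS; apply/hitP; exists S; split=> //; first exact: usr_X (hU SU).1.
  by have /eqP := rz S rS lS xS; rewrite ec mulf_eq0 (negbTE (cnz S)) orbF => /eqP.
have [x2|x2] := eqVneq (x D2) 0; last exact: (fin D2).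
by apply: (fin D3) => //; apply/negP => /eqP x3; apply: xel; exact: (line2 D23 x2 x3 iD2 iD3).
Qed.

Hypothesis no_k : forall D, usr (o k) D -> el i D = 0 -> False.

(** Each of the four users uses a line through [e j k]. Unless this is [lam j], [five_hit] makes it
    pass through [V j], [e i j] or [Q]. Three points for four users: two users share a line, and
    [share] applies. *)
Lemma alt4 : ~~ hit (lam k) i -> exists2 D, D \in U & usr (lam j) D.
Proof.
move=> nh; have ki := neqs ik; have kj := neqs jk; have ji := neqs ij.
have ex D : D \in U -> exists x : line, usr x D /\ x (e j k) = 0.
  move=> DU; have [u iD] := hU DU; apply: usr_at; [exact: usr_X u|exact: YX (eY jk)|].
  by move=> E1; have := Yel i (eY jk); rewrite E1 iD eqxx.
have [x hx] := seq_choice (el i) ex.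
have toj (y : line) S : y (e j k) = 0 -> y S = 0 -> lam j S = 0 -> S <> e j k -> eql y (lam j).
  by move=> ye yS lS Se; apply: (line2 Se yS ye lS); apply/eqP; rewrite le.
have [/hasP[D DU /eqP xV]|/hasPn n] := boolP (has (fun D => x D (V i) == 0) U).
  exists D => //; have [ux xe] := hx D DU; apply: eql_usr ux; apply: (toj _ (V i)) => //.
    by apply/eqP; rewrite lV.
  by move=> E1; have := lV k i; rewrite E1 le // ki (negbTE kj).
have ez D : D \in U -> exists z, z \in [:: V j; e i j; Q] /\ x D z = 0.
  move=> DU; have [ux xe] := hx D DU; have [u iD] := hU DU.
  have nox : ~ eql (o i) (x D) by move/(_ (e j k)); rewrite xe eqxx oe // (negbTE ik).
  have [xQ|[S [SY lS xS]]] := five_hit iD u ux nox QX iQ lQ oQ (nQ DU); first by exists Q; rewrite !inE eqxx !orbT.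
  case/tri_Y: SY lS xS => [->|[h ->]|[a [b [ab ->]]]] /eqP; rewrite ?lO // ?lV ?le //.
    case/or3P: (cover3 ij ik jk h) => /eqP->; rewrite ?eqxx //.
      by exists (V j); rewrite mem_head.
    move=> _ xS; have E1 : eql (x D) (lam j).
      apply: (toj _ (V k)) => //; first by apply/eqP; rewrite lV.
      by move=> E1; have := lV i k; rewrite E1 le // ik (negbTE ij).
    by have := E1 (V i); rewrite lV ji (negbTE (n D DU)).
  move=> /eqP ia; rewrite -ia in ab * => xS.
  have [bj|bj] := eqVneq b j; first by exists (e i j); rewrite -bj !inE eqxx orbT.
  have bk : b = k.
    by case/or3P: (cover3 ij ik jk b) => /eqP E1 //; [rewrite E1 eqxx in ab|rewrite E1 eqxx in bj].
  rewrite bk in xS; exfalso; apply: (no_k (D := D)) => //; apply: eql_usr ux.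
  apply: (@line2 _ (x D) (o k) (e i k) (e j k)) => //; try by apply/eqP; rewrite oe.
  by move=> E1; have := le i ik; rewrite E1 le // eqxx (negbTE ij).
have [z hz] := seq_choice (V j) ez.
have zne S : S \in [:: V j; e i j; Q] -> S <> e j k.
  rewrite !inE => /or3P[]/eqP-> E1.
  - by have := lV i j; rewrite E1 le // ij (negbTE ij).
  - by have := le i ij; rewrite E1 le // eqxx (negbTE ij).
  - by have := elY iQ; rewrite E1 eY.
have inj : {in U &, injective z}.
  move=> D D' DU DU' ezz; have [zI xz] := hz D DU; have [_ xz'] := hz D' DU'.
  have [ux xe] := hx D DU; have [ux' xe'] := hx D' DU'.
  apply/eqP; apply/negP => /negP/eqP DD'; move/negP: nh; apply.
  apply: (@share D D' (x D)) => //; last 2 first.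
  - exact: n.
  - by move: zI xz; rewrite !inE => /or3P[]/eqP->; [constructor 1|constructor 2|constructor 3].
  apply: eql_usr ux'; apply: (@line2 _ _ _ (z D) (e j k)) => //; first exact: zne.
  by rewrite ezz.
have : (size (map z U) <= size [:: V j; e i j; Q])%N.
  by apply: uniq_leq_size; [rewrite map_inj_in_uniq|move=> S /mapP[D /hz[zI _] ->]].
by rewrite size_map sU.
Qed.
End FourUsers.

Section Case3Lines.
Variables (T : seq line) (c : pt -> line) (S : 'I_3 -> line).
Hypothesis hc : forall D i, D \in X -> el i D = 0 -> usr (c D) D /\ c D O = 0.
Hypothesis hT : forall m, m \in T -> m O = 0 /\ forall i, hit m i.
Hypothesis hT1 : forall m m' P, m \in T -> m' \in T -> P \in X -> P <> O -> m P = 0 -> m' P = 0 -> m = m'.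
Hypothesis ST : forall i, S i \in T.
Hypothesis Su : forall i, (3 <= cu c (S i) i)%N.
Hypothesis So : forall i, eql (S i) (o i).

Let U i := [seq D <- E i | c D == S i].

Lemma U_users i D : D \in U i -> usr (o i) D /\ el i D = 0.
Proof.
rewrite mem_filter in_E => /and3P[/eqP cD /eqP iD DX]; split=> //.
by have [u _] := hc DX iD; apply: eql_usr (So i) _; rewrite -cD.
Qed.

Lemma U_data i : exists P Q, [/\ uniq (P :: Q :: U i), {subset P :: Q :: U i <= E i}, o i P = 0,
  lam i Q = 0 & o i Q != 0].
Proof.
have [_ [P [Q [[PX iP mP] [QX iQ lQ] mQ uPQ sub]]] _] : [/\ forall D j, usr (o i) D -> el j D = 0 -> j = i,
      exists P Q, [/\ [/\ P \in X, el i P = 0 & o i P = 0], [/\ Q \in X, el i Q = 0 & lam i Q = 0],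
        o i Q != 0, uniq (P :: Q :: U i) & {subset P :: Q :: U i <= E i}] & (size (U i) <= 4)%N].
  apply: (typed_S (t4' i)); [exact: o_miss|exact: filter_uniq (uE i)|exact: U_users| |].
    by rewrite size_filter; exact: leq_trans (Su i).
  have [_ /(_ i)/hitP[P [PX iP sP]]] := hT (ST i); apply/hitP; exists P; split=> //.
  by apply/eqP; rewrite -So sP.
by exists P, Q.
Qed.

Lemma o_single i D j : usr (o i) D -> el j D = 0 -> j = i.
Proof.
have s2 : (2 <= size (U i))%N by rewrite size_filter; apply: leq_trans (Su i).
have [A [B [/U_users[uA iA] /U_users[uB iB] AB]]] := two_of (filter_uniq _ (uE i)) s2.
exact: (lemV_single (t4' i) (@o_miss i) uA uB iA iB AB).
Qed.

Lemma hit_self i : hit (lam i) i.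
Proof.
have [P [Q [_ sub _ lQ _]]] := U_data i; apply/hitP; exists Q.
by have := sub Q; rewrite !inE eqxx orbT in_E => /(_ isT)/andP[/eqP].
Qed.

(** If [lam k] misses [el i], some node on [el i] uses [lam j] by [alt4]; hence [lam j] misses
    [el i] and meets the two other lines. Then [j] and [k] exchange roles. *)
Lemma alt_pair i j k : i != j -> i != k -> j != k -> size (U i) = 4%N ->
  (hit (lam j) i && hit (lam k) i) || [&& ~~ hit (lam j) i, ~~ hit (lam k) i, hit (lam j) j, hit (lam j) k, hit (lam k) j & hit (lam k) k].
Proof.
move=> ij ik jk s4; have [P [Q [u sub oP lQ oQ]]] := U_data i.
have use a b : i != a -> i != b -> a != b -> ~~ hit (lam b) i -> ~~ hit (lam a) i /\ forall h, h != i -> hit (lam a) h.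
  move=> ia ib ab nb; have [D|D DU uD] := alt4 ia ib ab u sub s4 (@U_users i) lQ oQ _ nb.
    by move=> uD iD; have := o_single uD iD => e1; rewrite e1 eqxx in ib.
  have [_ iD] := U_users DU; split=> [|h hi]; last by apply/hitP; exact: meets uD iD hi.
  by apply/hitP => -[Z [ZX iZ aZ]]; exact: (max_avoid (t4' a) uD iD ZX iZ aZ).
have [hk|nk] := boolP (hit (lam k) i); have [hj|nj] := boolP (hit (lam j) i) => //=.
- by have [] := use k j ik ij (neqs jk) nj; rewrite hk.
- by have [] := use j k ij ik jk nk; rewrite hj.
have [_ h1] := use j k ij ik jk nk; have [_ h2] := use k j ik ij (neqs jk) nj.
by rewrite !h1 ?h2 // neqs.
Qed.

(** The node [Q'] of [lam k] on [el x] lies on [o k] by [lemV_only]; the point is that it is [Dx].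
    If not, and [m] avoids [Q], then [lam k] divides the quintic of [Dx], against [max_avoid]. If
    [m] contains [Q], a combination of the three quintics killed at [Dz] and an extra point of
    [lam k] is divisible by [lam k], [el z], [el k] and [el x], and vanishes at all three users. *)
Lemma B_miss m k x z Dk Dx Dz : m O = 0 -> k != x -> k != z -> x != z ->
  (forall P, P \in Y -> lam k P = 0 -> m P != 0) ->
  usr m Dk -> usr m Dx -> usr m Dz -> el k Dk = 0 -> el x Dx = 0 -> el z Dz = 0 ->
  hit (lam k) x -> ~~ hit (lam k) z -> lam k Dx = 0 /\ o k Dx = 0.
Proof.
move=> mO kx kz xz mis uk ux uz kDk xDx zDz /hitP[Q' [Q'X xQ' lQ']] nz.
have [P [Q [uq sub oP lQ oQ]]] := U_data k.
have [QX kQ] : Q \in X /\ el k Q = 0.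
  by have := sub Q; rewrite !inE eqxx orbT in_E => /(_ isT)/andP[/eqP].
have s2 : (2 <= size (U k))%N by rewrite size_filter; apply: leq_trans (Su k).
have [A [B [/[dup] AU /U_users[uA kA] /[dup] BU /U_users[uB kB] AB]]] := two_of (filter_uniq _ (uE k)) s2.
have nQ D : D \in U k -> Q <> D by move=> DU e1; have := uq; rewrite /= e1 DU /= andbF.
have oQ' : o k Q' = 0.
  apply/eqP; apply/negP => /negP oQ'.
  have [Q'Y|e1] := lemV_only (t4' k) (@o_miss k) uA kA QX kQ lQ oQ (nQ A AU) Q'X lQ' oQ'.
    by have := elY xQ'; rewrite Q'Y.
  by have := eld' QX kQ (neqs kx); rewrite -e1 xQ' eqxx.
have nmo : ~ eql m (o k).
  by move=> e1; have := o_single (eql_usr e1 ux) xDx => e2; rewrite e2 eqxx in kx.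
have Q'O : Q' <> O by move=> e1; have := elY xQ'; rewrite e1 OY.
have mQ' : m Q' != 0.
  apply/negP => /eqP mQ'; apply: nmo; apply: (line2 Q'O mQ' mO oQ'); by apply/eqP; rewrite oO.
suff e1 : Dx = Q' by rewrite e1.
apply/eqP; apply/negP => /negP/eqP DQ'.
have DX D : usr m D -> D \in X := @usr_X m D.
have QQ' : Q <> Q' by move=> e1; have := eld' QX kQ (neqs kx); rewrite e1 xQ' eqxx.
have offD a b D D' : a != b -> D \in X -> el a D = 0 -> el b D' = 0 -> D <> D'.
  by move=> ab DX' aD bD e1; have := eld' DX' aD (neqs ab); rewrite e1 bD eqxx.
have lamY D a : el a D = 0 -> forall R', R' \in Y -> R' <> D.
  by move=> aD R' RY e1; have := elY aD; rewrite -e1 RY.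
have [mQ|mQ] := eqVneq (m Q) 0; last first.
  have [q hq] := ux; have [_ mD pq qD q0] := hq.
  have [||R'|g [pg eg]] := @div_line _ 6 (lam k) q (Q :: Q' :: ym (lam k)) pq.
  - by rewrite /= uym !inE !in_ym (negbTE (elY kQ)) (negbTE (elY xQ')) !andbF orbF !andbT; apply/eqP.
  - by rewrite /= t4.
  - rewrite !inE in_ym => /or3P[/eqP->|/eqP->|/andP[/eqP lR RY]]; split=> //; apply: q0 => //.
    + exact: (offD k x).
    + exact: nesym.
    + exact: YX.
    + exact: (lamY _ x).
    + exact: mis.
  apply: (max_avoid (t4' k) _ xDx Q'X xQ' lQ').
  exists (fun R' => m R' * g R'); apply: (fund_usesq (DX _ ux) (usesq_fund hq)) => [|R']; first exact: pol_line.
  by rewrite eg; ring.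
have [W [lW WX]] := line_pt (lam k) X.
have [|R'|//|f [pf f0 fs _ [F FU fF]]] := @Wm m [:: Dz; Dx; Dk] [:: W; Dz].
- rewrite /= !inE negb_or andbT -andbA; apply/and3P; split; apply/eqP.
  + by apply: (offD z x) => //; [exact: neqs|exact: DX].
  + by apply: (offD z k) => //; [exact: neqs|exact: DX].
  + by apply: (offD x k) => //; [exact: neqs|exact: DX].
- by rewrite !inE => /or3P[]/eqP->.
have fz : f Dz = 0 by apply: fs; rewrite !inE eqxx orbT.
have fW : f W = 0 by apply: fs; rewrite !inE eqxx.
have f0' R' : R' \in X -> m R' != 0 -> R' <> Dx -> R' <> Dk -> f R' = 0.
  move=> RX mR Rx Rk; have [->//|/eqP Rz] := eqVneq R' Dz; apply: f0 => //.
  by rewrite !inE !negb_or; apply/and3P; split; apply/eqP.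
have [||R'|g [pg eg]] := @div_line _ 6 (lam k) f (W :: Q' :: ym (lam k)) pf.
- rewrite /= uym !inE !in_ym (negbTE (elY xQ')) !andbF !andbT.
  by apply/norP; split; [apply/eqP => e1; move: WX; rewrite e1 Q'X|apply/negP => /andP[_ /YX]; rewrite (negbTE WX)].
- by rewrite /= t4.
- rewrite !inE in_ym => /or3P[/eqP->|/eqP->|/andP[/eqP lR RY]] //; split=> //; apply: f0' => //.
  + exact: nesym.
  + by apply: (offD x k) => //; exact: neqs.
  + exact: YX.
  + exact: mis.
  + exact: (lamY _ x).
  + exact: (lamY _ k).
have elp a : exists Z, forall P', P' \in X -> el a P' = 0 -> m P' = 0 -> P' = Z.
  have [/hasP[Z ZX /andP[/eqP aZ /eqP mZ]]|/hasPn n] := boolP (has (fun Z => (el a Z == 0) && (m Z == 0)) X).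
    exists Z => P' PX' aP' mP'; apply/eqP; apply/negP => /negP/eqP PZ.
    by apply: (prim_not_el ux xDx (j := a)); exact: (line2 PZ mP' mZ aP' aZ).
  by exists O => P' PX' aP' mP'; have := n P' PX'; rewrite aP' mP' eqxx.
have [Zz hZz] := elp z; have [Zx hZx] := elp x.
have lk a P' : a != k -> P' \in X -> el a P' = 0 -> lam k P' = 0 -> a = x /\ P' = Q'.
  move=> ak PX' aP' lP'; case/or3P: (cover3 kx kz xz a) => /eqP e1.
  - by rewrite e1 eqxx in ak.
  - by split=> //; apply: (@max_el_uniq (lam k) x) => //; rewrite ?t4 // -e1.
  - by case/negP: nz; apply/hitP; exists P'; rewrite -e1.
have [|R' RX zR|h [ph eh]] := @divX 5 (el z) g [:: Zz] pg; first by rewrite el6.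
  rewrite inE => /eqP RZ; have mR : m R' != 0 by apply/negP => /eqP mR; apply: RZ; exact: hZz.
  have /eqP := f0' R' RX mR (offD z x _ _ (neqs xz) RX zR xDx) (offD z k _ _ (neqs kz) RX zR kDk).
  rewrite eg mulf_eq0 => /orP[/eqP lR|/eqP//].
  by have [e1 _] := lk z R' (neqs kz) RX zR lR; rewrite e1 eqxx in xz.
have [|R' RX kR|c2 [pc ec]] := @divX 4 (el k) h [:: Q; Dk] ph; first by rewrite el6.
  rewrite !inE negb_or => /andP[/eqP RQ /eqP RD].
  have mR : m R' != 0.
    apply/negP => /eqP mR; apply: RQ; apply/eqP; apply/negP => /negP/eqP RQ.
    by apply: (prim_not_el ux xDx (j := k)); exact: (line2 RQ mR mQ kR kQ).
  have /eqP := f0' R' RX mR (offD k x _ _ kx RX kR xDx) RD.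
  rewrite eg eh !mulf_eq0 (negbTE (eld' RX kR (neqs kz))) => /orP[/eqP lR|/eqP//].
  by case: RQ; apply: (@max_el_uniq (lam k) k) => //; rewrite t4.
have [|R' RX xR|c3 [_ ec3]] := @divX 3 (el x) c2 [:: Zx; Dx; Q'] pc; first by rewrite el6.
  rewrite !inE !negb_or => /and3P[/eqP RZ /eqP RD /eqP RQ'].
  have mR : m R' != 0 by apply/negP => /eqP mR; apply: RZ; exact: hZx.
  have /eqP := f0' R' RX mR RD (offD x k _ _ (neqs kx) RX xR kDk).
  rewrite eg eh ec !mulf_eq0 (negbTE (eld' RX xR (neqs xz))) (negbTE (eld' RX xR kx)) => /orP[/eqP lR|/eqP//].
  by case: RQ'; apply: (@max_el_uniq (lam k) x) => //; rewrite t4.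
move: fF; rewrite eg eh ec ec3; move: FU; rewrite !inE => /or3P[]/eqP->; rewrite ?zDz ?xDx ?kDk !(mul0r, mulr0) eqxx //.
Qed.

(** A line with one chosen user per [el i] is no [S j], so it has no inner node. On [el a] the nodes
    [P], [Q] and the four users of [S a] are all; hence its user there is [P] or [Q] and cannot be
    on both [lam k] and [o k] for another [k]. By [B_miss] the line then meets [lam b] and [lam d]
    in vertices, which agree, else [O] would be on a side; the vertex is [V a]. Two such lines
    coincide. *)
Lemma B_final a b d m m' : a != b -> a != d -> b != d -> size (U a) = 4%N -> size (U b) = 4%N ->
  hit (lam b) a -> ~~ hit (lam b) d -> hit (lam d) a -> ~~ hit (lam d) b ->
  m \in T -> m' \in T -> m <> m' -> (forall i, cu c m i = 1%N /\ cu c m' i = 1%N) -> False.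
Proof.
move=> ab ad bd sa sb hba hbd hda hdb mT mT' mm hm.
have key l : l \in T -> (forall i, cu c l i = 1%N) -> l (V a) = 0.
  move=> lT hl; have [lO0 lhit] := hT lT.
  have exD i : exists D, [/\ D \in X, el i D = 0 & c D = l].
    have : has (fun D => c D == l) (E i) by rewrite has_count; move: (hl i); rewrite /cu => ->.
    by case/hasP=> D; rewrite in_E => /andP[/eqP iD DX] /eqP; exists D.
  have [Da [DaX aDa ca]] := exD a; have [Db [DbX bDb cb]] := exD b; have [Dd [DdX dDd cd]] := exD d.
  have ua : usr l Da by rewrite -ca; case: (hc DaX aDa).
  have ub : usr l Db by rewrite -cb; case: (hc DbX bDb).
  have ud : usr l Dd by rewrite -cd; case: (hc DdX dDd).
  have lS i : l <> S i by move=> e1; have := Su i; rewrite -e1 hl.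
  have noL k : a != k -> lam k Da = 0 -> o k Da = 0 -> False.
    move=> ak lD oD; have [P [Q [uq sub oP lQ oQ]]] := U_data a.
    have DE : Da \in E a by rewrite in_E aDa eqxx.
    have [|_ eqE] := uniq_min_size uq sub; first by rewrite sE /= sa.
    have DO : Da <> O by move=> e1; have := elY aDa; rewrite e1 OY.
    have : Da \in P :: Q :: U a by rewrite eqE.
    rewrite !inE => /or3P[/eqP e1|/eqP e1|].
    - apply: (o_neq ak); apply: (@line2 _ _ _ Da O) => //; try by apply/eqP; rewrite oO.
      by rewrite e1.
    - have [h [ha hk _]] := third ak.
      have DV : Da <> V h by move=> e2; have := elY aDa; rewrite e2 VY.
      apply: (lam_neq ak); apply: (@line2 _ _ _ Da (V h)) => //; try by apply/eqP; rewrite lV neqs.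
      by rewrite e1.
    by rewrite mem_filter ca => /andP[/eqP/lS].
  have hits k z Dk Dz : k != a -> k != z -> a != z -> usr l Dk -> usr l Dz -> el k Dk = 0 -> el z Dz = 0 ->
      hit (lam k) a -> ~~ hit (lam k) z -> exists P, [/\ P \in Y, lam k P = 0 & l P = 0].
    move=> ka kz az uk uz kD zD h1 h2.
    have [/hasP[P PY /andP[/eqP lP /eqP mP]]|/hasPn n] := boolP (has (fun P => (lam k P == 0) && (l P == 0)) Y); first by exists P.
    have [|h3 h4] := B_miss lO0 ka kz az _ uk ua uz kD aDa zD h1 h2.
      by move=> P PY lP; have := n P PY; rewrite lP eqxx.
    by case: (noL k (neqs ka) h3 h4).
  have noe i j : i != j -> l (e i j) != 0.
    move=> ij; apply/negP => /eqP le0; apply: (lS j).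
    apply: (hT1 (P := e i j) lT (ST j)) => //; first exact: YX (eY ij).
      by move=> e1; have := le i ij; rewrite e1 lO eqxx.
    by apply/eqP; rewrite So oe // eqxx.
  have [P [PY lP mP]] := hits b d Db Dd (neqs ab) bd ad ub ud bDb dDd hba hbd.
  have [P' [PY' lP' mP']] := hits d b Dd Db (neqs ad) (neqs bd) ab ud ub dDd bDb hda hdb.
  have V1 W k : W \in Y -> lam k W = 0 -> l W = 0 -> exists h, W = V h /\ h != k.
    move=> WY; case/tri_Y: WY => [->|[h ->]|[i [j [ij ->]]]] => /eqP; rewrite ?lO ?lV //.
      by move=> kh _; exists h; split=> //; exact: neqs.
    by move=> _ /eqP h; have := noe i j ij; rewrite h.
  have [h [eP hb]] := V1 P b PY lP mP; have [h' [eP' hd]] := V1 P' d PY' lP' mP'.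
  suff : h = a by move=> <-; rewrite -eP.
  have hh : h = h'.
    apply/eqP; apply/negP => /negP hh; have [i [ih ih' _]] := third hh.
    have : eql l (lam i).
      apply: (@line2 _ l (lam i) P P') => //; try by apply/eqP; rewrite ?eP ?eP' lV.
      by rewrite eP eP' => e1; have := lV h h; rewrite e1 lV eqxx hh.
    by move/(_ O); rewrite lO0 eqxx lO.
  by case/or3P: (cover3 ab ad bd h) => /eqP // e1; [rewrite e1 eqxx in hb|rewrite -hh e1 eqxx in hd].
apply: mm; apply: (hT1 (P := V a) mT mT').
- exact: YX (VY a).
- by move=> e1; have [i ia] := other a; have := lO i; rewrite -e1 lV ia.
- by apply: key => // i; case: (hm i).
- by apply: key => // i; case: (hm i).
Qed.

(** Only the nine truth values of [hit (lam i) j] remain: each [lam i] meets its own [el i], none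
    meets all three, and [alt_pair] holds wherever there are four users. Four users everywhere are
    inconsistent; with one exception, [B_final] excludes the surviving patterns. *)
Lemma case3_lines k : (forall i, i != k -> cu c (S i) i = 4%N) ->
  (cu c (S k) k = 4%N \/ exists m m', [/\ m \in T, m' \in T, m <> m' & forall i, cu c m i = 1%N /\ cu c m' i = 1%N]) -> False.
Proof.
move=> h4 hk; have [a ak] := other k; have [b [ba bk _]] := third ak.
have ab := neqs ba; have ka := neqs ak; have kb := neqs bk.
have sU i : size (U i) = cu c (S i) i by rewrite size_filter.
have ha := alt_pair ab ak bk (etrans (sU a) (h4 a ak)).
have hb := alt_pair ba bk ak (etrans (sU b) (h4 b bk)).
have sa := hit_self a; have sb := hit_self b; have sk := hit_self k.
have no i : ~~ [&& hit (lam i) a, hit (lam i) b & hit (lam i) k].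
  apply/negP => /and3P[h1 h2 h3]; apply: (max_hit3 (t4 i)).
  - by case/or3P: (cover3 ab ak bk o0) => /eqP->.
  - by case/or3P: (cover3 ab ak bk o1) => /eqP->.
  - by case/or3P: (cover3 ab ak bk o2) => /eqP->.
have na := no a; have nb := no b; have nk := no k; clear no.
case: hk => [hk|[m [m' [mT mT' mm hm]]]].
  have hk' := alt_pair ka kb ab (etrans (sU k) hk).
  move: ha hb hk' sa sb sk na nb nk.
  by case: (hit (lam a) a); case: (hit (lam a) b); case: (hit (lam a) k); case: (hit (lam b) a); case: (hit (lam b) b);
    case: (hit (lam b) k); case: (hit (lam k) a); case: (hit (lam k) b); case: (hit (lam k) k).
have fa := @B_final a b k m m' ab ak bk (etrans (sU a) (h4 a ak)) (etrans (sU b) (h4 b bk)).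
have fb := @B_final b a k m m' ba bk ak (etrans (sU b) (h4 b bk)) (etrans (sU a) (h4 a ak)).
move: ha hb sa sb sk na nb nk fa fb.
case: (hit (lam a) a); case: (hit (lam a) b); case: (hit (lam a) k); case: (hit (lam b) a); case: (hit (lam b) b);
  case: (hit (lam b) k); case: (hit (lam k) a); case: (hit (lam k) b); case: (hit (lam k) k) => //= _ _ _ _ _ _ _ _ fa fb;
  by [apply: fa|apply: fb].
Qed.

End Case3Lines.

End Case3.

Lemma tridata_perm lam V O o e (p : 'I_3 -> 'I_3) : injective p -> tridata lam V O o e ->
  tridata (lam \o p) (V \o p) O (o \o p) (fun i j => e (p i) (p j)).
Proof.
move=> ip [h1 h2 [h3 h3'] h4 [h5 h6]].
have pe i j : (p i == p j) = (i == j) := inj_eq ip i j.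
split=> //=.
- by move=> k; have [hY hV] := h2 (p k); split=> // i; rewrite hV pe.
- by move=> i j ij; have [|hY hL] := h4 (p i) (p j); [rewrite pe|split=> // h; rewrite hL pe].
split.
- by move=> k; have [hO hV] := h5 (p k); split=> // h; exact: hV.
- by move=> i j ij h; rewrite h6 ?pe.
Qed.

Lemma three_max_false lam V O o e : tridata lam V O o e -> False.
Proof.
move=> T3; have OY' := OY T3.
have [T [c [d [uT hc hT hT1 [s5 sd h6]]]]] := count_at OY'.
have users m i : uniq [seq D <- E i | c D == m] /\ forall D, D \in [seq D <- E i | c D == m] -> usr m D /\ el i D = 0.
  split; first exact: filter_uniq (uE i).
  move=> D; rewrite mem_filter in_E => /and3P[/eqP cD /eqP iD DX]; split=> //.
  by have [u _] := hc D i DX iD; rewrite -cD.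
have hu m i : m \in T -> (2 <= cu c m i)%N -> (cu c m i <= 4)%N /\ forall j, j != i -> cu c m j = 0%N.
  move=> mT h2; have [mO mh] := hT m mT; have [h mis] := thru_miss T3 mO.
  have [uU hU] := users m i.
  have [hs _ hs4] := typed_S (t4' T3 h) mis uU hU (eq_rect _ (fun n => (2 <= n)%N) h2 _ (esym (size_filter _ _))) (mh i).
  split; first by rewrite /cu -size_filter.
  move=> j ji; apply/eqP; rewrite -leqn0 leqNgt -has_count; apply/hasPn => D; rewrite in_E => /andP[/eqP jD DX].
  apply/negP => /eqP cD; have [u _] := hc D j DX jD; rewrite cD in u.
  by rewrite (hs D j u jD) eqxx in ji.
have [S [hS [k [k4 kB]]]] := num_case3 uT s5 sd h6 hu.
have exp i : exists j, eql (S i) (o j).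
  have [ST Su] := hS i; have [mO mh] := hT _ ST; have [uU hU] := users (S i) i.
  by apply: (S_line T3 mO (mh i) uU hU); rewrite size_filter.
have [p hp] := @seq_choice _ _ o0 (enum 'I_3) _ (fun i _ => exp i).
have {}hp i := hp i (mem_enum _ i).
(* Two equal lines among the [S i] would have users on two different [el i], against [typed_S]. So
   the [o k] can be renamed to match the [el i]. *)
have ip : injective p.
  move=> i j eij; apply/eqP; apply/negP => /negP ij.
  have eS : eql (S j) (S i) by apply: eql_trans (hp j) _; rewrite -eij; exact: eql_sym.
  have [ST Su] := hS i; have [_ mh] := hT _ ST; have [mO _] := hT _ ST; have [h mis] := thru_miss T3 mO; have [uU hU] := users (S i) i.
  have [hs _ _] := typed_S (t4' T3 h) mis uU hU (leq_trans (isT : (2 <= 3)%N) (eq_rect _ (fun n => (3 <= n)%N) Su _ (esym (size_filter _ _)))) (mh i).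
  have : has (fun D => c D == S j) (E j) by rewrite has_count; apply: leq_trans (hS j).2.
  case/hasP=> D; rewrite in_E => /andP[/eqP jD DX] /eqP cD; have [u _] := hc D j DX jD; rewrite cD in u.
  by rewrite (hs D j (eql_usr eS u) jD) eqxx in ij.
have T3' := tridata_perm ip T3.
apply: (case3_lines T3' hc hT hT1 (fun i => (hS i).1) (fun i => (hS i).2) hp k4 kB).
Qed.

(** * Four lines with four nodes in [Y] *)

Section Case4.
Variables (lam : 'I_4 -> line) (W : 'I_4 -> 'I_4 -> pt).
Hypothesis Q4 : quad lam W.

Lemma q4 x : size (ym (lam x)) = 4%N. Proof. by case: Q4. Qed.
Lemma q4' x : (4 <= size (ym (lam x)))%N. Proof. by rewrite q4. Qed.
Lemma WY x y : W x y \in Y. Proof. by case: Q4. Qed.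
Lemma Wsym x y : W x y = W y x. Proof. by case: Q4. Qed.
Lemma lW h x y : (lam h (W x y) == 0) = (h == x) || (h == y). Proof. by case: Q4. Qed.

Lemma lW0 h x : lam h (W h x) = 0. Proof. by apply/eqP; rewrite lW eqxx. Qed.
Lemma lW1 h x : lam h (W x h) = 0. Proof. by apply/eqP; rewrite lW eqxx orbT. Qed.

Lemma W_inj x y z : W x y = W x z -> y = z.
Proof.
move=> e; have h1 : (y == x) || (y == z) by rewrite -lW -e lW eqxx orbT.
have h2 : (z == x) || (z == y) by rewrite -lW e lW eqxx orbT.
by case/orP: h1 => /eqP // h1; case/orP: h2 => /eqP // ->.
Qed.

Lemma W_neq (s t p q : 'I_4) : s \notin [:: p; q] -> W s t <> W p q.
Proof. by move=> h e; have := lW s s t; rewrite e lW eqxx; move: h; rewrite !inE => /negbTE->. Qed.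

Lemma disj m x y z : ~ eql m (lam x) -> m (W x y) = 0 -> m (W x z) = 0 -> y = z.
Proof.
move=> ne my mz; apply/eqP; apply/negP => /negP yz; apply: ne.
apply: (@line2 _ _ _ (W x y) (W x z)) => //; rewrite ?lW0 //.
by move/W_inj => e; rewrite e eqxx in yz.
Qed.

Lemma lam_ne x y : x != y -> ~ eql (lam x) (lam y).
Proof. by move=> xy /(_ (W x x)); rewrite !lW eqxx orbb eq_sym (negbTE xy). Qed.

Lemma tri_ne m x : (forall i, hit m i) -> ~ eql m (lam x).
Proof.
move=> hm e; have h i : hit (lam x) i.
  by have /hitP[P [PX iP mP]] := hm i; apply/hitP; exists P; split=> //; apply/eqP; rewrite -e mP.
exact: (max_hit3 (q4 x)).
Qed.

Lemma lprod3 (l1 l2 l3 : line) P : (lprod [:: l1; l2; l3] P == 0) = [|| l1 P == 0, l2 P == 0 | l3 P == 0].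
Proof. by rewrite lprod_eq0 /= orbF. Qed.

Lemma lam_meet x y N : x != y -> N \notin Y -> lam x N = 0 -> lam y N = 0 -> False.
Proof.
move=> xy NY xN yN; apply: (lam_ne xy); apply: (@line2 _ _ _ N (W x y)); rewrite ?lW0 ?lW1 //.
by move=> e; rewrite e WY in NY.
Qed.

Lemma lA_meet l x N : ~ eql l (lam x) -> N \notin Y -> l (W x x) = 0 -> l N = 0 -> lam x N = 0 -> False.
Proof.
move=> ne NY lx lN xN; apply: ne; apply: (@line2 _ _ _ N (W x x)); rewrite ?lW0 //.
by move=> e; rewrite e WY in NY.
Qed.

Lemma sub3 m i U : uniq U -> (forall D, D \in U -> usr m D /\ el i D = 0) -> (3 <= size U)%N -> hit m i ->
  exists U' N1 N2, [/\ uniq U' /\ size U' = 3%N, forall D, D \in U' -> usr m D /\ el i D = 0, N1 <> N2 &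
   forall N, N \in [:: N1; N2] -> [/\ N \in X, el i N = 0, m N != 0 & N \notin U']].
Proof.
move=> uU hU s3 /hitP[P [PX iP mP]]; pose U' := take 3 U.
have uU' : uniq U' by rewrite take_uniq.
have sU' : size U' = 3%N by rewrite size_takel.
have hU' D : D \in U' -> usr m D /\ el i D = 0 by move/mem_take/hU.
have uP : uniq (P :: U') by rewrite /= uU' andbT; apply/negP => /hU'[/usr_off]; rewrite mP eqxx.
have sPU : {subset P :: U' <= E i}.
  by move=> S; rewrite inE in_E => /orP[/eqP->|/hU'[/usr_X SX ->]]; rewrite ?iP ?eqxx // SX.
have h2 : (2 <= count (fun S => S \notin P :: U') (E i))%N.
  have := count_predC (fun S => S \in P :: U') (E i); rewrite sE.
  have -> : count (fun S => S \in P :: U') (E i) = 4%N.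
    rewrite -size_filter -[4%N]/(1 + 3)%N -sU' -[(1 + _)%N]/(size (P :: U')); apply/eqP.
    rewrite eqn_leq !uniq_leq_size ?filter_uniq ?uE //; first by move=> S /[dup] /sPU SE SP; rewrite mem_filter SE SP.
    by move=> S; rewrite mem_filter => /andP[].
  by rewrite /predC /=; set n := count _ _; lia.
have [t [ut st ht]] := take_count (uE i) h2.
have [N1 [N2 [N1t N2t N12]]] := two_of ut (eq_leq (esym st)).
have D0 : exists2 D, usr m D & el i D = 0 by case: (U') sU' hU' => // D s _ /(_ D (mem_head _ _))[? ?]; exists D.
have [D uD iD] := D0.
exists U', N1, N2; split=> // N NI; have : N \in t by move: NI; rewrite !inE => /orP[]/eqP->.
case/ht; rewrite in_E inE negb_or => /andP[/eqP iN NX] /andP[/eqP NP NU]; split=> //.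
by apply/negP => /eqP mN; apply: NP; exact: (meet_uniq uD iD iN mN iP mP).
Qed.

Section Four.
Variables a b c d : 'I_4.
Hypothesis u4 : uniq [:: a; b; c; d].

Lemma neqE : (((a == b) = false) * ((a == c) = false) * ((a == d) = false) * ((b == c) = false) * ((b == d) = false) * ((c == d) = false) *
  ((b == a) = false) * ((c == a) = false) * ((d == a) = false) * ((c == b) = false) * ((d == b) = false) * ((d == c) = false))%type.
Proof.
move: u4; rewrite /= !inE !negb_or -!andbA => /and5P[h1 h2 h3 h4 /and3P[h5 h6 _]].
by rewrite !(eq_sym b) !(eq_sym c) !(eq_sym d) (negbTE h1) (negbTE h2) (negbTE h3) (negbTE h4) (negbTE h5) (negbTE h6).
Qed.

Lemma cover4 x : [|| x == a, x == b, x == c | x == d].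
Proof.
have [|_ e] := uniq_min_size u4 (fun y _ => mem_enum 'I_4 y); first by rewrite size_enum_ord.
by have := mem_enum 'I_4 x; rewrite -e !inE.
Qed.

Lemma quad_Y : Y =i [:: W a b; W a c; W a d; W b c; W b d; W c d; W a a; W b b; W c c; W d d].
Proof.
set s := (X in _ =i X).
pose sig S := [:: lam a S == 0; lam b S == 0; lam c S == 0; lam d S == 0].
have sW x y : sig (W x y) = [:: (a == x) || (a == y); (b == x) || (b == y); (c == x) || (c == y); (d == x) || (d == y)] by rewrite /sig !lW.
have us : uniq s by apply: (map_uniq (f := sig)); rewrite /s [map _ _]/= !sW !eqxx !neqE.
have sub : {subset s <= Y}.
  by move=> S; rewrite !inE => /or4P[/eqP->|/eqP->|/eqP->|/or4P[/eqP->|/eqP->|/eqP->|/or4P[]/eqP->]]; rewrite WY.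
have [|_ e] := uniq_min_size us sub; first by rewrite sY.
by move=> P; rewrite e.
Qed.

(** Any other node of [Y] lies on [lam a] or [lam b], where [m] already has [W a b]. *)
Lemma on_ab m P : (forall x, ~ eql m (lam x)) -> m (W a b) = 0 -> P \in Y -> m P = 0 ->
  [\/ P = W a b, P = W c d, P = W c c | P = W d d].
Proof.
move=> ne mab; have mba : m (W b a) = 0 by rewrite Wsym.
rewrite quad_Y !inE => /or4P[/eqP->|/eqP->|/eqP->|/or4P[/eqP->|/eqP->|/eqP->|/or4P[]/eqP->]];
  do ?[by constructor 1|by constructor 2|by constructor 3|by constructor 4] => mP; exfalso.
- by have := disj (ne a) mab mP => /eqP; rewrite neqE.
- by have := disj (ne a) mab mP => /eqP; rewrite neqE.
- by have := disj (ne b) mba mP => /eqP; rewrite neqE.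
- by have := disj (ne b) mba mP => /eqP; rewrite neqE.
- by have := disj (ne a) mab mP => /eqP; rewrite neqE.
- by have := disj (ne b) mba mP => /eqP; rewrite neqE.
Qed.

Lemma lab_off l : l (W a a) = 0 -> l (W b b) = 0 -> l (W a b) != 0.
Proof.
move=> la lb; apply/negP => /eqP lab; have : eql l (lam a).
  apply: (@line2 _ _ _ (W a a) (W a b)) => //; rewrite ?lW0 //.
  by move/W_inj/eqP; rewrite neqE.
by move/(_ (W b b)); rewrite lb eqxx lW !neqE.
Qed.

Lemma lab_lam l x : l (W a a) = 0 -> l (W b b) = 0 -> ~ eql l (lam x).
Proof.
by move=> la lb e; have := e (W a a); have := e (W b b); rewrite la lb eqxx !lW !orbb => /esym/eqP-> /esym/eqP/eqP; rewrite neqE.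
Qed.

(** [lam c] and [lam d] contain all nodes but [W a b], [W a a] and [W b b]; the line through the
    last two completes the product. *)
Lemma yf_ab l : l (W a a) = 0 -> l (W b b) = 0 -> yfund (W a b) (lprod [:: lam c; lam d; l]).
Proof.
move=> la lb; split; first exact: pol_lprod.
  by rewrite lprod3 !lW !neqE /=; exact: lab_off.
move=> P PY Pn; apply/eqP; rewrite lprod3; move: PY Pn.
rewrite quad_Y !inE => /or4P[/eqP->|/eqP->|/eqP->|/or4P[/eqP->|/eqP->|/eqP->|/or4P[]/eqP->]] //;
  by rewrite ?lW ?la ?lb ?eqxx ?orbT.
Qed.

Lemma yf_cc : yfund (W c c) (lprod [:: lam a; lam b; lam d]).
Proof.
split; [exact: pol_lprod|by rewrite lprod3 !lW !neqE|].
move=> P PY Pn; apply/eqP; rewrite lprod3; move: PY Pn.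
rewrite quad_Y !inE => /or4P[/eqP->|/eqP->|/eqP->|/or4P[/eqP->|/eqP->|/eqP->|/or4P[]/eqP->]] //;
  by rewrite ?lW ?eqxx ?orbT.
Qed.

(** Of the nine pairs of factors, eight meet in a node of [Y] and nowhere else. *)
Lemma common_zero l l' N : N \notin Y -> l (W a a) = 0 -> l (W b b) = 0 -> l' (W c c) = 0 -> l' (W d d) = 0 ->
  (forall x, ~ eql l' (lam x)) ->
  lprod [:: lam c; lam d; l] N = 0 -> lprod [:: lam a; lam b; l'] N = 0 -> l N = 0 /\ l' N = 0.
Proof.
move=> NY la lb lc ld ne' /eqP; rewrite lprod3 => h /eqP; rewrite lprod3 => h'.
case/or3P: h h' => /eqP h /or3P[]/eqP h' //.
- by case: (@lam_meet c a N) => //; rewrite neqE.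
- by case: (@lam_meet c b N) => //; rewrite neqE.
- by case: (@lA_meet l' c N).
- by case: (@lam_meet d a N) => //; rewrite neqE.
- by case: (@lam_meet d b N) => //; rewrite neqE.
- by case: (@lA_meet l' d N).
- by case: (@lA_meet l a N) => //; exact: lab_lam.
- by case: (@lA_meet l b N) => //; exact: lab_lam.
Qed.

Hypothesis fourth_nodes_not_collinear : forall l, ~ (forall x, l (W x x) = 0).

Lemma two_common l l' N1 N2 : l (W a a) = 0 -> l (W b b) = 0 -> l' (W c c) = 0 -> l' (W d d) = 0 -> N1 <> N2 ->
  l N1 = 0 -> l' N1 = 0 -> l N2 = 0 -> l' N2 = 0 -> False.
Proof.
move=> la lb lc ld N12 l1 l1' l2 l2'; have e := line2 N12 l1 l2 l1' l2'.
by apply: (fourth_nodes_not_collinear (l := l)) => x; case/or4P: (cover4 x) => /eqP-> //; apply/eqP; rewrite e ?lc ?ld.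
Qed.

(** With three users, [base] makes the fundamental cubics of [W a b] and [W c d] vanish at two
    further nodes of [el i]. These lie on both lines of [common_zero], which therefore coincide and
    contain all four fourth nodes. *)
Lemma pp_le2 m i U : (forall x, ~ eql m (lam x)) -> m (W a b) = 0 -> m (W c d) = 0 ->
  uniq U -> (forall D, D \in U -> usr m D /\ el i D = 0) -> hit m i -> (size U <= 2)%N.
Proof.
move=> ne mab mcd uU hU hm; rewrite leqNgt; apply/negP => s3.
have [U' [N1 [N2 [[uU' sU'] hU' N12 hN]]]] := sub3 uU hU s3 hm.
have [l [la lb]] := line_thru (W a a) (W b b); have [l' [lc ld]] := line_thru (W c c) (W d d).
have mdc : m (W d c) = 0 by rewrite Wsym.
have y2 : (size (ym m) < size U')%N.
  rewrite sU' -[3%N]/(size [:: W a b; W c d]).+1 ltnS; apply: uniq_leq_size (uym m) _ => P; rewrite in_ym => /andP[/eqP mP PY].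
  have [->|->|e|e] := on_ab ne mab PY mP; rewrite ?inE ?eqxx ?orbT //.
    by have := disj (ne c) mcd (z := c); rewrite -e => /(_ mP)/eqP; rewrite neqE.
  by have := disj (ne d) mdc (z := d); rewrite -e => /(_ mP)/eqP; rewrite neqE.
have ne' x : ~ eql l' (lam x).
  by move=> e; have := e (W c c); have := e (W d d); rewrite lc ld eqxx !lW !orbb => /esym/eqP-> /esym/eqP/eqP; rewrite neqE.
have f2 : yfund (W c d) (lprod [:: lam a; lam b; l']).
  split; first exact: pol_lprod.
    rewrite lprod3 !lW !neqE /=; apply/negP => /eqP lcd.
    apply: (ne' c); apply: (@line2 _ _ _ (W c c) (W c d)) => //; rewrite ?lW0 //.
    by move/W_inj/eqP; rewrite neqE.
  move=> P PY Pn; apply/eqP; rewrite lprod3; move: PY Pn.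
  rewrite quad_Y !inE => /or4P[/eqP->|/eqP->|/eqP->|/or4P[/eqP->|/eqP->|/eqP->|/or4P[]/eqP->]] //;
  by rewrite ?lW ?lc ?ld ?eqxx ?orbT.
have z N : N \in [:: N1; N2] -> l N = 0 /\ l' N = 0.
  move/hN=> [NX iN mN NU]; apply: common_zero => //; first exact: elY iN.
    exact: (base uU' hU' y2 (WY a b) mab (yf_ab la lb) NX iN mN NU).
  exact: (base uU' hU' y2 (WY c d) mcd f2 NX iN mN NU).
have [z1 z1'] := z N1 (mem_head _ _); have [|z2 z2'] := z N2; first by rewrite !inE eqxx orbT.
exact: (two_common la lb lc ld N12).
Qed.

End Four.

Lemma ord4_dist : exists a b c d : 'I_4, uniq [:: a; b; c; d].
Proof. by exists ord0, (Ordinal (isT : (1 < 4)%N)), (Ordinal (isT : (2 < 4)%N)), ord_max. Qed.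

Lemma users_c (c : pt -> line) y m i : (forall D i, D \in X -> el i D = 0 -> usr (c D) D /\ c D y = 0) ->
  uniq [seq D <- E i | c D == m] /\ forall D, D \in [seq D <- E i | c D == m] -> usr m D /\ el i D = 0.
Proof.
move=> hc; split; first exact: filter_uniq (uE i).
move=> D; rewrite mem_filter in_E => /and3P[/eqP cD /eqP iD DX]; split=> //.
by have [u _] := hc D i DX iD; rewrite -cD.
Qed.

Lemma typed_cu (c : pt -> line) y m la i : (forall D i, D \in X -> el i D = 0 -> usr (c D) D /\ c D y = 0) ->
  (4 <= size (ym la))%N -> (forall P, P \in Y -> la P = 0 -> m P != 0) -> hit m i -> (2 <= cu c m i)%N ->
  forall j, j != i -> cu c m j = 0%N.
Proof.
move=> hc la4 mis hm h2 j ji; have [uU hU] := users_c m i hc.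
have [hs _ _] := typed_S la4 mis uU hU (eq_rect _ (fun n => (2 <= n)%N) h2 _ (esym (size_filter _ _))) hm.
apply/eqP; rewrite -leqn0 leqNgt -has_count; apply/hasPn => D; rewrite in_E => /andP[/eqP jD DX].
apply/negP => /eqP cD; have [u _] := hc D j DX jD; rewrite cD in u.
by rewrite (hs D j u jD) eqxx in ji.
Qed.

(** Such a line would be a fifth one with four nodes. Every line counted at [W a b] then has at most
    two nodes of [Y] and misses one of the five lines; if it has two users on [el i], it has at most
    three there and none elsewhere, too few by [num_case4_no]. *)
Lemma fourth_nodes_not_collinear l : ~ (forall x, l (W x x) = 0).
Proof.
move=> hl; have inj : injective (fun x => W x x).
  by move=> x y e; have := lW x x x; rewrite e lW !orbb eqxx => /eqP.
have [a [b [c [d u4]]]] := ord4_dist; have nE := neqE u4.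
have l4 : (4 <= size (ym l))%N.
  rewrite -[4%N]/(size [:: W a a; W b b; W c c; W d d]); apply: uniq_leq_size.
    by rewrite -[X in uniq X]/(map (fun x => W x x) [:: a; b; c; d]) map_inj_uniq.
  by move=> P; rewrite !inE => /or4P[]/eqP->; rewrite in_ym hl eqxx WY.
have lne x : ~ eql l (lam x).
  move=> e; have h y : y = x by have := e (W y y); rewrite hl eqxx lW orbb => /esym/eqP.
  by have := nE; rewrite (h a) (h b) eqxx => -[[[[[[[[[[[]]]]]]]]]]].
have [T [cc [dd [uT hc hT hT1 [s5 sd h6]]]]] := count_at (WY a b).
apply: (num_case4_no (u := fun m i => cu cc m i) s5 sd h6) => m i mT h2.
have [mab hm] := hT m mT; have ne x : ~ eql m (lam x) := @tri_ne m x hm.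
have nab : ~ eql m l.
  move=> e; have ma : m (W a a) = 0 by apply/eqP; rewrite e hl.
  by have := disj (ne a) mab ma => /eqP; rewrite nE.
have [uU hU] := users_c m i hc.
have mis : exists la, (4 <= size (ym la))%N /\ forall P, P \in Y -> la P = 0 -> m P != 0.
  have [mcd|mcd] := eqVneq (m (W c d)) 0.
    exists l; split=> // P PY lP; apply/negP => /eqP mP.
    have mdc : m (W d c) = 0 by rewrite Wsym.
    have mba : m (W b a) = 0 by rewrite Wsym.
    have [e|e|e|e] := on_ab u4 ne mab PY mP.
    - apply: (lne a); apply: (@line2 _ l (lam a) (W a b) (W a a)) => //; rewrite ?lW0 -?e //.
      by rewrite e => /W_inj/eqP; rewrite nE.
    - apply: (lne c); apply: (@line2 _ l (lam c) (W c d) (W c c)) => //; rewrite ?lW0 -?e //.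
      by rewrite e => /W_inj/eqP; rewrite nE.
    - by have := disj (ne c) mcd (z := c); rewrite -e => /(_ mP)/eqP; rewrite nE.
    - by have := disj (ne d) mdc (z := d); rewrite -e => /(_ mP)/eqP; rewrite nE.
  have mlam x : x \in [:: c; d] -> m (W x x) != 0 -> exists la, (4 <= size (ym la))%N /\ forall P, P \in Y -> la P = 0 -> m P != 0.
    move=> xI mx; exists (lam x); split; first by rewrite q4.
    move=> P PY lP; apply/negP => /eqP mP; move: lP.
    have [e|e|e|e] := on_ab u4 ne mab PY mP; rewrite e => /eqP; rewrite lW.
    - by move: xI; rewrite !inE => /orP[]/eqP->; rewrite !nE.
    - by rewrite -e mP eqxx in mcd.
    - by rewrite orbb => /eqP xc; rewrite xc -e mP eqxx in mx.
    - by rewrite orbb => /eqP xc; rewrite xc -e mP eqxx in mx.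
  have [mc|mc] := eqVneq (m (W c c)) 0; last by apply: (mlam c); rewrite ?mem_head.
  have [md|md] := eqVneq (m (W d d)) 0; last by apply: (mlam d); rewrite // !inE eqxx orbT.
  case: nab; apply: (line2 _ mc md (hl c) (hl d)) => e.
  by have := lW c c c; rewrite {1}e !lW eqxx nE.
have [la [la4 mis']] := mis.
split; last by move=> j; exact: (typed_cu hc la4 mis' (hm i) h2).
have := ybound uU hU; rewrite size_filter => h; apply: leq_trans h _; rewrite ltnS.
have [mcd|mcd] := eqVneq (m (W c d)) 0.
  rewrite -[2%N]/(size [:: W a b; W c d]); apply: uniq_leq_size (uym m) _ => P; rewrite in_ym => /andP[/eqP mP PY].
  have mdc : m (W d c) = 0 by rewrite Wsym.
  have [->|->|e|e] := on_ab u4 ne mab PY mP; rewrite ?inE ?eqxx ?orbT //.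
    by have := disj (ne c) mcd (z := c); rewrite -e => /(_ mP)/eqP; rewrite nE.
  by have := disj (ne d) mdc (z := d); rewrite -e => /(_ mP)/eqP; rewrite nE.
have [mc|mc] := eqVneq (m (W c c)) 0.
  rewrite -[2%N]/(size [:: W a b; W c c]); apply: uniq_leq_size (uym m) _ => P; rewrite in_ym => /andP[/eqP mP PY].
  have [->|e|->|e] := on_ab u4 ne mab PY mP; rewrite ?inE ?eqxx ?orbT //.
    by rewrite -e mP eqxx in mcd.
  case: nab; have md : m (W d d) = 0 by rewrite -e. apply: (line2 _ mc md (hl c) (hl d)) => e'.
  by have := lW c c c; rewrite {1}e' !lW eqxx nE.
rewrite -[2%N]/(size [:: W a b; W d d]); apply: uniq_leq_size (uym m) _ => P; rewrite in_ym => /andP[/eqP mP PY].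
have [->|e|e|->] := on_ab u4 ne mab PY mP; rewrite ?inE ?eqxx ?orbT //.
  by rewrite -e mP eqxx in mcd.
by rewrite -e mP eqxx in mc.
Qed.

Section PPcount.
Variables a b c d : 'I_4.
Hypothesis u4 : uniq [:: a; b; c; d].
Hypothesis nbad : forall l, l (W c c) = 0 -> l (W d d) = 0 -> l (W a b) <> 0.

(** If [m] contains [W h h], three users would make the fundamental cubics of [W a b] and [W h h]
    vanish at two more nodes of [el i]. Off [Y] these cubics have only [lam k] in common, which
    meets [el i] once. *)
Lemma one_le2 m i U (h k : 'I_4) : (h, k) \in [:: (c, d); (d, c)] -> (forall x, ~ eql m (lam x)) -> m (W a b) = 0 -> m (W c d) != 0 ->
  m (W k k) != 0 -> uniq U -> (forall D, D \in U -> usr m D /\ el i D = 0) -> hit m i -> (size U <= 2)%N.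
Proof.
move=> hk ne mab mcd mk uU hU hm; have nE := neqE u4.
have u4' : uniq [:: a; b; h; k].
  by move: hk; rewrite !inE => /orP[]/eqP[-> ->] //; rewrite /= !inE !nE.
have mhk : m (W h k) != 0 by move: hk; rewrite !inE => /orP[]/eqP[-> ->] //; rewrite Wsym.
have nE' := neqE u4'.
have sub P : P \in Y -> m P = 0 -> P \in [:: W a b; W h h].
  move=> PY mP; have [->|e|->|e] := on_ab u4' ne mab PY mP; rewrite ?inE ?eqxx ?orbT //.
    by rewrite -e mP eqxx in mhk.
  by rewrite -e mP eqxx in mk.
have y2 : (size (ym m) <= 2)%N.
  by rewrite -[2%N]/(size [:: W a b; W h h]); apply: uniq_leq_size (uym m) _ => P; rewrite in_ym => /andP[/eqP mP PY]; exact: sub.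
have [mh|mh] := eqVneq (m (W h h)) 0; last first.
  apply: leq_trans (ybound uU hU) _; rewrite ltnS.
  rewrite -[1%N]/(size [:: W a b]); apply: uniq_leq_size (uym m) _ => P; rewrite in_ym => /andP[/eqP mP PY].
  have := sub P PY mP; rewrite !inE => /orP[->//|/eqP e].
  by rewrite -e mP eqxx in mh.
rewrite leqNgt; apply/negP => s3.
have [U' [N1 [N2 [[uU' sU'] hU' N12 hN]]]] := sub3 uU hU s3 hm.
have mis P : P \in Y -> lam k P = 0 -> m P != 0.
  move=> PY lP; apply/negP => /eqP mP; move/eqP: lP; have := sub P PY mP.
  by rewrite !inE => /orP[]/eqP->; rewrite lW !nE'.
have [l [l1 l2]] := line_thru (W a a) (W b b).
have ys : (size (ym m) < size U')%N by rewrite sU'.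
have z N : N \in [:: N1; N2] -> lam k N = 0.
  move=> NI; have [NX iN mN NU] := hN N NI; have NY := elY iN.
  have z1 := base uU' hU' ys (WY a b) mab (yf_ab u4' l1 l2) NX iN mN NU.
  have z2 := base uU' hU' ys (WY h h) mh (yf_cc u4') NX iN mN NU.
  move/eqP: z1; rewrite lprod3 => z1; move/eqP: z2; rewrite lprod3 => z2.
  case/or3P: z2 z1 => /eqP // z2 /or3P[]/eqP // z1.
  - by case: (@lam_meet h a N) => //; rewrite nE'.
  - by case: (@lA_meet l a N) => //; exact: (lab_lam u4').
  - by case: (@lam_meet h b N) => //; rewrite nE'.
  - by case: (@lA_meet l b N) => //; exact: (lab_lam u4').
have [N1X iN1 _ _] := hN N1 (mem_head _ _).
have [|_ iN2 _ _] := hN N2; first by rewrite !inE eqxx orbT.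
apply: N12; apply: (@max_el_uniq (lam k) i) => //; rewrite ?q4 //; apply: z; rewrite !inE eqxx ?orbT //.
Qed.

(** In the count at [W a b] the exempt line is the one through [W c d], which meets all four [lam]
    in nodes of [Y]; [nbad] provides every other line with a [lam k] that it misses. *)
Lemma pp_count : exists m i j k D1 D1' D2 D2' D3, [/\ m (W a b) = 0 /\ m (W c d) = 0, [/\ i != j, k != i & k != j], forall h, hit m h,
  D1 <> D1' /\ D2 <> D2' & [/\ usr m D1 /\ el i D1 = 0, usr m D1' /\ el i D1' = 0, usr m D2 /\ el j D2 = 0, usr m D2' /\ el j D2' = 0 & usr m D3 /\ el k D3 = 0]].
Proof.
have nE := neqE u4.
have [T [cc [dd [uT hc hT hT1 [s5 sd h6]]]]] := count_at (WY a b).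
pose sp (m : line) := m (W c d) == 0.
have c1 : (count sp T <= 1)%N.
  rewrite leqNgt; apply/negP => h2; have [t [ut st ht]] := take_count uT h2.
  have [m [m' [mt m't mm]]] := two_of ut (eq_leq (esym st)).
  have [mT /eqP ms] := ht m mt; have [m'T /eqP m's] := ht m' m't.
  apply: mm; apply: (hT1 m m' (W c d) mT m'T) => //; first exact: YX (WY c d).
  by move=> e; have := lW c c d; rewrite e lW !nE eqxx.
have hne m : m \in T -> forall x, ~ eql m (lam x) by move=> /hT[_ hm] x; exact: tri_ne.
have h2sp m i : m \in T -> sp m -> (cu cc m i <= 2)%N.
  move=> mT /eqP ms; have [mab hm] := hT m mT; have [uU hU] := users_c m i hc.
  by rewrite /cu -size_filter; exact: (pp_le2 u4 fourth_nodes_not_collinear (hne m mT) mab ms uU hU (hm i)).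
have hn m : m \in T -> ~~ sp m -> forall i, (2 <= cu cc m i)%N -> (cu cc m i <= 2)%N /\ forall j, j != i -> cu cc m j = 0%N.
  move=> mT ms i h2; have [mab hm] := hT m mT; have [uU hU] := users_c m i hc; have ne := hne m mT.
  have [k [h [hk mk]]] : exists k h : 'I_4, (h, k) \in [:: (c, d); (d, c)] /\ m (W k k) != 0.
    have [mc|mc] := eqVneq (m (W c c)) 0; last by exists c, d; rewrite !inE eqxx orbT.
    have [md|md] := eqVneq (m (W d d)) 0; last by exists d, c; rewrite !inE eqxx.
    by case: (nbad mc md).
  split; first by rewrite /cu -size_filter; exact: (one_le2 hk ne mab ms mk uU hU (hm i)).
  apply: (typed_cu (la := lam k) hc _ _ (hm i) h2); first by rewrite q4.
  move=> P PY lP; apply/negP => /eqP mP; move/eqP: lP.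
  have [e|e|e|e] := on_ab u4 ne mab PY mP; rewrite e lW.
  - by move: hk; rewrite !inE => /orP[]/eqP[_ ->]; rewrite !nE.
  - by rewrite /sp -e mP eqxx in ms.
  - by rewrite orbb => /eqP kc; rewrite kc -e mP eqxx in mk.
  - by rewrite orbb => /eqP kc; rewrite kc -e mP eqxx in mk.
have [m [i [j [k [mT sm ij /andP[ki kj] [u1 u2 u3]]]]]] := num_case4 s5 sd h6 c1 h2sp hn.
have [mab hm] := hT m mT.
have get h : exists2 s, uniq s /\ size s = cu cc m h & forall D, D \in s -> usr m D /\ el h D = 0.
  have [uU hU] := users_c m h hc; exists [seq D <- E h | cc D == m] => //; by rewrite size_filter.
have [s1 [us1 ss1] hs1] := get i; have [s2 [us2 ss2] hs2] := get j; have [s3 [us3 ss3] hs3] := get k.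
have [D1 [D1' [d1 d1' n1]]] := two_of us1 (eq_leq (esym (etrans ss1 u1))).
have [D2 [D2' [d2 d2' n2]]] := two_of us2 (eq_leq (esym (etrans ss2 u2))).
have [D3 d3] : exists D3, D3 \in s3 by case: (s3) ss3 => [e|D s _]; [by have := leq_trans u3 (eq_leq (esym e))|exists D; rewrite mem_head].
exists m, i, j, k, D1, D1', D2, D2', D3; split=> //; first by split=> //; exact/eqP.
by split; [exact: hs1|exact: hs1|exact: hs2|exact: hs2|exact: hs3].
Qed.

End PPcount.

(** * The common cubic factor *)

Lemma count_rest (T : Type) (p : pred T) (s : seq T) n r : (count p s <= n)%N -> (n + r <= size s)%N -> (r <= count (predC p) s)%N.
Proof. by have := count_predC p s; lia. Qed.

Lemma pol_mul n (k : nat) f g : pol n.+1 f -> pol k.+1 g -> pol (n + k).+1 (fun P => f P * g P).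
Proof.
elim: n f => [|n IH] f.
  move=> [f1 [f2 [c [h1 h2 h]]]] pg; apply: pol_ext (pol_scale c pg) => P.
  by rewrite h h1 h2; ring.
move=> [f1 [f2 [c [h1 h2 h]]]] pg.
have p1 := pol_x (IH _ h1 pg); have p2 := pol_y (IH _ h2 pg).
have p3 : pol (n.+1 + k).+1 g by apply: pol_wid pg; rewrite ltnS leq_addl.
apply: pol_ext (pol_lin 1 c (pol_lin 1 1 p1 p2) p3) => P /=.
by rewrite h; ring.
Qed.

Lemma sep P Q : P <> Q -> exists l, l P = 0 /\ l Q != 0.
Proof.
move=> PQ; have [k [kP kQ]] := line_thru P Q; have [S kS] := pt_off k.
have [l [lP lS]] := line_thru P S; exists l; split=> //; apply: contra kS => /eqP lQ.
by rewrite -(line2 PQ lP lQ kP kQ) lS eqxx.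
Qed.

Lemma delta2 P Q : P <> Q -> exists f, [/\ pol 2 f, f P = 1 & f Q = 0].
Proof.
move=> PQ; have [l [lQ lP]] := sep (nesym PQ); exists (fun S => (l P)^-1 * l S); split.
- exact: pol_scale (pol_lev 0 l).
- by rewrite mulVf.
- by rewrite lQ mulr0.
Qed.

Lemma delta3 P Q S : P <> Q -> P <> S -> exists f, [/\ pol 3 f, f P = 1, f Q = 0 & f S = 0].
Proof.
move=> PQ PS; have [f [pf fP fQ]] := delta2 PQ; have [g [pg gP gS]] := delta2 PS.
exists (fun x => f x * g x); split; [exact: (@pol_mul 1 1)|by rewrite fP gP mulr1|by rewrite fQ mul0r|by rewrite gS mulr0].
Qed.

(** Among [n + k] points of [l], one of the factors has as many zeros as divisibility requires. *)
Lemma pol_split l n (k : nat) f g : pol n f -> pol k g -> (forall P, l P = 0 -> f P * g P = 0) ->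
  (exists f', pol n.-1 f' /\ forall P, f P = l P * f' P) \/ (exists g', pol k.-1 g' /\ forall P, g P = l P * g' P).
Proof.
move=> pf pg h; have [t [ut st ht]] := line_pts l [::] (n + k).
have cv : (size t <= count (fun P => f P == 0%R) t + count (fun P => g P == 0%R) t)%N.
  by apply: count_cover => P /ht[lP _]; rewrite -mulf_eq0 h.
have aux (q : pt -> R) r : pol r q -> (r <= count (fun P => q P == 0%R) t)%N -> exists q', pol r.-1 q' /\ forall P, q P = l P * q' P.
  move=> pq hr; apply: (div_line (s := filter (fun P => q P == 0) t) pq); rewrite ?filter_uniq ?size_filter //.
  by move=> P; rewrite mem_filter => /andP[/eqP qP /ht[lP _]].
have [hn|hn] := leqP n (count (fun P => f P == 0%R) t); [left|right]; apply: aux => //.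
by move: cv; rewrite st; lia.
Qed.

(** Each line of [L] divides [f] or [g], and the exact count [size L = n + k] leaves only constants
    at the end. *)
Lemma factor (L : seq line) n (k : nat) f g (c : R) : pol n.+1 f -> pol k.+1 g -> size L = (n + k)%N -> c != 0 ->
  (forall P, f P * g P = c * lprod L P) ->
  exists (G : seq line) c', [/\ {subset G <= L}, size G = n, c' != 0 & forall P, f P = c' * lprod G P].
Proof.
elim: L n k f g => [|l L IH] n k f g pf pg.
  move=> /esym/eqP; rewrite addn_eq0 => /andP[/eqP n0 /eqP k0] c0 h; subst n k.
  exists [::], (f (0, 0)); split=> //.
    have /eqP := h (0, 0); rewrite lprod_nil mulr1; apply: contraTneq => ->.
    by rewrite mul0r eq_sym.
  by move=> P; rewrite lprod_nil mulr1; exact: pol1_const.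
move=> sL c0 h.
have nz (q : pt -> R) : (forall P, q P = c * lprod (l :: L) P) -> ~ (forall P, q P = 0).
  move=> hq q0; apply: (@lprod_neq0 (l :: L)) => P; have /eqP := hq P.
  by rewrite q0 eq_sym mulf_eq0 (negbTE c0) => /eqP.
have cancel (q : pt -> R) r : pol r q -> (size L < r)%N -> (forall P, l P * q P = c * lprod (l :: L) P) -> forall P, q P = c * lprod L P.
  move=> pq sr hq P; apply/eqP; rewrite -subr_eq0; apply/eqP.
  have e : (fun S => 1 * q S + (- c) * lprod L S) =1 (fun S => q S - c * lprod L S) by move=> S; ring.
  have pp : pol r (fun S => q S - c * lprod L S) by apply: pol_ext e _; apply: pol_lin => //; exact: pol_lprod.
  by apply: (pol_cancel (l := l) pp) => S; rewrite mulrBr hq lprod_cons; ring.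
have [|[f' [pf' ef]]|[g' [pg' eg]]] := pol_split (l := l) pf pg.
- by move=> P lP; rewrite h lprod_cons lP mul0r mulr0.
- case: n pf sL pf' => [|n] pf sL pf'.
    by case: (nz _ h) => P; rewrite ef pf'; ring.
  have sL' : size L = (n + k)%N by move: sL; rewrite /= addSn => -[].
  have hc : forall P, f' P * g P = c * lprod L P.
    apply: (cancel _ (n + k).+1); [exact: pol_mul|by rewrite sL'|].
    by move=> P; rewrite -h ef; ring.
  have [G [c' [sub sG c'0 eG]]] := IH n k f' g pf' pg sL' c0 hc.
  exists (l :: G), c'; split=> //; last by move=> P; rewrite ef eG lprod_cons; ring.
    by move=> x; rewrite !inE => /orP[->//|/sub->]; rewrite orbT.
  by rewrite /= sG.
- case: k pg sL pg' => [|k] pg sL pg'.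
    by case: (nz _ h) => P; rewrite eg pg'; ring.
  have sL' : size L = (n + k)%N by move: sL; rewrite /= addnS => -[].
  have hc : forall P, f P * g' P = c * lprod L P.
    apply: (cancel _ (n + k).+1); [exact: pol_mul|by rewrite sL'|].
    by move=> P; rewrite -h eg; ring.
  have [G [c' [sub sG c'0 eG]]] := IH n k f g' pf pg' sL' c0 hc.
  by exists G, c'; split=> // x /sub xL; rewrite inE xL orbT.
Qed.

(** Dividing [la] out of the cubics of [yprod] gives fundamental conics of the six nodes of [Z];
    five conditions leave a nonzero combination. *)
Lemma conic5 (s : seq pt) : (size s <= 5)%N -> exists f, [/\ pol 3 f, forall S, S \in s -> f S = 0 & ~ forall P, f P = 0].
Proof.
move=> ss; pose la := lam ord0; have la4 := q4 ord0.
have ex z : z \in Z la -> exists f, [/\ pol 3 f, f z != 0 & forall P, P \in Z la -> P <> z -> f P = 0].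
  rewrite in_Z => /andP[lz zY]; have [L [sL Lz L0]] := yprod zY.
  have pL : pol 4 (lprod L) by apply: pol_lprod; rewrite sL.
  have [|P|g [pg eg]] := div_line (l := la) (s := ym la) pL (uym _).
  - by rewrite la4.
  - by rewrite in_ym => /andP[/eqP lP PY]; split=> //; apply: L0 => // e; rewrite -e lP eqxx in lz.
  exists g; split=> // [|P]; first by move: Lz; rewrite eg mulf_eq0 negb_or => /andP[].
  rewrite in_Z => /andP[lP PY] Pz; have /eqP := L0 P PY Pz; rewrite eg mulf_eq0 (negbTE lP) => /eqP//.
have [q hq] := seq_choice (fun=> 0 : R) ex.
have [|c [[D DZ cD] hc]] := @kern _ (Z la) s q (uZ la); first by rewrite (sZ la4).
exists (fun P => \sum_(D <- Z la) c D * q D P); split=> //; first by apply: pol_sum => S /hq[].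
move=> z; have := z D; rewrite (big_rem D) // big_seq big1 => [/eqP|S SZ].
  by rewrite /= addr0 mulf_eq0 (negbTE cD) /=; case: (hq D DZ) => _ /negbTE->.
have [_ _ ->] := hq S (mem_rem SZ) => //; first by rewrite mulr0.
by move=> e; rewrite e mem_rem_uniqF ?uZ in SZ.
Qed.

Section PP.
Variables a b c d : 'I_4.
Hypothesis u4 : uniq [:: a; b; c; d].
Variables (m : line) (i j k : 'I_3) (D1 D1' D2 D2' D3 : pt).
Hypotheses (mab : m (W a b) = 0) (mcd : m (W c d) = 0) (mne : forall x, ~ eql m (lam x)).
Hypotheses (ij : i != j) (ki : k != i) (kj : k != j) (hm : forall h, hit m h).
Hypotheses (u1 : usr m D1) (u1' : usr m D1') (u2 : usr m D2) (u2' : usr m D2') (u3 : usr m D3).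
Hypotheses (iD1 : el i D1 = 0) (iD1' : el i D1' = 0) (jD2 : el j D2 = 0) (jD2' : el j D2' = 0) (kD3 : el k D3 = 0).
Hypotheses (n1 : D1 <> D1') (n2 : D2 <> D2').

Let nE := neqE u4.

Lemma pp_ym P : P \in Y -> m P = 0 -> P = W a b \/ P = W c d.
Proof.
move=> PY mP; have [->|->|e|e] := on_ab u4 (@mne) mab PY mP; [by left|by right|..].
  by have := disj (@mne c) mcd (z := c); rewrite -e => /(_ mP)/eqP; rewrite nE.
have mdc : m (W d c) = 0 by rewrite Wsym.
by have := disj (@mne d) mdc (z := d); rewrite -e => /(_ mP)/eqP; rewrite nE.
Qed.

(** Such cubics form a two-dimensional space, with coordinates the values at [W a b] and [W c d],
    the only nodes of [Y] on [m]. *)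
Definition offm f := forall P, P \in Y -> m P != 0 -> f P = 0.

(** Cramer's rule in that space: the difference of the two sides vanishes on [Y]. *)
Lemma K3comb f g h : pol 4 f -> pol 4 g -> pol 4 h -> offm f -> offm g -> offm h -> forall P,
  (g (W a b) * h (W c d) - g (W c d) * h (W a b)) * f P =
  (f (W a b) * h (W c d) - f (W c d) * h (W a b)) * g P + (g (W a b) * f (W c d) - g (W c d) * f (W a b)) * h P.
Proof.
move=> pf pg ph kf kg kh P.
pose x := g (W a b) * h (W c d) - g (W c d) * h (W a b); pose y := f (W a b) * h (W c d) - f (W c d) * h (W a b).
pose z := g (W a b) * f (W c d) - g (W c d) * f (W a b).
rewrite -/x -/y -/z; apply/eqP; rewrite -subr_eq0; apply/eqP.
have e : (fun S => 1 * (x * f S + (- y) * g S) + (- z) * h S) =1 (fun S => x * f S - (y * g S + z * h S)) by move=> S; ring.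
have pp : pol 4 (fun S => x * f S - (y * g S + z * h S)).
  by apply: pol_ext e _; apply: pol_lin => //; exact: pol_lin.
apply: (Y3 pp) => S SY; have [mS|mS] := eqVneq (m S) 0; last by rewrite kf ?kg ?kh //; ring.
by have [->|->] := pp_ym SY mS; rewrite /x /y /z; ring.
Qed.

Let u4' : uniq [:: c; d; a; b].
Proof. by rewrite /= !inE !nE. Qed.

Lemma K3basis : exists g h l l', [/\ l (W a a) = 0, l (W b b) = 0, l' (W c c) = 0, l' (W d d) = 0 &
  [/\ g = lprod [:: lam c; lam d; l], h = lprod [:: lam a; lam b; l'], pol 4 g /\ pol 4 h, offm g /\ offm h &
    [/\ g (W a b) != 0, g (W c d) = 0, h (W a b) = 0 & h (W c d) != 0]]].
Proof.
have [l [la lb]] := line_thru (W a a) (W b b); have [l' [lc ld]] := line_thru (W c c) (W d d).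
have [pg gA g0] := yf_ab u4 la lb; have [ph hB h0] := yf_ab u4' lc ld.
have AB : W a b <> W c d by move=> e; have := lW a a b; rewrite e !lW !nE eqxx.
exists (lprod [:: lam c; lam d; l]), (lprod [:: lam a; lam b; l']), l, l'; split=> //; split=> //.
- by split=> P PY mP; [apply: g0|apply: h0] => // e; rewrite e ?mab ?mcd eqxx in mP.
- by split=> //; [apply: g0|apply: h0] => //; rewrite ?WY //; exact: nesym.
Qed.

(** Common zeros of two independent elements are zeros of the whole space, in particular of both
    products of [K3basis]; two such points off [Y] contradict [two_common]. *)
Lemma K3two g h N N' : pol 4 g -> pol 4 h -> offm g -> offm h ->
  g (W a b) * h (W c d) - g (W c d) * h (W a b) != 0 -> N \notin Y -> N' \notin Y ->
  g N = 0 -> h N = 0 -> g N' = 0 -> h N' = 0 -> N = N'.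
Proof.
move=> pg ph kg kh det NY NY' gN hN gN' hN'; apply/eqP; apply/negP => /negP/eqP NN.
have [g1 [h1 [l [l' [la lb lc ld [eg eh [pg1 ph1] [kg1 kh1] _]]]]]] := K3basis.
have z f S : pol 4 f -> offm f -> g S = 0 -> h S = 0 -> f S = 0.
  move=> pf kf gS hS; have /eqP := K3comb pf pg ph kf kg kh S.
  by rewrite gS hS !mulr0 addr0 mulf_eq0 (negbTE det) => /eqP.
have ne' x : ~ eql l' (lam x) by exact: (lab_lam u4').
have [||lN lN'] := @common_zero a b c d u4 l l' N NY la lb lc ld ne'; rewrite -?eg -?eh; try exact: z.
have [||kN kN'] := @common_zero a b c d u4 l l' N' NY' la lb lc ld ne'; rewrite -?eg -?eh; try exact: z.
exact: (two_common u4 fourth_nodes_not_collinear la lb lc ld NN).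
Qed.

(** [N] lists the nodes of [el h] off [m] other than the two users. The cubic vanishes there; a
    further zero on [el h] would be a fourth and make it vanish at the users. *)
Lemma pair_data h A A' : usr m A -> usr m A' -> el h A = 0 -> el h A' = 0 -> A <> A' ->
  exists N r, [/\ uniq N, (3 <= size N)%N, forall S, S \in N -> [/\ S \in X, el h S = 0, m S != 0, S <> A & S <> A'] &
    [/\ pol 4 r, offm r, forall S, S \in N -> r S = 0 & forall S, el h S = 0 -> S \notin N -> r S != 0]].
Proof.
move=> uA uA' hA hA' AA'; pose N := [seq S <- E h | (m S != 0) && (S \notin [:: A; A'])].
have uN : uniq N by rewrite filter_uniq ?uE.
have inN S : (S \in N) = [&& m S != 0, S \notin [:: A; A'] & S \in E h] by rewrite mem_filter andbA.
have sN : (3 <= size N)%N.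
  have /hitP[P [PX hP mP]] := hm h.
  have : (size (E h) <= size (P :: A :: A' :: N))%N.
    apply: uniq_leq_size (uE h) _ => S SE; rewrite !in_cons inN SE andbT !inE.
    have [mS|mS] := eqVneq (m S) 0; last by case: (S == P); case: (S == A); case: (S == A').
    move: SE; rewrite in_E => /andP[/eqP hS SX]; apply/orP; left; apply/eqP.
    by apply: (meet_uniq uA hA hS mS hP mP).
  by rewrite sE /= !ltnS.
have [|S|//|//|r [pr r0 _ _ [F FU rF]]] := @cubic m h [:: A; A'] [::].
- by rewrite /= inE andbT; apply/eqP.
- by rewrite !inE => /orP[]/eqP->.
have rN S : S \in N -> r S = 0.
  by rewrite inN in_E => /and3P[mS SU /andP[/eqP hS SX]]; apply: r0 => //; exact: el_offi.
exists N, r; split=> //.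
  move=> S; rewrite inN in_E !inE negb_or => /and3P[mS /andP[/eqP SA /eqP SA'] /andP[/eqP hS SX]].
  by split.
split=> //.
- move=> P PY mP; apply: r0 => //; [exact: YX|exact: Y_offi|].
  by rewrite !inE; apply/negP => PU; have := Yel h PY; case/orP: PU => /eqP->; rewrite ?hA ?hA' eqxx.
- move=> S hS SN; apply/negP => /eqP rS; move: rF; rewrite (pol_line0 (l := el h) (s := S :: N) pr) ?eqxx //.
  + by rewrite /= SN.
  + by move=> Q; rewrite inE inN in_E => /orP[/eqP->|/and3P[mQ QU /andP[/eqP hQ QX]]]; split=> //; apply: rN; rewrite inN mQ QU in_E hQ eqxx.
  + by move: FU; rewrite !inE => /orP[]/eqP->.
Qed.

Variables (N1 N2 : seq pt) (r1 r2 : pt -> R).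
Hypotheses (uN1 : uniq N1) (sN1 : (3 <= size N1)%N) (uN2 : uniq N2) (sN2 : (3 <= size N2)%N).
Hypothesis hN1 : forall S, S \in N1 -> [/\ S \in X, el i S = 0, m S != 0, S <> D1 & S <> D1'].
Hypothesis hN2 : forall S, S \in N2 -> [/\ S \in X, el j S = 0, m S != 0, S <> D2 & S <> D2'].
Hypotheses (pr1 : pol 4 r1) (kr1 : offm r1) (zr1 : forall S, S \in N1 -> r1 S = 0) (nr1 : forall S, el i S = 0 -> S \notin N1 -> r1 S != 0).
Hypotheses (pr2 : pol 4 r2) (kr2 : offm r2) (zr2 : forall S, S \in N2 -> r2 S = 0) (nr2 : forall S, el j S = 0 -> S \notin N2 -> r2 S != 0).

Let D1N : D1 \notin N1. Proof. by apply/negP => /hN1[_ _ _ []]. Qed.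
Let D1N' : D1' \notin N1. Proof. by apply/negP => /hN1[_ _ _ _ []]. Qed.
Let D2N : D2 \notin N2. Proof. by apply/negP => /hN2[_ _ _ []]. Qed.
Let D2N' : D2' \notin N2. Proof. by apply/negP => /hN2[_ _ _ _ []]. Qed.
Let jD1 D : el i D = 0 -> D \in X -> el j D != 0. Proof. by move=> iD DX; apply: (eld' DX iD); exact: neqs. Qed.
Let iD2  D : el j D = 0 -> D \in X -> el i D != 0. Proof. by move=> jD DX; exact: (eld' DX jD). Qed.
Let kD12  D : (el i D = 0 \/ el j D = 0) -> D \in X -> el k D != 0.
Proof. by move=> [iD|jD] DX; [exact: (eld' DX iD)|exact: (eld' DX jD)]. Qed.

Lemma Pk_ex : exists Pk, [/\ Pk \in X, el k Pk = 0, m Pk = 0 & forall S, S \in X -> el k S = 0 -> m S = 0 -> S = Pk].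
Proof.
have /hitP[P [PX kP mP]] := hm k; exists P; split=> // S SX kS mS.
exact: (meet_uniq u1 iD1 kS mS kP mP).
Qed.

Lemma in4 S : S \in [:: D1; D1'; D2; D2'] -> usr m S /\ (el i S = 0 \/ el j S = 0).
Proof. by rewrite !inE => /or4P[]/eqP->; split=> //; [left|left|right|right]. Qed.

Lemma u4D : uniq [:: D1; D1'; D2; D2'].
Proof.
have ne A B : el i A = 0 -> usr m A -> el j B = 0 -> A <> B.
  by move=> iA uA jB e; have := jD1 iA (usr_X uA); rewrite e jB eqxx.
by rewrite /= !inE !negb_or !andbT; do !(apply/andP; split); apply/eqP => //; exact: ne.
Qed.

(** If independent, [r1] and [r2] span the cubics of [offm]. A combination of the four quintics
    killed at [Pk], [D1] and [D2] is divisible by [el k]. Reducing the quartic [t] by a multiple of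
    [r1] along [el i] expresses [dt * t] as [r1] times a linear form plus a multiple of [el i * r2].
    The zeros of [t] on [N2] make the linear form a multiple of [el j], and those at [D1] and [D2]
    then annihilate both terms. *)
Lemma r_det : r1 (W a b) * r2 (W c d) - r1 (W c d) * r2 (W a b) = 0.
Proof.
apply/eqP; apply/negP => /negP det; set dt := (X in X != 0) in det.
have [Pk [PkX kPk mPk hPk]] := Pk_ex.
have [S hS|//|f [pf f0 fs _ [F FU fF]]] := @Wm m _ [:: Pk; D1; D2] u4D; first by case: (in4 hS).
have fz S : S \in X -> m S != 0 -> S <> D1' -> S <> D2' -> f S = 0.
  move=> SX mS S1 S2; have [->|/eqP S3] := eqVneq S D1; first by apply: fs; rewrite !inE eqxx orbT.
  have [->|/eqP S4] := eqVneq S D2; first by apply: fs; rewrite !inE eqxx !orbT.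
  by apply: f0 => //; rewrite !inE !negb_or; apply/and4P; split; apply/eqP.
have fD1 : f D1 = 0 by apply: fs; rewrite !inE eqxx orbT.
have fD2 : f D2 = 0 by apply: fs; rewrite !inE eqxx !orbT.
have kne S A : el k S = 0 -> S \in X -> usr m A -> (el i A = 0 \/ el j A = 0) -> S <> A.
  by move=> kS SX uA h e; have := kD12 h (usr_X uA); rewrite -e kS eqxx.
have [|S SX kS _|t [pt' et]] := @divX 6 (el k) f [::] pf; first by rewrite addn0 el6.
  have [mS|mS] := eqVneq (m S) 0; first by rewrite (hPk S SX kS mS); apply: fs; rewrite mem_head.
  by apply: fz => //; apply: kne => //; [left|right].
have tz S : f S = 0 -> el k S != 0 -> t S = 0.
  by move=> fS kS; move/eqP: fS; rewrite et mulf_eq0 (negbTE kS) => /eqP.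
have tY S : S \in Y -> m S != 0 -> t S = 0.
  move=> SY mS; apply: tz; last exact: Yel.
  by apply: fz => //; [exact: YX|..] => e; [have := Yel i SY|have := Yel j SY]; rewrite e ?iD1' ?jD2' eqxx.
have ijne A B : el i A = 0 -> usr m B -> el j B = 0 -> A <> B.
  by move=> iA uB jB e; have := iD2 jB (usr_X uB); rewrite -e iA eqxx.
have jine A B : el j A = 0 -> usr m B -> el i B = 0 -> A <> B.
  by move=> jA uB iB e; have := jD1 iB (usr_X uB); rewrite -e jA eqxx.
have tN1 S : S \in N1 -> t S = 0.
  move=> /hN1[SX iS mS _ SD]; apply: tz; last by apply: kD12 => //; left.
  by apply: fz => //; exact: ijne.
have tN2 S : S \in N2 -> t S = 0.
  move=> /hN2[SX jS mS _ SD]; apply: tz; last by apply: kD12 => //; right.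
  by apply: fz => //; exact: jine.
have tD1 : t D1 = 0 by apply: tz => //; apply: kD12; [left|exact: usr_X u1].
have tD2 : t D2 = 0 by apply: tz => //; apply: kD12; [right|exact: usr_X u2].
have [M [M1 M1']] := sep n1.
pose cc := t D1' / (r1 D1' * M D1').
have rM0 : r1 D1' * M D1' != 0 by rewrite mulf_neq0 // nr1.
have pg0 : pol 5 (fun S => t S - cc * (M S * r1 S)).
  apply: pol_ext (pol_lin 1 (- cc) pt' (pol_line M pr1)) => S; ring.
have [||S|g [pg eg]] := @div_line _ 5 (el i) _ (D1 :: D1' :: N1) pg0.
- by rewrite /= inE negb_or D1N D1N' uN1 !andbT; apply/eqP.
- by rewrite /= !ltnS.
- rewrite !inE => /or3P[/eqP->|/eqP->|SN]; split=> //.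
  + by rewrite tD1 M1; ring.
  + by rewrite /cc -[M _ * r1 _]mulrC divfK // subrr.
  + by case: (hN1 SN).
  + by rewrite tN1 // zr1 //; ring.
have kg : offm g.
  move=> S SY mS; have /eqP := eg S; rewrite tY // kr1 // mulr0 mulr0 subrr eq_sym mulf_eq0 (negbTE (Yel i SY)) => /eqP//.
pose x := g (W a b) * r2 (W c d) - g (W c d) * r2 (W a b).
pose y := r1 (W a b) * g (W c d) - r1 (W c d) * g (W a b).
have eq1 S : dt * t S = r1 S * (dt * cc * M S + x * el i S) + y * (el i S * r2 S).
  have := K3comb pg pr1 pr2 kg kr1 kr2 S; rewrite -/dt -/x -/y => h.
  have -> : t S = cc * (M S * r1 S) + el i S * g S by rewrite -eg; ring.
  by rewrite mulrDr [dt * (el i S * g S)]mulrCA h; ring.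
pose M' S := dt * cc * M S + x * el i S.
have pM' : pol 2 M' by apply: pol_lin; exact: pol_lev.
have M'N S : S \in N2 -> r1 S != 0 -> M' S = 0.
  move=> SN rS; have /eqP := eq1 S; rewrite tN2 // zr2 // !mulr0 addr0 eq_sym mulf_eq0 (negbTE rS) => /eqP//.
(* At most one point of [N2] is lost, since [r2] vanishes on [N2] and [K3two] bounds the common
   zeros. *)
pose N2' := filter (predC (fun S => r1 S == 0)) N2.
have sN2' : (2 <= size N2')%N.
  have : (count (fun S => r1 S == 0%R) N2 <= 1)%N.
    rewrite leqNgt; apply/negP => h2; have [tt [utt stt htt]] := take_count uN2 h2.
    have [A [B [At Bt AB]]] := two_of utt (eq_leq (esym stt)).
    have [AN /eqP rA] := htt A At; have [BN /eqP rB] := htt B Bt.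
    have [AX jA _ _ _] := hN2 AN; have [BX jB _ _ _] := hN2 BN.
    by apply: AB; apply: (K3two pr1 pr2 kr1 kr2 det (elY jA) (elY jB)) => //; exact: zr2.
  by move=> h1; rewrite /N2' size_filter; exact: count_rest h1 sN2.
have [||S|z [pz ez]] := @div_line _ 2 (el j) M' N2' pM'; first by rewrite filter_uniq.
- by [].
- by rewrite mem_filter => /andP[rS SN]; split; [case: (hN2 SN)|exact: M'N].
have z0 S : z S = 0.
  rewrite (pol1_const S D1 pz); have /eqP := eq1 D1; rewrite -/(M' D1) ez tD1 iD1 mul0r !mulr0 addr0.
  by rewrite eq_sym !mulf_eq0 (negbTE (nr1 iD1 D1N)) (negbTE (jD1 iD1 (usr_X u1))) => /eqP.
have y0 : y = 0.
  have /eqP := eq1 D2; rewrite -/(M' D2) ez z0 tD2 !mulr0 add0r.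
  by rewrite eq_sym !mulf_eq0 (negbTE (nr2 jD2 D2N)) (negbTE (iD2 jD2 (usr_X u2))) !orbF => /eqP.
have t0 S : t S = 0.
  have /eqP := eq1 S; rewrite -/(M' S) ez z0 y0 !(mulr0, mul0r, addr0) mulf_eq0 (negbTE det) => /eqP//.
by move: fF; rewrite et t0 mulr0 eqxx.
Qed.

Lemma r_prop : exists2 mu, mu != 0 & forall S, r2 S = mu * r1 S.
Proof.
have nz r : (forall S, r S = 0) -> r D1 = 0 /\ r D2 = 0 by move=> h.
have key mu : (forall S, S \in Y -> r2 S = mu * r1 S) -> exists2 mu, mu != 0 & forall S, r2 S = mu * r1 S.
  move=> h; have e S : r2 S = mu * r1 S.
    apply/eqP; rewrite -subr_eq0; apply/eqP.
    have pp : pol 4 (fun S => r2 S - mu * r1 S) by apply: pol_ext (pol_lin 1 (- mu) pr2 pr1) => Q; ring.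
    by apply: (Y3 pp) => Q QY; rewrite h // subrr.
  exists mu => //; apply/negP => /eqP mu0; have := nr2 jD2 D2N.
  by rewrite e mu0 mul0r eqxx.
have det := r_det.
have [rA|rA] := eqVneq (r1 (W a b)) 0; last first.
  apply: (key (r2 (W a b) / r1 (W a b))) => S SY; have [mS|mS] := eqVneq (m S) 0; last by rewrite (kr1 SY mS) (kr2 SY mS) mulr0.
  have [->|->] := pp_ym SY mS; first by rewrite divfK.
  by apply: (mulfI rA); move/eqP: det; rewrite subr_eq0 => /eqP->; field.
have [rB|rB] := eqVneq (r1 (W c d)) 0; last first.
  apply: (key (r2 (W c d) / r1 (W c d))) => S SY; have [mS|mS] := eqVneq (m S) 0; last by rewrite (kr1 SY mS) (kr2 SY mS) mulr0.
  have [->|->] := pp_ym SY mS; last by rewrite divfK.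
  by apply: (mulfI rB); move/eqP: det; rewrite subr_eq0 rA mul0r => /eqP e; rewrite -e; ring.
have : r1 D1 = 0; last by move=> h; have := nr1 iD1 D1N; rewrite h eqxx.
apply: (Y3 pr1) => S SY; have [mS|mS] := eqVneq (m S) 0; last exact: kr1.
by have [->|->] := pp_ym SY mS.
Qed.

Let r1N2  S : S \in N2 -> r1 S = 0.
Proof.
move=> SN; have [mu mu0 e] := r_prop; have /eqP := zr2 SN.
by rewrite e mulf_eq0 (negbTE mu0) => /eqP.
Qed.

Let nr1j  S : el j S = 0 -> S \notin N2 -> r1 S != 0.
Proof.
move=> jS SN; have [mu mu0 e] := r_prop; have := nr2 jS SN.
by rewrite e mulf_eq0 negb_or => /andP[].
Qed.

Lemma gam_ex : exists g, [/\ pol 4 g, offm g & r1 (W a b) * g (W c d) - r1 (W c d) * g (W a b) != 0].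
Proof.
have [g [h [l [l' [_ _ _ _ [_ _ [pg ph] [kg kh] [gA gB hA hB]]]]]]] := K3basis.
have [rB|rB] := eqVneq (r1 (W c d)) 0; last first.
  by exists g; split=> //; rewrite gB mulr0 sub0r oppr_eq0 mulf_neq0.
exists h; split=> //; rewrite hA mulr0 subr0 mulf_neq0 //.
apply/negP => /eqP rA; have := nr1 iD1 D1N; rewrite (Y3 pr1) ?eqxx // => S SY.
have [mS|mS] := eqVneq (m S) 0; last exact: kr1.
by have [->|->] := pp_ym SY mS.
Qed.

Definition E3 := [seq S <- E k | m S != 0].
Definition Z3 := [seq S <- E3 | r1 S == 0].

Lemma in_E3 S : S \in E3 -> [/\ S \in X, el k S = 0 & m S != 0].
Proof. by rewrite mem_filter in_E => /and3P[mS /eqP kS SX]. Qed.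

Lemma sE3 : (5 <= size E3)%N.
Proof.
have [Pk [PkX kPk mPk hPk]] := Pk_ex.
have : (size (E k) <= size (Pk :: E3))%N.
  apply: uniq_leq_size (uE k) _ => S SE; rewrite inE mem_filter SE andbT.
  have [mS|mS] := eqVneq (m S) 0; last by rewrite orbT.
  by move: SE; rewrite in_E => /andP[/eqP kS SX]; rewrite (hPk S SX kS mS) eqxx.
by rewrite sE /= ltnS.
Qed.

Lemma uE3 : uniq E3. Proof. exact: filter_uniq (uE k). Qed.

Section Gamma.
Variable g' : pt -> R.
Hypotheses (pg' : pol 4 g') (kg' : offm g').
Hypothesis det : r1 (W a b) * g' (W c d) - r1 (W c d) * g' (W a b) != 0.

(** Interpolating [F / r1] by a conic at three nodes of [el i], then the quotient over [r1] by a
    linear form at two nodes of [el j], leaves multiples of these lines. The last quotient is a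
    cubic of [offm], hence a combination of [r1] and [g']. *)
Lemma Fdecomp F : pol 6 F -> offm F -> (forall S, S \in N1 -> F S = 0) -> (forall S, S \in N2 -> F S = 0) ->
  exists f y, pol 3 f /\ forall S, F S = r1 S * f S + y * (el i S * (el j S * g' S)).
Proof.
move=> pF kF F1 F2; have /hitP[Q [QX iQ mQ]] := hm i.
have QD1 : Q <> D1 by move=> e; have := usr_off u1; rewrite -e mQ eqxx.
have QD1' : Q <> D1' by move=> e; have := usr_off u1'; rewrite -e mQ eqxx.
have QN : Q \notin N1 by apply/negP => /hN1[_ _]; rewrite mQ eqxx.
have [e1 [pe1 e11 e12 e13]] := delta3 n1 (nesym QD1).
have [e2 [pe2 e22 e21 e23]] := delta3 (nesym n1) (nesym QD1').
have [e3 [pe3 e33 e31 e32]] := delta3 QD1 QD1'.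
pose k0 S := F D1 / r1 D1 * e1 S + 1 * (F D1' / r1 D1' * e2 S + F Q / r1 Q * e3 S).
have pk0 : pol 3 k0 by apply: pol_lin => //; exact: pol_lin.
have pG0 : pol 6 (fun S => F S - r1 S * k0 S).
  by apply: pol_ext (pol_lin 1 (-1) pF (@pol_mul 3 2 _ _ pr1 pk0)) => S; ring.
have [||S|G [pG eG]] := @div_line _ 6 (el i) _ (D1 :: D1' :: Q :: N1) pG0.
- rewrite /= !inE !negb_or D1N D1N' QN uN1 !andbT; apply/andP; split; first by apply/andP; split; apply/eqP => //; exact: nesym.
  by apply/eqP; exact: nesym.
- by rewrite /= !ltnS.
- rewrite !inE => /or4P[/eqP->|/eqP->|/eqP->|SN]; split=> //.
  + have -> : k0 D1 = F D1 / r1 D1 by rewrite /k0 e11 e21 e31; ring.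
    by rewrite mulrC divfK ?subrr //; exact: nr1 iD1 D1N.
  + have -> : k0 D1' = F D1' / r1 D1' by rewrite /k0 e12 e22 e32; ring.
    by rewrite mulrC divfK ?subrr //; exact: nr1 iD1' D1N'.
  + have -> : k0 Q = F Q / r1 Q by rewrite /k0 e13 e23 e33; ring.
    by rewrite mulrC divfK ?subrr //; exact: nr1 iQ QN.
  + by case: (hN1 SN).
  + by rewrite F1 // zr1 // mul0r subrr.
have GN S : F S = 0 -> r1 S = 0 -> el i S != 0 -> G S = 0.
  by move=> FS rS iS; have /eqP := eG S; rewrite FS rS mul0r subrr eq_sym mulf_eq0 (negbTE iS) => /eqP.
have kG : offm G by move=> S SY mS; apply: GN; [exact: kF|exact: kr1|exact: Yel].
have [f1 [pf1 f11 f12]] := delta2 n2; have [f2 [pf2 f22 f21]] := delta2 (nesym n2).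
pose M S := G D2 / r1 D2 * f1 S + G D2' / r1 D2' * f2 S.
have pM : pol 2 M by exact: pol_lin.
have pH0 : pol 5 (fun S => G S - r1 S * M S).
  by apply: pol_ext (pol_lin 1 (-1) pG (@pol_mul 3 1 _ _ pr1 pM)) => S; ring.
have [||S|H [pH eH]] := @div_line _ 5 (el j) _ (D2 :: D2' :: N2) pH0.
- by rewrite /= !inE !negb_or D2N D2N' uN2 !andbT; apply/eqP.
- by rewrite /= !ltnS.
- rewrite !inE => /or3P[/eqP->|/eqP->|SN]; split=> //.
  + have -> : M D2 = G D2 / r1 D2 by rewrite /M f11 f21; ring.
    by rewrite mulrC divfK ?subrr //; exact: nr1j jD2 D2N.
  + have -> : M D2' = G D2' / r1 D2' by rewrite /M f12 f22; ring.
    by rewrite mulrC divfK ?subrr //; exact: nr1j jD2' D2N'.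
  + by case: (hN2 SN).
  + have [SX jS _ _ _] := hN2 SN; rewrite (r1N2 SN) mul0r subr0.
    by apply: GN; [exact: F2|exact: r1N2|exact: iD2].
have kH : offm H.
  by move=> S SY mS; have /eqP := eH S; rewrite kG // kr1 // mul0r subrr eq_sym mulf_eq0 (negbTE (Yel j SY)) => /eqP.
pose dt := r1 (W a b) * g' (W c d) - r1 (W c d) * g' (W a b); have det' : dt != 0 := det.
pose x := H (W a b) * g' (W c d) - H (W c d) * g' (W a b); pose y := r1 (W a b) * H (W c d) - r1 (W c d) * H (W a b).
have eHH S : H S = x / dt * r1 S + y / dt * g' S.
  apply: (mulfI det'); have := K3comb pH pr1 pg' kH kr1 kg' S; rewrite -/dt -/x -/y => ->; by field.
exists (fun S => 1 * (1 * k0 S + 1 * (el i S * M S)) + x / dt * (el i S * el j S)), (y / dt); split.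
  apply: pol_lin; first by apply: pol_lin => //; exact: pol_line.
  by apply: pol_line; exact: pol_lev.
move=> S; have -> : F S = r1 S * k0 S + el i S * G S by rewrite -eG; ring.
have -> : G S = r1 S * M S + el j S * H S by rewrite -eH; ring.
by rewrite eHH; ring.
Qed.

Let nYk  S : S \in E3 -> S \notin Y. Proof. by move=> /in_E3[_ kS _]; exact: elY kS. Qed.

Let ik  S : S \in E3 -> el i S != 0. Proof. by move=> /in_E3[SX kS _]; apply: (eld' SX kS); exact: neqs. Qed.
Let jk  S : S \in E3 -> el j S != 0. Proof. by move=> /in_E3[SX kS _]; apply: (eld' SX kS); exact: neqs. Qed.

Lemma Z3_two A B F f y : A \in Z3 -> B \in Z3 -> A <> B ->
  (forall S, F S = r1 S * f S + y * (el i S * (el j S * g' S))) -> F A = 0 -> F B = 0 -> y = 0.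
Proof.
rewrite !(mem_filter (fun S => r1 S == 0)) => /andP[/eqP rA AE] /andP[/eqP rB BE] AB e FA FB.
apply/eqP; apply/negP => /negP y0; apply: AB.
have z S : S \in E3 -> r1 S = 0 -> F S = 0 -> g' S = 0.
  move=> SE rS /eqP; rewrite e rS mul0r add0r !mulf_eq0 (negbTE y0) (negbTE (ik SE)) (negbTE (jk SE)) => /eqP//.
apply: (K3two pr1 pg' kr1 kg' det (nYk AE) (nYk BE)) => //; exact: z.
Qed.

Let ne12  D S : usr m D -> (el i D = 0 \/ el j D = 0) -> S \in E3 -> S <> D.
Proof. by move=> uD h /in_E3[SX kS _] e; have := kD12 h (usr_X uD); rewrite -e kS eqxx. Qed.

(** Suppose [Z3] has at most two points, and let [f] be a combination nonzero only at the user
    [D2']. If its coefficient [y] were zero, the conic part would be divisible by [el k] and [el i],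
    and zero because of [D2]. With [y] nonzero, two points of [Z3] contradict [Z3_two]; with fewer,
    [f] removes the [g'] term from the quintic of [D3], and the conic left has three zeros on
    [el k], hence vanishes at [D3]. *)
Lemma Z3_size : (3 <= size Z3)%N.
Proof.
rewrite leqNgt ltnS; apply/negP => sz; have [Pk [PkX kPk mPk hPk]] := Pk_ex.
have sNZ n : (size Z3 <= n)%N -> (n + 3 <= 5)%N -> (3 <= count (predC (fun S => r1 S == 0%R)) E3)%N.
  by move=> h1 h2; apply: (count_rest (n := n)); [rewrite -size_filter|exact: leq_trans h2 sE3].
have [S hS|//|f [pf f0 fs _ [F FU fF]]] := @Wm m _ [:: D1; D1'; D2] u4D; first by case: (in4 hS).
have f1 : f D1 = 0 by apply: fs; rewrite inE eqxx.
have f1' : f D1' = 0 by apply: fs; rewrite !inE eqxx orbT.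
have f2 : f D2 = 0 by apply: fs; rewrite !inE eqxx !orbT.
have fz S : S \in X -> m S != 0 -> S <> D2' -> f S = 0.
  move=> SX mS S4; have [->//|/eqP S1] := eqVneq S D1; have [->//|/eqP S2] := eqVneq S D1'.
  have [->//|/eqP S3] := eqVneq S D2.
  by apply: f0 => //; rewrite !inE !negb_or; apply/and4P; split; apply/eqP.
have f2' : f D2' != 0 by move: fF; move: FU; rewrite !inE => /or4P[]/eqP->; rewrite ?f1 ?f1' ?f2 ?eqxx.
have fE S : S \in E3 -> f S = 0.
  by move=> SE; have [SX _ mS] := in_E3 SE; apply: fz => //; apply: ne12 SE => //; right.
have [] := @Fdecomp f pf.
- by move=> S SY mS; apply: fz => //; [exact: YX|move=> e; have := Yel j SY; rewrite e jD2' eqxx].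
- by move=> S /hN1[SX iS mS _ _]; apply: fz => // e; have := jD1 iS SX; rewrite e jD2' eqxx.
- by move=> S /hN2[SX jS mS _ SD]; exact: fz.
move=> kp [y [pk ef]].
have y0 : y != 0.
  apply/negP => /eqP y0.
  have [||S|L [pL eL]] := @div_line _ 3 (el k) kp (filter (predC (fun S => r1 S == 0)) E3) pk.
  - by rewrite filter_uniq // uE3.
  - by rewrite size_filter; exact: (sNZ 2).
  - rewrite mem_filter => /andP[/= rS SE]; have [_ kS _] := in_E3 SE; split=> //.
    by have /eqP := fE S SE; rewrite ef y0 mul0r addr0 mulf_eq0 (negbTE rS) => /eqP.
  have ef' S : f S = r1 S * (el k S * L S) by rewrite ef y0 eL mul0r addr0.
  have Lz S : el i S = 0 -> S \in X -> S \notin N1 -> f S = 0 -> L S = 0.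
    move=> iS SX SN /eqP; rewrite ef' !mulf_eq0 (negbTE (nr1 iS SN)) (negbTE (kD12 _ SX)); last by left.
    by move/eqP.
  have [|//|S|c0 [pc ec]] := @div_line _ 2 (el i) L [:: D1; D1'] pL.
  - by rewrite /= inE andbT; apply/eqP.
  - by rewrite !inE => /orP[]/eqP->; split=> //; [exact: (Lz _ iD1 (usr_X u1) D1N f1)|exact: (Lz _ iD1' (usr_X u1') D1N' f1')].
  move: f2'; rewrite ef' ec (pol1_const D2' D2 pc).
  have /eqP := f2; rewrite ef' ec !mulf_eq0 (negbTE (nr1j jD2 D2N)) (negbTE (iD2 jD2 (usr_X u2))) (negbTE (kD12 _ (usr_X u2))); last by right.
  by move/eqP->; rewrite ?mulr0 eqxx ?orbT.
have [s2|s2] := leqP 2 (size Z3).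
  have [A [B [AZ BZ AB]]] := two_of (filter_uniq _ uE3) s2.
  have AE : A \in E3 by move: AZ; rewrite mem_filter => /andP[].
  have BE : B \in E3 by move: BZ; rewrite mem_filter => /andP[].
  by move: y0; rewrite (Z3_two AZ BZ AB ef (fE A AE) (fE B BE)) eqxx.
have [q3 [D3X mD3 pq3 q3D q30]] := u3.
have [] := @Fdecomp q3 pq3.
- by move=> S SY mS; apply: q30 => //; [exact: YX|move=> e; have := Yel k SY; rewrite e kD3 eqxx].
- move=> S /hN1[SX iS mS _ _]; apply: q30 => // e; have h : el k S != 0 by apply: kD12 => //; left.
  by rewrite e kD3 eqxx in h.
- move=> S /hN2[SX jS mS _ _]; apply: q30 => // e; have h : el k S != 0 by apply: kD12 => //; right.
  by rewrite e kD3 eqxx in h.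
move=> k3 [y3 [pk3 eq3]].
pose k' S := y * k3 S + (- y3) * kp S.
have pk' : pol 3 k' by exact: pol_lin.
have ek S : S \in E3 -> y * q3 S = r1 S * k' S.
  move=> SE; have -> : y * q3 S = y * q3 S - y3 * f S by rewrite fE // mulr0 subr0.
  by rewrite eq3 ef /k'; ring.
have D3E : D3 \in E3 by rewrite mem_filter in_E mD3 kD3 eqxx.
have k'3 : k' D3 != 0.
  have : y * q3 D3 != 0 by rewrite mulf_neq0.
  by rewrite ek // mulf_eq0 negb_or => /andP[].
move: k'3; rewrite (pol_line0 (l := el k) (s := rem D3 (filter (predC (fun S => r1 S == 0)) E3)) pk') ?eqxx //.
- by rewrite rem_uniq // filter_uniq // uE3.
- have h4 : (4 <= size (filter (predC (fun S => r1 S == 0%R)) E3))%N.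
    by rewrite size_filter; apply: (count_rest (n := 1)); [rewrite -size_filter -ltnS|exact: sE3].
  have [DI|DI] := boolP (D3 \in filter (predC (fun S => r1 S == 0)) E3).
    by rewrite size_rem // -ltnS (ltn_predK h4).
  by rewrite rem_id //; exact: ltnW.
- move=> S; rewrite (mem_rem_uniq _ (filter_uniq _ uE3)) => /andP[/eqP SD]; rewrite mem_filter => /andP[/= rS SE].
  have [SX kS mS] := in_E3 SE; split=> //.
  by have /eqP := ek S SE; rewrite q30 // mulr0 eq_sym mulf_eq0 (negbTE rS) => /eqP.
Qed.

(** At least two points of [Z3] differ from [D], so the quintic of [D] has no [g'] term. *)
Lemma gamma_conic D : D \in [:: D1; D1'; D2; D2'; D3] -> exists f, pol 3 f /\ usesq m D (fun S => r1 S * f S).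
Proof.
move=> DI; have uD : usr m D by move: DI; rewrite !inE => /or4P[/eqP->|/eqP->|/eqP->|/orP[]/eqP->].
have [q [DX mD pq qD q0]] := uD.
have DN S : S \in Y \/ S \in N1 \/ S \in N2 -> S <> D.
  move=> h e; move: h; rewrite e => -[DY|[DN|DN]].
  - move: DI; rewrite !inE => /or4P[/eqP e1|/eqP e1|/eqP e1|/orP[]/eqP e1];
    [have := Yel i DY|have := Yel i DY|have := Yel j DY|have := Yel j DY|have := Yel k DY]; by rewrite e1 ?iD1 ?iD1' ?jD2 ?jD2' ?kD3 eqxx.
  - have [_ iD _ h1 h1'] := hN1 DN; move: DI; rewrite !inE => /or4P[/eqP//|/eqP//|/eqP e1|/orP[]/eqP e1].
    + by have := jD1 iD DX; rewrite e1 jD2 eqxx.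
    + by have := jD1 iD DX; rewrite e1 jD2' eqxx.
    + by have := @kD12 D (or_introl iD) DX; rewrite e1 kD3 eqxx.
  - have [_ jD _ h2 h2'] := hN2 DN; move: DI; rewrite !inE => /or4P[/eqP e1|/eqP e1|/eqP//|/orP[/eqP//|/eqP e1]].
    + by have := iD2 jD DX; rewrite e1 iD1 eqxx.
    + by have := iD2 jD DX; rewrite e1 iD1' eqxx.
    + by have := @kD12 D (or_intror jD) DX; rewrite e1 kD3 eqxx.
have [] := @Fdecomp q pq.
- by move=> S SY mS; apply: q0 => //; [exact: YX|apply: DN; left].
- by move=> S SN; have [SX _ mS _ _] := hN1 SN; apply: q0 => //; apply: DN; right; left.
- by move=> S SN; have [SX _ mS _ _] := hN2 SN; apply: q0 => //; apply: DN; right; right.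
move=> f [y [pf e]]; exists f; split=> //.
have uZ3 : uniq Z3 := filter_uniq _ uE3.
have s2 : (2 <= size (rem D Z3))%N.
  have [DZ|DZ] := boolP (D \in Z3); last by rewrite rem_id //; apply: ltnW; exact: Z3_size.
  by have := Z3_size; rewrite size_rem //; case: (size Z3).
have [A [B [AZ BZ AB]]] := two_of (rem_uniq _ uZ3) s2.
have inr S : S \in rem D Z3 -> S \in Z3 /\ q S = 0.
  rewrite (mem_rem_uniq _ uZ3) => /andP[/eqP SD SZ]; split=> //.
  by move: SZ; rewrite mem_filter => /andP[_ /in_E3[SX _ mS]]; exact: q0.
have [AZ' qA] := inr A AZ; have [BZ' qB] := inr B BZ.
have y0 := Z3_two AZ' BZ' AB e qA qB.
have e' S : q S = r1 S * f S by rewrite e y0 mul0r addr0.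
split=> //; [by apply: pol_ext pq|by rewrite -e'|].
by move=> P PX PD mP; rewrite -e' q0.
Qed.

End Gamma.

Lemma lprod_cancel (L : seq line) n f : pol n f -> (forall P, lprod L P * f P = 0) -> forall P, f P = 0.
Proof.
elim: L n f => [|l L IH] n f pf h P; first by rewrite -(h P) lprod_nil mul1r.
apply: (pol_cancel (l := l) pf); apply: (IH n.+1); first exact: pol_line.
by move=> S; rewrite -(h S) lprod_cons; ring.
Qed.

(** [r1] divides the quintic of [D1], which is a product of five lines, so [factor] splits it. A
    node whose quintic is [r1] times a conic then uses each of the three lines. *)
Lemma pp_factor : exists (G : seq line) cc, [/\ size G = 3%N, cc != 0, forall P, r1 P = cc * lprod G P &
  forall D f l, pol 3 f -> usesq m D (fun S => r1 S * f S) -> l \in G -> usr l D].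
Proof.
have [g' [pg' kg' det]] := gam_ex.
have [f [pf hf]] := gamma_conic pg' kg' det (mem_head D1 [:: D1'; D2; D2'; D3]).
have D1X := usr_X u1; have [L [sL h1 h2]] := GC D1X.
have [l0 l0L e0] := usr_lns D1X sL h1 h2 u1; have [k0 k00 ek] := eqlP e0.
have e := fund_eq (usesq_fund hf) (lns_fund D1X sL h1 h2).
have [_ mD _ fD _] := hf.
pose al := m D1 * (r1 D1 * f D1) * k0; have al0 : al != 0 := mulf_neq0 (mulf_neq0 mD fD) k00.
pose be := al / lprod L D1; have be0 : be != 0.
  exact: mulf_neq0 al0 (invr_neq0 h1).
have eq1 P : r1 P * f P = be * lprod (rem l0 L) P.
  apply/eqP; rewrite -subr_eq0; apply/eqP.
  have pp : pol 6 (fun S => r1 S * f S - be * lprod (rem l0 L) S).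
    have p1 : pol 6 (lprod (rem l0 L)) by apply: pol_lprod; rewrite size_rem // sL.
    by apply: pol_ext (pol_lin 1 (- be) (@pol_mul 3 2 _ _ pr1 pf) p1) => S; ring.
  apply: (pol_cancel (l := m) pp) => S.
  have e1 : lprod L D1 * (m S * (r1 S * f S)) = m D1 * (r1 D1 * f D1) * lprod L S := e S.
  have e2 := lprod_rem S l0L; have e3 := ek S.
  have lb : lprod L D1 * be = al by rewrite /be mulrC divfK.
  apply: (mulfI h1); rewrite mulr0.
  have -> : lprod L D1 * (m S * (r1 S * f S - be * lprod (rem l0 L) S)) =
    lprod L D1 * (m S * (r1 S * f S)) - lprod L D1 * be * (m S * lprod (rem l0 L) S) by ring.
  by rewrite e1 e2 e3 lb /al; ring.
have sL' : size (rem l0 L) = (3 + 2)%N by rewrite size_rem // sL.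
have [G [cc [sub sG cc0 eG]]] := factor pr1 pf sL' be0 eq1.
exists G, cc; split=> // D f' l pf' hf' gG; have [DX _ _ _ _] := hf'.
exists (fun P => m P * (cc * lprod (rem l G) P * f' P)).
apply: (fund_usesq DX (usesq_fund hf')) => [|P]; last by rewrite eG (lprod_rem _ gG); ring.
apply: pol_line; apply: (@pol_mul 2 2) => //; apply: pol_scale; apply: pol_lprod.
by rewrite size_rem // sG.
Qed.

Let N1full  S : S \in X -> el i S = 0 -> m S != 0 -> S <> D1 -> S <> D1' -> S \in N1.
Proof.
move=> SX iS mS S1 S1'; have /hitP[Q [QX iQ mQ]] := hm i.
have uu : uniq (Q :: D1 :: D1' :: N1).
  rewrite /= !inE !negb_or uN1 D1N D1N' !andbT -!andbA; apply/and4P; split; try by apply/eqP => // e; have := usr_off u1; rewrite -e mQ eqxx.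
  - by apply/eqP => e; have := usr_off u1'; rewrite -e mQ eqxx.
  - by apply/negP => /hN1[_ _]; rewrite mQ eqxx.
have sub : {subset Q :: D1 :: D1' :: N1 <= E i}.
  move=> T; rewrite !inE in_E => /or4P[/eqP->|/eqP->|/eqP->|/hN1[TX -> _ _ _]]; rewrite ?iQ ?iD1 ?iD1' eqxx //.
  - exact: usr_X u1.
  - exact: usr_X u1'.
have [|_ e] := uniq_min_size uu sub; first by rewrite sE /= !ltnS.
have : S \in Q :: D1 :: D1' :: N1 by rewrite e in_E iS eqxx.
by rewrite !inE => /or4P[/eqP e1|/eqP//|/eqP//|//]; rewrite e1 mQ eqxx in mS.
Qed.

Let N2full  S : S \in X -> el j S = 0 -> m S != 0 -> S <> D2 -> S <> D2' -> S \in N2.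
Proof.
move=> SX iS mS S1 S1'; have /hitP[Q [QX iQ mQ]] := hm j.
have uu : uniq (Q :: D2 :: D2' :: N2).
  rewrite /= !inE !negb_or uN2 D2N D2N' !andbT -!andbA; apply/and4P; split; try by apply/eqP => // e; have := usr_off u2; rewrite -e mQ eqxx.
  - by apply/eqP => e; have := usr_off u2'; rewrite -e mQ eqxx.
  - by apply/negP => /hN2[_ _]; rewrite mQ eqxx.
have sub : {subset Q :: D2 :: D2' :: N2 <= E j}.
  move=> T; rewrite !inE in_E => /or4P[/eqP->|/eqP->|/eqP->|/hN2[TX -> _ _ _]]; rewrite ?iQ ?jD2 ?jD2' eqxx //.
  - exact: usr_X u2.
  - exact: usr_X u2'.
have [|_ e] := uniq_min_size uu sub; first by rewrite sE /= !ltnS.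
have : S \in Q :: D2 :: D2' :: N2 by rewrite e in_E iS eqxx.
by rewrite !inE => /or4P[/eqP e1|/eqP//|/eqP//|//]; rewrite e1 mQ eqxx in mS.
Qed.

(** The conic through the five known users, times [r1], vanishes at all nodes off [m] outside
    [el k], and not at all of those on [el k]. The node on [m], [D3] and at least three zeros of
    [r1] leave room for just one node of [el k] where it is nonzero, so this node uses [m]. *)
Lemma third_user : exists D3', [/\ el k D3' = 0, D3' <> D3 & exists f, pol 3 f /\ usesq m D3' (fun S => r1 S * f S)].
Proof.
have [g' [pg' kg' det]] := gam_ex; have [G [cc [sG cc0 eG _]]] := pp_factor.
have [f3 [_ [_ mD3 _ gD3 _]]] := @gamma_conic g' pg' kg' det D3 (mem_last D1 [:: D1'; D2; D2'; D3]).
have rD3 : r1 D3 != 0 by move: gD3; rewrite mulf_eq0 negb_or => /andP[].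
have [f [pf fz fn]] := @conic5 [:: D1; D1'; D2; D2'; D3] isT.
have pF : pol 6 (fun S => r1 S * f S) := @pol_mul 3 2 _ _ pr1 pf.
have Fz S : S \in X -> m S != 0 -> el k S != 0 -> r1 S * f S = 0.
  move=> SX mS kS; have [SY|SY] := boolP (S \in Y); first by rewrite (kr1 SY mS) mul0r.
  have [h hS] := notY SX SY; case/or3P: (cover3 ij (neqs ki) (neqs kj) h) => /eqP e; rewrite e in hS; last by rewrite hS eqxx in kS.
  - have [->|/eqP S1] := eqVneq S D1; first by rewrite fz ?mulr0 // !inE eqxx.
    have [->|/eqP S1'] := eqVneq S D1'; first by rewrite fz ?mulr0 // !inE eqxx !orbT.
    by rewrite zr1 ?mul0r //; exact: N1full.
  - have [->|/eqP S1] := eqVneq S D2; first by rewrite fz ?mulr0 // !inE eqxx !orbT.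
    have [->|/eqP S1'] := eqVneq S D2'; first by rewrite fz ?mulr0 // !inE eqxx !orbT.
    by rewrite r1N2 ?mul0r //; exact: N2full.
have [/hasP[S SX /andP[mS FS]]|/hasPn n] := boolP (has (fun S => (m S != 0) && (r1 S * f S != 0)) X); last first.
  case: fn; apply: (lprod_cancel (L := m :: G) pf) => P; rewrite lprod_cons.
  have : m P * (r1 P * f P) = 0.
    apply: (Xc (pol_line m pF)) => S SX; apply/eqP; rewrite mulf_eq0; have := n S SX; rewrite negb_and !negbK //.
  by move/eqP; rewrite eG !mulf_eq0 (negbTE cc0) /= => h; apply/eqP; rewrite !mulf_eq0 -orbA.
have kS : el k S = 0 by apply/eqP; apply/negP => /negP kS; move: FS; rewrite Fz // eqxx.
have SD3 : S <> D3 by move=> e; move: FS; rewrite e fz ?mulr0 ?eqxx // !inE eqxx !orbT.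
exists S; split=> //; exists f; split=> //; split=> // T TX TS mT.
have [kT|kT] := eqVneq (el k T) 0; last exact: Fz.
apply/eqP; apply/negP => /negP FT.
have TD3 : T <> D3 by move=> e; move: FT; rewrite e fz ?mulr0 ?eqxx // !inE eqxx !orbT.
have rT : r1 T != 0 by move: FT; rewrite mulf_eq0 negb_or => /andP[].
have rS : r1 S != 0 by move: FS; rewrite mulf_eq0 negb_or => /andP[].
have inE3 Q : Q \in X -> el k Q = 0 -> m Q != 0 -> Q \in E3 by move=> QX kQ mQ; rewrite mem_filter in_E mQ kQ eqxx.
have nZ Q : r1 Q != 0 -> Q \notin Z3 by move=> h; rewrite mem_filter (negbTE h).
have [Pk [PkX kPk mPk hPk]] := Pk_ex.
have uZ3 : uniq Z3 := filter_uniq _ uE3.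
have PZ : Pk \notin Z3 by apply/negP; rewrite mem_filter => /andP[_ /in_E3[_ _]]; rewrite mPk eqxx.
have Pne Q : m Q != 0 -> Pk != Q by move=> mQ; apply: contraNneq mQ => <-; rewrite mPk.
have uu : uniq (Pk :: S :: T :: D3 :: Z3).
  rewrite !cons_uniq !inE !negb_or PZ (nZ _ rS) (nZ _ rT) (nZ _ rD3) uZ3 !Pne //= !andbT.
  by do !(apply/andP; split); apply/eqP => // e; apply: TS.
have sub : {subset Pk :: S :: T :: D3 :: Z3 <= E k}.
  move=> Q; rewrite !inE in_E => /or4P[/eqP->|/eqP->|/eqP->|/orP[/eqP->|]]; rewrite ?kPk ?kS ?kT ?kD3 ?eqxx ?SX ?TX ?PkX //.
    exact: usr_X u3.
  by rewrite mem_filter => /andP[_ /in_E3[QX -> _]]; rewrite eqxx.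
have := uniq_leq_size uu sub; rewrite sE /= ltnS => h.
by have := leq_trans (Z3_size pg' kg' det) (h : (size Z3 <= 2)%N).
Qed.

Lemma pp_lines : exists (G : seq line) D3', [/\ size G = 3%N, el k D3' = 0, D3 <> D3',
  forall P, P \in Y -> m P != 0 -> has (fun l => l P == 0) G &
  (forall D l, D \in [:: D1; D1'; D2; D2'; D3; D3'] -> l \in G -> usr l D) /\ usr m D3'].
Proof.
have [g' [pg' kg' det]] := gam_ex; have [G [cc [sG cc0 eG hG]]] := pp_factor.
have [D3' [kD3' D33' [f [pf hf]]]] := third_user.
exists G, D3'; split=> //; first exact: nesym.
  move=> P PY mP; have /eqP := kr1 PY mP.
  by rewrite eG mulf_eq0 (negbTE cc0) /= lprod_eq0.
split; last by exists (fun S => r1 S * f S).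
move=> D l DI lG.
have : D \in [:: D1; D1'; D2; D2'; D3] \/ D = D3'.
  move: DI; rewrite !inE => /or4P[->|->|->|/or3P[->|->|/eqP->]]; rewrite ?orbT; by [left|right].
case=> [DI'|->]; last exact: (hG _ f).
by have [f' [pf' hf']] := gamma_conic pg' kg' det DI'; exact: (hG _ f').
Qed.

End PP.

(* The lines [k1] to [k4] partition [Y], and each of them is used by [x h] and [x' h]. *)
Definition Str (x x' : 'I_3 -> pt) (a b c d : 'I_4) := exists k1 k2 k3 k4 : line,
  [/\ k1 (W a b) = 0 /\ k1 (W c d) = 0, k2 (W a c) = 0 /\ k2 (W b d) = 0,
      [/\ k3 (W a d) = 0, k3 (W b b) = 0 & k3 (W c c) = 0],
      [/\ k4 (W b c) = 0, k4 (W a a) = 0 & k4 (W d d) = 0] &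
      forall h, [/\ el h (x h) = 0, el h (x' h) = 0, x h <> x' h &
        forall l, l \in [:: k1; k2; k3; k4] -> usr l (x h) /\ usr l (x' h)]].

(** The colours are the three factor lines, given to the eight nodes off [m]; nodes on a common
    [lam] get different ones. Up to renaming there are three colourings: two give [Str], the third
    puts all four fourth nodes on one line. *)
Lemma coloring : let r := iota 0 3 in
  all (fun ac => all (fun ad => all (fun bc => all (fun bd => all (fun aa => all (fun bb => all (fun cc => all (fun dd =>
    [&& uniq [:: ac; ad; aa], uniq [:: bc; bd; bb], uniq [:: ac; bc; cc] & uniq [:: ad; bd; dd]] ==>
    [|| [&& bd == ac, bb == ad, cc == ad, aa == bc & dd == bc],
        [&& bc == ad, bb == ac, dd == ac, aa == bd & cc == bd] |
        [&& bb == aa, cc == aa & dd == aa]]) r) r) r) r) r) r) r) r.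
Proof. by vm_compute. Qed.

Lemma color_str (a b c d : 'I_4) m (G : seq line) (x x' : 'I_3 -> pt) : uniq [:: a; b; c; d] ->
  m (W a b) = 0 -> m (W c d) = 0 -> (forall y, ~ eql m (lam y)) -> size G = 3%N ->
  (forall P, P \in Y -> m P != 0 -> has (fun l => l P == 0) G) ->
  (forall h, [/\ el h (x h) = 0, el h (x' h) = 0, x h <> x' h &
        forall l, l \in m :: G -> usr l (x h) /\ usr l (x' h)]) -> Str x x' a b c d \/ Str x x' a b d c.
Proof.
move=> u4 mab mcd mne sG hG hx; have nE := neqE u4.
pose col P := find (fun l => l P == 0) G; pose K (n : nat) := nth m G n.
have KG (n : nat) : (n < 3)%N -> K n \in G by move=> h; rewrite mem_nth ?sG.
have mba : m (W b a) = 0 by rewrite Wsym.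
have mdc : m (W d c) = 0 by rewrite Wsym.
have hc P : P \in Y -> m P != 0 -> col P \in iota 0 3 /\ K (col P) P = 0.
  move=> PY mP; have h := hG P PY mP; split; first by rewrite mem_iota /= add0n -sG -has_find.
  by apply/eqP; exact: (nth_find m h).
have gne l y : l \in G -> ~ eql l (lam y).
  move=> lG e; have [iD iD' nD hl] := hx ord0; apply: nD.
  have [|v v'] := hl l; first by rewrite inE lG orbT.
  by apply: (max_user1 (q4' y) (eql_usr e v) (eql_usr e v') iD iD').
have dd y z t : m (W y z) != 0 -> m (W y t) != 0 -> z != t -> col (W y z) != col (W y t).
  move=> mz mt zt; have [hz kz] := hc _ (WY y z) mz; have [ht kt] := hc _ (WY y t) mt.
  apply/negP => /eqP e; move/eqP: zt; apply; rewrite e in kz.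
  by apply: disj (gne _ y _) kz kt; apply: KG; rewrite mem_iota in ht.
have m0 y z t : m (W y z) = 0 -> t != z -> m (W y t) != 0.
  move=> h tz; apply/negP => /eqP h'; move/eqP: tz; apply; exact: disj (mne y) h' h.
have mac : m (W a c) != 0 by apply: m0 mab _; rewrite nE.
have mad : m (W a d) != 0 by apply: m0 mab _; rewrite nE.
have maa : m (W a a) != 0 by apply: m0 mab _; rewrite nE.
have mbc : m (W b c) != 0 by apply: m0 mba _; rewrite nE.
have mbd : m (W b d) != 0 by apply: m0 mba _; rewrite nE.
have mbb : m (W b b) != 0 by apply: m0 mba _; rewrite nE.
have mcc : m (W c c) != 0 by apply: m0 mcd _; rewrite nE.
have mdd : m (W d d) != 0 by apply: m0 mdc _; rewrite nE.
have [cac zac] := hc _ (WY _ _) mac; have [cad zad] := hc _ (WY _ _) mad; have [caa zaa] := hc _ (WY _ _) maa.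
have [cbc zbc] := hc _ (WY _ _) mbc; have [cbd zbd] := hc _ (WY _ _) mbd; have [cbb zbb] := hc _ (WY _ _) mbb.
have [ccc zcc] := hc _ (WY _ _) mcc; have [cdd zdd] := hc _ (WY _ _) mdd.
have mca : m (W c a) != 0 by rewrite Wsym.
have mda : m (W d a) != 0 by rewrite Wsym.
have mcb : m (W c b) != 0 by rewrite Wsym.
have mdb : m (W d b) != 0 by rewrite Wsym.
have /implyP H := allP (allP (allP (allP (allP (allP (allP (allP coloring _ cac) _ cad) _ cbc) _ cbd) _ caa) _ cbb) _ ccc) _ cdd.
have mem (n : nat) : n \in iota 0 3 -> K n \in m :: G by move=> h; rewrite inE KG ?orbT //; rewrite mem_iota in h.
have Hu : [&& uniq [:: col (W a c); col (W a d); col (W a a)], uniq [:: col (W b c); col (W b d); col (W b b)],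
    uniq [:: col (W a c); col (W b c); col (W c c)] & uniq [:: col (W a d); col (W b d); col (W d d)]].
  have dd' y z t : m (W z y) != 0 -> m (W t y) != 0 -> z != t -> col (W z y) != col (W t y).
    by rewrite !(Wsym _ y); exact: dd.
  rewrite /= !inE !negb_or !andbT.
  by do !(apply/andP; split); first [by apply: dd; rewrite ?nE|by apply: dd'; rewrite ?nE].
case/or3P: (H Hu).
- case/and5P=> /eqP e1 /eqP e2 /eqP e3 /eqP e4 /eqP e5; left.
  rewrite e1 in zbd; rewrite e2 in zbb; rewrite e3 in zcc; rewrite e4 in zaa; rewrite e5 in zdd.
  exists m, (K (col (W a c))), (K (col (W a d))), (K (col (W b c))); split=> // h.
  have [h1 h2 h3 h4] := hx h; split=> // l lI; apply: h4; move: lI.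
  by rewrite !inE => /or4P[]/eqP->; rewrite -in_cons ?mem ?mem_head.
- case/and5P=> /eqP e1 /eqP e2 /eqP e3 /eqP e4 /eqP e5; right.
  rewrite e1 in zbc; rewrite e2 in zbb; rewrite e3 in zdd; rewrite e4 in zaa; rewrite e5 in zcc.
  exists m, (K (col (W a d))), (K (col (W a c))), (K (col (W b d))); split=> // h.
  have [h1 h2 h3 h4] := hx h; split=> // l lI; apply: h4; move: lI.
  by rewrite !inE => /or4P[]/eqP->; rewrite -in_cons ?mem ?mem_head.
- case/and3P=> /eqP e1 /eqP e2 /eqP e3; rewrite e1 in zbb; rewrite e2 in zcc; rewrite e3 in zdd.
  by case: (@fourth_nodes_not_collinear (K (col (W a a)))) => y; case/or4P: (cover4 u4 y) => /eqP->.
Qed.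

(** [x i = D1] is recorded for [cross_le4], where a prescribed node has to be recognised among the
    users of the four lines. *)
Lemma pp_str (a b c d : 'I_4) m i j k D1 D1' D2 D2' D3 : uniq [:: a; b; c; d] -> m (W a b) = 0 -> m (W c d) = 0 ->
  i != j -> k != i -> k != j -> (forall h, hit m h) ->
  usr m D1 -> usr m D1' -> usr m D2 -> usr m D2' -> usr m D3 ->
  el i D1 = 0 -> el i D1' = 0 -> el j D2 = 0 -> el j D2' = 0 -> el k D3 = 0 -> D1 <> D1' -> D2 <> D2' ->
  exists x x', x i = D1 /\ (Str x x' a b c d \/ Str x x' a b d c).
Proof.
move=> u4 mab mcd ij ki kj hm u1 u1' u2 u2' u3 i1 i1' j2 j2' k3 n1 n2.
have mne y : ~ eql m (lam y) := @tri_ne m y hm.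
have [N1 [r1 [uN1 sN1 hN1 [pr1 kr1 zr1 nr1]]]] := pair_data hm u1 u1' i1 i1' n1.
have [N2 [r2 [uN2 sN2 hN2 [pr2 kr2 zr2 nr2]]]] := pair_data hm u2 u2' j2 j2' n2.
have [G [D3' [sG kD3' n3 hG [hu u3']]]] := pp_lines u4 mab mcd mne ij ki kj hm u1 u1' u2 u2' u3 i1 i1' j2 j2' k3 n1 n2
  uN1 sN1 uN2 sN2 hN1 hN2 pr1 kr1 zr1 nr1 pr2 kr2 zr2 nr2.
pose x h := if h == i then D1 else if h == j then D2 else D3.
pose x' h := if h == i then D1' else if h == j then D2' else D3'.
exists x, x'; split; first by rewrite /x eqxx.
apply: (@color_str a b c d m G x x') => // h; rewrite /x /x'.
have hl D : usr m D -> D \in [:: D1; D1'; D2; D2'; D3; D3'] -> forall l, l \in m :: G -> usr l D.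
  by move=> v DI l; rewrite inE => /orP[/eqP->//|]; exact: hu.
have [->|hi] := eqVneq h i; first by split=> // l lG; split; apply: hl lG; rewrite // !inE eqxx ?orbT.
have [->|hj] := eqVneq h j; first by split=> // l lG; split; apply: hl lG; rewrite // !inE eqxx ?orbT.
have -> : h = k by have := cover3 ij (neqs ki) (neqs kj) h; rewrite (negbTE hi) (negbTE hj) => /eqP.
by split=> // l lG; split; apply: hl lG; rewrite // !inE eqxx ?orbT.
Qed.

Lemma str_ex (a b c d : 'I_4) : uniq [:: a; b; c; d] -> (forall l, l (W c c) = 0 -> l (W d d) = 0 -> l (W a b) <> 0) ->
  exists x x', Str x x' a b c d \/ Str x x' a b d c.
Proof.
move=> u4 nb; have [m [i [j [k [D1 [D1' [D2 [D2' [D3 [[mab mcd] [ij ki kj] hm [n1 n2] [[u1 i1] [u1' i1'] [u2 j2] [u2' j2'] [u3 k3]]]]]]]]]]]] := pp_count u4 nb.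
have [x [x' [_ h]]] := pp_str u4 mab mcd ij ki kj hm u1 u1' u2 u2' u3 i1 i1' j2 j2' k3 n1 n2.
by exists x, x'.
Qed.

(** * The remaining twelve primary nodes *)

(** The linear form in the proof vanishes at [W x x] by construction and at [W z t] because [lam z]
    and [lam t] do, hence along [l]; at [W y y] this is the identity. *)
Lemma bad_eq l (x y z t : 'I_4) : uniq [:: x; y; z; t] -> l (W x x) = 0 -> l (W y y) = 0 -> l (W z t) = 0 ->
  lam z (W x x) * lam t (W y y) = lam t (W x x) * lam z (W y y).
Proof.
move=> u4 lx ly lzt; have nE := neqE u4.
have pf : pol 2 (fun S => lam t (W x x) * lam z S - lam z (W x x) * lam t S).
  by apply: pol_ext (pol_lin (lam t (W x x)) (- lam z (W x x)) (pol_lev 0 (lam z)) (pol_lev 0 (lam t))) => S; ring.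
have ne : W x x <> W z t by move=> e; have := lW z x x; rewrite e lW !nE eqxx.
have us : uniq [:: W x x; W z t] by rewrite /= inE andbT; apply/eqP.
apply/esym/eqP; rewrite -subr_eq0; apply/eqP; apply: (pol_line0 (l := l) pf us) ly => // S.
rewrite !inE => /orP[]/eqP->; split=> //; first by ring.
by rewrite lW0 lW1; ring.
Qed.

Lemma lW_neq0 (x y z : 'I_4) : x != y -> x != z -> lam x (W y z) != 0.
Proof. by move=> xy xz; rewrite lW negb_or xy. Qed.

(** A linear form is determined by its values at the three vertices of a triangle; the coefficients
    are nonzero since no vertex is on the fourth line. *)
Lemma lam_comb (a b c d : 'I_4) : uniq [:: a; b; c; d] -> exists al be ga : R, [/\ al != 0, be != 0, ga != 0 &
  forall S, lam d S = al * lam a S + be * lam b S + ga * lam c S].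
Proof.
move=> u4; have nE := neqE u4.
have z x y : lam x (W x y) = 0 by exact: lW0.
have z' x y : lam x (W y x) = 0 by exact: lW1.
have nbc : lam a (W b c) != 0 by rewrite lW_neq0 ?nE.
have nac : lam b (W a c) != 0 by rewrite lW_neq0 ?nE.
have nab : lam c (W a b) != 0 by rewrite lW_neq0 ?nE.
have dbc : lam d (W b c) != 0 by rewrite lW_neq0 ?nE.
have dac : lam d (W a c) != 0 by rewrite lW_neq0 ?nE.
have dab : lam d (W a b) != 0 by rewrite lW_neq0 ?nE.
pose al := lam d (W b c) / lam a (W b c); pose be := lam d (W a c) / lam b (W a c); pose ga := lam d (W a b) / lam c (W a b).
exists al, be, ga; split; try exact: mulf_neq0 _ (invr_neq0 _).
move=> S; apply/eqP; rewrite -subr_eq0; apply/eqP.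
have pf : pol 2 (fun S => lam d S - (al * lam a S + be * lam b S + ga * lam c S)).
  apply: pol_ext (pol_lin 1 (-1) (pol_lev 0 (lam d)) (pol_lin 1 ga (pol_lin al be (pol_lev 0 (lam a)) (pol_lev 0 (lam b))) (pol_lev 0 (lam c)))) => T; ring.
have fab : lam d (W a b) - (al * lam a (W a b) + be * lam b (W a b) + ga * lam c (W a b)) = 0.
  by rewrite z z' /ga divfK //; ring.
have fac : lam d (W a c) - (al * lam a (W a c) + be * lam b (W a c) + ga * lam c (W a c)) = 0.
  by rewrite z z' /be divfK //; ring.
have fbc : lam d (W b c) - (al * lam a (W b c) + be * lam b (W b c) + ga * lam c (W b c)) = 0.
  by rewrite z z' /al divfK //; ring.
have [||T|g [pg eg]] := @div_line _ 2 (lam a) _ [:: W a b; W a c] pf => //.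
- by rewrite /= inE andbT; apply/eqP => /W_inj/eqP; rewrite nE.
- by rewrite !inE => /orP[]/eqP->; split.
have g0 : g (W b c) = 0 by have /eqP := eg (W b c); rewrite fbc eq_sym mulf_eq0 (negbTE nbc) => /eqP.
by rewrite eg (pol1_const S (W b c) pg) g0 mulr0.
Qed.

Lemma cross_cancel (g u v A B : R) : u * (A + g * v) = (B + g * u) * v -> u * A = B * v.
Proof. by move=> e; apply: (addIr (u * (g * v))); rewrite -mulrDr e; ring. Qed.

(* With barycentric coordinates on three of the lines, three of the collinearities force equal
   coordinates, and the other two give [3 = 0]. *)
Lemma five_bad (a b c d : 'I_4) : uniq [:: a; b; c; d] ->
  (exists l, [/\ l (W a a) = 0, l (W b b) = 0 & l (W c d) = 0]) -> (exists l, [/\ l (W a a) = 0, l (W c c) = 0 & l (W b d) = 0]) ->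
  (exists l, [/\ l (W b b) = 0, l (W c c) = 0 & l (W a d) = 0]) -> (exists l, [/\ l (W a a) = 0, l (W d d) = 0 & l (W b c) = 0]) ->
  (exists l, [/\ l (W b b) = 0, l (W d d) = 0 & l (W a c) = 0]) -> False.
Proof.
move=> u4 [l1 [h1 h1' h1'']] [l2 [h2 h2' h2'']] [l3 [h3 h3' h3'']] [l4 [h4 h4' h4'']] [l5 [h5 h5' h5'']].
have nE := neqE u4; have [al [be [ga [al0 be0 ga0 e]]]] := lam_comb u4.
have p x y z t : x != y -> x != z -> x != t -> y != z -> y != t -> z != t -> uniq [:: x; y; z; t].
  by move=> *; rewrite /= !inE !negb_or; do !(apply/andP; split).
have e1 := bad_eq u4 h1 h1' h1''.
have e2 : lam b (W a a) * lam d (W c c) = lam d (W a a) * lam b (W c c) by apply: bad_eq h2 h2' h2''; apply: p; rewrite nE.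
have e3 : lam a (W b b) * lam d (W c c) = lam d (W b b) * lam a (W c c) by apply: bad_eq h3 h3' h3''; apply: p; rewrite nE.
have e4 : lam b (W a a) * lam c (W d d) = lam c (W a a) * lam b (W d d) by apply: bad_eq h4 h4' h4''; apply: p; rewrite nE.
have e5 : lam a (W b b) * lam c (W d d) = lam c (W b b) * lam a (W d d) by apply: bad_eq h5 h5' h5''; apply: p; rewrite nE.
have n x y : (x == y) = false -> lam x (W y y) != 0 by move=> xy; rewrite lW_neq0 ?xy.
have := n d a; have := n d b; have := n d c.
rewrite !e !lW0 !nE => /(_ erefl) nd3 /(_ erefl) nd2 /(_ erefl) nd1.
move: e1 e2 e3 nd1 nd2 nd3; rewrite !e !lW0 !mulr0 ?addr0 ?add0r.
have pb0 : be * lam b (W a a) != 0 by rewrite mulf_neq0 ?n ?nE.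
have pc0 : ga * lam c (W a a) != 0 by rewrite mulf_neq0 ?n ?nE.
have qa0 : al * lam a (W b b) != 0 by rewrite mulf_neq0 ?n ?nE.
have qc0 : ga * lam c (W b b) != 0 by rewrite mulf_neq0 ?n ?nE.
have ra0 : al * lam a (W c c) != 0 by rewrite mulf_neq0 ?n ?nE.
have rb0 : be * lam b (W c c) != 0 by rewrite mulf_neq0 ?n ?nE.
have sc0 : ga * lam c (W d d) != 0 by rewrite mulf_neq0 ?n ?nE.
have sd : al * lam a (W d d) + be * lam b (W d d) + ga * lam c (W d d) = 0 by rewrite -e lW0.
move=> e1 e2 e3 nd1 nd2 nd3.
rewrite [X in _ = X * _]addrC in e2; rewrite addrC [X in _ = X * _]addrC in e3.
have {}e1 := cross_cancel e1; have {}e2 := cross_cancel e2; have {}e3 := cross_cancel e3.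
move: nd1 pb0 pc0 qa0 qc0 ra0 rb0 sc0 sd.
set pb := be * lam b (W a a); set pc := ga * lam c (W a a); set qa := al * lam a (W b b); set qc := ga * lam c (W b b).
set ra := al * lam a (W c c); set rb := be * lam b (W c c); set sa := al * lam a (W d d); set sb := be * lam b (W d d); set sc := ga * lam c (W d d).
move=> nd1 pb0 pc0 qa0 qc0 ra0 rb0 sc0 sd.
have {}e1 : pc * qa = pb * qc by rewrite /pc -mulrA e1 mulrCA.
have {}e2 : pb * ra = pc * rb by rewrite /pb -mulrA e2 mulrCA.
have {}e3 : qa * rb = qc * ra by rewrite /qa -mulrA e3 mulrCA.
have {}e4 : pb * sc = pc * sb by rewrite /pb /sc /pc /sb mulrACA e4; ring.
have {}e5 : qa * sc = qc * sa by rewrite /qa /sc /qc /sa mulrACA e5; ring.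
have pp : pb = pc.
  have h : (pb + pc) * (pb - pc) * (qa * rb) = 0.
    have -> : (pb + pc) * (pb - pc) * (qa * rb) = pb * pb * (qa * rb) - (pc * qa) * (pc * rb) by ring.
    by rewrite e1 -e2 e3; ring.
  apply/eqP; rewrite -subr_eq0; apply/eqP; apply: (mulfI nd1); apply: (mulIf (mulf_neq0 qa0 rb0)).
  by rewrite mulr0 mul0r.
have qq : qa = qc by apply: (mulfI pb0); rewrite {1}pp e1.
have s1 : sc = sb by apply: (mulfI pb0); rewrite e4 pp.
have s2 : sc = sa by apply: (mulfI qa0); rewrite e5 qq.
by move/eqP: sd; rewrite -s1 -s2 -mulr2n -mulrSr mulrn_eq0 (negbTE sc0).
Qed.

Lemma dj m (x y z : 'I_4) : ~ eql m (lam x) -> m (W x y) = 0 -> y != z -> m (W x z) != 0.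
Proof. by move=> ne my yz; apply/negP => /eqP mz; rewrite (disj ne my mz) eqxx in yz. Qed.

Section Three.
Variables (x y z t : 'I_4) (g : line) (i : 'I_3) (U : seq pt).
Hypotheses (u4 : uniq [:: x; y; z; t]) (ne : forall h, ~ eql g (lam h)) (gx : g (W x x) = 0) (gz : g (W z t) = 0).
Hypotheses (uU : uniq U) (hU : forall D, D \in U -> usr g D /\ el i D = 0) (s3 : (3 <= size U)%N).
Variables N1 N2 : pt.
Hypotheses (N1X : N1 \in X) (N2X : N2 \in X) (iN1 : el i N1 = 0) (iN2 : el i N2 = 0) (gN1 : g N1 != 0) (gN2 : g N2 != 0).
Hypotheses (N1U : N1 \notin U) (N2U : N2 \notin U) (N12 : N1 <> N2) (zN1 : lam z N1 != 0) (tN1 : lam t N1 != 0).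

Lemma three_cubic S : S \in Y -> exists r, [/\ pol 4 r, forall P, P \in Y -> g P != 0 -> r P = 0, r S = 0, r N1 = 0 /\ r N2 = 0 &
  ~ forall P, r P = 0].
Proof.
move=> SY; have [||r [pr r0 rs _ [D _ rD]]] := @cubic g i U [:: S] uU hU.
- exact: s3.
- by move=> T; rewrite inE => /eqP->; exact: Y_offi.
exists r; split=> //.
- move=> P PY gP; apply: r0 => //; [exact: YX|exact: Y_offi|].
  by apply/negP => /hU[_ iP]; have := Yel i PY; rewrite iP eqxx.
- by apply: rs; rewrite mem_head.
- by split; apply: r0 => //; exact: el_offi.
- by move=> h; rewrite h eqxx in rD.
Qed.

(** The cubic killed at [W z t] is the product of [lam z], [lam t] and a linear form vanishing at
    [N1] and [W x y]. If [N2] were on neither line, this form would vanish on [el i] and at [W x y],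
    hence be zero. *)
Lemma three_N2 : lam z N2 = 0 \/ lam t N2 = 0.
Proof.
have nE := neqE u4; have [r [pr rY rS [rN1 rN2] nr]] := three_cubic (WY z t).
have gzt : g (W t z) = 0 by rewrite Wsym.
have rW h h' : g (W h h') != 0 -> r (W h h') = 0 by apply: rY; exact: WY.
have [||P|q [pq eq1]] := @div_line _ 4 (lam z) r (map (W z) [:: x; y; z; t]) pr.
- by rewrite (map_inj_uniq (@W_inj z)).
- by [].
- case/mapP => h hI ->; split; first exact: lW0.
  have [->|ht] := eqVneq h t; first by [].
  by apply: rW; apply: (dj (@ne z) gz); rewrite eq_sym.
have [||P|L [pL eL]] := @div_line _ 3 (lam t) q (map (W t) [:: x; y; t]) pq.
- by rewrite (map_inj_uniq (@W_inj t)) /= !inE !nE.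
- by [].
- case/mapP => h hI ->; split; first exact: lW0.
  have hz : h != z by move: hI; rewrite !inE => /or3P[]/eqP->; rewrite nE.
  have /eqP : r (W t h) = 0 by apply: rW; apply: (dj (@ne t) gzt); rewrite eq_sym.
  by rewrite eq1 mulf_eq0 lW (eq_sym z h) (negbTE hz) nE => /eqP.
have LN1 : L N1 = 0.
  by have /eqP := rN1; rewrite eq1 eL !mulf_eq0 (negbTE zN1) (negbTE tN1) => /eqP.
have Lxy : L (W x y) = 0.
  have /eqP : r (W x y) = 0 by apply: rW; apply: (dj (@ne x) gx); rewrite nE.
  by rewrite eq1 eL !mulf_eq0 !lW !nE => /eqP.
have /eqP := rN2; rewrite eq1 eL !mulf_eq0 => /or3P[/eqP|/eqP|/eqP LN2]; [by left|by right|exfalso; apply: nr].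
have [||P|c [pc ec]] := @div_line _ 2 (el i) L [:: N1; N2] pL.
- by rewrite /= inE andbT; apply/eqP.
- by [].
- by rewrite !inE => /orP[]/eqP->.
have c0 : c (W x y) = 0.
  by have /eqP := Lxy; rewrite ec mulf_eq0 (negbTE (Yel i (WY x y))) => /eqP.
by move=> P; rewrite eq1 eL ec (pol1_const P (W x y) pc) c0 !mulr0.
Qed.

(** The cubic killed at [W x x] is divisible by [lam x], by [lam z] with [N2] as third zero, and by
    [lam t]; the constant left is zero because [N1] is on none of them. *)
Lemma three_false : lam x N1 != 0 -> lam z N2 = 0 -> False.
Proof.
move=> xN1 zN2; have nE := neqE u4; have [r [pr rY rS [rN1 rN2] nr]] := three_cubic (WY x x); apply: nr.
have gzt : g (W t z) = 0 by rewrite Wsym.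
have rW h h' : g (W h h') != 0 -> r (W h h') = 0 by apply: rY; exact: WY.
have N2Y := elY iN2.
have [||P|q [pq eq1]] := @div_line _ 4 (lam x) r (map (W x) [:: x; y; z; t]) pr.
- by rewrite (map_inj_uniq (@W_inj x)).
- by [].
- case/mapP => h hI ->; split; first exact: lW0.
  have [->|ht] := eqVneq h x; first by [].
  by apply: rW; apply: (dj (@ne x) gx); rewrite eq_sym.
have [||P|q' [pq' eq2]] := @div_line _ 3 (lam z) q (N2 :: map (W z) [:: y; z]) pq.
- rewrite cons_uniq (map_inj_uniq (@W_inj z)) /= !inE !nE !andbT.
  by apply: contra N2Y => /orP[]/eqP->; exact: WY.
- by [].
- rewrite inE => /orP[/eqP->|/mapP[h hI ->]].
    split=> //; have /eqP := rN2; rewrite eq1 mulf_eq0 => /orP[/eqP xN2|/eqP//].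
    by case: (@lam_meet x z N2) => //; rewrite nE.
  split; first exact: lW0.
  have ht : h != t by move: hI; rewrite !inE => /orP[]/eqP->; rewrite nE.
  have hx : h != x by move: hI; rewrite !inE => /orP[]/eqP->; rewrite nE.
  have /eqP : r (W z h) = 0 by apply: rW; apply: (dj (@ne z) gz); rewrite eq_sym.
  by rewrite eq1 mulf_eq0 lW (eq_sym x h) (negbTE hx) nE => /eqP.
have [||P|c [pc ec]] := @div_line _ 2 (lam t) q' (map (W t) [:: y; t]) pq'.
- by rewrite (map_inj_uniq (@W_inj t)) /= !inE !nE.
- by [].
- move=> /mapP[h hI ->]; split; first exact: lW0.
  have hz : h != z by move: hI; rewrite !inE => /orP[]/eqP->; rewrite nE.
  have hx : h != x by move: hI; rewrite !inE => /orP[]/eqP->; rewrite nE.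
  have /eqP : r (W t h) = 0 by apply: rW; apply: (dj (@ne t) gzt); rewrite eq_sym.
  by rewrite eq1 eq2 !mulf_eq0 !lW (eq_sym x h) (eq_sym z h) (negbTE hz) (negbTE hx) !nE => /eqP.
have c0 : c N1 = 0.
  by have /eqP := rN1; rewrite eq1 eq2 ec !mulf_eq0 (negbTE xN1) (negbTE zN1) (negbTE tN1) => /eqP.
by move=> P; rewrite eq1 eq2 ec (pol1_const P N1 pc) c0 !mulr0.
Qed.
End Three.

(** If [N1] avoids both lines, [N2] is on one of them. As [N1] is not on both [lam x] and [lam y],
    one of these can serve in [three_false]. *)
Lemma bad_three (x y z t : 'I_4) (g : line) i U N1 N2 : uniq [:: x; y; z; t] -> (forall h, ~ eql g (lam h)) ->
  g (W x x) = 0 -> g (W y y) = 0 -> g (W z t) = 0 -> uniq U -> (forall D, D \in U -> usr g D /\ el i D = 0) -> (3 <= size U)%N ->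
  N1 \in X -> N2 \in X -> el i N1 = 0 -> el i N2 = 0 -> g N1 != 0 -> g N2 != 0 -> N1 \notin U -> N2 \notin U -> N1 <> N2 ->
  lam z N1 = 0 \/ lam t N1 = 0.
Proof.
move=> u4 ne gx gy gz uU hU s3 N1X N2X iN1 iN2 gN1 gN2 N1U N2U N12.
have [|zN1] := eqVneq (lam z N1) 0; [by left|]; have [|tN1] := eqVneq (lam t N1) 0; [by right|exfalso].
have nE := neqE u4; have p : uniq [:: x; y; t; z] /\ uniq [:: y; x; z; t] /\ uniq [:: y; x; t; z] by rewrite /= !inE !nE.
have [p1 [p2 p3]] := p; have gzt : g (W t z) = 0 by rewrite Wsym.
have h2 := three_N2 u4 ne gx gz uU hU s3 N1X N2X iN1 iN2 gN1 gN2 N1U N2U N12 zN1 tN1.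
have [xN1|xN1] := eqVneq (lam x N1) 0; last first.
  case: h2 => h; first exact: (three_false u4 ne gx gz uU hU s3 N1X N2X iN1 iN2 gN1 gN2 N1U N2U zN1 tN1 xN1).
  exact: (three_false p1 ne gx gzt uU hU s3 N1X N2X iN1 iN2 gN1 gN2 N1U N2U tN1 zN1 xN1).
have yN1 : lam y N1 != 0 by apply/negP => /eqP yN1; case: (@lam_meet x y N1) => //; [rewrite nE|exact: elY iN1].
case: h2 => h; first exact: (three_false p2 ne gy gz uU hU s3 N1X N2X iN1 iN2 gN1 gN2 N1U N2U zN1 tN1 yN1).
exact: (three_false p3 ne gy gzt uU hU s3 N1X N2X iN1 iN2 gN1 gN2 N1U N2U tN1 zN1 yN1).
Qed.

Lemma size_el U : (forall D, D \in U -> exists i, el i D = 0) -> (size U <= \sum_(i < 3) count (fun D => el i D == 0%R) U)%N.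
Proof.
move=> hU; have -> : (\sum_(i < 3) count (fun D => el i D == 0%R) U = \sum_(D <- U) \sum_(i < 3) (el i D == 0%R))%N.
  by rewrite exchange_big; apply: eq_bigr => i _; rewrite -sum1_count big_mkcond.
rewrite -sum1_size big_seq [leqRHS]big_seq; apply: leq_sum => D DU.
by have [i iD] := hU D DU; rewrite (bigD1 i) //= iD eqxx.
Qed.

(** Two users on one [el i] force all of them there, and [ybound] allows three; otherwise there is
    at most one on each of three lines. *)
Lemma miss_le3 (g : line) (y : 'I_4) U : (forall P, P \in Y -> lam y P = 0 -> g P != 0) -> (size (ym g) <= 2)%N -> uniq U ->
  (forall D, D \in U -> usr g D /\ exists i, el i D = 0) -> (size U <= 3)%N.
Proof.
move=> mis y2 uU hU; have [/existsP[i h2]|/existsPn h] := boolP [exists i, 2 <= count (fun D => el i D == 0%R) U]%N.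
  have [t [ut st ht]] := take_count uU h2; have [D [D' [Dt D't DD]]] := two_of ut (eq_leq (esym st)).
  have [DU /eqP iD] := ht D Dt; have [DU' /eqP iD'] := ht D' D't.
  apply: leq_trans (ybound (m := g) (i := i) uU _) (y2 : (_ < 3)%N) => S SU.
  have [uS [j jS]] := hU S SU; split=> //.
  by rewrite -(lemV_single (q4' y) mis (hU D DU).1 (hU D' DU').1 iD iD' DD uS jS).
have c1 i : (count (fun D => el i D == 0%R) U <= 1)%N by rewrite leqNgt; exact: h.
apply: (@leq_trans (\sum_(i < 3) count (fun D => el i D == 0%R) U)%N).
  by apply: size_el => D /hU[].
apply: (@leq_trans (\sum_(i < 3) 1)%N); first by apply: leq_sum => i _; exact: c1.
by rewrite sum_nat_const card_ord.
Qed.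

Lemma el_more i s : (size s <= 4)%N -> exists N1 N2, [/\ [/\ N1 \in X, N2 \in X, el i N1 = 0 & el i N2 = 0], N1 <> N2, N1 \notin s & N2 \notin s].
Proof.
move=> ss; have h2 : (2 <= count (predC (mem s)) (E i))%N.
  apply: (count_rest (n := 4)); last by rewrite sE.
  apply: leq_trans ss; rewrite -size_filter; apply: uniq_leq_size; first exact: filter_uniq (uE i).
  by move=> S; rewrite mem_filter => /andP[].
have [t [ut st ht]] := take_count (uE i) h2; have [N1 [N2 [t1 t2 N12]]] := two_of ut (eq_leq (esym st)).
have [E1 S1] := ht _ t1; have [E2 S2] := ht _ t2.
move: E1 E2; rewrite !in_E => /andP[/eqP i1 X1] /andP[/eqP i2 X2].
by exists N1, N2.
Qed.

Lemma lprod_rem4 (L : seq line) (l1 l2 l3 l4 : line) : uniq [:: l1; l2; l3; l4] -> {subset [:: l1; l2; l3; l4] <= L} -> size L = 6%N ->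
  exists n n' : line, {subset [:: n; n'] <= L} /\ forall P, lprod L P = l1 P * (l2 P * (l3 P * (l4 P * (n P * n' P)))).
Proof.
rewrite /= !inE !negb_or !andbT -!andbA => /and5P[n12 n13 n14 n23 /andP[n24 n34]] sub sL.
have remin (s : seq line) u v : u != v -> v \in s -> v \in rem u s.
  by move=> uv; apply: rem_mem; rewrite eq_sym.
have I1 : l1 \in L by apply: (sub); rewrite inE eqxx.
have I2 : l2 \in rem l1 L by apply: (remin) => //; apply: (sub); rewrite !inE eqxx orbT.
have I3 : l3 \in rem l2 (rem l1 L) by do 2 (apply: (remin) => //); apply: (sub); rewrite !inE eqxx !orbT.
have I4 : l4 \in rem l3 (rem l2 (rem l1 L)) by do 3 (apply: (remin) => //); apply: (sub); rewrite !inE eqxx !orbT.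
have s2 : size (rem l4 (rem l3 (rem l2 (rem l1 L)))) = 2%N by rewrite !size_rem // sL.
case Er : (rem l4 (rem l3 (rem l2 (rem l1 L)))) s2 => [|n [|n' [|//]]] // _.
exists n, n'; split=> [l|P].
  by rewrite -Er => /mem_rem/mem_rem/mem_rem/mem_rem.
rewrite (lprod_rem _ I1) (lprod_rem _ I2) (lprod_rem _ I3) (lprod_rem _ I4) Er !lprod_cons lprod_nil; ring.
Qed.

Section Fin.
Variables (a b c d : 'I_4) (x x' : 'I_3 -> pt) (k1 k2 k3 k4 : line).
Hypothesis u4 : uniq [:: a; b; c; d].
Hypotheses (k1ab : k1 (W a b) = 0) (k1cd : k1 (W c d) = 0) (k2ac : k2 (W a c) = 0) (k2bd : k2 (W b d) = 0).
Hypotheses (k3ad : k3 (W a d) = 0) (k3b : k3 (W b b) = 0) (k3c : k3 (W c c) = 0).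
Hypotheses (k4bc : k4 (W b c) = 0) (k4a : k4 (W a a) = 0) (k4d : k4 (W d d) = 0).
Definition KK := [:: k1; k2; k3; k4].
Hypothesis hx : forall h, [/\ el h (x h) = 0, el h (x' h) = 0, x h <> x' h &
  forall l, l \in KK -> usr l (x h) /\ usr l (x' h)].

Lemma KKne l y : l \in KK -> ~ eql l (lam y).
Proof.
move=> lK e; have [h1 h2 h3 h4] := hx ord0; have [u u'] := h4 l lK; apply: h3.
exact: (max_user1 (q4' y) (eql_usr e u) (eql_usr e u') h1 h2).
Qed.

Lemma KKhit l i : l \in KK -> hit l i.
Proof.
move=> lK; have [j ji] := other i; have [h1 _ _ h4] := hx j; have [u _] := h4 l lK.
by apply/hitP; exact: (meets u h1 (neqs ji)).
Qed.

Definition Uu i w w' := w = x i /\ w' = x' i \/ w = x' i /\ w' = x i.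

Lemma Uu_sym i w w' : Uu i w w' -> Uu i w' w.
Proof. by case=> -[-> ->]; [right|left]. Qed.

Lemma UuP i w w' : Uu i w w' -> [/\ el i w = 0, w \in X, w <> w' & forall l, l \in KK -> usr l w].
Proof.
have [h1 h2 h3 h4] := hx i; have [v v'] := h4 k1 (mem_head _ _).
by case=> -[-> ->]; split=> //; [exact: usr_X v|move=> l /h4[]|exact: usr_X v'|exact: nesym|move=> l /h4[]].
Qed.

Lemma Uu0 i : Uu i (x i) (x' i). Proof. by left. Qed.

Lemma xlines i w w' : Uu i w w' -> exists n n' : line, [/\ usr n w, usr n' w &
  forall P, P \in X -> P <> w -> (forall l, l \in KK -> l P != 0) -> n P = 0 \/ n' P = 0].
Proof.
move=> /UuP[iw wX _ uK]; have [L [sL h1 h2]] := GC wX.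
have kl l : l \in KK -> exists2 l', l' \in L & eql l' l by move=> /uK; exact: usr_lns.
have [l1 L1 e1] := kl k1 (mem_head _ _).
have [|l2 L2 e2] := kl k2; first by rewrite !inE eqxx orbT.
have [|l3 L3 e3] := kl k3; first by rewrite !inE eqxx !orbT.
have [|l4 L4 e4] := kl k4; first by rewrite !inE eqxx !orbT.
have nE := neqE u4; have sw := Wsym.
have dif l l' (k k' : line) (s t r : 'I_4) : k \in KK -> eql l k -> eql l' k' -> k (W s t) = 0 -> k' (W s r) = 0 -> t != r -> l != l'.
  move=> kK ee ee' kt kr tr; apply/eqP => ll; move/eqP: tr; apply; apply: (disj (KKne (y := s) kK) kt).
  by apply/eqP; rewrite -ee ll ee' kr.
have u : uniq [:: l1; l2; l3; l4].
  rewrite /= !inE !negb_or !andbT -!andbA; apply/and5P; split; last apply/andP; try split.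
  - by apply: (dif _ _ _ _ a b c _ e1 e2); rewrite ?nE ?inE ?eqxx ?orbT.
  - by apply: (dif _ _ _ _ a b d _ e1 e3); rewrite ?nE ?inE ?eqxx ?orbT.
  - by apply: (dif _ _ _ _ b a c _ e1 e4); rewrite ?nE ?inE ?eqxx ?orbT // sw.
  - by apply: (dif _ _ _ _ a c d _ e2 e3); rewrite ?nE ?inE ?eqxx ?orbT.
  - by apply: (dif _ _ _ _ b d c _ e2 e4); rewrite ?nE ?inE ?eqxx ?orbT.
  - by apply: (dif _ _ _ _ a d a _ e3 e4); rewrite ?nE ?inE ?eqxx ?orbT.
have sub : {subset [:: l1; l2; l3; l4] <= L} by move=> l; rewrite !inE => /or4P[]/eqP->.
have [n [n' [nL eL]]] := lprod_rem4 u sub sL.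
exists n, n'; split; [apply: (lns_usr wX sL h1 h2); apply: nL; rewrite !inE eqxx ?orbT // ..|].
move=> P PX Pw Pk; have /eqP := h2 P PX Pw; rewrite eL !mulf_eq0 e1 e2 e3 e4.
by rewrite (negbTE (Pk k1 _)) ?(negbTE (Pk k2 _)) ?(negbTE (Pk k3 _)) ?(negbTE (Pk k4 _)) ?inE ?eqxx ?orbT //= => /orP[]/eqP; [left|right].
Qed.

(* A primary node on [el i] other than the two users of [k1] to [k4]. *)
Definition Vat i D := [/\ D \in X, el i D = 0, D <> x i & D <> x' i].

Lemma Ukoff i w w' l : Uu i w w' -> l \in KK -> l w != 0.
Proof. by move=> /UuP[_ _ _ uK] /uK/usr_off. Qed.

Lemma UVeq i D : D \in X -> el i D = 0 -> (exists w, Uu i D w) \/ Vat i D.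
Proof.
move=> DX iD; have [->|/eqP h1] := eqVneq D (x i); first by left; exists (x' i); left.
have [->|/eqP h2] := eqVneq D (x' i); first by left; exists (x i); right.
by right.
Qed.

(** If [D] avoided [KK], the two residual lines of a user on another [el j] would have to contain
    [D], [x i] and [x' i], three nodes of [el i], which each line meets only once. *)
Lemma Vk i D : Vat i D -> exists2 l : line, l \in KK & l D = 0.
Proof.
move=> [DX iD n n']; have [/hasP[l lK /eqP lD]|/hasPn h] := boolP (has (fun l => l D == 0) KK); first by exists l.
exfalso; have [j ji] := other i; have [m [m' [um um' hm]]] := xlines (Uu0 j).
have [jx _ _ _] := UuP (Uu0 j); have [ix xX xx uK] := UuP (Uu0 i); have [ix' xX' _ uK'] := UuP (Uu_sym (Uu0 i)).
have ne P : P \in X -> el i P = 0 -> P <> x j by move=> PX iP e; have := eld' PX iP ji; rewrite e jx eqxx.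
have hD := hm D DX (ne _ DX iD) h.
have h1 := hm _ xX (ne _ xX ix) (fun l lK => Ukoff (Uu0 i) lK).
have h2 := hm _ xX' (ne _ xX' ix') (fun l lK => Ukoff (Uu_sym (Uu0 i)) lK).
have mu l P Q : usr l (x j) -> el i P = 0 -> el i Q = 0 -> l P = 0 -> l Q = 0 -> P = Q.
  by move=> ul iP iQ lP lQ; exact: (meet_uniq ul jx iP lP iQ lQ).
case: hD h1 h2 => hD [h1|h1] [h2|h2]; [apply: n|apply: n|apply: n'|apply: xx|apply: xx|apply: n'|apply: n|apply: n];
  by [exact: (mu m)|exact: (mu m')].
Qed.

Lemma KKY l h : l \in KK -> exists y, l (W h y) = 0.
Proof.
move=> lK; case/or4P: (cover4 u4 h) => /eqP->; move: lK; rewrite !inE => /or4P[]/eqP->;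
  by [exists a|exists b|exists c|exists d|exists a; rewrite Wsym|exists b; rewrite Wsym|exists c; rewrite Wsym].
Qed.

(** [D] is on a line of [KK], and each of these already meets [lam h] in a node of [Y]. *)
Lemma Vlam h i D : Vat i D -> lam h D != 0.
Proof.
move=> vD; have [l lK lD] := Vk vD; have [y ly] := KKY h lK; apply/negP => /eqP hD.
have [_ iD _ _] := vD; apply: (KKne (y := h) lK); apply: (@line2 _ _ _ D (W h y)); rewrite ?lW0 //.
by move=> e; have := elY iD; rewrite e WY.
Qed.

(** [D] would be a third user on [el i]. For [k1] and [k2] this contradicts [pp_le2]; for [k3] and
    [k4], [bad_three] would put a node satisfying [Vat] on some [lam]. *)
Lemma KK_users l i D : l \in KK -> usr l D -> Vat i D -> False.
Proof.
move=> lK uD vD; have [DX iD n n'] := vD; have hl := KKhit i lK.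
have [i1 i2 xx uK] := hx i; have [v v'] := uK l lK.
have uU : uniq [:: x i; x' i; D].
  by rewrite /= !inE !negb_or !andbT; do !(apply/andP; split); apply/eqP => //; exact: nesym.
have hU S : S \in [:: x i; x' i; D] -> usr l S /\ el i S = 0 by rewrite !inE => /or3P[]/eqP->.
have nE := neqE u4; have ne y := KKne (y := y) lK.
have three (s t p q : 'I_4) : uniq [:: s; t; p; q] -> l (W s s) = 0 -> l (W t t) = 0 -> l (W p q) = 0 -> False.
  move=> us ls lt lp; have /hitP[P [PX iP lP]] := hl.
  have [//|N1 [N2 [[N1X N2X N1i N2i] N12]]] := el_more i (s := [:: P; x i; x' i; D]).
  rewrite in_cons negb_or => /andP[P1 U1]; rewrite in_cons negb_or => /andP[P2 U2].
  have lN N : el i N = 0 -> N != P -> l N != 0.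
    by move=> iN; apply: contra => /eqP lN; apply/eqP; exact: (meet_uniq uD iD iN lN iP lP).
  have vN : Vat i N1 by split=> // e; rewrite e !inE eqxx ?orbT in U1.
  have := bad_three us ne ls lt lp uU hU isT N1X N2X N1i N2i (lN _ N1i P1) (lN _ N2i P2) U1 U2 N12.
  by case=> h; [have := Vlam p vN|have := Vlam q vN]; rewrite h eqxx.
move: (lK); rewrite !inE => /or4P[]/eqP e; subst l.
- by have := pp_le2 u4 (@fourth_nodes_not_collinear) ne k1ab k1cd uU hU hl.
- have u4' : uniq [:: a; c; b; d] by rewrite /= !inE !nE.
  by have := pp_le2 u4' (@fourth_nodes_not_collinear) ne k2ac k2bd uU hU hl.
- by apply: (three b c a d) => //; rewrite /= !inE !nE.
- by apply: (three a d b c) => //; rewrite /= !inE !nE.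
Qed.

(** [lam h] meets the two other [el] in nodes, which by [Vlam] are among the users of [KK]. The two
    residual lines of [x i], and likewise those of [x' i], cover these nodes and their partners, and
    [max_user1] leaves one way to pair them. So both nodes have the same residual lines, one of
    which passes through a node using it. *)
Lemma lam_users h i D : usr (lam h) D -> Vat i D -> False.
Proof.
move=> uD vD; have [DX iD nD nD'] := vD; have [j ji] := other i; have [k [ki kj hk]] := third (neqs ji).
have UQ r : r != i -> exists Q y, Uu r Q y /\ lam h Q = 0.
  move=> ri; have [Q [QX rQ lQ]] := meets uD iD ri.
  case: (UVeq QX rQ) => [[w hw]|vQ]; first by exists Q, w.
  by have := Vlam h vQ; rewrite lQ eqxx.
have [Qj [y [Uj lQj]]] := UQ j ji; have [Qk [z [Uk lQk]]] := UQ k ki.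
have [jQ QjX Qjy _] := UuP Uj; have [jy yX _ _] := UuP (Uu_sym Uj).
have [kQ QkX Qkz _] := UuP Uk; have [kz zX _ _] := UuP (Uu_sym Uk).
have jkne P Q : P \in X -> el j P = 0 -> el k Q = 0 -> P <> Q.
  by move=> PX jP kQ' e; have := eld' PX jP kj; rewrite e kQ' eqxx.
have ine w P r : el i w = 0 -> P \in X -> el r P = 0 -> r != i -> P <> w.
  by move=> iw PX rP ri e; have := eld' PX rP (neqs ri); rewrite e iw eqxx.
have claim w w' : Uu i w w' -> exists n n' : line, [/\ usr n w, usr n' w, n Qj = 0 /\ n z = 0, n' y = 0 /\ n' Qk = 0 & n w' = 0 \/ n' w' = 0].
  move=> Uw; have [iw wX ww uK] := UuP Uw; have [iw' wX' _ _] := UuP (Uu_sym Uw).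
  have Dw : D <> w by case: Uw => -[-> _].
  have [m [m' [um um' hm]]] := xlines Uw.
  have mQ (n : line) : usr n w -> n Qj = 0 -> n Qk = 0 -> False.
    move=> un nj nk; have e : eql n (lam h) by apply: (@line2 _ _ _ Qj Qk) => //; exact: jkne.
    by apply: Dw; exact: (max_user1 (q4' h) uD (eql_usr e un) iD iw).
  have mj (n : line) : usr n w -> n Qj = 0 -> n y = 0 -> False.
    by move=> un nj ny; apply: Qjy; exact: (meet_uniq un iw jQ nj jy ny).
  have mk (n : line) : usr n w -> n Qk = 0 -> n z = 0 -> False.
    by move=> un nj ny; apply: Qkz; exact: (meet_uniq un iw kQ nj kz ny).
  have hQj := hm _ QjX (ine _ _ _ iw QjX jQ ji) (fun l lK => Ukoff Uj lK).
  have hy := hm _ yX (ine _ _ _ iw yX jy ji) (fun l lK => Ukoff (Uu_sym Uj) lK).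
  have hQk := hm _ QkX (ine _ _ _ iw QkX kQ ki) (fun l lK => Ukoff Uk lK).
  have hz := hm _ zX (ine _ _ _ iw zX kz ki) (fun l lK => Ukoff (Uu_sym Uk) lK).
  have hw := hm _ wX' (nesym ww) (fun l lK => Ukoff (Uu_sym Uw) lK).
  case: hQj => hQj.
    case: hy => hy; first by case: (mj m).
    case: hQk => hQk; first by case: (mQ m).
    by case: hz => hz; [exists m, m'|case: (mk m')].
  case: hy => hy; last by case: (mj m').
  case: hQk => hQk; last by case: (mQ m').
  case: hz => hz; first by case: (mk m).
  by exists m', m; split=> //; case: hw; [right|left].
have [n [n' [un un' [n1 n2] [n3 n4] hw]]] := claim _ _ (Uu0 i).
have [m [m' [um um' [m1 m2] [m3 m4] _]]] := claim _ _ (Uu_sym (Uu0 i)).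
have e : eql n m by apply: (@line2 _ _ _ Qj z) => //; exact: jkne.
have e' : eql n' m' by apply: (@line2 _ _ _ y Qk) => //; exact: jkne.
by case: hw => /eqP; [rewrite e (negbTE (usr_off um))|rewrite e' (negbTE (usr_off um'))].
Qed.

Lemma sum3 (f : 'I_3 -> nat) : (\sum_(i < 3) f i = f o0 + f o1 + f o2)%N.
Proof.
rewrite !big_ord_recl big_ord0 addn0 addnA; congr (_ + _ + _)%N; congr (f _); exact: val_inj.
Qed.

Lemma num5 (f : 'I_3 -> nat) : (forall i, f i <= 2)%N -> (5 <= \sum_(i < 3) f i)%N ->
  exists i j k, [/\ [/\ i != j, k != i & k != j], (2 <= f i)%N, (2 <= f j)%N & (1 <= f k)%N].
Proof.
move=> h; rewrite sum3 => s; have h0 := h o0; have h1 := h o1; have h2 := h o2.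
have [e0|e0] := leqP 2 (f o0); have [e1|e1] := leqP 2 (f o1).
- by exists o0, o1, o2; split=> //; move: s h0 h1 h2 e0 e1; clear; lia.
- by exists o0, o2, o1; split=> //; move: s h0 h1 h2 e0 e1; clear; lia.
- by exists o1, o2, o0; split=> //; move: s h0 h1 h2 e0 e1; clear; lia.
- by exfalso; move: s h0 h1 h2 e0 e1; clear; lia.
Qed.

Lemma num7 (f : 'I_3 -> nat) : (forall i, f i <= 3)%N -> (7 <= \sum_(i < 3) f i)%N ->
  exists i j k, [/\ i != j, k != i & k != j] /\ ([/\ 3 <= f i, 3 <= f j & 1 <= f k]%N \/ [/\ 3 <= f i, 2 <= f j & 2 <= f k]%N).
Proof.
move=> h; rewrite sum3 => s; have h0 := h o0; have h1 := h o1; have h2 := h o2.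
have [e0|e0] := leqP 3 (f o0); have [e1|e1] := leqP 3 (f o1).
- by exists o0, o1, o2; split=> //; left; split=> //; move: s h0 h1 h2 e0 e1; clear; lia.
- have [e2|e2] := leqP 3 (f o2).
    by exists o0, o2, o1; split=> //; left; split=> //; move: s h0 h1 h2 e0 e1 e2; clear; lia.
  by exists o0, o1, o2; split=> //; right; split=> //; move: s h0 h1 h2 e0 e1 e2; clear; lia.
- have [e2|e2] := leqP 3 (f o2).
    by exists o1, o2, o0; split=> //; left; split=> //; move: s h0 h1 h2 e0 e1 e2; clear; lia.
  by exists o1, o0, o2; split=> //; right; split=> //; move: s h0 h1 h2 e0 e1 e2; clear; lia.
- by exists o2, o0, o1; split=> //; right; split=> //; move: s h0 h1 h2 e0 e1; clear; lia.
Qed.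

Section Users.
Variables (g : line) (U : seq pt).
Hypotheses (uU : uniq U) (hU : forall D, D \in U -> usr g D /\ exists i, Vat i D).
Definition Un i := [seq D <- U | el i D == 0].

Lemma uUn i : uniq (Un i). Proof. exact: filter_uniq. Qed.

Lemma hUn i D : D \in Un i -> usr g D /\ Vat i D.
Proof.
rewrite mem_filter => /andP[/eqP iD /hU[uD [j vD]]]; split=> //.
by have [DX jD _ _] := vD; have -> : i = j := eld DX iD jD.
Qed.

Lemma hUn' i D : D \in Un i -> usr g D /\ el i D = 0.
Proof. by move=> /hUn[uD []]. Qed.

Lemma sUn : (size U <= \sum_(i < 3) size (Un i))%N.
Proof.
apply: leq_trans (size_el _) _ => [D /hU[_ [i [_ iD _ _]]]|]; first by exists i.
by apply: leq_sum => i _; rewrite size_filter.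
Qed.

(** More users than one [el i] can have are spread over two of these lines, and a used line meets
    every [el] except possibly that of its user. *)
Lemma Un_hit (n : nat) : (forall i, size (Un i) <= n)%N -> (n < size U)%N -> forall i, hit g i.
Proof.
move=> h nU i; have [j ji] := other i; have [k [kj ki hk]] := third ji.
have aux h' : h' != i -> Un h' != [::] -> hit g i.
  move=> hi; case E0 : (Un h') => [//|D s] _; have [|uD hD] := @hUn' h' D; first by rewrite E0 mem_head.
  by apply/hitP; exact: (meets uD hD (neqs hi)).
have [e1|] := eqVneq (Un j) [::]; last exact: aux.
have [e2|] := eqVneq (Un k) [::]; last exact: aux.
have : (size U <= size (Un i))%N.
  apply: leq_trans sUn _; rewrite (bigD1 i) //= big1 ?addn0 // => h' hi.
  by case/or3P: (hk h') => /eqP e; rewrite e ?e1 ?e2 // in hi *; rewrite eqxx in hi.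
by move/(leq_trans nU); rewrite ltnNge h.
Qed.
End Users.

(** Five users are at least 2, 2 and 1 on the [el i], so [pp_str] yields a second structure
    containing [g]. One of its lines joins the same intersections as [k1] or [k2] and is used by
    [D1], against [KK_users]. *)
Lemma cross_le4 (g : line) U : (forall h, ~ eql g (lam h)) -> g (W a d) = 0 -> g (W b c) = 0 -> uniq U ->
  (forall D, D \in U -> usr g D /\ exists i, Vat i D) -> (size U <= 4)%N.
Proof.
move=> ne gad gbc uU hU; rewrite leqNgt; apply/negP => s5; have nE := neqE u4.
have v4 : uniq [:: a; d; b; c] by rewrite /= !inE !nE.
have y2 : (size (ym g) <= 2)%N.
  rewrite -[2%N]/(size [:: W a d; W b c]); apply: uniq_leq_size (uym g) _ => P; rewrite in_ym => /andP[/eqP gP PY].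
  have gcb : g (W c b) = 0 by rewrite Wsym.
  have [->|->|e|e] := on_ab v4 ne gad PY gP; rewrite ?inE ?eqxx ?orbT //.
    by have := disj (ne b) gbc (z := b); rewrite -e => /(_ gP)/eqP; rewrite nE.
  by have := disj (ne c) gcb (z := c); rewrite -e => /(_ gP)/eqP; rewrite nE.
have c3 i : (size (Un U i) <= 3)%N by apply: leq_trans (ybound (uUn uU i) (@hUn' g U hU i)) _.
have hg := Un_hit hU c3 (leq_trans (isT : (3 < 5)%N) s5).
have c2 i : (size (Un U i) <= 2)%N := pp_le2 v4 (@fourth_nodes_not_collinear) ne gad gbc (uUn uU i) (@hUn' g U hU i) (hg i).
have [i [j [k [[ij ki kj] ci cj ck]]]] := num5 c2 (leq_trans s5 (sUn hU)).
have [D1 [D1' [d1 d1' n1]]] := two_of (uUn uU i) ci; have [D2 [D2' [d2 d2' n2]]] := two_of (uUn uU j) cj.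
have [D3 d3] : exists D3, D3 \in Un U k by case: (Un U k) ck => // D s _; exists D; rewrite mem_head.
have [[u1 i1] [u1' i1'] [u2 j2] [u2' j2'] [u3 k3']] := And5 (hUn' hU d1) (hUn' hU d1') (hUn' hU d2) (hUn' hU d2') (hUn' hU d3).
have [y [y' [ey hS]]] := pp_str v4 gad gbc ij ki kj hg u1 u1' u2 u2' u3 i1 i1' j2 j2' k3' n1 n2.
have [_ vD] := hUn hU d1.
case: hS => -[m1 [m2 [m3 [m4 [_ [h1 h2] _ _ hS]]]]]; have [_ _ _ /(_ m2)] := hS i; rewrite !inE eqxx orbT => /(_ isT)[um _];
  rewrite ey in um.
- have e : eql m2 k1 by apply: (@line2 _ _ _ (W a b) (W c d)) => //; [apply: W_neq; rewrite !inE !nE|rewrite Wsym].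
  by apply: (KK_users (l := k1) _ (eql_usr e um) vD); rewrite !inE eqxx.
- have e : eql m2 k2 by apply: (@line2 _ _ _ (W a c) (W b d)) => //; [apply: W_neq; rewrite !inE !nE|rewrite Wsym].
  by apply: (KK_users (l := k2) _ (eql_usr e um) vD); rewrite !inE eqxx orbT.
Qed.

Lemma hit2_miss la i j k : size (ym la) = 4%N -> i != j -> k != i -> k != j -> hit la i -> hit la j -> ~~ hit la k.
Proof.
move=> s4 ij ki kj hi hj; apply/negP => hk.
have h h' : hit la h' by case/or3P: (cover3 ij (neqs ki) (neqs kj) h') => /eqP->.
exact: (max_hit3 s4).
Qed.

Section Bad.
Variables (p q z t : 'I_4) (g : line).
Hypothesis v4 : uniq [:: p; q; z; t].
Hypotheses (ne : forall h, ~ eql g (lam h)) (gp : g (W p p) = 0) (gq : g (W q q) = 0) (gz : g (W z t) = 0).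

Let vE := neqE v4.
Let gt : g (W t z) = 0. Proof. by rewrite Wsym. Qed.

Lemma gWz h : h != t -> g (W z h) != 0.
Proof. by move=> ht; apply: (dj (@ne z) gz); rewrite eq_sym. Qed.

Lemma gWt h : h != z -> g (W t h) != 0.
Proof. by move=> ht; apply: (dj (@ne t) gt); rewrite eq_sym. Qed.

Lemma gWpq : g (W p q) != 0.
Proof. by apply: (dj (@ne p) gp); rewrite vE. Qed.

Lemma bad_ym : (size (ym g) <= 3)%N.
Proof.
rewrite -[3%N]/(size [:: W p p; W q q; W z t]); apply: uniq_leq_size (uym g) _ => P; rewrite in_ym => /andP[/eqP gP PY].
have v4' : uniq [:: z; t; p; q] by rewrite /= !inE !vE.
have [->|e|->|->] := on_ab v4' (@ne) gz PY gP; rewrite ?inE ?eqxx ?orbT //.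
by have := gWpq; rewrite -e gP eqxx.
Qed.

Lemma lam_off (n : pt) : n \notin Y -> lam z n = 0 \/ lam t n = 0 -> g n != 0.
Proof.
move=> nY h; apply/negP => /eqP gn.
have ne' : n <> W z t by move=> e; rewrite e WY in nY.
by case: h => h; [apply: (@ne z)|apply: (@ne t)]; apply: (line2 ne') => //; rewrite ?lW0 ?lW1.
Qed.

Lemma lamz_div (n : nat) f s : pol n f -> (forall h, f (W z h) = 0) -> uniq s -> (n <= 4 + size s)%N ->
  (forall S, S \in s -> [/\ S \notin Y, lam z S = 0 & f S = 0]) ->
  exists f', pol n.-1 f' /\ forall P, f P = lam z P * f' P.
Proof.
move=> pf fW us ss hs; apply: (div_line (s := map (W z) [:: p; q; z; t] ++ s)) => //.
  rewrite cat_uniq (map_inj_uniq (@W_inj z)) v4 us andbT; apply/hasPn => S /hs[SY _ _].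
  by apply: contra SY => /mapP[h _ ->]; exact: WY.
by move=> P; rewrite mem_cat => /orP[/mapP[h _ ->]|/hs[]//]; rewrite lW0.
Qed.

(** Only three nodes of [lam t] count: [W t z] is also on [lam z], which has been divided out
    before. *)
Lemma lamt_div (n : nat) f s : pol n f -> (forall h, h != z -> f (W t h) = 0) -> uniq s -> (n <= 3 + size s)%N ->
  (forall S, S \in s -> [/\ S \notin Y, lam t S = 0 & f S = 0]) ->
  exists f', pol n.-1 f' /\ forall P, f P = lam t P * f' P.
Proof.
move=> pf fW us ss hs; apply: (div_line (s := map (W t) [:: p; q; t] ++ s)) => //.
  rewrite cat_uniq (map_inj_uniq (@W_inj t)) us andbT; apply/andP; split; first by rewrite /= !inE !vE.
  apply/hasPn => S /hs[SY _ _].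
  by apply: contra SY => /mapP[h _ ->]; exact: WY.
move=> P; rewrite mem_cat => /orP[/mapP[h hI ->]|/hs[]//]; rewrite lW0 fW //.
by move: hI; rewrite !inE => /or3P[]/eqP->; rewrite vE.
Qed.

Section Kill.
Variables (i j k : 'I_3) (Ui Uj Uk : seq pt).
Hypotheses (ij : i != j) (ki : k != i) (kj : k != j) (hg : forall h, hit g h).
Hypotheses (uUi : uniq Ui) (uUj : uniq Uj) (uUk : uniq Uk).
Hypotheses (hUi : forall D, D \in Ui -> usr g D /\ Vat i D) (hUj : forall D, D \in Uj -> usr g D /\ Vat j D)
  (hUk : forall D, D \in Uk -> usr g D /\ Vat k D).

Let UU := Ui ++ Uj ++ Uk.

Lemma UU_V D : D \in UU -> exists h, Vat h D.
Proof. by rewrite !mem_cat => /or3P[/hUi[_ v]|/hUj[_ v]|/hUk[_ v]]; [exists i|exists j|exists k]. Qed.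

Lemma UU_u D : D \in UU -> usr g D.
Proof. by rewrite !mem_cat => /or3P[/hUi[]|/hUj[]|/hUk[]]. Qed.

Let excl h h' D : h != h' -> Vat h D -> Vat h' D -> False.
Proof. by move=> hh [DX hD _ _] [_ hD' _ _]; have := eld' DX hD (neqs hh); rewrite hD' eqxx. Qed.

Lemma uUU : uniq UU.
Proof.
rewrite /UU !cat_uniq uUi uUj uUk !andbT /=; apply/andP; split; last first.
  by apply/hasPn => D /hUk[_ v]; apply/negP => /hUj[_ v']; exact: (excl kj v v').
apply/hasPn => D; rewrite mem_cat => /orP[/hUj[_ v]|/hUk[_ v]]; apply/negP => /hUi[_ v']; first exact: (excl ij v' v).
exact: (excl ki v v').
Qed.

Lemma UUY S : S \in Y -> S \notin UU.
Proof. by move=> SY; apply/negP => /UU_V[h [_ hS _ _]]; have := Yel h SY; rewrite hS eqxx. Qed.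

Lemma UUlam S h : lam h S = 0 -> S \notin UU.
Proof. by move=> hS; apply/negP => /UU_V[h' v]; have := Vlam h v; rewrite hS eqxx. Qed.

Lemma UUj S : el j S = 0 -> S \in UU -> S \in Uj.
Proof.
move=> iS /[dup] /UU_u/usr_X SX; rewrite !mem_cat => /or3P[/hUi[_ [_ h _ _]]|//|/hUk[_ [_ h _ _]]].
  by have := eld' SX iS ij; rewrite h eqxx.
by have := eld' SX iS kj; rewrite h eqxx.
Qed.

Lemma UUk S : el k S = 0 -> S \in UU -> S \in Uk.
Proof.
move=> iS /[dup] /UU_u/usr_X SX; rewrite !mem_cat => /or3P[/hUi[_ [_ h _ _]]|/hUj[_ [_ h _ _]]|//].
  by have := eld' SX iS (neqs ki); rewrite h eqxx.
by have := eld' SX iS (neqs kj); rewrite h eqxx.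
Qed.

Lemma getf s : (size s < size UU)%N -> W z t \in s -> exists f, [/\ pol 6 f,
  forall S, S \in X -> g S != 0 -> S \notin UU -> f S = 0, forall S, S \in s -> f S = 0,
  (forall h, f (W z h) = 0) /\ (forall h, h != z -> f (W t h) = 0) /\ f (W p q) = 0 & ~ forall S, f S = 0].
Proof.
move=> ss sz; have [f [pf f0 fs _ [D _ fD]]] := Wm uUU UU_u ss.
have fY h h' : g (W h h') != 0 -> f (W h h') = 0.
  by move=> gW; apply: f0 => //; [exact: YX (WY _ _)|exact: UUY (WY _ _)].
exists f; split=> //; last by move=> h; rewrite h eqxx in fD.
split; last by split=> [h hz|]; apply: fY; [exact: gWt|exact: gWpq].
by move=> h; have [->|ht] := eqVneq h t; [exact: fs|apply: fY; exact: gWz].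
Qed.

Lemma lam_pt (h : 'I_4) i' : h \in [:: z; t] -> hit (lam h) i' -> exists n : pt, [/\ n \in X, el i' n = 0, lam h n = 0, n \notin Y & g n != 0 /\ n \notin UU].
Proof.
move=> hI /hitP[n [nX iN hn]]; have nY := elY iN; exists n; split=> //; split; last exact: UUlam hn.
by apply: lam_off => //; move: hI; rewrite !inE => /orP[]/eqP e; rewrite e in hn; [left|right].
Qed.

Lemma nhit h i' P : ~~ hit (lam h) i' -> P \in X -> el i' P = 0 -> lam h P != 0.
Proof. by move=> /negP nh PX iP; apply/negP => /eqP hP; apply: nh; apply/hitP; exists P. Qed.

Lemma gpt i' : exists Q, [/\ Q \in X, el i' Q = 0, g Q = 0 & forall P, P \in X -> el i' P = 0 -> P != Q -> g P != 0].
Proof.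
have /hitP[Q [QX iQ gQ]] := hg i'; exists Q; split=> // P PX iP; apply: contra => /eqP gP.
apply/negP => /negP PQ; have := Yel i' (WY p p).
by rewrite -(line2 (elimN eqP PQ) gP gQ iP iQ) gp eqxx.
Qed.

(* Each killing argument divides a quintic vanishing off [g] and the users by [lam z], [lam t]
   and the primaries, until a constant vanishing at [W p q] remains. *)
Lemma kill32 : size Ui = 3%N -> size Uj = 2%N -> Uk = [::] -> hit (lam z) i -> hit (lam t) i ->
  hit (lam z) j || hit (lam t) j.
Proof.
move=> si sj sk hz ht; apply/negP => /negP; rewrite negb_or => /andP[nz nt].
have [Pk [PkX kPk gPk hPk]] := gpt k; have [Pj [PjX jPj gPj hPj]] := gpt j.
have [n1 [n1X in1 zn1 n1Y [gn1 n1U]]] := lam_pt (mem_head z [:: t]) hz.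
have [n2 [n2X in2 tn2 n2Y [gn2 n2U]]] := lam_pt (mem_last z [:: t]) ht.
(* Four conditions against five users. The lines [el k], [lam z], [lam t], [el j], [el i] then carry
   the required 6, 5, 4, 3, 2 zeros. *)
have [||f [pf f0 fs [fz [ft fpq]] nf]] := @getf [:: Pk, W z t & take 2 Ui].
- by rewrite /= size_takel ?si // /UU !size_cat si sj sk.
- by rewrite !inE eqxx orbT.
have kk S : S \in X -> el k S = 0 -> f S = 0.
  move=> SX kS; have [->|SP] := eqVneq S Pk; first by apply: fs; rewrite mem_head.
  by apply: f0; [|exact: hPk|apply/negP => /(UUk kS); rewrite sk].
have [||f1 [pf1 e1]] := @divX 6 (el k) f [::] pf; [by rewrite addn0 el6|by move=> P PX kP _; exact: kk|].
have f1z S : f S = 0 -> el k S != 0 -> f1 S = 0 by move=> /eqP; rewrite e1 mulf_eq0 => /orP[->//|/eqP].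
have [||||f2 [pf2 e2]] := @lamz_div 5 f1 [:: n1] pf1; [by move=> h; apply: f1z => //; exact: Yel (WY _ _)|by []|by []| |].
  move=> S; rewrite inE => /eqP->; split=> //; apply: f1z; first exact: f0.
  by apply: (eld' n1X in1).
have f2z S : f S = 0 -> el k S != 0 -> lam z S != 0 -> f2 S = 0.
  by move=> fS kS; move/eqP: (f1z S fS kS); rewrite e2 mulf_eq0 => /orP[->//|/eqP].
have zWt h : h != z -> lam z (W t h) != 0 by move=> hz'; rewrite lW vE eq_sym.
have [||||f3 [pf3 e3]] := @lamt_div 4 f2 [:: n2] pf2; [|by []|by []| |].
- by move=> h hz'; apply: f2z; [exact: ft|exact: Yel (WY _ _)|exact: zWt].
- move=> S; rewrite inE => /eqP->; split=> //; apply: f2z; [exact: f0|exact: (eld' n2X in2)|].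
  by apply/negP => /eqP zn2; case: (@lam_meet z t n2); rewrite ?vE.
have f3z S : f S = 0 -> el k S != 0 -> lam z S != 0 -> lam t S != 0 -> f3 S = 0.
  by move=> fS kS zS; move/eqP: (f2z S fS kS zS); rewrite e3 mulf_eq0 => /orP[->//|/eqP].
have [||f4 [pf4 e4]] := @divX 3 (el j) f3 (Pj :: Uj) pf3; [by rewrite /= sj el6| |].
  move=> P PX jP; rewrite inE negb_or => /andP[PP PU]; apply: f3z.
  - by apply: f0; [|exact: hPj|apply/negP => /(UUj jP); rewrite (negbTE PU)].
  - exact: (eld' PX jP).
  - exact: nhit nz PX jP.
  - exact: nhit nt PX jP.
have f4z S : f S = 0 -> el k S != 0 -> lam z S != 0 -> lam t S != 0 -> el j S != 0 -> f4 S = 0.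
  by move=> fS kS zS tS; move/eqP: (f3z S fS kS zS tS); rewrite e4 mulf_eq0 => /orP[->//|/eqP].
have [||P PU|f5 [pf5 e5]] := @div_line _ 2 (el i) f4 (take 2 Ui) pf4; [by rewrite take_uniq|by rewrite size_takel ?si| |].
  have [_ v] := hUi (mem_take PU); have [PX iP _ _] := v; split=> //; apply: f4z.
  - by apply: fs; rewrite !inE PU !orbT.
  - exact: (eld' PX iP).
  - exact: Vlam v.
  - exact: Vlam v.
  - by apply: (eld' PX iP); exact: neqs.
apply: nf => S; rewrite e1 e2 e3 e4 e5 (pol1_const S (W p q) pf5).
have f4pq : f4 (W p q) = 0 by apply: f4z => //; rewrite ?lW ?vE //; exact: Yel (WY _ _).
have /eqP := f4pq; rewrite e5 mulf_eq0 (negbTE (Yel i (WY p q))) => /eqP->.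
by rewrite !mulr0.
Qed.

Lemma kill322 : size Ui = 3%N -> size Uj = 2%N -> size Uk = 2%N -> hit (lam z) i -> hit (lam t) i ->
  hit (lam z) j -> hit (lam t) k -> False.
Proof.
move=> si sj sk hz ht hzj htk.
have nzk := hit2_miss (q4 z) ij ki kj hz hzj.
have ntj := hit2_miss (q4 t) (neqs ki) (neqs ij) (neqs kj) ht htk.
have [Pk [PkX kPk gPk hPk]] := gpt k; have [Pj [PjX jPj gPj hPj]] := gpt j.
have [n1 [n1X in1 zn1 n1Y [gn1 n1U]]] := lam_pt (mem_head z [:: t]) hz.
have [n2 [n2X in2 tn2 n2Y [gn2 n2U]]] := lam_pt (mem_last z [:: t]) ht.
have [m1 [m1X jm1 zm1 m1Y [gm1 m1U]]] := lam_pt (mem_head z [:: t]) hzj.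
have [m2 [m2X km2 tm2 m2Y [gm2 m2U]]] := lam_pt (mem_last z [:: t]) htk.
have zt (n : pt) : n \notin Y -> lam t n = 0 -> lam z n != 0.
  by move=> nY tn; apply/negP => /eqP zn; case: (@lam_meet z t n); rewrite ?vE.
(* Six conditions against seven users. The required zeros are found on [lam z], [lam t], [el j],
   [el k], [el i], although one user on [el k] and one on [el i] are not killed. *)
have [||f [pf f0 fs [fz [ft fpq]] nf]] := @getf (W z t :: Uj ++ take 1 Uk ++ take 2 Ui).
- by rewrite /= !size_cat !size_takel ?si ?sk // sj.
- by rewrite mem_head.
have [||||f1 [pf1 e1]] := @lamz_div 6 f [:: n1; m1] pf; [by []| |by []| |].
- by rewrite /= inE andbT; apply/eqP => e; have := eld' n1X in1 (neqs ij); rewrite e jm1 eqxx.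
- by move=> S; rewrite !inE => /orP[]/eqP->; split=> //; exact: f0.
have f1z S : f S = 0 -> lam z S != 0 -> f1 S = 0 by move=> /eqP; rewrite e1 mulf_eq0 => /orP[->//|/eqP].
have [||||f2 [pf2 e2]] := @lamt_div 5 f1 [:: n2; m2] pf1; [| |by []| |].
- by move=> h hz'; apply: f1z; [exact: ft|rewrite lW vE eq_sym].
- by rewrite /= inE andbT; apply/eqP => e; have := eld' n2X in2 ki; rewrite e km2 eqxx.
- by move=> S; rewrite !inE => /orP[]/eqP->; split=> //; apply: f1z; [exact: f0|exact: zt|exact: f0|exact: zt].
have f2z S : f S = 0 -> lam z S != 0 -> lam t S != 0 -> f2 S = 0.
  by move=> fS zS; move/eqP: (f1z S fS zS); rewrite e2 mulf_eq0 => /orP[->//|/eqP].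
have zuniq i' A B : lam z A = 0 -> lam z B = 0 -> el i' A = 0 -> el i' B = 0 -> A = B by apply: max_el_uniq; rewrite q4.
have tuniq i' A B : lam t A = 0 -> lam t B = 0 -> el i' A = 0 -> el i' B = 0 -> A = B by apply: max_el_uniq; rewrite q4.
have [||f3 [pf3 e3]] := @divX 4 (el j) f2 [:: Pj; m1] pf2; [by rewrite el6| |].
  move=> P PX jP; rewrite !inE negb_or => /andP[PP Pm]; apply: f2z.
  - have [PU|PU] := boolP (P \in UU); last by apply: f0 => //; exact: hPj.
    by apply: fs; rewrite inE mem_cat (UUj jP PU) orbT.
  - by apply: contra Pm => /eqP zP; apply/eqP; exact: (zuniq j).
  - exact: nhit ntj PX jP.
have f3z S : f S = 0 -> lam z S != 0 -> lam t S != 0 -> el j S != 0 -> f3 S = 0.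
  by move=> fS zS tS; move/eqP: (f2z S fS zS tS); rewrite e3 mulf_eq0 => /orP[->//|/eqP].
have [||f4 [pf4 e4]] := @divX 3 (el k) f3 [:: Pk, m2 & drop 1 Uk] pf3; [by rewrite /= size_drop sk el6| |].
  move=> P PX kP; rewrite !inE !negb_or => /and3P[PP Pm Pd]; apply: f3z.
  - have [PU|PU] := boolP (P \in UU); last by apply: f0 => //; exact: hPk.
    apply: fs; rewrite inE !mem_cat; have := UUk kP PU.
    by rewrite -{1}(cat_take_drop 1 Uk) mem_cat (negbTE Pd) orbF => ->; rewrite !orbT.
  - exact: nhit nzk PX kP.
  - by apply: contra Pm => /eqP zP; apply/eqP; exact: (tuniq k).
  - by apply: (eld' PX kP); exact: neqs.
have f4z S : f S = 0 -> lam z S != 0 -> lam t S != 0 -> el j S != 0 -> el k S != 0 -> f4 S = 0.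
  by move=> fS zS tS jS; move/eqP: (f3z S fS zS tS jS); rewrite e4 mulf_eq0 => /orP[->//|/eqP].
have [||P PU|f5 [pf5 e5]] := @div_line _ 2 (el i) f4 (take 2 Ui) pf4; [by rewrite take_uniq|by rewrite size_takel ?si| |].
  have [_ v] := hUi (mem_take PU); have [PX iP _ _] := v; split=> //; apply: f4z.
  - by apply: fs; rewrite inE !mem_cat PU !orbT.
  - exact: Vlam v.
  - exact: Vlam v.
  - by apply: (eld' PX iP); exact: neqs.
  - exact: (eld' PX iP).
apply: nf => S; rewrite e1 e2 e3 e4 e5 (pol1_const S (W p q) pf5).
have f4pq : f4 (W p q) = 0 by apply: f4z => //; rewrite ?lW ?vE //; exact: Yel (WY _ _).
have /eqP := f4pq; rewrite e5 mulf_eq0 (negbTE (Yel i (WY p q))) => /eqP->.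
by rewrite !mulr0.
Qed.

Lemma kill331 : size Ui = 3%N -> size Uj = 3%N -> size Uk = 1%N -> hit (lam z) i -> hit (lam t) i ->
  hit (lam z) j -> hit (lam t) j -> False.
Proof.
move=> si sj sk hz ht hzj htj.
have nzk := hit2_miss (q4 z) ij ki kj hz hzj; have ntk := hit2_miss (q4 t) ij ki kj ht htj.
have [Pk [PkX kPk gPk hPk]] := gpt k.
have [n1 [n1X in1 zn1 n1Y [gn1 n1U]]] := lam_pt (mem_head z [:: t]) hz.
have [n2 [n2X in2 tn2 n2Y [gn2 n2U]]] := lam_pt (mem_last z [:: t]) ht.
have [m1 [m1X jm1 zm1 m1Y [gm1 m1U]]] := lam_pt (mem_head z [:: t]) hzj.
have [m2 [m2X jm2 tm2 m2Y [gm2 m2U]]] := lam_pt (mem_last z [:: t]) htj.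
have zt (n : pt) : n \notin Y -> lam t n = 0 -> lam z n != 0.
  by move=> nY tn; apply/negP => /eqP zn; case: (@lam_meet z t n); rewrite ?vE.
(* Six conditions against seven users; the user on [el k] and one on [el j] are not killed, and
   [el j] is divided out last. *)
have [||f [pf f0 fs [fz [ft fpq]] nf]] := @getf (W z t :: Ui ++ take 2 Uj).
- by rewrite /= !size_cat !size_takel ?sj // si sk.
- by rewrite mem_head.
have [||||f1 [pf1 e1]] := @lamz_div 6 f [:: n1; m1] pf; [by []| |by []| |].
- by rewrite /= inE andbT; apply/eqP => e; have := eld' n1X in1 (neqs ij); rewrite e jm1 eqxx.
- by move=> S; rewrite !inE => /orP[]/eqP->; split=> //; exact: f0.
have f1z S : f S = 0 -> lam z S != 0 -> f1 S = 0 by move=> /eqP; rewrite e1 mulf_eq0 => /orP[->//|/eqP].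
have [||||f2 [pf2 e2]] := @lamt_div 5 f1 [:: n2; m2] pf1; [| |by []| |].
- by move=> h hz'; apply: f1z; [exact: ft|rewrite lW vE eq_sym].
- by rewrite /= inE andbT; apply/eqP => e; have := eld' n2X in2 (neqs ij); rewrite e jm2 eqxx.
- by move=> S; rewrite !inE => /orP[]/eqP->; split=> //; apply: f1z; [exact: f0|exact: zt|exact: f0|exact: zt].
have f2z S : f S = 0 -> lam z S != 0 -> lam t S != 0 -> f2 S = 0.
  by move=> fS zS; move/eqP: (f1z S fS zS); rewrite e2 mulf_eq0 => /orP[->//|/eqP].
have [||f3 [pf3 e3]] := @divX 4 (el k) f2 (Pk :: Uk) pf2; [by rewrite /= sk el6| |].
  move=> P PX kP; rewrite inE negb_or => /andP[PP PU]; apply: f2z.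
  - by apply: f0; [|exact: hPk|apply/negP => /(UUk kP); rewrite (negbTE PU)].
  - exact: nhit nzk PX kP.
  - exact: nhit ntk PX kP.
have f3z S : f S = 0 -> lam z S != 0 -> lam t S != 0 -> el k S != 0 -> f3 S = 0.
  by move=> fS zS tS; move/eqP: (f2z S fS zS tS); rewrite e3 mulf_eq0 => /orP[->//|/eqP].
have [||P PU|f4 [pf4 e4]] := @div_line _ 3 (el i) f3 Ui pf3; [by []|by rewrite si| |].
  have [_ v] := hUi PU; have [PX iP _ _] := v; split=> //; apply: f3z.
  - by apply: fs; rewrite inE mem_cat PU !orbT.
  - exact: Vlam v.
  - exact: Vlam v.
  - exact: (eld' PX iP).
have f4z S : f S = 0 -> lam z S != 0 -> lam t S != 0 -> el k S != 0 -> el i S != 0 -> f4 S = 0.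
  by move=> fS zS tS kS; move/eqP: (f3z S fS zS tS kS); rewrite e4 mulf_eq0 => /orP[->//|/eqP].
have [||P PU|f5 [pf5 e5]] := @div_line _ 2 (el j) f4 (take 2 Uj) pf4; [by rewrite take_uniq|by rewrite size_takel ?sj| |].
  have [_ v] := hUj (mem_take PU); have [PX jP _ _] := v; split=> //; apply: f4z.
  - by apply: fs; rewrite inE mem_cat PU !orbT.
  - exact: Vlam v.
  - exact: Vlam v.
  - exact: (eld' PX jP).
  - exact: (eld' PX jP).
apply: nf => S; rewrite e1 e2 e3 e4 e5 (pol1_const S (W p q) pf5).
have f4pq : f4 (W p q) = 0 by apply: f4z => //; rewrite ?lW ?vE //; exact: Yel (WY _ _).
have /eqP := f4pq; rewrite e5 mulf_eq0 (negbTE (Yel j (WY p q))) => /eqP->.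
by rewrite !mulr0.
Qed.
End Kill.

(** Two nodes of [el i] besides three users and the node on [g] lie on [lam z] or [lam t] by
    [bad_three], one on each since a [lam] meets [el i] once. A fourth user would be such a node,
    against [Vlam]. *)
Lemma bad_hit i Ui : uniq Ui -> (forall D, D \in Ui -> usr g D /\ Vat i D) -> hit g i -> (3 <= size Ui)%N ->
  [/\ hit (lam z) i, hit (lam t) i & (size Ui <= 3)%N].
Proof.
move=> uU hU /hitP[Q [QX iQ gQ]] s3; pose U3 := take 3 Ui.
have s3' : size U3 = 3%N by rewrite size_takel.
have hU3 D : D \in U3 -> usr g D /\ el i D = 0 by move=> /mem_take/hU[u [_ iD _ _]].
have gN N : el i N = 0 -> N <> Q -> g N != 0.
  move=> iN NQ; apply/negP => /eqP gN; have := Yel i (WY p p).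
  by rewrite -(line2 NQ gN gQ iN iQ) gp eqxx.
have key N N' : N \in X -> N' \in X -> el i N = 0 -> el i N' = 0 -> N <> N' -> N <> Q -> N' <> Q -> N \notin U3 -> N' \notin U3 ->
    lam z N = 0 \/ lam t N = 0.
  move=> NX NX' iN iN' NN NQ NQ' NU NU'.
  exact: (bad_three v4 (@ne) gp gq gz (take_uniq 3 uU) hU3 (eq_leq (esym s3')) NX NX' iN iN' (gN _ iN NQ) (gN _ iN' NQ') NU NU' NN).
have [|N1 [N2 [[X1 X2 i1 i2] N12]]] := el_more i (s := Q :: U3); first by rewrite /= s3'.
rewrite !in_cons !negb_or => /andP[/eqP Q1 U1] /andP[/eqP Q2 U2].
have zuniq h A B : lam h A = 0 -> lam h B = 0 -> el i A = 0 -> el i B = 0 -> A = B by apply: max_el_uniq; rewrite q4.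
have [hz ht] : hit (lam z) i /\ hit (lam t) i.
  have h (h' : 'I_4) N : N \in X -> el i N = 0 -> lam h' N = 0 -> hit (lam h') i by move=> NX iN hN; apply/hitP; exists N.
  case: (key N1 N2) => // h1; case: (key N2 N1) => //; try exact: nesym; move=> h2.
  - by case: N12; exact: (zuniq z).
  - by split; [exact: h h1|exact: h h2].
  - by split; [exact: h h2|exact: h h1].
  - by case: N12; exact: (zuniq t).
split=> //; rewrite leqNgt; apply/negP => s4.
case E4 : (drop 3 Ui) => [|D s]; first by have := size_drop 3 Ui; rewrite E4 => /esym/eqP; rewrite subn_eq0 leqNgt s4.
have DU : D \in Ui by rewrite -(cat_take_drop 3 Ui) mem_cat E4 mem_head orbT.
have DU3 : D \notin U3.
  by move: uU; rewrite -(cat_take_drop 3 Ui) cat_uniq E4 /= negb_or => /and3P[_ /andP[-> _] _].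
have [uD v] := hU D DU; have [DX iD _ _] := v.
have DQ : D <> Q by move=> e; have := usr_off uD; rewrite e gQ eqxx.
have [e|/eqP n] := eqVneq N1 D; last by case: (key D N1) => //; [exact: nesym|move=> h; have := Vlam z v; rewrite h eqxx|move=> h; have := Vlam t v; rewrite h eqxx].
have n : D <> N2 by rewrite -e.
by case: (key D N2) => // h; [have := Vlam z v|have := Vlam t v]; rewrite h eqxx.
Qed.

(** Seven users include 3, 3, 1 or 3, 2, 2 on the [el i]. An [el i] with three is met by both
    [lam z] and [lam t], and a [lam] meets at most two of the [el]; what remains is refuted by the
    killing lemmas. *)
Lemma bad_le6 U : uniq U -> (forall D, D \in U -> usr g D /\ exists i, Vat i D) -> (size U <= 6)%N.
Proof.
move=> uU hU; rewrite leqNgt; apply/negP => s7.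
have c4 i : (size (Un U i) <= 4)%N by apply: leq_trans (ybound (uUn uU i) (@hUn' g U hU i)) _; rewrite ltnS; exact: bad_ym.
have hg := Un_hit hU c4 (leq_trans (isT : (4 < 7)%N) s7).
have bh i h3 := bad_hit (uUn uU i) (@hUn g U hU i) (hg i) h3.
have c3 i : (size (Un U i) <= 3)%N by rewrite leqNgt; apply/negP => h; have [_ _] := bh i (ltnW h); rewrite leqNgt h.
have [i [j [k [[ij ki kj] hc]]]] := num7 c3 (leq_trans s7 (sUn hU)).
have ut (n : nat) h : uniq (take n (Un U h)) by rewrite take_uniq // uUn.
have ht (n : nat) h D : D \in take n (Un U h) -> usr g D /\ Vat h D by move/mem_take; exact: hUn.
have st (n : nat) h : (n <= size (Un U h))%N -> size (take n (Un U h)) = n by move=> le; rewrite size_takel.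
case: hc => [[ci cj ck]|[ci cj ck]].
  have [zi ti _] := bh i ci; have [zj tj _] := bh j cj.
  by apply: (kill331 ij ki kj hg (ut 3 i) (ut 3 j) (ut 1%N k) (ht 3 i) (ht 3 j) (ht 1%N k)); rewrite ?st.
have [zi ti _] := bh i ci.
have nil0 : uniq ([::] : seq pt) by [].
have n0 (h : 'I_3) D : D \in [::] -> usr g D /\ Vat h D by [].
have Hj := kill32 ij ki kj hg (ut 3 i) (ut 2 j) nil0 (ht 3 i) (ht 2 j) (n0 k) (st _ _ ci) (st _ _ cj) erefl zi ti.
have Hk := kill32 (neqs ki) (neqs ij) (neqs kj) hg (ut 3 i) (ut 2 k) nil0 (ht 3 i) (ht 2 k) (n0 j) (st _ _ ci) (st _ _ ck) erefl zi ti.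
case/orP: Hj => Hj; case/orP: Hk => Hk.
- by have := hit2_miss (q4 z) ij ki kj zi Hj; rewrite Hk.
- exact: (kill322 ij ki kj hg (ut 3 i) (ut 2 j) (ut 2 k) (ht 3 i) (ht 2 j) (ht 2 k) (st _ _ ci) (st _ _ cj) (st _ _ ck) zi ti Hj Hk).
- exact: (kill322 (neqs ki) (neqs ij) (neqs kj) hg (ut 3 i) (ut 2 k) (ut 2 j) (ht 3 i) (ht 2 k) (ht 2 j) (st _ _ ci) (st _ _ ck) (st _ _ cj) zi ti Hk Hj).
- by have := hit2_miss (q4 t) ij ki kj ti Hj; rewrite Hk.
Qed.
End Bad.

(** * Counting the nodes of [Y] on the lines of the remaining nodes *)

Definition Vi i := [seq D <- E i | D \notin [:: x i; x' i]].
Definition VV := Vi o0 ++ Vi o1 ++ Vi o2.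

Lemma ViP i D : D \in Vi i -> Vat i D.
Proof.
rewrite mem_filter in_E !inE negb_or => /andP[/andP[/eqP n /eqP n'] /andP[/eqP iD DX]].
by split.
Qed.

Lemma VVP D : D \in VV -> exists i, Vat i D.
Proof. by rewrite !mem_cat => /or3P[]/ViP v; [exists o0|exists o1|exists o2]. Qed.

Lemma uVV : uniq VV.
Proof.
have ex i j D : i != j -> D \in Vi i -> D \in Vi j -> False.
  by move=> ij /ViP[DX iD _ _] /ViP[_ jD _ _]; have := eld' DX iD (neqs ij); rewrite jD eqxx.
rewrite /VV !cat_uniq !filter_uniq ?uE //= !andbT; apply/andP; split.
  apply/hasPn => D; rewrite mem_cat => h; apply/negP => h0.
  by case/orP: h => [/(@ex o0 o1 D isT h0)|/(@ex o0 o2 D isT h0)].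
by apply/hasPn => D h2; apply/negP => h1; exact: (@ex o1 o2 D isT h1 h2).
Qed.

Lemma sVV : (12 <= size VV)%N.
Proof.
have s4 i : (4 <= size (Vi i))%N.
  rewrite size_filter; apply: (@count_rest _ (mem [:: x i; x' i]) (E i) 2 4); last by rewrite sE.
  rewrite -size_filter -[2%N]/(size [:: x i; x' i]); apply: uniq_leq_size; first exact: filter_uniq (uE i).
  by move=> S; rewrite mem_filter => /andP[].
by rewrite !size_cat (leq_add (s4 o0) (leq_add (s4 o1) (s4 o2))).
Qed.

(* A line which a node satisfying [Vat] can use. *)
Definition Good (g : line) := (forall h, ~ eql g (lam h)) /\ (forall l, l \in KK -> ~ eql g l).

Lemma Good_usr i D l : usr l D -> Vat i D -> Good l.
Proof.
move=> ul v; split=> [h e|k kK e]; first exact: (lam_users (eql_usr e ul) v).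
exact: (KK_users kK (eql_usr e ul) v).
Qed.

Lemma Good_pair (g l : line) P Q : Good g -> l \in KK -> P <> Q -> l P = 0 -> l Q = 0 -> g P = 0 -> g Q != 0.
Proof.
move=> [_ h] lK PQ lP lQ gP; apply/negP => /eqP gQ; apply: (h l lK).
exact: (line2 PQ gP gQ lP lQ).
Qed.

(** A repeated factor would leave five lines covering the six nodes of some [el j], so a primary
    node would use [el j], against [prim_not_el]. *)
Lemma GCpair D i L P Q : D \in X -> el i D = 0 -> size L = 6%N -> lprod L D != 0 -> (forall P, P \in X -> P <> D -> lprod L P = 0) ->
  P <> Q -> (count (fun l => (l P == 0%R) && (l Q == 0%R)) L <= 1)%N.
Proof.
move=> DX iD sL h1 h2 PQ; rewrite leqNgt; apply/negP => c2.
have : has (fun l => (l P == 0) && (l Q == 0)) L by rewrite has_count (ltnW c2).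
case/hasP => l1 L1 /andP[/eqP p1 /eqP q1].
have : has (fun l => (l P == 0) && (l Q == 0)) (rem l1 L).
  by rewrite has_count; have := c2; rewrite (permP (perm_to_rem L1)) /= p1 q1 !eqxx.
case/hasP => l2 L2 /andP[/eqP p2 /eqP q2]; have e := line2 PQ p1 q1 p2 q2.
have [j ji] := other i.
have [||S SE|l lL el'] := @lprod_seq _ (el j) (rem l1 L) (E j); first exact: uE.
- by rewrite size_rem // sL sE.
- move: SE; rewrite in_E => /andP[/eqP jS SX]; split=> //.
  have SD : S <> D by move=> eS; have := eld' DX iD ji; rewrite -eS jS eqxx.
  have /eqP := h2 S SX SD; rewrite (lprod_rem _ L1) mulf_eq0 => /orP[l1S|/eqP//].
  by apply/eqP; rewrite lprod_eq0; apply/hasP; exists l2 => //; rewrite -e.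
by apply: (prim_not_el (lns_usr DX sL h1 h2 (mem_rem lL)) iD el').
Qed.

(** The first hypotheses say that a line other than the [lam] has at most one node on each of them,
    the second that it has at most one node in common with each line of [KK]. Nodes past the first
    are charged to an opposite pair or to one of four triples. *)
Lemma ten_bool (ab ac ad bc bd cd aa bb cc dd : bool) :
  [&& (aa + ab + ac + ad <= 1)%N, (bb + ab + bc + bd <= 1)%N, (cc + ac + bc + cd <= 1)%N & (dd + ad + bd + cd <= 1)%N] ->
  [&& ~~ (ab && cd), ~~ (ac && bd), (ad + bb + cc <= 1)%N & (bc + aa + dd <= 1)%N] ->
  (ab + ac + ad + bc + bd + cd + aa + bb + cc + dd <=
   1 + (ad && bc) + ((aa + bb + cd).-1 + ((cc + dd + ab).-1 + ((aa + cc + bd).-1 + (bb + dd + ac).-1))))%N.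
Proof. by case: ab; case: ac; case: ad; case: bc; case: bd; case: cd; case: aa; case: bb; case: cc; case: dd. Qed.

(* The number of nodes exceeding one on [l] among the triple [W p p], [W q q], [W z t]. *)
Definition tri (p q z t : 'I_4) (l : line) : nat := ((l (W p p) == 0%R) + (l (W q q) == 0%R) + (l (W z t) == 0%R)).-1.
Definition cross (l : line) : nat := (l (W a d) == 0) && (l (W b c) == 0).

Lemma ym_tri l : Good l -> (size (ym l) <= 1 + cross l + (tri a b c d l + (tri c d a b l + (tri a c b d l + tri b d a c l))))%N.
Proof.
move=> Gl; have nE := neqE u4; have [nl nk] := Gl.
pose s := [:: W a b; W a c; W a d; W b c; W b d; W c d; W a a; W b b; W c c; W d d].
have le : (size (ym l) <= count (fun P => l P == 0%R) s)%N.
  rewrite -size_filter; apply: uniq_leq_size (uym l) _ => P; rewrite in_ym => /andP[lP PY].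
  by rewrite mem_filter lP -(quad_Y u4).
apply: leq_trans le _.
have ds (e f g h : 'I_4) : uniq [:: e; f; g; h] -> ((l (W e e) == 0%R) + (l (W e f) == 0%R) + (l (W e g) == 0%R) + (l (W e h) == 0%R) <= 1)%N.
  move=> ue; have eE := neqE ue.
  have no y z : y != z -> (l (W e y) == 0) && (l (W e z) == 0) = false.
    by move=> yz; apply/negP => /andP[/eqP hy /eqP hz]; rewrite (disj (@nl e) hy hz) eqxx in yz.
  have := no e f; have := no e g; have := no e h; have := no f g; have := no f h; have := no g h.
  rewrite !eE => /(_ isT) + /(_ isT) + /(_ isT) + /(_ isT) + /(_ isT) + /(_ isT).
  by case: (l (W e e) == 0); case: (l (W e f) == 0); case: (l (W e g) == 0); case: (l (W e h) == 0).
have pr (k : line) P Q : k \in KK -> P <> Q -> k P = 0 -> k Q = 0 -> (l P == 0) && (l Q == 0) = false.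
  by move=> kK PQ kP kQ; apply/negP => /andP[/eqP lP]; apply/negP; exact: (Good_pair Gl kK PQ kP kQ lP).
have p1 : (l (W a b) == 0) && (l (W c d) == 0) = false by apply: (pr k1); rewrite ?inE ?eqxx //; apply: W_neq; rewrite !inE !nE.
have p2 : (l (W a c) == 0) && (l (W b d) == 0) = false by apply: (pr k2); rewrite ?inE ?eqxx ?orbT //; apply: W_neq; rewrite !inE !nE.
have q1 : (l (W a d) == 0) && (l (W b b) == 0) = false by apply: (pr k3); rewrite ?inE ?eqxx ?orbT //; apply: W_neq; rewrite !inE !nE.
have q2 : (l (W a d) == 0) && (l (W c c) == 0) = false by apply: (pr k3); rewrite ?inE ?eqxx ?orbT //; apply: W_neq; rewrite !inE !nE.
have q3 : (l (W b b) == 0) && (l (W c c) == 0) = false by apply: (pr k3); rewrite ?inE ?eqxx ?orbT //; apply: W_neq; rewrite !inE !nE.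
have r1 : (l (W b c) == 0) && (l (W a a) == 0) = false by apply: (pr k4); rewrite ?inE ?eqxx ?orbT //; apply: W_neq; rewrite !inE !nE.
have r2 : (l (W b c) == 0) && (l (W d d) == 0) = false by apply: (pr k4); rewrite ?inE ?eqxx ?orbT //; apply: W_neq; rewrite !inE !nE.
have r3 : (l (W a a) == 0) && (l (W d d) == 0) = false by apply: (pr k4); rewrite ?inE ?eqxx ?orbT //; apply: W_neq; rewrite !inE !nE.
have H1 : [&& ((l (W a a) == 0%R) + (l (W a b) == 0%R) + (l (W a c) == 0%R) + (l (W a d) == 0%R) <= 1)%N,
    ((l (W b b) == 0%R) + (l (W a b) == 0%R) + (l (W b c) == 0%R) + (l (W b d) == 0%R) <= 1)%N,
    ((l (W c c) == 0%R) + (l (W a c) == 0%R) + (l (W b c) == 0%R) + (l (W c d) == 0%R) <= 1)%N &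
    ((l (W d d) == 0%R) + (l (W a d) == 0%R) + (l (W b d) == 0%R) + (l (W c d) == 0%R) <= 1)%N].
  apply/and4P; split.
  + by apply: ds.
  + by rewrite (Wsym a b); apply: ds; rewrite /= !inE !nE.
  + by rewrite (Wsym a c) (Wsym b c); apply: ds; rewrite /= !inE !nE.
  + by rewrite (Wsym a d) (Wsym b d) (Wsym c d); apply: ds; rewrite /= !inE !nE.
have := ten_bool H1; rewrite p1 p2 => /(_ _).
rewrite /s /tri /cross /= addn0 !addnA; apply; apply/andP; split.
  by move: q1 q2 q3; case: (l (W a d) == 0); case: (l (W b b) == 0); case: (l (W c c) == 0).
by move: r1 r2 r3; case: (l (W b c) == 0); case: (l (W a a) == 0); case: (l (W d d) == 0).
Qed.

Lemma size_sum_const (n : nat) U : (\sum_(D <- U) n = n * size U)%N.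
Proof. by rewrite big_const_seq count_predT iter_addn addn0. Qed.

Section Sums.
Variable Lf : pt -> seq line.
Hypothesis hL : forall D, D \in VV -> [/\ size (Lf D) = 6%N, lprod (Lf D) D != 0 & forall P, P \in X -> P <> D -> lprod (Lf D) P = 0].
Definition SS (F : line -> nat) := (\sum_(D <- VV) \sum_(l <- Lf D) F l)%N.

Lemma SS_le (F G : line -> nat) : (forall l, Good l -> F l <= G l)%N -> (SS F <= SS G)%N.
Proof.
move=> h; rewrite /SS big_seq [leqRHS]big_seq; apply: leq_sum => D DV.
have [sL h1 h2] := hL DV; have [i v] := VVP DV; have [DX _ _ _] := v.
rewrite big_seq [leqRHS]big_seq; apply: leq_sum => l lL.
by apply: h; exact: (Good_usr (lns_usr DX sL h1 h2 lL) v).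
Qed.

Lemma SSD (F G : line -> nat) : SS (fun l => F l + G l)%N = (SS F + SS G)%N.
Proof. by rewrite /SS -big_split; apply: eq_bigr => D _; rewrite big_split. Qed.

(** By [GCpair] each node contributes at most once, and the contributing nodes all use the line
    through [P] and [Q]. *)
Lemma SS_pair P Q (n : nat) : P <> Q -> (forall (g : line) U, Good g -> g P = 0 -> g Q = 0 -> uniq U ->
   (forall D, D \in U -> usr g D /\ exists i, Vat i D) -> (size U <= n)%N) ->
  (SS (fun l => (l P == 0%R) && (l Q == 0%R)) <= n)%N.
Proof.
move=> PQ hn; pose pr (l : line) := (l P == 0) && (l Q == 0).
pose U := [seq D <- VV | has pr (Lf D)].
have uU : uniq U by rewrite filter_uniq // uVV.
apply: (@leq_trans (size U)).
  rewrite size_filter -sum1_count /SS [leqRHS]big_mkcond big_seq [leqRHS]big_seq; apply: leq_sum => D DV.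
  have [sL h1 h2] := hL DV; have [i [DX iD _ _]] := VVP DV.
  have -> : (\sum_(l <- Lf D) ((l P == 0%R) && (l Q == 0%R)) = count pr (Lf D))%N.
    by rewrite -sum1_count [RHS]big_mkcond; apply: eq_bigr => l _; rewrite /pr; case: (_ && _).
  by rewrite has_count; have := GCpair DX iD sL h1 h2 PQ; rewrite -/pr; case: (count _ _) => [|[|]].
have [g [gP gQ]] := line_thru P Q.
have hU D : D \in U -> usr g D /\ exists i, Vat i D.
  rewrite mem_filter => /andP[/hasP[l lL /andP[/eqP lP /eqP lQ]] DV].
  have [sL h1 h2] := hL DV; have [i v] := VVP DV; have [DX _ _ _] := v.
  by split; [exact: (eql_usr (line2 PQ lP lQ gP gQ) (lns_usr DX sL h1 h2 lL))|exists i].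
case EU : U => [//|D s]; rewrite -EU; apply: (hn g) => //.
by have [|uD [i v]] := hU D; [rewrite EU mem_head|exact: Good_usr uD v].
Qed.

(** A collinear triple counts 2 on its line, which has at most six users: 12. Otherwise the three
    joining lines count 1 each and have no further node of [Y], so [miss_le3] gives 3 * 3. The lines
    [k] and [k'] keep [W z z] and [W t t] off the line through [W p p] and [W q q]. *)
Lemma tri_good (p q z t : 'I_4) : uniq [:: p; q; z; t] -> (exists2 k : line, k \in KK & k (W q q) = 0 /\ k (W z z) = 0) ->
  (exists2 k : line, k \in KK & k (W p p) = 0 /\ k (W t t) = 0) ->
  (SS (tri p q z t) <= 9)%N \/ (SS (tri p q z t) <= 12)%N /\ exists l, [/\ l (W p p) = 0, l (W q q) = 0 & l (W z t) = 0].
Proof.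
move=> v4 [k kK [kq kz]] [k' kK' [kp kt]]; have vE := neqE v4.
have [l [lp lq]] := line_thru (W p p) (W q q).
have npq : W p p <> W q q by apply: W_neq; rewrite !inE !vE.
have npz : W p p <> W z t by apply: W_neq; rewrite !inE !vE.
have nqz : W q q <> W z t by apply: W_neq; rewrite !inE !vE.
have [lz|lz] := eqVneq (l (W z t)) 0.
  right; split; last by exists l.
  apply: (@leq_trans (SS (fun l => ((l (W p p) == 0%R) && (l (W q q) == 0%R)) + ((l (W p p) == 0%R) && (l (W q q) == 0%R)))%N)).
    apply: SS_le => g _; rewrite /tri.
    have h2 (A B C : pt) : A <> B -> l A = 0 -> l B = 0 -> l C = 0 -> g A = 0 -> g B = 0 -> g C == 0.
      by move=> AB lA lB lC gA gB; rewrite (line2 AB gA gB lA lB) lC.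
    case: (eqVneq (g (W p p)) 0) => gp; case: (eqVneq (g (W q q)) 0) => gq; case: (eqVneq (g (W z t)) 0) => gz //.
    + by have := h2 _ _ (W q q) npz lp lz lq gp gz; rewrite (negbTE gq).
    + by have := h2 _ _ (W p p) nqz lq lz lp gq gz; rewrite (negbTE gp).
  rewrite SSD; have h6 : (SS (fun l => (l (W p p) == 0%R) && (l (W q q) == 0%R)) <= 6)%N.
    apply: SS_pair => // g U [gne _] gp gq uU hU.
    have gz : g (W z t) = 0 by apply/eqP; rewrite (line2 npq gp gq lp lq) lz.
    exact: (bad_le6 v4 gne gp gq gz uU hU).
  exact: (leq_add h6 h6).
left; apply: (@leq_trans (SS (fun l => ((l (W p p) == 0%R) && (l (W q q) == 0%R)) + (((l (W p p) == 0%R) && (l (W z t) == 0%R)) + ((l (W q q) == 0%R) && (l (W z t) == 0%R))))%N)).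
  apply: SS_le => g _; rewrite /tri.
  case: (eqVneq (g (W p p)) 0) => gp; case: (eqVneq (g (W q q)) 0) => gq; case: (eqVneq (g (W z t)) 0) => gz //.
have two (y : 'I_4) P Q : P <> Q -> lam y P != 0 -> lam y Q != 0 ->
    (forall (g : line) S, Good g -> g P = 0 -> g Q = 0 -> S \in Y -> g S = 0 -> S = P \/ S = Q) ->
    (SS (fun l => (l P == 0%R) && (l Q == 0%R)) <= 3)%N.
  move=> PQ yP yQ hS; apply: SS_pair => // g U Gg gP gQ uU hU.
  apply: (@miss_le3 g y) => //.
  - by move=> S SY yS; apply/negP => /eqP gS; case: (hS g S Gg gP gQ SY gS) => e; rewrite e in yS; [rewrite yS eqxx in yP|rewrite yS eqxx in yQ].
  - rewrite -[2%N]/(size [:: P; Q]); apply: uniq_leq_size (uym g) _ => S; rewrite in_ym => /andP[/eqP gS SY].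
    by rewrite !inE; case: (hS g S Gg gP gQ SY gS) => ->; rewrite eqxx ?orbT.
  - by move=> D /hU[uD [i [_ iD _ _]]]; split=> //; exists i.
have v4' : uniq [:: z; t; p; q] by rewrite /= !inE !vE.
have nodes (g : line) S : Good g -> S \in Y -> g S = 0 -> g (W z t) = 0 -> [\/ S = W z t, S = W p q, S = W p p | S = W q q].
  by move=> [gne _] SY gS gz; exact: (on_ab v4' gne gz SY gS).
have npq' (g : line) : Good g -> g (W p p) = 0 -> g (W p q) != 0 by move=> [gne _] gp; apply: (dj (gne p) gp); rewrite vE.
have npq'' (g : line) : Good g -> g (W q q) = 0 -> g (W p q) != 0.
  by move=> [gne _] gp; rewrite Wsym; apply: (dj (gne q) gp); rewrite vE.
have npqz (g : line) : g (W p p) = 0 -> g (W q q) = 0 -> g (W z t) != 0.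
  by move=> gp gq; rewrite (line2 npq gp gq lp lq).
rewrite !SSD; apply: (@leq_add _ _ 3 6); last apply: (@leq_add _ _ 3 3).
- apply: (two z) => //; rewrite ?lW ?vE // => g S Gg gp gq SY gS.
  have [gne _] := Gg; have := SY; rewrite (quad_Y v4) !inE.
  have dp h : p != h -> g (W p h) != 0 by move=> ph; apply: (dj (gne p) gp).
  have dq h : q != h -> g (W q h) != 0 by move=> ph; apply: (dj (gne q) gq).
  have gzt := npqz g gp gq.
  have gzz : g (W z z) != 0 by apply: (Good_pair Gg kK _ kq kz gq); apply: W_neq; rewrite !inE !vE.
  have gtt : g (W t t) != 0 by apply: (Good_pair Gg kK' _ kp kt gp); apply: W_neq; rewrite !inE !vE.
  case/or4P=> [/eqP e|/eqP e|/eqP e|/or4P[/eqP e|/eqP e|/eqP e|/or4P[]/eqP e]]; rewrite e in gS *; try by [left|right].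
  + by move: (dp q); rewrite gS vE eqxx => /(_ isT).
  + by move: (dp z); rewrite gS vE eqxx => /(_ isT).
  + by move: (dp t); rewrite gS vE eqxx => /(_ isT).
  + by move: (dq z); rewrite gS vE eqxx => /(_ isT).
  + by move: (dq t); rewrite gS vE eqxx => /(_ isT).
  + by rewrite gS eqxx in gzt.
  + by rewrite gS eqxx in gzz.
  + by rewrite gS eqxx in gtt.
- apply: (two q) => //; rewrite ?lW ?vE // => g S Gg gp gz SY gS.
  have [e|e|e|e] := nodes g S Gg SY gS gz; [by right| |by left|].
    by have := npq' g Gg gp; rewrite -e gS eqxx.
  by have := npqz g gp; rewrite -e => /(_ gS); rewrite gz eqxx.
- apply: (two p) => //; rewrite ?lW ?vE // => g S Gg gq gz SY gS.
  have [e|e|e|e] := nodes g S Gg SY gS gz; [by right| | |by left].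
    by have := npq'' g Gg gq; rewrite -e gS eqxx.
  by have gp : g (W p p) = 0; [rewrite -e|have := npqz g gp gq; rewrite gz eqxx].
Qed.

Lemma SS_ge : (10 * size VV <= SS (fun l => size (ym l)))%N.
Proof.
rewrite -size_sum_const /SS [leqLHS]big_seq [leqRHS]big_seq; apply: leq_sum => D DV.
have [sL h1 h2] := hL DV; have [i [DX iD _ _]] := VVP DV.
have -> : (\sum_(l <- Lf D) size (ym l) = \sum_(P <- Y) \sum_(l <- Lf D) (l P == 0%R))%N.
  rewrite exchange_big; apply: eq_bigr => l _.
  by rewrite size_filter -sum1_count big_mkcond; apply: eq_bigr => P _; case: (_ == _).
rewrite -sY -sum1_size big_seq [leqRHS]big_seq; apply: leq_sum => P PY.
have nPD : P <> D by move=> e; have := elY iD; rewrite -e PY.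
have /eqP := h2 P (YX PY) nPD; rewrite lprod_eq0 => /hasP[l lL lP].
by rewrite (big_rem l) //= lP.
Qed.
End Sums.

Lemma str_false : False.
Proof.
have [Lf hL] : exists Lf : pt -> seq line, forall D, D \in VV -> [/\ size (Lf D) = 6%N, lprod (Lf D) D != 0 & forall P, P \in X -> P <> D -> lprod (Lf D) P = 0].
  by apply: (@seq_choice _ _ ([::] : seq line) VV (fun D L => [/\ size L = 6%N, lprod L D != 0 & forall P, P \in X -> P <> D -> lprod L P = 0])) => D /VVP[i [DX _ _ _]]; exact: GC.
have nE := neqE u4; have sV := sVV.
have K1 : k1 \in KK by rewrite !inE eqxx.
have K3 : k3 \in KK by rewrite !inE eqxx !orbT.
have K4 : k4 \in KK by rewrite !inE eqxx !orbT.
have tab : _ \/ _ := tri_good hL u4 (ex_intro2 _ _ k3 K3 (conj k3b k3c)) (ex_intro2 _ _ k4 K4 (conj k4a k4d)).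
have v2 : uniq [:: c; d; a; b] by rewrite /= !inE !nE.
have tcd : _ \/ _ := tri_good hL v2 (ex_intro2 _ _ k4 K4 (conj k4d k4a)) (ex_intro2 _ _ k3 K3 (conj k3c k3b)).
have v3 : uniq [:: a; c; b; d] by rewrite /= !inE !nE.
have tac : _ \/ _ := tri_good hL v3 (ex_intro2 _ _ k3 K3 (conj k3c k3b)) (ex_intro2 _ _ k4 K4 (conj k4a k4d)).
have v4 : uniq [:: b; d; a; c] by rewrite /= !inE !nE.
have tbd : _ \/ _ := tri_good hL v4 (ex_intro2 _ _ k4 K4 (conj k4d k4a)) (ex_intro2 _ _ k3 K3 (conj k3b k3c)).
have cr : (SS Lf cross <= 4)%N.
  apply: (SS_pair hL) => [|g U [gne _] gad gbc uU hU]; first by apply: W_neq; rewrite !inE !nE.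
  exact: (cross_le4 gne gad gbc uU hU).
have h1 := SS_ge hL.
have h2 := SS_le hL ym_tri.
have s1 : SS Lf (fun=> 1%N) = (6 * size VV)%N.
  rewrite -size_sum_const /SS [LHS]big_seq [RHS]big_seq; apply: eq_bigr => D /hL[sL _ _].
  by rewrite sum1_size sL.
move: h2; rewrite !SSD s1 => h2.
pose bd (p q z t : 'I_4) := exists l, [/\ l (W p p) = 0, l (W q q) = 0 & l (W z t) = 0].
have bs (p q z t : 'I_4) : bd p q z t -> bd q p z t by move=> [l [h3 h4 h5]]; exists l.
have bt (p q z t : 'I_4) : bd p q z t -> bd p q t z by move=> [l [h3 h4 h5]]; exists l; rewrite Wsym.
have bad' : bd a d b c by exists k4.
have bbc : bd b c a d by exists k3.
(* For [n] nodes the ten nodes of [Y] need [10 * n] incidences; [6 * n] are free and 4 come from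
   [cross]. With [n] at least 12 this leaves 44. *)
have {h1 h2} tot : (44 <= SS Lf (tri a b c d) + SS Lf (tri c d a b) + SS Lf (tri a c b d) + SS Lf (tri b d a c))%N.
  by move: h1 h2 cr sV; clear; move: (size VV) (SS _ _) (SS _ _) (SS _ _) (SS _ _) (SS _ _) (SS _ _) => n A B C D E F; lia.
have no3 (p q z t : 'I_4) : uniq [:: p; q; z; t] -> bd p q z t -> bd p z q t -> bd q z p t -> bd p t q z -> bd q t p z -> False.
  by move=> v; exact: five_bad.
(* Three collinear triples out of these four would make five with those of [k3] and [k4]. So at most
   two sums reach 12, and 12 + 12 + 9 + 9 is below 44. *)
have no_cd : bd a b c d -> bd a c b d -> bd b d a c -> False by move=> e1 e2 e3; exact: (no3 a b c d).
have no_ab : bd c d a b -> bd a c b d -> bd b d a c -> False.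
  by move=> e1 e2 e3; apply: (no3 c d a b) => //; [apply: bs; exact: bt|apply: bs; exact: bt|apply: bs; exact: bt|apply: bs; exact: bt].
have no_ac : bd a b c d -> bd c d a b -> bd b d a c -> False.
  move=> e1 e2 e3; apply: (no3 b d a c) => //.
  - by apply: bs; apply: bt.
  - by apply: bs.
  - by apply: bt.
  - by apply: bs; apply: bt.
have no_bd : bd a b c d -> bd c d a b -> bd a c b d -> False.
  move=> e1 e2 e3; apply: (no3 a c b d) => //.
  - by apply: bs.
  - by apply: bt.
move: tab tcd tac tbd tot.
move: (SS Lf _) (SS Lf _) (SS Lf _) (SS Lf _) => A B C D.
case=> [ta|[ta ba]]; case=> [tb|[tb bb]]; case=> [tc|[tc bc]]; case=> [td|[td bd']] tot;
  try (by move: ta tb tc td tot; clear; lia).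
- exact: no_ab.
- exact: no_cd.
- exact: no_ac.
- exact: no_bd.
- exact: no_cd.
Qed.
End Fin.

Lemma Str_false x x' (a b c d : 'I_4) : uniq [:: a; b; c; d] -> Str x x' a b c d -> False.
Proof.
move=> u4 [k1 [k2 [k3 [k4 [[h1 h2] [h3 h4] [h5 h6 h7] [h8 h9 h10] hx]]]]].
exact: (str_false u4 h1 h2 h3 h4 h5 h6 h7 h8 h9 h10 hx).
Qed.

(** A failure is exactly what [str_ex] needs to build a structure. Hence all six collinearities
    hold, while [five_bad] refutes five. *)
Lemma fourth_nodes_collinear (p q z t : 'I_4) : uniq [:: p; q; z; t] -> exists l, [/\ l (W p p) = 0, l (W q q) = 0 & l (W z t) = 0].
Proof.
move=> v4; have vE := neqE v4; have [l [lp lq]] := line_thru (W p p) (W q q).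
exists l; split=> //; apply/eqP; apply/negP => /negP lz.
have npq : W p p <> W q q by move=> e; have := lW p p p; rewrite {1}e !lW eqxx !vE.
have u4 : uniq [:: z; t; p; q] by rewrite /= !inE !vE.
have u4' : uniq [:: z; t; q; p] by rewrite /= !inE !vE.
have [|x [x' [h|h]]] := str_ex u4.
- by move=> l' l'p l'q l'z; move: lz; rewrite -(line2 npq l'p l'q lp lq) l'z eqxx.
- exact: Str_false u4 h.
- exact: Str_false u4' h.
Qed.

Lemma four_max_false : False.
Proof.
have [a [b [c [d u4]]]] := ord4_dist; have nE := neqE u4.
by apply: (five_bad u4); apply: fourth_nodes_collinear; rewrite /= !inE !nE.
Qed.

End Case4.

Lemma four_node_line_false la : size (ym la) = 4%N -> False.
Proof.
move=> s4; have [lb [lc [sb sc ab ac bc]]] := three_max s4.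
pose lam (i : 'I_3) := nth la [:: la; lb; lc] i.
have [||[V [O [o [e h]]]]|[lam4 [h4 ne4]]] := @tri_or_quad lam.
- by apply: ord3P.
- have ba := fun e => ab (eql_sym e); have ca := fun e => ac (eql_sym e); have cb := fun e => bc (eql_sym e).
  by apply: ord3P; apply: ord3P; rewrite ?eqxx //= => _.
- exact: three_max_false h.
by have [W h] := quadP h4 ne4; exact: four_max_false h.
Qed.

End Config.

(** * Multivariate polynomials and m-d sequences *)

Lemma pol_sumf (R : realFieldType) (T : Type) (s : seq T) (n : nat) (F : T -> R * R -> R) (p : pred T) :
  (forall i, p i -> pol n (F i)) -> pol n (fun P => \sum_(i <- s | p i) F i P).
Proof.
move=> h; elim: s => [|i s IH]; first by apply: pol_ext (pol0 R n) => P; rewrite big_nil.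
have [pi|pi] := boolP (p i).
  by apply: pol_ext (pol_lin 1 1 (h i pi) IH) => P; rewrite big_cons pi !mul1r.
by apply: pol_ext IH => P; rewrite big_cons (negbTE pi).
Qed.

Lemma count_all (T : eqType) (b q : pred T) (s : seq T) (n : nat) : count (fun y => b y && q y) s = n -> (count q s <= n)%N ->
  forall y, y \in s -> q y -> b y.
Proof.
move=> e le y ys qy; apply/negPn; apply/negP => by_.
have : has (fun y => ~~ b y && q y) s by apply/hasP; exists y; rewrite ?by_.
rewrite has_count; have : (count (fun y => b y && q y) s + count (fun y => ~~ b y && q y) s = count q s)%N.
  by elim: s {e le ys} => //= u s <-; case: (b u); case: (q u) => /=; lia.
by lia.
Qed.

Lemma count_add4 (T : eqType) (p a b c d : pred T) (s : seq T) :
  (forall y, y \in s -> p y = a y + b y + c y + d y :> nat)%N -> (count p s = count a s + count b s + count c s + count d s)%N.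
Proof.
elim: s => //= y s IH h; have := h y (mem_head _ _); rewrite IH; first by lia.
by move=> z zs; apply: h; rewrite inE zs orbT.
Qed.

Section Bridge.
Variable R : realType.
Implicit Types (p q l : {mpoly R[2]}) (P A D : R * R).

Lemma pevalD p q P : peval (p + q) P = peval p P + peval q P. Proof. exact: mevalD. Qed.
Lemma pevalM p q P : peval (p * q) P = peval p P * peval q P. Proof. exact: mevalM. Qed.
Lemma pevalC c P : peval c%:MP P = c. Proof. exact: mevalC. Qed.
Lemma pevalX0 P : peval 'X_ord0 P = P.1. Proof. exact: mevalXU. Qed.
Lemma pevalX1 P : peval 'X_ord_max P = P.2. Proof. exact: mevalXU. Qed.

Lemma peval_prod (s : seq {mpoly R[2]}) P : peval (\prod_(l <- s) l) P = \prod_(l <- s) peval l P.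
Proof. by rewrite /peval rmorph_prod. Qed.

Lemma peval_pol (n : nat) p : (msize p <= n)%N -> pol n (peval p).
Proof.
move=> sp; have mono (u v k : nat) : (u + v < k)%N -> pol k (fun P : R * R => P.1 ^+ u * P.2 ^+ v).
  elim: u k => [|u IH] k; last first.
    by case: k => // k lt; apply: pol_ext (pol_x (IH k lt)) => P; rewrite exprS mulrA.
  elim: v k => [|v IH] [|k] // lt; first by apply: pol_ext (polC k 1) => P; rewrite !expr0 mul1r.
  by apply: pol_ext (pol_y (IH k lt)) => P; rewrite expr0 !mul1r exprS.
have l1 : lift ord0 ord0 = ord_max :> 'I_2 by exact: val_inj.
pose F (m : 'X_{1..2}) P := p@_m * (P.1 ^+ m ord0 * P.2 ^+ m ord_max).
have : pol n (fun P => \sum_(m <- msupp p | m \in msupp p) F m P).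
  apply: pol_sumf => m mp; apply: pol_scale; apply: mono; apply: leq_trans sp.
  by have := msize_mdeg_lt mp; rewrite mdegE !big_ord_recl big_ord0 addn0 l1.
apply: pol_ext => P; rewrite /peval mevalE -big_seq; apply: eq_bigr => m _.
by rewrite /F !big_ord_recl big_ord0 mulr1 /= l1.
Qed.

Lemma pol_peval (n : nat) (f : R * R -> R) : pol n f -> exists2 p, (msize p <= n)%N & forall P, peval p P = f P.
Proof.
elim: n f => [|n IH] f /=.
  by move=> h; exists 0; [rewrite msize0|move=> P; rewrite h /peval meval0].
move=> [f1 [f2 [c [/IH[p1 s1 e1] /IH[p2 s2 e2] e]]]].
exists ('X_ord0 * p1 + 'X_ord_max * p2 + c%:MP); last first.
  by move=> P; rewrite !pevalD !pevalM pevalX0 pevalX1 pevalC e1 e2 e.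
have sX (i : 'I_2) q : (msize q <= n)%N -> (msize ('X_i * q)%R <= n.+1)%N.
  move=> sq; have [->|q0] := eqVneq q 0; first by rewrite mulr0 msize0.
  have X0 : 'X_i != 0 :> {mpoly R[2]} by rewrite -msize_poly_eq0 msizeX.
  by rewrite msizeM // msizeX mdeg1 add2n ltnS.
apply: leq_trans (msizeD_le _ _) _; rewrite geq_max; apply/andP; split.
  by apply: leq_trans (msizeD_le _ _) _; rewrite geq_max !sX.
by rewrite msizeC; case: (c != 0).
Qed.

Section Correct.
Variable X : {fset R * R}.
Hypothesis GCX : GC_set 6 X.
Let sX : seq (R * R) := enum_fset X.

Lemma inX P : (P \in sX) = (P \in X). Proof. by []. Qed.

Lemma uniq_X p q : p \in Pi 6 -> q \in Pi 6 -> (forall P, P \in X -> peval p P = peval q P) -> p = q.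
Proof.
move=> hp hq h; have [C _] := GCX; have [r [_ ur]] := C (peval q).
by rewrite -(ur p) ?(ur q).
Qed.

Lemma bridge_Xc (f : R * R -> R) : pol 7 f -> (forall P, P \in sX -> f P = 0) -> forall P, f P = 0.
Proof.
move=> /pol_peval[p sp e] z P; have : p = 0.
  apply: uniq_X => //; first by rewrite inE msize0.
  by move=> S SX; rewrite e z // /peval meval0.
by move=> p0; rewrite -e p0 /peval meval0.
Qed.

(** With both leading coefficients zero, the polynomial would agree with a constant on [X], hence be
    constant, and its [msize] could not be 2. *)
Lemma line_ex l : is_line l -> exists L : line R, forall P, L P = peval l P.
Proof.
rewrite /is_line inE => /eqP sl; have := @peval_pol 2 l; rewrite sl => /(_ isT) [f1 [f2 [c [p1 p2 e]]]].
have e' P : peval l P = f1 (0, 0) * P.1 + f2 (0, 0) * P.2 + c.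
  by rewrite e (pol1_const P (0, 0) p1) (pol1_const P (0, 0) p2); ring.
have [|L eL] := @line_of _ (f1 (0, 0)) (f2 (0, 0)) c; last by exists L => P; rewrite eL e'.
apply/negPn; rewrite negb_or !negbK; apply/negP => /andP[/eqP h1 /eqP h2].
have el : l = c%:MP.
  apply: uniq_X; [by rewrite inE sl|by rewrite inE msizeC; case: (c != 0)|].
  by move=> P _; rewrite e' h1 h2 pevalC; ring.
by move: sl; rewrite el msizeC; case: (c != 0).
Qed.

Lemma line_seq (ls : seq {mpoly R[2]}) : all (@is_line R) ls -> exists L : seq (line R), size L = size ls /\
  forall P, lprod L P = peval (\prod_(l <- ls) l) P.
Proof.
elim: ls => [|l ls IH] /=; first by exists [::]; split=> // P; rewrite lprod_nil big_nil /peval meval1.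
move=> /andP[/line_ex[m em] /IH[L [sL eL]]]; exists (m :: L); split; first by rewrite /= sL.
by move=> P; rewrite lprod_cons em eL big_cons pevalM.
Qed.

Lemma fund_ex D : D \in X -> exists p, fundamental 6 X D p.
Proof.
move=> DX; have [C _] := GCX; have [p [[pP h] _]] := C (fun P => if P == D then 1 else 0).
exists p; split=> //; first by rewrite h ?eqxx.
by move=> B BX BD; rewrite h // (negbTE BD).
Qed.

Lemma bridge_GC D : D \in sX -> exists L : seq (line R),
  [/\ size L = 6%N, lprod L D != 0 & forall P, P \in sX -> P <> D -> lprod L P = 0].
Proof.
move=> DX; have [p hp] := fund_ex DX; have [_ G] := GCX.
have [ls als ep] := G D DX p hp; have [L [sL eL]] := line_seq als.
have [_ pD p0] := hp; exists L; split; first by rewrite sL size_tuple.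
  by rewrite eL -ep pD oner_neq0.
by move=> P PX PD; rewrite eL -ep p0 //; apply/eqP.
Qed.

Lemma uX' : uniq sX. Proof. exact: fset_uniq. Qed.

Lemma card_filter (b : pred (R * R)) : #|` [fset P in X | b P]%fset|%fset = count b sX.
Proof.
rewrite -size_filter; apply: perm_size; apply: uniq_perm; rewrite ?fset_uniq ?filter_uniq ?uX' //.
by move=> P; rewrite mem_filter -[LHS]/(P \in [fset P in X | b P]%fset) !inE /= andbC.
Qed.

Hypothesis nomax : ~ exists l, maximal_line 6 X l.

Lemma line_mpoly (L : line R) : exists2 l, is_line l & forall P, peval l P = L P.
Proof.
have [l sl e] := pol_peval (pol_lev 0 L); exists l => //; rewrite /is_line inE eqn_leq sl ltnNge; apply/negP => s1.
have e' P : L P = l@_0 by rewrite -e (msize1_polyC s1) pevalC mcoeffC eqxx mulr1.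
have [P LP] := pt_off L; have [Q [LQ _]] := line_pt L [::].
by move: LP; rewrite e' -(e' Q) LQ eqxx.
Qed.

(** Seven nodes are excluded by [nomax]. With eight, the fundamental polynomial of one of them would
    have seven zeros on the line, too many for degree 6. *)
Lemma bridge_M6 (L : line R) : (cn sX L <= 6)%N.
Proof.
rewrite leqNgt; apply/negP => c7.
have [c8|c8] := ltnP 7 (cn sX L); last first.
  apply: nomax; have [l hl e] := line_mpoly L; exists l; split=> //.
  rewrite card_filter -[RHS]/7%N; apply/eqP; rewrite eqn_leq -[count _ _]/(count (fun P => peval l P == 0) sX).
  by rewrite (eq_count (a2 := fun P => L P == 0)) ?c8 // => P; rewrite e.
have : has (fun P => L P == 0) sX by rewrite has_count; apply: leq_trans c7.
case/hasP => D DX /eqP LD; have [G [sG fD f0]] := bridge_GC DX.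
have pf : pol 7 (lprod G) by apply: pol_lprod; rewrite sG.
move: fD; rewrite (pol_line0 (l := L) (s := rem D [seq P <- sX | L P == 0]) pf) ?eqxx //.
- by rewrite rem_uniq // filter_uniq // uX'.
- rewrite size_rem ?mem_filter ?LD ?eqxx // size_filter.
  by move: c8; rewrite /cn; case: (count _ _).
- move=> P; rewrite (mem_rem_uniq _ (filter_uniq _ uX')) => /andP[/eqP PD]; rewrite mem_filter => /andP[/eqP LP PX].
  by split=> //; exact: f0.
Qed.

(** A node other than [A] is a zero of a linear factor of the fundamental polynomial. The product of
    the other five factors has degree at most 5, so the factor is a used line and occurs in the
    ordering as a point set. *)
Lemma used_lines A (ls : 6.-tuple {mpoly R[2]}) : A \in X -> used_lines_ordering X A ls ->
  (forall i, is_line (tnth ls i) /\ ~~ on_line (tnth ls i) A) /\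
  (forall P, P \in X -> P != A -> exists i, on_line (tnth ls i) P).
Proof.
move=> AX [hu _ hall]; split=> [i|P PX PA].
  have [li [p [q [[_ pA _] _ e]]]] := hu i; split=> //; apply/negP => /eqP lA.
  by move/eqP: pA; rewrite e pevalM lA mul0r eq_sym oner_eq0.
have [p hp] := fund_ex AX; have [_ G] := GCX; have [ms als ep] := G A AX p hp.
have [pP pA p0] := hp; have := p0 P PX PA; rewrite ep peval_prod => /eqP.
rewrite prodf_seq_eq0 => /hasP[l lm /= /eqP lP].
have [|i h] := hall l; last by exists i; rewrite -h /on_line lP.
have ll : is_line l by exact: (allP als).
split=> //; exists p, (\prod_(m <- rem l ms) m); split=> //; last by rewrite ep (big_rem l).
have hs : all (@is_line R) (rem l ms) by apply/allP => m /mem_rem; exact: (allP als).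
have : size (rem l ms) = 5%N by rewrite size_rem // size_tuple.
rewrite inE; move: hs; move: (rem l ms) => s hs <-.
elim: s hs => [|m s IH] /=; first by rewrite big_nil msize1.
move=> /andP[/eqP sm /IH h]; rewrite big_cons;
have m0 : m != 0 by rewrite -msize_poly_eq0 sm.
have [->|q0] := eqVneq (\prod_(j <- s) j) 0; first by rewrite mulr0 msize0.
by rewrite msizeM // sm add2n ltnS.
Qed.

(** No line has more than six nodes, so an entry 6 means that all nodes of that line are off the
    previous ones: the first three lines are disjoint on [X]. What remains is [A] and the 4 + 3 + 2
    nodes counted next, ten in all, with four on the fourth line. *)
Lemma md_sequence_false A (ls : 6.-tuple {mpoly R[2]}) : A \in X -> used_lines_ordering X A ls ->
  distribution X ls = [tuple 6; 6; 6; 4; 3; 2]%N -> False.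
Proof.
move=> AX hu hd; have [h1 h2] := used_lines AX hu.
have hk (s : 'I_6) := congr1 (fun t => tnth t s) hd.
have ex (i : 'I_6) : exists L : line R, forall P, (L P == 0) = on_line (tnth ls i) P.
  by have [/line_ex[L eL] _] := h1 i; exists L => P; rewrite eL.
(* Reduction modulo 6 makes every natural number an index, so that the six counts can be evaluated
   on literals. *)
pose o (i : nat) := Ordinal (ltn_pmod i (isT : 0 < 6)%N) : 'I_6.
pose on i P := on_line (tnth ls (o i)) P.
have hk' (s : nat) : count (fun P => [forall i : 'I_6, (i < s %% 6)%N ==> ~~ on_line (tnth ls i) P] && on s P) sX = tnth [tuple 6; 6; 6; 4; 3; 2]%N (o s).
  by rewrite -hk tnth_mktuple card_filter.
have fo (i : 'I_6) : i = o i by apply: val_inj; rewrite /= modn_small.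
have hall (s : nat) P : [forall i : 'I_6, (i < s)%N ==> ~~ on_line (tnth ls i) P] = all (fun i => (i < s)%N ==> ~~ on i P) (iota 0 6).
  apply/forallP/allP => [h i|h i]; last by have := h i; rewrite /on -fo; apply; rewrite mem_iota /= ltn_ord.
  by rewrite mem_iota /= => i6; have := h (o i); rewrite /= modn_small.
have c0 := hk' 0%N; have c1 := hk' 1%N; have c2 := hk' 2; have c3 := hk' 3; have c4 := hk' 4; have c5 := hk' 5.
move: c0 c1 c2 c3 c4 c5.
rewrite !(eq_count (fun P => congr1 (fun b => b && _) (hall _ P))) /= !(tnth_nth 0%N) /=.
move=> c0 c1 c2 c3 c4 c5.
have [L0 e0] := ex (o 0%N); have [L1 e1] := ex (o 1%N); have [L2 e2] := ex (o 2); have [L3 e3] := ex (o 3).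
pose el (i : 'I_3) := nth L0 [:: L0; L1; L2] i.
have eE (i : 'I_3) P : (el i P == 0) = on i P by move: i; apply: ord3P; rewrite /el /=.
have le6 (L : line R) (b : pred (R * R)) : (forall P, (L P == 0) = b P) -> (count b sX <= 6)%N.
  by move=> h; have := bridge_M6 L; rewrite /cn (eq_count h).
have n0 := count_all c1 (le6 L1 _ e1); have n1 := count_all c2 (le6 L2 _ e2).
have el6 i : cn sX (el i) = 6%N.
  rewrite /cn (eq_count (eE i)); move: i; apply: ord3P => /=; first exact: c0.
    by apply/eqP; rewrite eqn_leq (le6 L1) //= -c1; apply: sub_count => P /andP[].
  by apply/eqP; rewrite eqn_leq (le6 L2) //= -c2; apply: sub_count => P /andP[].
have eld i j P : P \in sX -> el i P = 0 -> el j P = 0 -> i = j.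
  move=> PX /eqP; rewrite eE => hi /eqP; rewrite eE => hj.
  have x01 : on 1%N P -> ~~ on 0%N P by move/(n0 P PX); case/andP.
  have x2 : on 2 P -> ~~ on 0%N P && ~~ on 1%N P by move/(n1 P PX); rewrite andbT.
  move: i hi j hj; apply: ord3P => /= hi; apply: ord3P => //= hj.
  - by have := x01 hj; rewrite hi.
  - by have := x2 hj; rewrite hi.
  - by have := x01 hi; rewrite hj.
  - by have := x2 hj; rewrite hi andbF.
  - by have := x2 hi; rewrite hj.
  - by have := x2 hi; rewrite hj andbF.
have fY P : [forall i, el i P != 0] = [&& ~~ on 0%N P, ~~ on 1%N P & ~~ on 2 P].
  apply/forallP/and3P => [h|[h0' h1' h2'] i]; last by rewrite eE; move: i; exact: ord3P.
  by split; [have := h o0|have := h o1|have := h o2]; rewrite eE.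
have sY : size (Y sX el) = 10%N.
  rewrite size_filter (eq_count fY); have cA : count (pred1 A) sX = 1%N by rewrite count_uniq_mem ?uX' // inX AX.
  pose r3 P := [&& ~~ on 0%N P, ~~ on 1%N P, ~~ on 2 P & true] && on 3 P.
  pose r4 P := [&& ~~ on 0%N P, ~~ on 1%N P, ~~ on 2 P, ~~ on 3 P & true] && on 4 P.
  pose r5 P := [&& ~~ on 0%N P, ~~ on 1%N P, ~~ on 2 P, ~~ on 3 P, ~~ on 4 P & true] && on 5 P.
  rewrite (@count_add4 _ _ (pred1 A) r3 r4 r5); first by rewrite cA c3 c4 c5.
  move=> P PX; rewrite /r3 /r4 /r5 /= !andbT.
  have [->|PA] := eqVneq P A.
    have off (i : nat) : on i A = false by apply/negbTE; case: (h1 (o i)).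
    by rewrite !off.
  have [i hi] := h2 P PX PA; have : has (fun i => on i P) (iota 0 6).
    by apply/hasP; exists (val i); rewrite ?mem_iota ?ltn_ord // /on -fo.
  by rewrite /= orbF; case: (on 0%N P); case: (on 1%N P); case: (on 2 P); case: (on 3 P); case: (on 4 P); case: (on 5 P).
apply: (@four_node_line_false R sX uX' bridge_Xc bridge_GC el el6 eld sY bridge_M6 L3).
rewrite /ym size_filter count_filter -c3; apply: eq_count => P /=.
by rewrite fY e3 andbC !andbT.
Qed.
End Correct.
End Bridge.

Local Close Scope ring_scope.

Theorem proposition3p9 (R : realType) (X : {fset R * R}) :
  GC_set 6 X ->
  ~ (exists l : {mpoly R[2]}, maximal_line 6 X l) ->
  ~ (exists2 A : R * R, A \in X &
       md_sequence X A [tuple 6; 6; 6; 4; 3; 2]).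
Proof.
move=> GCX nomax [A AX [[ls hu hd] _]]; exact: (md_sequence_false GCX nomax AX hu hd).
Qed.
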